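(* Let $G$ be a commutative algebraic group over $C_0$ and let $\Gamma\le G(K)$ be a subgroup which is $\bigwedge$-definable over $\emptyset$ and contained in an $\emptyset$-definable subset $X\subset G(K)$ which is cgp in $G$. Assume $\delta(\Gamma)=\dim G$. Then for any coherent tuple $\bar\gamma\in\Gamma^n$, the locus of $\bar\gamma$ in $G^n$ over $C_0$ (the smallest Zariski closed subvariety of $G^n$ defined over $C_0$ containing $\bar\gamma$) is a coset of an algebraic subgroup of $G^n$.
   Context: Non-standard setup: $\mathcal{U}$ is a non-principal ultrafilter on $\mathbb{N}$, $K=\prod_{s\to\mathcal{U}}K_s$ with each $K_s$ having underlying field $\mathbb{C}$. $C_0\subset K$ is a countable algebraically closed subfield. $\mathcal{L}$ is a countable language extending the language of rings with constants for elements of $C_0$; each $K_s$ is an $\mathcal{L}$-structure and $K$ carries the ultraproduct structure. Points of varieties over $C_0$ are identified with tuples from $K$ via a constructible embedding over $C_0$ (elimination of imaginaries). Internal sets are ultraproducts $X=\prod_{s\to\mathcal{U}}X_s$, with $|X|=\lim_{\mathcal{U}}|X_s|$. Fix $\xi\in\mathbb{R}^{\mathcal{U}}$ larger than every standard real; $\delta(X)=\mathrm{st}(\log|X|/\log\xi)$ for internal $X$. A $\bigwedge$-definable set is an intersection of countably many definable sets, and for such $Z$, $\delta(Z)=\inf\{\delta(Y):Y\supset Z\text{ internal}\}$. For a tuple $\bar a$ and set of tuples $B$, $\delta(\bar a/B)=\inf\{\delta(Y):\bar a\in Y,\ Y\text{ definable over co-ordinates of }B\}$. $\delta$ is assumed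 continuous: for $\emptyset$-definable $Y\subset K^n\times K^m$, $\alpha\in\mathbb{R}$, $\epsilon>0$ there is $\emptyset$-definable $W$ with $\{\bar b:\delta(Y_{\bar b})\ge\alpha+\epsilon\}\subset W\subset\{\bar b:\delta(Y_{\bar b})\ge\alpha\}$. $d^0(A/B)$ is transcendence degree of $C_0(A\cup B)$ over $C_0(B)$. A tuple $\bar c$ is cgp if for all sets of tuples $B$, $d^0(\bar c/B)<d^0(\bar c)$ implies $\delta(\bar c/B)=0$. A tuple $(\gamma_1,\dots,\gamma_n)$ is coherent if each $\gamma_i$ is cgp and $\delta=d^0$ on each concatenation of elements of $\{\gamma_1,\dots,\gamma_n\}$. An internal set $X\subset W(K)$, $W$ an irreducible variety over $C_0$, is cgp in $W$ if $0<\delta(X)<\infty$ and $\delta(X\cap W'(K))=0$ for every proper closed subvariety $W'\subsetneq W$ defined over $K$. *)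

(* Defs.v *)
From HB Require Import structures.
From mathcomp Require Import all_boot all_order all_algebra.
(* [mpoly] has to be loaded before MathComp-Analysis: their grammars only
   coexist in that order. *)
From mathcomp Require Import finmap complex mpoly.
From mathcomp Require Import all_classical all_reals all_analysis.

Set Implicit Arguments.
Unset Strict Implicit.
Unset Printing Implicit Defensive.

Import Order.TTheory GRing.Theory Num.Theory.
Import numFieldNormedType.Exports.

Local Open Scope classical_set_scope.
Local Open Scope ring_scope.

Record nonprincipal_ultrafilter := NonprincipalUltrafilter {
  ufilter : set_system nat ;
  ufilterP : UltraFilter ufilter ;
  ufilter_nonprincipal : forall s, ~ ufilter [set s] }.

#[global] Instance ufilter_ultra (U : nonprincipal_ultrafilter) :
  UltraFilter (ufilter U) := ufilterP U.

Section Ultrapower.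
Variables (R : realType) (U : nonprincipal_ultrafilter).

Definition null_seq (f : nat -> R[i]) : bool := `[< \forall s \near ufilter U, f s = 0 >].

Lemma null_seq_idealr : idealr_closed null_seq.
Proof.
split; first by apply/asboolP; exact: nearW.
- apply/negP => /asboolP /filter_ex [s] /eqP.
  by rewrite /GRing.one /= oner_eq0.
- move=> a f g /asboolP f0 /asboolP g0; apply/asboolP.
  near=> s.
  have -> : (a * f + g) s = a s * f s + g s by [].
  have -> : f s = 0 by near: s.
  have -> : g s = 0 by near: s.
  by rewrite mulr0 addr0.
Unshelve. all: by end_near. Qed.

HB.instance Definition _ :=
  isIdealr.Build (nat -> R[i]) null_seq null_seq_idealr.

Definition null_ideal : idealr (nat -> R[i]) := null_seq.

Definition ultrapower : Type := {ideal_quot null_ideal}.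

HB.instance Definition _ := GRing.ComNzRing.on ultrapower.

Definition ucl (f : nat -> R[i]) : ultrapower := \pi_({ideal_quot null_ideal})%qT f.

Definition rep (x : ultrapower) : nat -> R[i] := repr (x : {ideal_quot null_ideal}).

Lemma repK : cancel rep ucl.
Proof. by move=> x; exact: reprK. Qed.

Lemma ucl_eq f g : ucl f = ucl g <-> \forall s \near ufilter U, f s = g s.
Proof.
rewrite /ucl; split=> [/eqP|fg].
  rewrite -Quotient.idealrBE => /asboolP; apply: filterS => s.
  by move=> /(congr1 (+%R^~ (g s))); rewrite add0r => <-; rewrite -[LHS](subrK (g s)).
apply/eqP; rewrite -Quotient.idealrBE; apply/asboolP; apply: filterS fg => s fgs.
by have -> : (f - g) s = f s - g s by []; rewrite fgs subrr.
Qed.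

Lemma ucl0 : ucl (fun=> 0) = 0.
Proof. exact: (rmorph0 (\pi_({ideal_quot null_ideal})%qT)). Qed.

Lemma ucl1 : ucl (fun=> 1) = 1.
Proof. exact: (rmorph1 (\pi_({ideal_quot null_ideal})%qT)). Qed.

Lemma uclD f g : ucl (fun s => f s + g s) = ucl f + ucl g.
Proof. exact: (rmorphD (\pi_({ideal_quot null_ideal})%qT)). Qed.

Lemma uclM f g : ucl (fun s => f s * g s) = ucl f * ucl g.
Proof. exact: (rmorphM (\pi_({ideal_quot null_ideal})%qT)). Qed.

Let uinv (x : ultrapower) : ultrapower := ucl (fun s => (rep x s)^-1).

Let umulVf x : x != 0 -> uinv x * x = 1.
Proof.
move=> x0; rewrite -{2}[x]repK -uclM -ucl1; apply/ucl_eq.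
have [x0U|] := in_ultra_setVsetC [set s | rep x s = 0] (ufilterP U).
  by case/eqP: x0; rewrite -[x]repK -ucl0; exact/ucl_eq.
by apply: filterS => s /= /eqP xs0; rewrite mulVf.
Qed.

Let uinvr0 : uinv 0 = 0.
Proof.
rewrite -[RHS]ucl0; apply/ucl_eq.
have /ucl_eq : ucl (rep 0) = ucl (fun=> 0) by rewrite repK ucl0.
by apply: filterS => s ->; rewrite invr0.
Qed.

HB.instance Definition _ := GRing.ComNzRing_isField.Build ultrapower umulVf uinvr0.

End Ultrapower.

(* The non-logical symbols besides those of rings and the constants; countable
   because [countType]s are. *)
Record language := Language {
  lfun : countType ;
  lfun_arity : lfun -> nat ;
  lrel : countType ;
  lrel_arity : lrel -> nat }.

Section FirstOrder.
(* [Cst] indexes the constant symbols, later the elements of C_0. *)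
Variables (L : language) (Cst : Type).

Inductive fo_term :=
| TVar of nat
| TZero
| TOne
| TAdd of fo_term & fo_term
| TOpp of fo_term
| TMul of fo_term & fo_term
| TCst of Cst
| TFun (f : lfun L) of ('I_(lfun_arity f) -> fo_term).

(* [FEx] binds de Bruijn index 0. *)
Inductive fo_formula :=
| FEq of fo_term & fo_term
| FRel (r : lrel L) of ('I_(lrel_arity r) -> fo_term)
| FNot of fo_formula
| FAnd of fo_formula & fo_formula
| FEx of fo_formula.

Record fo_structure (M : pzRingType) := FoStructure {
  scst : Cst -> M ;
  sfun : forall f : lfun L, (lfun_arity f).-tuple M -> M ;
  srel : forall r : lrel L, set ((lrel_arity r).-tuple M) }.

Section Semantics.
Variables (M : pzRingType) (S : fo_structure M).

Fixpoint term_val (e : nat -> M) (t : fo_term) : M :=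
  match t with
  | TVar k => e k
  | TZero => 0
  | TOne => 1
  | TAdd t1 t2 => term_val e t1 + term_val e t2
  | TOpp t1 => - term_val e t1
  | TMul t1 t2 => term_val e t1 * term_val e t2
  | TCst c => scst S c
  | TFun f ts => sfun S [tuple term_val e (ts i) | i < lfun_arity f]
  end.

Fixpoint holds (e : nat -> M) (phi : fo_formula) : Prop :=
  match phi with
  | FEq t1 t2 => term_val e t1 = term_val e t2
  | FRel r ts => srel S [tuple term_val e (ts i) | i < lrel_arity r]
  | FNot phi1 => ~ holds e phi1
  | FAnd phi1 phi2 => holds e phi1 /\ holds e phi2
  | FEx phi1 => exists x, holds (fun k => if k is k'.+1 then e k' else x) phi1
  end.

(* The solution set of phi(x, b) with b a finite tuple from [B]; the variables
   beyond those of x and b are set to 0, a closed term. *)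
Definition definable (B : set M) n (Y : set (n.-tuple M)) :=
  exists (phi : fo_formula) (b : seq M), [set` b] `<=` B /\
    Y = [set x : n.-tuple M | holds (nth 0 (tval x ++ b)) phi].

Definition bigwedge_definable (B : set M) n (Z : set (n.-tuple M)) :=
  exists D : nat -> set (n.-tuple M),
    (forall k, definable B (D k)) /\ Z = \bigcap_k D k.

End Semantics.
End FirstOrder.

Section UltraproductStructure.
Variables (R : realType) (U : nonprincipal_ultrafilter).
Local Notation K := (ultrapower R U).

Definition slice n (s : nat) (x : n.-tuple K) : n.-tuple R[i] :=
  map_tuple (fun z => rep z s) x.

Definition ultraprod n (F : nat -> set (n.-tuple R[i])) : set (n.-tuple K) :=
  [set x | \forall s \near ufilter U, F s (slice s x)].

Definition ultraproduct L Cst (Ks : nat -> fo_structure L Cst R[i]) :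
    fo_structure L Cst K :=
  FoStructure
    (fun c => ucl U (fun s => scst (Ks s) c))
    (fun f x => ucl U (fun s => sfun (Ks s) (slice s x)))
    (fun r => ultraprod (fun s => @srel _ _ _ (Ks s) r)).

(* [ln 0 = 0] in the library, so log|X| = 0 for empty X. This is the convention
   under which the condition delta(X `&` W') = 0 of [cgp_in] makes sense for
   every W', including those disjoint from X. *)
Definition log_card (T : choiceType) (A : set T) : \bar R :=
  if `[< finite_set A >] then (ln #|` fset_set A|%:R)%:E else +oo%E.

(* The standard part of an element of R^U is the limit along U of a
   representing sequence. *)
Definition delta_fam (xi : nat -> R) n (F : nat -> set (n.-tuple R[i])) : \bar R :=
  lim ((fun s => (log_card (F s) * ((ln (xi s))^-1)%:E)%E) @ ufilter U).

(* On an internal set this is [delta_fam] of any representing family, see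
   [delta_internal]; on the others, the infimum over the internal supersets. *)
Definition delta (xi : nat -> R) n (Z : set (n.-tuple K)) : \bar R :=
  ereal_inf [set delta_fam xi F | F in [set F | Z `<=` ultraprod F]].

End UltraproductStructure.

Section DeltaInternal.
Variables (R : realType) (U : nonprincipal_ultrafilter).

Lemma ultralimit_cvg (u : nat -> \bar R) : cvg (u @ ufilter U).
Proof.
pose l := ereal_sup [set x | \forall s \near ufilter U, (x <= u s)%E].
have lo y : (y < l)%E -> \forall s \near ufilter U, (y < u s)%E.
  move=> /ereal_sup_gt[x xu yx]; near=> s.
  by apply: lt_le_trans yx _; near: s.
have hi y : (l < y)%E -> \forall s \near ufilter U, (u s < y)%E.
  move=> ly; have [yu|] := in_ultra_setVsetC [set s | (y <= u s)%E] (ufilterP U).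
    have : (y <= l)%E by apply: ereal_sup_ubound.
    by rewrite leNgt ly.
  by apply: filterS => s /= /negP; rewrite -ltNge.
apply/cvg_ex; exists l; case: l lo hi => [r||] lo hi.
- apply/fine_cvgP; split.
    near=> s; rewrite fin_numElt; apply/andP; split; near: s.
      by apply: lo; rewrite ltNyr.
    by apply: hi; rewrite ltry.
  apply/cvgrPdist_lt => e e0; near=> s.
  have h1 : ((r - e)%:E < u s)%E by near: s; apply: lo; rewrite lte_fin ltrBlDr ltrDl.
  have h2 : (u s < (r + e)%:E)%E by near: s; apply: hi; rewrite lte_fin ltrDl.
  rewrite /=; case: (u s) h1 h2 => [v||] //=; rewrite !lte_fin => h1 h2.
  by rewrite distrC ltr_distl h1 h2.
- by apply/cvgeyPgt => A; apply: lo; rewrite ltry.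
- by apply/cvgeNyPlt => A; apply: hi; rewrite ltNyr.
Unshelve. all: by end_near. Qed.

Lemma le_log_card (T : choiceType) (A B : set T) :
  A `<=` B -> (log_card R A <= log_card R B)%E.
Proof.
move=> AB; rewrite /log_card.
case: (asboolP (finite_set B)) => Bfin; last by rewrite leey.
case: asboolP => Afin; last by case: Afin; exact: sub_finite_set AB Bfin.
have le_AB : (#|` fset_set A| <= #|` fset_set B|)%N.
  by apply: fsubset_leq_card; rewrite -fset_set_sub.
rewrite lee_fin; case: (posnP #|` fset_set A|) => [->|A0].
  rewrite ln0 //; case: (posnP #|` fset_set B|) => [->|B0]; first by rewrite ln0.
  by rewrite ln_ge0 // ler1n.
by rewrite ler_ln ?posrE ?ltr0n ?ler_nat // (leq_trans A0).
Qed.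

Lemma ultraprod_sub n (F G : nat -> set (n.-tuple R[i])) :
  @ultraprod R U n F `<=` ultraprod G -> \forall s \near ufilter U, F s `<=` G s.
Proof.
move=> FG.
have [//|nFG] := in_ultra_setVsetC [set s | F s `<=` G s] (ufilterP U).
pose y s : n.-tuple R[i] := xget (nseq_tuple n 0) (F s `\` G s).
pose x : n.-tuple (ultrapower R U) := [tuple ucl U (fun s => tnth (y s) j) | j < n].
have xy : \forall s \near ufilter U, slice s x = y s.
  have : \forall s \near ufilter U, forall j, rep (tnth x j) s = tnth (y s) j.
    apply: filter_forall => j; apply/ucl_eq.
    by rewrite repK tnth_mktuple.
  by apply: filterS => s xs; apply: eq_from_tnth => j; rewrite tnth_map xs.
have yFG : \forall s \near ufilter U, (F s `\` G s) (y s).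
  apply: filterS nFG => s /= /existsNP[z /not_implyP[Fz Gz]].
  by rewrite /y; case: xgetP => [t _ []|/(_ z)[]].
have /FG Gx : ultraprod F x.
  near=> s; have -> : slice s x = y s by near: s.
  by have [] : (F s `\` G s) (y s) by near: s.
have /filter_ex [s [xs [_ nG] Gxs]] : \forall s \near ufilter U,
    [/\ slice s x = y s, (F s `\` G s) (y s) & G s (slice s x)].
  by near=> s; split; near: s.
by case: nG; rewrite -xs.
Unshelve. all: by end_near. Qed.

Lemma delta_internal (xi : nat -> R) n (F : nat -> set (n.-tuple R[i])) :
  (forall r : R, \forall s \near ufilter U, r < xi s) ->
  delta xi (@ultraprod R U n F) = delta_fam U xi F.
Proof.
move=> xi_inf; apply/eqP; rewrite eq_le; apply/andP; split.
  by apply: ereal_inf_lbound; exists F.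
apply: le_ereal_inf_tmp => _ [G /= /ultraprod_sub FG <-].
apply: lee_lim; [exact: ultralimit_cvg|exact: ultralimit_cvg|].
near=> s; apply: lee_wpmul2r.
  by rewrite lee_fin invr_ge0 ln_ge0 // ltW //; near: s; exact: xi_inf.
by apply: le_log_card; near: s.
Unshelve. all: by end_near. Qed.

End DeltaInternal.

Section Fields.
Variable K : fieldType.
Implicit Types (F E : set K).

Definition is_subfield F := GRing.divring_closed (mem F).

Definition gen_field (S : set K) : set K := smallest is_subfield S.

Definition alg_closed_in F := forall p : {poly K},
  p \is a polyOver (mem F) -> (1 < size p)%N -> exists2 x, F x & root p x.

Definition mpoly_over F m (p : {mpoly K[m]}) := forall e, F p@_e.

Definition alg_indep F m (t : m.-tuple K) := forall p : {mpoly K[m]},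
  mpoly_over F p -> p.@[tnth t] = 0 -> p = 0.

Definition trdeg (R : realType) F E : \bar R :=
  ereal_sup [set (m%:R)%:E | m in
    [set m : nat | exists t : m.-tuple K, [set` t] `<=` E /\ alg_indep F t]].

Definition coordinates_of (B : set (seq K)) : set K :=
  [set x | exists2 b, B b & x \in b].

End Fields.

Section Varieties.
Variable K : fieldType.

Definition zeros m (S : set {mpoly K[m]}) : set (m.-tuple K) :=
  [set x | forall p, S p -> p.@[tnth x] = 0].

Definition affine_closed (F : set K) m (Z : set (m.-tuple K)) :=
  exists S : set {mpoly K[m]}, S `<=` @mpoly_over K F m /\ Z = zeros S.

Definition constructible (F : set K) m (Z : set (m.-tuple K)) :=
  exists s : seq (seq {mpoly K[m]} * {mpoly K[m]}),
    (forall c, c \in s ->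
       {in c.1, forall p, mpoly_over F p} /\ mpoly_over F c.2) /\
    Z = [set x | exists c, [/\ c \in s,
           {in c.1, forall p, p.@[tnth x] = 0} & c.2.@[tnth x] != 0]].

(* The data of a finite atlas of affine charts, in the style of Weil, on points
   of type [T]; the charts take values in the same affine space, which can be
   achieved by padding with zeros. *)
Record atlas (T : Type) := Atlas {
  chart : finType ;
  adim : nat ;
  dom : chart -> set T ;
  coords : chart -> T -> adim.-tuple K }.

Definition pts T (V : atlas T) : set T := \bigcup_i dom (a := V) i.

Lemma flat_subproof n m (t : n.-tuple (m.-tuple K)) :
  size (flatten (map val t)) == (n * m)%N.
Proof.
case: t => s /= /eqP <-.
by elim: s => //= a s IH; rewrite size_cat size_tuple (eqP IH) mulSn.
Qed.

Definition flat n m (t : n.-tuple (m.-tuple K)) : (n * m).-tuple K :=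
  Tuple (flat_subproof t).

Definition pow_atlas T (V : atlas T) (n : nat) : atlas (n.-tuple T) :=
  @Atlas (n.-tuple T) (n.-tuple (chart V)) (n * adim V)
    (fun i => [set x | forall j, dom (tnth i j) (tnth x j)])
    (fun i x => flat [tuple coords (tnth i j) (tnth x j) | j < n]).

Definition closed_over (F : set K) T (V : atlas T) (Z : set T) :=
  Z `<=` pts V /\
  forall i : chart V, exists2 A, affine_closed F A &
    forall x, dom i x -> (Z x <-> A (coords i x)).

(* Near each point, in charts, [h] is given by quotients of polynomials over
   [F]; one denominator [q] is enough, and shrinking the neighbourhood one may
   take it to be {q <> 0}. *)
Definition is_morphism (F : set K) T T' (V : atlas T) (W : atlas T') (h : T -> T') :=
  (forall x, pts V x -> pts W (h x)) /\
  forall (i : chart V) (j : chart W) x, dom i x -> dom j (h x) ->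
    exists (q : {mpoly K[adim V]}) (P : (adim W).-tuple {mpoly K[adim V]}),
      [/\ mpoly_over F q, forall k, mpoly_over F (tnth P k),
          q.@[tnth (coords i x)] != 0 &
          forall y, dom i y -> q.@[tnth (coords i y)] != 0 ->
            dom j (h y) /\ forall k, tnth (coords j (h y)) k =
              (tnth P k).@[tnth (coords i y)] / q.@[tnth (coords i y)]].

(* That the identity is a morphism says that the charts overlap in open sets
   with regular transition maps; the last condition is separatedness. *)
Record is_variety (F : set K) T (V : atlas T) : Prop := IsVariety {
  chart_inj : forall i : chart V, set_inj (dom i) (coords i) ;
  chart_affine : forall i : chart V, affine_closed F (coords i @` dom i) ;
  transition_regular : is_morphism F V V id ;
  diagonal_closed :
    closed_over F (pow_atlas V 2) [set [tuple x; x] | x in pts V] }.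

(* V(K) lies in K^N; the identification of its points with N-tuples is
   constructible over [F]. *)
Definition constructibly_embedded (F : set K) N (V : atlas (N.-tuple K)) :=
  forall i : chart V, constructible F
    [set [tuple of x ++ coords i x] | x in dom (a := V) i].

Definition irreducible T (V : atlas T) (Z : set T) :=
  Z !=set0 /\ forall Z1 Z2, closed_over setT V Z1 -> closed_over setT V Z2 ->
    Z `<=` Z1 `|` Z2 -> Z `<=` Z1 \/ Z `<=` Z2.

Definition variety_dim (R : realType) T (V : atlas T) : \bar R :=
  ereal_sup [set (d%:R)%:E | d in [set d : nat | exists Z : nat -> set T,
    (forall k, (k <= d)%N -> closed_over setT V (Z k) /\ irreducible V (Z k)) /\
    (forall k, (k < d)%N -> Z k `<` Z k.+1)]].

Definition locus (F : set K) T (V : atlas T) (x : T) : set T :=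
  \bigcap_(Z in [set Z | closed_over F V Z /\ Z x]) Z.

Definition rational_point (F : set K) T (V : atlas T) (x : T) :=
  exists2 i : chart V, dom i x & forall k, F (tnth (coords i x) k).

Record group_data (T : Type) := GroupData {
  gvar :> atlas T ;
  gmul : T -> T -> T ;
  ginv : T -> T ;
  gone : T }.

Record is_comm_alg_group (F : set K) T (G : group_data T) : Prop := IsCommAlgGroup {
  gvarP : is_variety F G ;
  gmul_morphism : is_morphism F (pow_atlas G 2) G
    (fun z => gmul G (tnth z ord0) (tnth z ord_max)) ;
  ginv_morphism : is_morphism F G G (ginv G) ;
  gone_rational : rational_point F G (gone G) ;
  gmulA : {in pts G & &, associative (gmul G)} ;
  gmulC : {in pts G &, commutative (gmul G)} ;
  gmul1 : {in pts G, left_id (gone G) (gmul G)} ;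
  gmulV : {in pts G, left_inverse (gone G) (ginv G) (gmul G)} }.

Definition pow_group T (G : group_data T) n : group_data (n.-tuple T) :=
  GroupData (pow_atlas G n)
    (fun x y => [tuple gmul G (tnth x i) (tnth y i) | i < n])
    (fun x => [tuple ginv G (tnth x i) | i < n])
    [tuple gone G | i < n].

Definition is_subgroup T (G : group_data T) (H : set T) :=
  [/\ H `<=` pts G, H (gone G),
      forall x y, H x -> H y -> H (gmul G x y) & forall x, H x -> H (ginv G x)].

Definition is_alg_subgroup (F : set K) T (G : group_data T) (H : set T) :=
  closed_over F G H /\ is_subgroup G H.

(* Over C_0 the subgroup may be asked to be closed over C_0: if a coset g H is
   closed over C_0 then so is H, its stabiliser. The point g is in G(K). *)
Definition is_coset_of_alg_subgroup (F : set K) T (G : group_data T) (Z : set T) :=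
  exists (H : set T) (g : T),
    [/\ is_alg_subgroup F G H, pts G g & Z = [set gmul G g h | h in H]].

End Varieties.

Section Coherence.
Variables (R : realType) (U : nonprincipal_ultrafilter).
Local Notation K := (ultrapower R U).
Variables (C0 : set K) (L : language) (S : fo_structure L C0 K) (xi : nat -> R).

Definition d0 (a : seq K) (B : set (seq K)) : \bar R :=
  trdeg R (gen_field (C0 `|` coordinates_of B))
          (gen_field (C0 `|` ([set` a] `|` coordinates_of B))).

Definition delta_tp (a : seq K) (B : set (seq K)) : \bar R :=
  ereal_inf [set delta xi Y | Y in [set Y : set ((size a).-tuple K) |
    Y (in_tuple a) /\ definable S (coordinates_of B) Y]].

Definition delta_continuous :=
  forall n m (Y : set ((n + m).-tuple K)) (alpha eps : R),
    definable S set0 Y -> 0 < eps ->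
    let fiber (b : m.-tuple K) := [set a : n.-tuple K | Y [tuple of a ++ b]] in
    exists W : set (m.-tuple K),
      [/\ definable S set0 W,
          [set b | ((alpha + eps)%:E <= delta xi (fiber b))%E] `<=` W &
          W `<=` [set b | (alpha%:E <= delta xi (fiber b))%E]].

Definition cgp (c : seq K) := forall B : set (seq K),
  (d0 c B < d0 c set0)%E -> delta_tp c B = 0%E.

Definition coherent N n (gamma : n.-tuple (N.-tuple K)) :=
  (forall i, cgp (tnth gamma i)) /\
  forall s : seq 'I_n, let a := flatten [seq tval (tnth gamma i) | i <- s] in
    delta_tp a set0 = d0 a set0.

Definition internal n (X : set (n.-tuple K)) :=
  exists F : nat -> set (n.-tuple R[i]), X = ultraprod F.

Definition cgp_in N (W : atlas K (N.-tuple K)) (X : set (N.-tuple K)) :=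
  [/\ internal X, X `<=` pts W, irreducible W (pts W),
      (0 < delta xi X < +oo)%E &
      forall W', closed_over setT W W' -> W' `<` pts W ->
        delta xi (X `&` W') = 0%E].

End Coherence.

(* Main.v *)
(* Let d be the transcendence degree of a generic point of G. Coherence makes
   every non-constant gamma_i generic in G, and a maximal independent subfamily
   gamma_I, with k = |I|, has delta = k d. For each j the point
   a = (gamma_I, gamma_j) of G^(k+1) again has transcendence degree k d; let V be
   its locus. Writing a = p v with v in Gamma^(k+1) generic over a shows that the
   relation "p v in V", between definable approximations of Gamma^(k+1) whose
   delta is close to (k+1) d, contains pairs (p, v) of delta (2k+1) d. On the
   finite sets of the ultraproduct this relation is, in charts, given by the
   vanishing and non-vanishing of two real bilinear forms; a cutting lemma for
   such relations yields an incidence bound which forces rectangles: p, q, v, v'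
   with p v, q v, p v', q v' all in V and as generic as this allows. So q p^-1
   maps the generic point p v' of V to q v', hence stabilises V, and letting p v,
   q v, p v' specialize gives x y^-1 z in V for all x, y, z in V: V is a coset.
   The loci for the different j glue, since gamma is algebraic over gamma_I.
   Specializations are handled through local homomorphisms (places) over C0,
   along which morphisms of varieties can be transported; smallness for delta of
   definable sets containing a tuple is related to transcendence degree by the
   cgp hypothesis on X, one coordinate at a time. *)

Require Import Defs.
From HB Require Import structures.
From mathcomp Require Import all_boot all_order all_algebra.
From mathcomp Require Import ring lra zify.
From mathcomp Require Import finmap complex mpoly.
From mathcomp Require Import all_classical all_reals all_analysis.

Set Implicit Arguments.
Unset Strict Implicit.
Unset Printing Implicit Defensive.

Import Order.TTheory GRing.Theory Num.Theory.
Import numFieldNormedType.Exports.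

Local Open Scope ring_scope.

(** * A cutting lemma and an incidence bound for bilinear relations *)

(** The count sits exactly at the threshold of Cauchy-Schwarz. Both sides of the relation have delta
    (k+1) d and the pairs (2k+1) d, so a point has k d neighbours; if two points typically shared
    (k-1) d of them, the exponents would balance: (k+1) d + (k-1) d = 2 k d. Any gain by a fixed
    power of xi is thus decisive. The cutting lemma supplies it, at a price polynomial in the gain:
    at least half of the incidences of a large part of the points lie on the few neighbours that
    this part splits, and Cauchy-Schwarz is applied to these only. All approximations of delta must
    stay far below the gain.

    Passing the threshold slightly is enough. Since X is cgp, a coordinate of a tuple in X is, over
    the later ones, either generic in G or without effect on delta; a tuple larger than (k-1) d
    therefore has transcendence degree at least k d.

    Continuity of delta makes it additive on types, by cutting a definable set down to the part with
    fibres of controlled size. Points of an abstract variety have no global coordinates to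
    specialize; places act in all charts at once. *)

Lemma pigeonhole_class (T : finType) (P : {set T}) (M : nat) (f : T -> nat) :
  (0 < M)%N -> (forall p, p \in P -> (f p < M)%N) ->
  exists j, (#|P| <= M * #|[set p in P | f p == j]|)%N.
Proof.
move=> M0 fM; apply: contrapT => nj.
have lt j : (M * #|[set p in P | f p == j]| < #|P|)%N.
  by rewrite ltnNge; apply/negP => le; apply: nj; exists j.
have cP : (#|P| = \sum_(j < M) #|[set p in P | f p == j]|)%N.
  transitivity (\sum_(j < M) \sum_(p in P) (f p == j : nat))%N.
    rewrite exchange_big /= -sum1_card; apply: eq_bigr => p pP.
    rewrite (bigD1 (Ordinal (fM p pP))) //= eqxx big1 // => j jN.
    by apply/eqP; rewrite eqb0; apply: contraNneq jN => fj; apply/eqP/val_inj.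
  apply: eq_bigr => j _; rewrite -sum1_card big_mkcond /= [RHS]big_mkcond /=.
  by apply: eq_bigr => p _; rewrite inE; case: (p \in P); case: (f p == j).
have : (M * #|P| < M * #|P|)%N; last by rewrite ltnn.
rewrite {1}cP big_distrr /=; move: lt M0; clear.
case: M => // M lt _.
have -> : (M.+1 * #|P| = \sum_(j < M.+1) #|P|)%N by rewrite sum_nat_const card_ord.
rewrite !big_ord_recl /= -addSn.
by apply: leq_add => //; apply: leq_sum => j _; apply: ltnW.
Qed.

Section Cutting.
Import mathcomp.boot.fintype mathcomp.boot.finset.
Variable R : realType.

Section Window.
Variables (TP TQ : finType) (P : {set TP}) (Q : {set TQ}).
Variables (lam : TP -> TQ -> R) (B : TP -> {set TQ}) (p0 : TP) (w g : R).
Hypothesis p0P : p0 \in P.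
Hypothesis BQ : forall p, B p \subset Q.
Hypothesis Bdown : forall p u v, v \in Q -> lam p v <= lam p u -> u \in B p -> v \in B p.
Hypothesis Bw : forall p, p \in P -> #|B p|%:R <= #|B p0|%:R + w.
Hypothesis w0 : 0 <= w.
Hypothesis g0 : 0 <= g.

Definition flips (u v : TQ) :=
  [exists p in P, exists p' in P, (lam p v <= lam p u) != (lam p' v <= lam p' u)].

(** Let [u] be the counted element with the largest value under [lam p0]. The elements of [Q] not
    above [u] for [p0] include all counted elements and all of [B p0], an initial segment missing
    [u]. Up to [g] flips they are also not above [u] for some [p] with [u] in [B p], hence lie in
    [B p], which has at most [w] more elements than [B p0]. *)
Lemma window_bound :
  #|[set u in Q | [&& #|[set v in Q | flips u v]|%:R <= g, u \notin B p0 &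
      [exists p in P, u \in B p]]]|%:R <= w + g.
Proof.
set A := [set u in Q | _].
have [->|[u1 u1A]] := set_0Vmem A; first by rewrite cards0 addr_ge0.
case: (@Order.TotalTheory.arg_maxP _ _ _ u1 (mem A) (lam p0) u1A) => u uA umax.
have /[!inE]/andP[uQ /and3P[ug uB /existsP[p /andP[pP uBp]]]] : u \in A by [].
pose pos q := [set v in Q | lam q v <= lam q u].
have h1 : #|pos p|%:R <= #|B p0|%:R + w.
  apply: le_trans (Bw pP); rewrite ler_nat; apply: subset_leq_card.
  by apply/subsetP => v; rewrite inE => /andP[vQ le]; apply: Bdown le uBp.
have h2 : #|pos p0|%:R <= #|pos p|%:R + g.
  apply: le_trans (_ : #|pos p :|: [set v in Q | flips u v]|%:R <= _).
    rewrite ler_nat; apply: subset_leq_card; apply/subsetP => v.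
    rewrite !inE => /andP[-> le0] /=; case: leP => //= lt.
    apply/existsP; exists p0; rewrite p0P; apply/existsP; exists p; rewrite pP /=.
    by rewrite le0 (lt_geF lt).
  apply: le_trans (_ : (#|pos p| + #|[set v in Q | flips u v]|)%:R <= _).
    by rewrite ler_nat cardsU leq_subr.
  by rewrite natrD lerD2l.
have h3 : #|A|%:R + #|B p0|%:R <= #|pos p0|%:R :> R.
  rewrite -natrD ler_nat.
  have <- : #|A :|: B p0| = (#|A| + #|B p0|)%N.
    rewrite cardsU; have -> : A :&: B p0 = set0; last by rewrite cards0 subn0.
    apply/setP => v; rewrite !inE; apply/negP => /andP[/andP[_ /and3P[_ vB _]]].
    by rewrite (negPf vB).
  apply: subset_leq_card; apply/subsetP => v; rewrite in_setU [v \in pos _]inE => /orP[vA|vB].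
    by rewrite (umax v vA : lam p0 v <= lam p0 u) andbT; move: vA; rewrite inE => /andP[].
  rewrite (subsetP (BQ p0)) //=; rewrite leNgt; apply/negP => lt.
  by move: uB; rewrite (Bdown uQ (ltW lt) vB).
lra.
Qed.

End Window.

Definition crossing (TP TQ : finType) (r : TP -> TQ -> R) (P : {set TP}) (Q : {set TQ}) :=
  [set u in Q | [exists p in P, exists p' in P, Num.sg (r p u) != Num.sg (r p' u)]].

Lemma crossing_sub (TP TQ : finType) (r : TP -> TQ -> R) (P P' : {set TP}) (Q : {set TQ}) :
  P' \subset P -> crossing r P' Q \subset crossing r P Q.
Proof.
move=> /subsetP PP; apply/subsetP => u; rewrite !inE => /andP[-> /=].
move=> /existsP[p /andP[pP /existsP[p' /andP[p'P h]]]].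
by apply/existsP; exists p; rewrite PP //; apply/existsP; exists p'; rewrite PP.
Qed.

Definition bilin (TP TQ : Type) (D : nat) (phi : TP -> nat -> R) (psi : TQ -> nat -> R)
    (p : TP) (u : TQ) := \sum_(i < D) phi p i * psi u i.

(** The fraction [c] is uniform in the finite sets and in the forms, which is what allows the cut to
    be iterated. *)
Definition cuttable (D : nat) (e c : R) :=
  forall (TP TQ : finType) (phi : TP -> nat -> R) (psi : TQ -> nat -> R)
         (P : {set TP}) (Q : {set TQ}),
  exists P' : {set TP}, [/\ P' \subset P, c * #|P|%:R <= #|P'|%:R &
    #|crossing (bilin D phi psi) P' Q|%:R <= e * #|Q|%:R].

(* Dividing by the last coordinate of [psi] turns the sign of the form into a
   comparison of [phi p D] with [lam p u]. By induction, on a large part of [P]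
   the order of the values [lam p u] is nearly independent of [p]; pigeonholing
   on the rank of [phi p D] in this order leaves few sign changes. *)
Lemma cuttable_order_step (TP TQ : finType) (lam : TP -> TQ -> R) (phi : TP -> R)
    (P : {set TP}) (Q : {set TQ}) (e d2 : R) (L : nat) :
  0 < e -> (0 < L)%N -> 16 <= e * L%:R -> d2 <= e / 16 * (e / 4) ->
  #|crossing (fun p uv => lam p uv.2 - lam p uv.1) P (setX Q Q)|%:R
     <= d2 * (#|Q| * #|Q|)%:R ->
  exists P' : {set TP}, [/\ P' \subset P, (#|P| <= L * L * #|P'|)%N &
    #|crossing (fun p u => phi p - lam p u) P' Q|%:R <= e * #|Q|%:R].
Proof.
move=> e0 L0 Le d2e Xe.
pose N := #|Q|.
pose Ble p := [set u in Q | lam p u <= phi p].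
pose Blt p := [set u in Q | lam p u < phi p].
(* Two ranks of [phi p] among the values [lam p u], non-strict and strict, each rounded to [L]
   levels and packed into one number below [L * L]. Both are kept so that the sign 0 is controlled
   too. *)
pose cl p := (((#|Ble p| * L) %/ N.+1) + L * ((#|Blt p| * L) %/ N.+1))%N.
have lt_cl (A : {set TQ}) : A \subset Q -> ((#|A| * L) %/ N.+1 < L)%N.
  by move=> AQ; rewrite ltn_divLR // mulnC ltn_pmul2l // ltnS subset_leq_card.
have leQ p : Ble p \subset Q by apply/subsetP => u; rewrite inE => /andP[].
have ltQ p : Blt p \subset Q by apply/subsetP => u; rewrite inE => /andP[].
have clL p : p \in P -> (cl p < L * L)%N.
  move=> _; apply: leq_trans (_ : L + L * ((#|Blt p| * L) %/ N.+1) <= _)%N.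
    by rewrite /cl ltn_add2r lt_cl.
  by rewrite -mulnS leq_pmul2l // lt_cl.
have [|j Pj] := pigeonhole_class _ clL; first by rewrite muln_gt0 L0.
set P' := [set p in P | cl p == j] in Pj.
have P'P : P' \subset P by apply/subsetP => p; rewrite inE => /andP[].
exists P'; split => //.
have [->|[p0 p0P']] := set_0Vmem P'.
  have -> : crossing (fun p u => phi p - lam p u) set0 Q = set0.
    by apply/setP => u; rewrite !inE; apply/negP => /andP[_ /existsP[p]]; rewrite inE.
  by rewrite cards0 mulr_ge0 // ltW.
have clE p : p \in P' ->
    ((#|Ble p| * L) %/ N.+1 = (#|Ble p0| * L) %/ N.+1)%N /\
    ((#|Blt p| * L) %/ N.+1 = (#|Blt p0| * L) %/ N.+1)%N.
  rewrite inE => /andP[_ /eqP pj]; move: p0P'; rewrite inE => /andP[_ /eqP].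
  rewrite -pj /cl ![(_ + L * _)%N]addnC ![(L * _)%N]mulnC => eqd.
  have := congr1 (fun x => x %/ L)%N eqd; have := congr1 (fun x => x %% L)%N eqd.
  rewrite !modnMDl !divnMDl // !modn_small ?lt_cl // => ->.
  by rewrite !(divn_small (lt_cl _ _)) // !addn0 => ->.
pose w : R := N%:R / L%:R.
have L0' : 0 < L%:R :> R by rewrite ltr0n.
have diffw (a b : nat) : ((a * L) %/ N.+1 = (b * L) %/ N.+1)%N -> a%:R <= b%:R + w :> R.
  move=> ab; rewrite /w -lerBlDl ler_pdivlMr // mulrBl lerBlDl -!natrM -natrD ler_nat.
  rewrite (divn_eq (a * L) N.+1) ab (divn_eq (b * L) N.+1) divnMDl //.
  rewrite (divn_small (ltn_pmod _ _)) // addn0 -addnA leq_add2l.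
  by apply: leq_trans (_ : N <= _)%N; [rewrite -ltnS ltn_pmod | rewrite leq_addl].
(* Budget: [w] and [g] are each at most [e / 16] of [N], so the four windows below take [e / 2]; the
   two sets of elements with more than [g] flips take [e / 4] each. *)
pose g : R := e / 16 * N%:R.
have g0 : 0 <= g by rewrite mulr_ge0 // divr_ge0 // ltW.
have w0 : 0 <= w by rewrite divr_ge0.
pose bad := [set u in Q | g < #|[set v in Q | flips P' lam u v]|%:R].
pose badN := [set u in Q | g < #|[set v in Q | flips P' (fun p u => - lam p u) u v]|%:R].
pose Wd (la : TP -> TQ -> R) (B : TP -> {set TQ}) :=
  [set u in Q | [&& #|[set v in Q | flips P' la u v]|%:R <= g, u \notin B p0 &
      [exists p in P', u \in B p]]].
pose X2 := crossing (fun p uv => lam p uv.2 - lam p uv.1) P (setX Q Q).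
have flipX u v : u \in Q -> v \in Q -> flips P' lam u v -> (u, v) \in X2.
  move=> uQ vQ /existsP[p /andP[pP /existsP[p' /andP[p'P h]]]].
  rewrite inE in_setX uQ vQ /=; apply/existsP; exists p.
  rewrite (subsetP P'P) //; apply/existsP; exists p'.
  rewrite (subsetP P'P) //=; apply: contraNneq h => sgE.
  by rewrite -[_ <= _]subr_le0 -[X in _ == X]subr_le0 -sgr_le0 sgE sgr_le0.
have flipXN u v : u \in Q -> v \in Q -> flips P' (fun p u => - lam p u) u v ->
    (u, v) \in X2.
  move=> uQ vQ /existsP[p /andP[pP /existsP[p' /andP[p'P h]]]].
  rewrite inE in_setX uQ vQ /=; apply/existsP; exists p.
  rewrite (subsetP P'P) //; apply/existsP; exists p'.
  rewrite (subsetP P'P) //=; apply: contraNneq h => sgE.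
  by rewrite !lerN2 -[_ <= _]subr_ge0 -[X in _ == X]subr_ge0 -sgr_ge0 sgE sgr_ge0.
(* Markov's inequality: each counted element is the first component of more than [g] pairs in
   [X2]. *)
have badc (la : TP -> TQ -> R) :
    (forall u v, u \in Q -> v \in Q -> flips P' la u v -> (u, v) \in X2) ->
    #|[set u in Q | g < #|[set v in Q | flips P' la u v]|%:R]|%:R <= e / 4 * N%:R.
  move=> laX; set b := [set u in Q | _].
  have [N00|N0] := posnP N.
    have : (#|b| <= N)%N by apply: subset_leq_card; apply/subsetP => u; rewrite inE => /andP[].
    by rewrite N00 leqn0 => /eqP ->; rewrite mulr0.
  have gp : 0 < g by rewrite mulr_gt0 ?ltr0n // divr_gt0.
  rewrite -(ler_pM2r gp).
  apply: le_trans (_ : #|X2|%:R <= _); last first.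
    apply: le_trans Xe _; rewrite natrM -/N /g.
    apply: le_trans (_ : e / 16 * (e / 4) * (N%:R * N%:R) <= _).
      by rewrite ler_wpM2r // mulr_ge0.
    lra.
  apply: le_trans (_ : (\sum_(u in b) #|[set v in Q | flips P' la u v]|)%:R <= _).
    rewrite natr_sum mulr_natl -sumr_const; apply: ler_sum => u.
    by rewrite inE => /andP[_ /ltW].
  rewrite ler_nat.
  have -> : (\sum_(u in b) #|[set v in Q | flips P' la u v]| =
     #|[set uv : TQ * TQ | (uv.1 \in b) && (uv.2 \in [set v in Q | flips P' la uv.1 v])]|)%N.
    rewrite -[RHS]sum1_card; under [LHS]eq_bigr do rewrite -sum1_card.
    by rewrite pair_big_dep /=; apply: eq_bigl => uv; rewrite [RHS]inE.
  apply: subset_leq_card; apply/subsetP => -[u v].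
  rewrite [X in is_true X -> _]inE /= => /andP[ub uvb].
  have uQ : u \in Q by move: ub; rewrite in_set => /andP[].
  by move: uvb; rewrite in_set => /andP[vQ]; apply: laX.
have p0P : p0 \in P' by [].
have W1 : #|Wd lam Ble|%:R <= w + g.
  apply: window_bound => //.
  - by move=> p u v vQ le; rewrite !inE vQ => /andP[_ /(le_trans le)].
  - by move=> p pP; apply: diffw; case: (clE _ pP).
have W2 : #|Wd lam Blt|%:R <= w + g.
  apply: window_bound => //.
  - by move=> p u v vQ le; rewrite !inE vQ => /andP[_ /(le_lt_trans le)].
  - by move=> p pP; apply: diffw; case: (clE _ pP).
(* Elements leaving the segments are counted with the order reversed: the complements are initial
   segments for [- lam]. *)
have cD (A : {set TQ}) : A \subset Q -> #|Q :\: A|%:R = N%:R - #|A|%:R :> R.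
  move=> AQ; rewrite cardsD (setIidPr AQ) natrB // subset_leq_card //.
have W3 : #|Wd (fun p u => - lam p u) (fun p => Q :\: Ble p)|%:R <= w + g.
  apply: window_bound => //.
  - by move=> p; apply: subsetDl.
  - move=> p u v vQ; rewrite lerN2 !inE vQ /= andbT => le /andP[].
    by move=> h uQ; move: h; rewrite uQ /= -!ltNge => /lt_le_trans; apply.
  - move=> p pP; rewrite !cD //; have [h _] := clE _ pP; have := diffw _ _ (esym h); lra.
have W4 : #|Wd (fun p u => - lam p u) (fun p => Q :\: Blt p)|%:R <= w + g.
  apply: window_bound => //.
  - by move=> p; apply: subsetDl.
  - move=> p u v vQ; rewrite lerN2 !inE vQ /= andbT => le /andP[].
    by move=> h uQ; move: h; rewrite uQ /= -!leNgt => /le_trans; apply.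
  - move=> p pP; rewrite !cD //; have [_ h] := clE _ pP; have := diffw _ _ (esym h); lra.
have cov : crossing (fun p u => phi p - lam p u) P' Q \subset
   bad :|: badN :|: (Wd lam Ble :|: Wd lam Blt :|:
   (Wd (fun p u => - lam p u) (fun p => Q :\: Ble p) :|:
    Wd (fun p u => - lam p u) (fun p => Q :\: Blt p))).
  apply/subsetP => u uX; rewrite !in_setU.
  have uQ : u \in Q by move: uX; rewrite inE => /andP[].
  have [//|ub] := boolP (u \in bad); have [//|ubN] := boolP (u \in badN).
  rewrite !orFb.
  move: ub ubN; rewrite [u \in bad]inE [u \in badN]inE uQ !andTb -!leNgt => ub ubN.
  move: uX; rewrite inE => /andP[_ /existsP[p /andP[pP /existsP[p' /andP[p'P sgN]]]]].
  have {sgN p p' pP p'P} [p [pP sgN]] :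
      exists p, p \in P' /\ Num.sg (phi p - lam p u) != Num.sg (phi p0 - lam p0 u).
    have [E|?] := eqVneq (Num.sg (phi p - lam p u)) (Num.sg (phi p0 - lam p0 u));
      last by exists p.
    by exists p'; split => //; rewrite -E eq_sym.
  have inW (la : TP -> TQ -> R) (B : TP -> {set TQ}) :
      #|[set v in Q | flips P' la u v]|%:R <= g -> u \notin B p0 -> u \in B p ->
      u \in Wd la B.
    move=> h1 h2 h3; rewrite inE uQ h1 h2 /=; apply/existsP; exists p.
    by rewrite pP.
  case: (ltgtP (lam p0 u) (phi p0)) sgN => l0.
  - rewrite (gtr0_sg (_ : 0 < phi p0 - lam p0 u)) ?subr_gt0 // => sgN.
    rewrite (inW (fun p u => - lam p u) (fun p => Q :\: Blt p)) ?orbT //.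
      by rewrite !inE uQ l0.
    rewrite !inE uQ andbT; apply: contra sgN => /= l.
    by rewrite gtr0_sg ?subr_gt0.
  - rewrite (ltr0_sg (_ : phi p0 - lam p0 u < 0)) ?subr_lt0 // => sgN.
    rewrite (inW lam Ble) // ?inE uQ /=; first by rewrite -ltNge.
    by rewrite leNgt; apply: contra sgN => l; rewrite ltr0_sg ?subr_lt0.
  - rewrite l0 subrr sgr0 sgr_eq0 subr_eq0 eq_sym neq_lt => /orP[l|l].
      by rewrite (inW lam Blt) ?orbT // inE uQ ?l // l0 ltxx.
    rewrite (inW (fun p u => - lam p u) (fun p => Q :\: Ble p)) ?orbT //.
      by rewrite !inE uQ l0 lexx.
    by rewrite !inE uQ /= andbT -ltNge.
have wE : w <= e / 16 * N%:R.
  rewrite /w mulrC ler_wpM2r // -[X in X <= _]mul1r ler_pdivrMr //; lra.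
have b1 := badc lam flipX; have b2 := badc _ flipXN.
have cU (A B : {set TQ}) : #|A :|: B|%:R <= #|A|%:R + #|B|%:R :> R.
  by rewrite -natrD ler_nat cardsU leq_subr.
have : #|crossing (fun p u => phi p - lam p u) P' Q|%:R <=
   #|bad|%:R + #|badN|%:R + (#|Wd lam Ble|%:R + #|Wd lam Blt|%:R +
   (#|Wd (fun p u => - lam p u) (fun p => Q :\: Ble p)|%:R +
    #|Wd (fun p u => - lam p u) (fun p => Q :\: Blt p)|%:R)) :> R.
  apply: le_trans (_ : _ <= #|_|%:R) _; first by rewrite ler_nat; exact: subset_leq_card cov.
  apply: le_trans (cU _ _) _; apply: lerD; first exact: cU.
  by apply: le_trans (cU _ _) _; apply: lerD; exact: cU.
rewrite /bad /badN; move: W1 W2 W3 W4 b1 b2; rewrite /g; rewrite -/N; lra.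
Qed.

Lemma bilin_cuttable (D : nat) (e : R) : 0 < e -> exists2 c, 0 < c & cuttable D e c.
Proof.
elim: D e => [|D IH] e e0.
  exists 1 => // TP TQ phi psi P Q; exists P; split => //; first by rewrite mul1r.
  have -> : crossing (bilin 0 phi psi) P Q = set0.
    apply/setP => u; rewrite !inE; apply/negP => /andP[_].
    by move=> /existsP[p /andP[_ /existsP[q]]]; rewrite /bilin !big_ord0 eqxx andbF.
  by rewrite cards0 mulr_ge0 // ltW.
pose L := (Num.truncn (16 / e)).+1.
pose d2 := e / 16 * (e / 4).
have d20 : 0 < d2 by rewrite mulr_gt0 // divr_gt0.
have [c1 c10 cut1] := IH e e0.
have [c2 c20 cut2] := IH d2 d20.
have L0 : 0 < L%:R * L%:R :> R by rewrite mulr_gt0 // ltr0n.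
exists (c2 * c1 / (L%:R * L%:R)); first by rewrite divr_gt0 // mulr_gt0.
move=> TP TQ phi psi P Q.
pose Q0 := [set u in Q | psi u D == 0]; pose Q1 := Q :\: Q0.
have [P1 [P1P cP1 X1]] := cut1 TP TQ phi psi P Q0.
pose psi' u i := psi u i / psi u D.
pose lam p u := - \sum_(i < D) phi p i * psi' u i.
(* Whether [u] precedes [v] under [lam p] is the sign of a form with only [D] terms in [p] and the
   pair [(u, v)], so the induction hypothesis applies to pairs. *)
have [P2 [P2P1 cP2 X2]] := cut2 TP (TQ * TQ)%type phi
  (fun uv i => psi' uv.1 i - psi' uv.2 i) P1 (setX Q1 Q1).
have [||||P3 [P3P2 cP3 X3]] := @cuttable_order_step TP TQ lam (phi^~ D) P2 Q1 e d2 L e0 _ _ _ _.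
- by [].
- have := @Num.Theory.truncnS_gt R (16 / e); rewrite ltr_pdivrMr // mulrC => /ltW h.
  by rewrite mulrC; apply: le_trans h _; rewrite mulrC.
- by [].
- move: X2; rewrite cardsX; congr (_%:R <= _); congr (#|pred_of_set _|).
  apply/setP => -[u v]; rewrite !inE; congr (_ && _).
  apply: eq_existsb => p; congr (_ && _); apply: eq_existsb => p'; congr (_ && _).
  have E q : bilin D phi (fun uv i => psi' uv.1 i - psi' uv.2 i) q (u, v)
      = lam q v - lam q u.
    rewrite /bilin /lam opprK addrC -sumrB; apply: eq_bigr => i _ /=.
    by rewrite mulrBr.
  by rewrite !E.
exists P3; split.
- exact: fintype.subset_trans P3P2 (fintype.subset_trans P2P1 P1P).
- rewrite mulrAC ler_pdivrMr // -mulrA.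
  apply: le_trans (_ : c2 * #|P1|%:R <= _); first by rewrite ler_wpM2l // ltW.
  by apply: le_trans cP2 _; rewrite mulrC -!natrM ler_nat.
have cov : crossing (bilin D.+1 phi psi) P3 Q \subset
    crossing (bilin D phi psi) P1 Q0 :|: crossing (fun p u => phi p D - lam p u) P3 Q1.
  apply/subsetP => u uX; rewrite in_setU.
  have uQ : u \in Q by move: uX; rewrite inE => /andP[].
  have [u0|u0] := boolP (psi u D == 0).
    apply/orP; left; apply: (subsetP (crossing_sub _ _ (fintype.subset_trans P3P2 P2P1))).
    move: uX; rewrite !inE uQ u0 /=; congr is_true.
    apply: eq_existsb => p; congr (_ && _); apply: eq_existsb => p'; congr (_ && _).
    by rewrite /bilin !big_ord_recr /= (eqP u0) !mulr0 !addr0.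
  apply/orP; right; move: uX; rewrite !inE uQ u0 /= => /existsP[p /andP[pP /existsP[p' /andP[p'P h]]]].
  apply/existsP; exists p; rewrite pP; apply/existsP; exists p'; rewrite p'P /=.
  apply: contra h => /eqP sgE.
  have E q : bilin D.+1 phi psi q u = psi u D * (phi q D - lam q u).
    rewrite /bilin big_ord_recr /= /lam opprK mulrDr mulrC addrC; congr (_ + _).
    rewrite mulr_sumr; apply: eq_bigr => i _; rewrite /psi' mulrCA [psi u D * _]mulrC.
    by rewrite -!mulrA mulVf // mulr1.
  by rewrite !E !sgrM sgE.
apply: le_trans (_ : #|crossing (bilin D phi psi) P1 Q0|%:R +
   #|crossing (fun p u => phi p D - lam p u) P3 Q1|%:R <= _).
  rewrite -natrD ler_nat; apply: leq_trans (subset_leq_card cov) _.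
  by rewrite cardsU leq_subr.
apply: le_trans (lerD X1 X3) _; rewrite -mulrDr; apply: ler_wpM2l; first exact: ltW.
rewrite -natrD ler_nat /Q1 cardsD.
have -> : Q :&: Q0 = Q0 by apply/setIidPr/subsetP => u; rewrite inE => /andP[].
by rewrite subnKC // subset_leq_card //; apply/subsetP => u; rewrite inE => /andP[].
Qed.

Lemma crossing_iter (TP TQ : finType) (r : TP -> TQ -> R) (P P' : {set TP}) (Q : {set TQ}) :
  P' \subset P -> crossing r P' Q = crossing r P' (crossing r P Q).
Proof.
move=> PP; apply/setP => u; apply/idP/idP => [uX|].
  rewrite inE (subsetP (crossing_sub _ _ PP) _ uX).
  by move: uX; rewrite inE => /andP[].
by rewrite !inE => /andP[/andP[-> _] ->].
Qed.

(** Halving is repeated on the elements that still cross, about log(1/rho) times, and each round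
    keeps at least a fixed fraction [c] of the part. With [c] above 2^-tau the total cost is a power
    of [rho / 2] whose exponent does not depend on [rho]; this makes a [rho] of the form xi^-si
    affordable. *)
Lemma bilin_cutting (D : nat) : exists tau : nat, forall (rho : R), 0 < rho <= 1 ->
  forall (TP TQ : finType) (phi : TP -> nat -> R) (psi : TQ -> nat -> R)
         (P : {set TP}) (Q : {set TQ}),
  exists P' : {set TP}, [/\ P' \subset P, (rho / 2) ^+ tau * #|P|%:R <= #|P'|%:R &
    #|crossing (bilin D phi psi) P' Q|%:R <= rho * #|Q|%:R].
Proof.
have h2 : 0 < 2^-1 :> R by rewrite invr_gt0.
have h21 : 2^-1 < 1 :> R by rewrite invf_lt1 ?ltr1n.
have small (x : R) : 0 < x -> exists a, 2^-1 ^+ a < x.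
  move=> x0; exists (Num.truncn x^-1).+1; rewrite exprVn invf_plt ?posrE ?exprn_gt0 //.
  apply: lt_trans (@Num.Theory.truncnS_gt R x^-1) _.
  by rewrite -natrX ltr_nat ltn_expl.
have [c c0 cut] := bilin_cuttable D h2.
have [tau tauc] := small c c0.
exists tau => rho /andP[rho0 rho1] TP TQ phi psi P Q.
have iter_cut a : exists P' : {set TP}, [/\ P' \subset P,
    (2^-1 ^+ a) ^+ tau * #|P|%:R <= #|P'|%:R :> R &
    #|crossing (bilin D phi psi) P' Q|%:R <= 2^-1 ^+ a * #|Q|%:R :> R].
  elim: a => [|a [P1 [P1P cP1 X1]]].
    exists P; split; rewrite ?expr0 ?expr1n ?mul1r // ler_nat.
    by apply: subset_leq_card; apply/subsetP => u; rewrite inE => /andP[].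
  have [P2 [P2P1 cP2 X2]] := cut TP TQ phi psi P1 (crossing (bilin D phi psi) P1 Q).
  exists P2; split.
  - exact: fintype.subset_trans P2P1 P1P.
  - apply: le_trans cP2; rewrite exprS exprMn -mulrA.
    by apply: ler_pM => //; rewrite ?exprn_ge0 ?mulr_ge0 ?exprn_ge0 // ?(ltW h2) // ltW.
  - rewrite (crossing_iter _ _ P2P1); apply: le_trans X2 _.
    by rewrite exprS -mulrA ler_wpM2l // ltW.
have [a [a1 a2]] : exists a, rho / 2 <= 2^-1 ^+ a /\ 2^-1 ^+ a <= rho.
  have ex : exists a, 2^-1 ^+ a <= rho by have [a /ltW] := small rho rho0; exists a.
  exists (ex_minn ex); case: ex_minnP => -[|a] ha amin; split => //.
    rewrite expr0; lra.
  rewrite exprS mulrC ler_wpM2l ?(ltW h2) // leNgt; apply/negP => /ltW /amin.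
  by rewrite ltnn.
have [P' [P'P cP' X']] := iter_cut a.
exists P'; split => //.
  apply: le_trans cP'; rewrite ler_wpM2r // lerXn2r // ?nnegrE ?exprn_ge0 ?(ltW h2) //.
  by rewrite divr_ge0 // ltW.
by apply: le_trans X' _; rewrite ler_wpM2r.
Qed.

Definition splits (TP TQ : finType) (E : TP -> TQ -> bool) (P : {set TP}) :=
  [set u | [exists p in P, exists p' in P, E p u != E p' u]].

Definition cut_rel (tau : nat) (TP TQ : finType) (E : TP -> TQ -> bool) :=
  forall (rho : R) (P : {set TP}), 0 < rho <= 1 ->
  exists P' : {set TP}, [/\ P' \subset P, (rho / 2) ^+ tau * #|P|%:R <= #|P'|%:R &
    #|splits E P'|%:R <= 2 * rho * #|TQ|%:R].

(** An element split by [E] changes sign for one of the two forms. Cutting for one form after the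
    other doubles the exponent and the proportion. *)
Lemma bilin_cut_rel (D : nat) : exists tau : nat, forall (TP TQ : finType)
    (phi phi' : TP -> nat -> R) (psi psi' : TQ -> nat -> R) (E : TP -> TQ -> bool),
  (forall p u, E p u = (bilin D phi psi p u == 0) && (bilin D phi' psi' p u != 0)) ->
  cut_rel tau E.
Proof.
have [tau cut] := bilin_cutting D.
exists (tau + tau)%N => TP TQ phi phi' psi psi' E EE rho P rho01.
have [P1 [P1P cP1 X1]] := cut rho rho01 TP TQ phi psi P setT.
have [P2 [P2P1 cP2 X2]] := cut rho rho01 TP TQ phi' psi' P1 setT.
exists P2; split.
- exact: fintype.subset_trans P2P1 P1P.
- apply: le_trans cP2; rewrite exprD -mulrA ler_wpM2l // exprn_ge0 // divr_ge0 //.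
  by case/andP: rho01 => /ltW.
apply: le_trans (_ : #|crossing (bilin D phi psi) P1 setT|%:R +
  #|crossing (bilin D phi' psi') P2 setT|%:R <= _).
  rewrite -natrD ler_nat.
  apply: leq_trans (_ : #|crossing (bilin D phi psi) P1 setT :|:
     crossing (bilin D phi' psi') P2 setT| <= _)%N; last by rewrite cardsU leq_subr.
  apply: subset_leq_card; apply/subsetP => u.
  rewrite inE => /existsP[p /andP[pP /existsP[p' /andP[p'P h]]]].
  apply: contraR h; rewrite in_setU negb_or => /andP[h1 h2].
  rewrite !EE; apply/eqP; congr (_ && ~~ _).
    rewrite -[LHS]sgr_eq0 -[RHS]sgr_eq0; congr (_ == _); apply/eqP.
    apply: contraR h1 => h; rewrite inE in_setT /=; apply/existsP; exists p.
    by rewrite (subsetP P2P1) //; apply/existsP; exists p'; rewrite (subsetP P2P1).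
  rewrite -[LHS]sgr_eq0 -[RHS]sgr_eq0; congr (_ == _); apply/eqP.
  apply: contraR h2 => h; rewrite inE in_setT /=; apply/existsP; exists p.
  by rewrite pP //; apply/existsP; exists p'; rewrite p'P.
move: X1 X2; rewrite cardsT; lra.
Qed.

Section Incidence.
Variables (TP TQ : finType) (E : TP -> TQ -> bool) (tau : nat).
Hypothesis Ecut : cut_rel tau E.

Definition codeg (p q : TP) := #|[set u | E p u && E q u]|.

Variables (rho m m' M : R).
Hypothesis rho01 : 0 < rho <= 1.
Hypothesis m0 : 0 <= m.
Hypothesis m'0 : 0 <= m'.
Hypothesis M0 : 0 < M.
Hypothesis degM : forall p, #|[set u | E p u]|%:R <= M.
Hypothesis codegm : forall p u, E p u ->
  #|[set q | E q u && (m < (codeg p q)%:R)]|%:R <= m'.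

Let e : R := (\sum_p \sum_u (E p u : nat))%N%:R.
Let D : R := e / #|TP|%:R.
(** A lower bound for the part kept by the cut: at least [e / (2 * M)] rows have half the average
    degree or more. *)
Let c1 : R := (rho / 2) ^+ tau * (e / (2 * M)).

Lemma degE p : #|[set u | E p u]| = (\sum_u (E p u : nat))%N.
Proof.
rewrite -sum1_card big_mkcond /=; apply: eq_bigr => u _.
by rewrite inE; case: (E p u).
Qed.

(** Cut the set of rows of at least half the average degree. At most [m] columns meet all the rows
    kept: otherwise all these rows, more than [m'] of them, would have codegree above [m] with one
    row through one common column. Hence at least [c * D / 4] incidences lie on columns split by the
    kept rows, a proportion [2 * rho] of all columns at most, and Cauchy-Schwarz over these columns
    gains the factor [rho]. *)
Lemma incidence_bound : 4 * m <= D -> m' < c1 ->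
  D ^+ 2 <= 32 * rho * #|TQ|%:R * (m + M * m' / c1).
Proof.
move=> mD m'c.
have c10 : 0 < c1 by apply: le_lt_trans m'c.
have e0 : 0 <= e by rewrite ler0n.
have TP0 : (0 < #|TP|)%N.
  rewrite lt0n; apply/eqP => TP0; move: c10; rewrite /c1 /e big1 ?mul0r ?mulr0 ?ltxx //.
  by move=> p _; have := fintype.card0_eq TP0 p; rewrite inE.
have TP0' : 0 < #|TP|%:R :> R by rewrite ltr0n.
have D0 : 0 <= D by rewrite divr_ge0.
pose P0 := [set p | D / 2 <= #|[set u | E p u]|%:R].
have P0M : e / 2 <= #|P0|%:R * M.
  have : e <= #|P0|%:R * M + #|TP|%:R * (D / 2).
    rewrite /e natr_sum (bigID (mem P0)) /=; apply: lerD.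
      rewrite mulr_natl -sumr_const; apply: ler_sum => p _; rewrite -degE; exact: degM.
    rewrite mulr_natl -sumr_const [leRHS](bigID (mem P0)) /= -[leLHS]add0r lerD //.
      by apply: sumr_ge0 => p _; rewrite divr_ge0.
    by apply: ler_sum => p; rewrite inE -ltNge -degE => /ltW.
  rewrite mulrA [_ * D]mulrC divfK ?gt_eqF //; lra.
have [P' [P'P cP' X']] := @Ecut rho P0 rho01.
have c1P' : c1 <= #|P'|%:R.
  apply: le_trans cP'; rewrite ler_wpM2l //.
    by rewrite exprn_ge0 // divr_ge0 //; case/andP: rho01 => /ltW.
  by rewrite invfM mulrA ler_pdivrMr.
have P'0 : 0 < #|P'|%:R :> R by apply: lt_le_trans c1P'.
set c : R := #|P'|%:R in c1P' P'0.
pose F := [set u | [forall p in P', E p u]].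
have Fm : #|F|%:R <= m.
  rewrite leNgt; apply/negP => mF.
  have F0 : (0 < #|F|)%N by rewrite -(@ltr_nat R); apply: le_lt_trans mF.
  have [u0 u0F] := card_gt0P F0.
  have [p0 p0P] : exists p0, p0 \in P' by apply/card_gt0P; rewrite -(@ltr_nat R).
  have Fp p u : u \in F -> p \in P' -> E p u.
    by rewrite inE => /forallP /(_ p) /implyP; apply.
  have := le_lt_trans (codegm (Fp _ _ u0F p0P)) (lt_le_trans m'c c1P').
  apply/negP; rewrite -leNgt ler_nat; apply: subset_leq_card; apply/subsetP => q qP.
  rewrite inE (Fp _ _ u0F qP) /=; apply: lt_le_trans mF _; rewrite ler_nat.
  by apply: subset_leq_card; apply/subsetP => u uF; rewrite inE !Fp.
pose dg u : R := (\sum_(p in P') (E p u : nat))%N%:R.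
pose X := splits E P'.
have sumX : c * D / 4 <= \sum_(u in X) dg u.
  have low : c * (D / 2) <= \sum_u dg u.
    rewrite /dg -natr_sum exchange_big natr_sum /c mulr_natl -sumr_const.
    apply: ler_sum => p /(subsetP P'P); rewrite inE -degE //.
  have up : \sum_u dg u <= c * m + \sum_(u in X) dg u.
    rewrite [leLHS](bigID (mem X)) /= addrC lerD2r.
    apply: le_trans (_ : \sum_(u in F) c <= _).
      rewrite big_mkcond [leRHS]big_mkcond /=; apply: ler_sum => u _.
      case: ifPn => uX; last by case: ifP.
      have dgc : dg u <= c by rewrite /dg /c ler_nat -sum1_card; apply: leq_sum => p _; case: (E p u).
      case: ifPn => [//|uF]; rewrite /dg big1 // => p pP; apply/eqP; rewrite eqb0.
      apply: contra uF => Epu; rewrite inE; apply/forallP => q; apply/implyP => qP.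
      apply: contraR uX => nE; rewrite inE; apply/existsP; exists p; rewrite pP.
      by apply/existsP; exists q; rewrite qP Epu (negPf nE).
    by rewrite sumr_const -mulr_natl mulrC; apply: ler_wpM2l => //; apply: ltW.
  have : c * m <= c * (D / 4) by rewrite ler_pM2l //; lra.
  move: low up; lra.
have dg0 u : 0 <= dg u by rewrite ler0n.
have CS : (\sum_(u in X) dg u) ^+ 2 <= #|X|%:R * \sum_u dg u ^+ 2.
  have -> : (\sum_(u in X) dg u) ^+ 2 = \sum_(u in X) \sum_(v in X) dg u * dg v.
    by rewrite expr2 mulr_suml; apply: eq_bigr => u _; rewrite mulr_sumr.
  apply: le_trans (_ : \sum_(u in X) \sum_(v in X) (dg u ^+ 2 + dg v ^+ 2) / 2 <= _).
    apply: ler_sum => u _; apply: ler_sum => v _.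
    by have := sqr_ge0 (dg u - dg v); rewrite sqrrB; lra.
  apply: le_trans (_ : #|X|%:R * \sum_(u in X) dg u ^+ 2 <= _).
    under eq_bigr => u _ do rewrite -mulr_suml big_split /= sumr_const.
    rewrite -mulr_suml big_split /= sumr_const.
    under eq_bigr => u _ do rewrite -mulr_natl.
    by rewrite -mulr_sumr -[_ *+ #|_|]mulr_natl; lra.
  rewrite ler_wpM2l // [leRHS](bigID (mem X)) /= lerDl.
  by apply: sumr_ge0 => u _; rewrite sqr_ge0.
(* Pairs of rows of codegree at most [m] give the first term; the others are counted through their
   common columns, with at most [m'] heavy partners for each incidence. *)
have dg2 : \sum_u dg u ^+ 2 <= c * (c * m) + c * (M * m').
  have -> : \sum_u dg u ^+ 2 = \sum_(p in P') \sum_(q in P') (codeg p q)%:R.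
    under eq_bigr => u _ do rewrite /dg expr2 -natrM big_distrl /= natr_sum.
    rewrite exchange_big; apply: eq_bigr => p _.
    under eq_bigr => u _ do rewrite big_distrr /= natr_sum.
    rewrite exchange_big; apply: eq_bigr => q _.
    rewrite -natr_sum; congr (_%:R); rewrite /codeg -sum1_card [RHS]big_mkcond /=.
    by apply: eq_bigr => u _; rewrite inE; case: (E p u); case: (E q u).
  rewrite -mulrDr mulr_natl -sumr_const; apply: ler_sum => p pP.
  rewrite (bigID (fun q => (codeg p q)%:R <= m)) /=; apply: lerD.
    apply: le_trans (_ : \sum_(q in P') m <= _).
      rewrite [leRHS](bigID (fun q => (codeg p q)%:R <= m)) /= -[leLHS]addr0 lerD //.
        by apply: ler_sum => q /andP[].
      by apply: sumr_ge0.
    by rewrite sumr_const -mulr_natl.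
  apply: le_trans (_ : \sum_(u | E p u) #|[set q | E q u && (m < (codeg p q)%:R)]|%:R <= _).
    under [leRHS]eq_bigr => u _ do rewrite -sum1_card natr_sum.
    rewrite [leRHS](exchange_big_dep predT) //=.
    rewrite [leRHS](bigID (fun q => (q \in P') && ~~ ((codeg p q)%:R <= m))) /=.
    rewrite -[leLHS]addr0 lerD //; last first.
      by apply: sumr_ge0 => q _; apply: sumr_ge0.
    apply: ler_sum => q /andP[_]; rewrite -ltNge => mq.
    rewrite -natr_sum sum1_card ler_nat /codeg; apply: subset_leq_card.
    by apply/subsetP => u; rewrite !inE unfold_in => /andP[h1 h2]; rewrite inE h1 h2 mq.
  apply: le_trans (_ : \sum_(u | E p u) m' <= _).
    by apply: ler_sum => u Epu; apply: codegm.
  rewrite sumr_const -mulr_natl ler_wpM2r //.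
  apply: le_trans (degM p); rewrite ler_nat; apply: subset_leq_card.
  by apply/subsetP => u; rewrite !inE.
have key : (c * D / 4) ^+ 2 <= 2 * rho * #|TQ|%:R * (c * (c * m) + c * (M * m')).
  apply: le_trans (_ : (\sum_(u in X) dg u) ^+ 2 <= _).
    by rewrite lerXn2r // nnegrE ?divr_ge0 ?mulr_ge0 ?sumr_ge0 // ltW.
  apply: le_trans CS _; apply: ler_pM => //.
  by apply: sumr_ge0 => u _; rewrite sqr_ge0.
have r0 : 0 <= rho * #|TQ|%:R by rewrite mulr_ge0 //; case/andP: rho01 => /ltW.
apply: le_trans (_ : 32 * rho * #|TQ|%:R * (m + M * m' / c) <= _); last first.
  rewrite -!mulrA ler_wpM2l // !mulrA ler_wpM2l // -!mulrA lerD2l.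
  rewrite ler_wpM2l ?(ltW M0) // ler_wpM2l // lef_pV2 ?posrE //.
have cc : 0 < c ^+ 2 by rewrite exprn_gt0.
rewrite -(ler_pM2l cc).
have -> : c ^+ 2 * (32 * rho * #|TQ|%:R * (m + M * m' / c)) =
   16 * (2 * rho * #|TQ|%:R * (c * (c * m) + c * (M * m'))).
  have : c * c^-1 = 1 by rewrite divff ?gt_eqF.
  move=> ci; have -> : c ^+ 2 * (32 * rho * #|TQ|%:R * (m + M * m' / c)) =
   32 * rho * #|TQ|%:R * (c * c * m + c * (c * c^-1) * (M * m')) by ring.
  by rewrite ci; ring.
move: key; rewrite !exprMn; lra.
Qed.

End Incidence.

(** The bound read on exponents of [x], the slack [th] absorbing the constants. The first two
    inequalities are the two hypotheses of [incidence_bound]; the last two push each summand of its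
    right-hand side below the square of the average degree, so that some incidence must have many
    partners of high codegree. *)
Lemma incidence_pow (TP TQ : finType) (E : TP -> TQ -> bool) (tau : nat)
    (x a b mu nu om si th : R) :
  cut_rel tau E -> 1 <= x -> 2 ^+ (tau + 8) <= x `^ th -> 0 <= si ->
  #|TP|%:R <= x `^ a -> #|TQ|%:R <= x `^ a ->
  x `^ b <= (\sum_p \sum_u (E p u : nat))%N%:R ->
  (forall p, #|[set u | E p u]|%:R <= x `^ nu) ->
  mu + th <= b - a -> om + th <= b - nu - si * tau%:R ->
  a - si + mu + th <= 2 * (b - a) ->
  a - si + nu + om - (b - nu - si * tau%:R) + th <= 2 * (b - a) ->
  exists p u, E p u /\ x `^ om < #|[set q | E q u && (x `^ mu < (codeg E p q)%:R)]|%:R.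
Proof.
move=> Ecut x1 xth si0 TPa TQa eb degn H1 H2 H3 H4.
apply: contrapT => nex.
have x0 : 0 < x by apply: lt_le_trans x1.
have px y : 0 < x `^ y by rewrite powR_gt0.
have pm y z : y <= z -> x `^ y <= x `^ z by apply: ler_powR.
have pD y z : x `^ (y + z) = x `^ y * x `^ z by rewrite powRD // (gt_eqF x0) implybT.
have codegm p u : E p u -> #|[set q | E q u && (x `^ mu < (codeg E p q)%:R)]|%:R <= x `^ om.
  by move=> Epu; rewrite leNgt; apply/negP => h; apply: nex; exists p, u.
pose rho := x `^ (- si).
have rho01 : 0 < rho <= 1.
  by rewrite px /= /rho -[leRHS](powRr0 x) pm // oppr_le0.
pose e : R := (\sum_p \sum_u (E p u : nat))%N%:R.
have TP0 : 0 < #|TP|%:R :> R.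
  rewrite ltr0n lt0n; apply/eqP => TP0; move: eb; rewrite big1 ?leNgt ?px //.
  by move=> p _; have := fintype.card0_eq TP0 p; rewrite inE.
pose D := e / #|TP|%:R.
have Dlow : x `^ (b - a) <= D.
  rewrite /D ler_pdivlMr //; apply: le_trans eb.
  apply: le_trans (_ : x `^ (b - a) * x `^ a <= _); first by rewrite ler_wpM2l // ltW.
  by rewrite -pD subrK.
pose c2 := x `^ (b - nu - si * tau%:R) / 2 ^+ tau.+1.
pose c1 := (rho / 2) ^+ tau * (e / (2 * x `^ nu)).
have two k : 0 < 2 ^+ k :> R by rewrite exprn_gt0.
have rt : rho ^+ tau = x `^ (- (si * tau%:R)).
  by rewrite /rho -powR_mulrn ?(ltW (px _)) // -powRrM mulNr.
have xnE : x `^ (b - nu - si * tau%:R) = x `^ b * rho ^+ tau / x `^ nu.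
  apply/eqP; rewrite eq_sym; apply/eqP; apply: (canLR (mulfK _)); first by rewrite gt_eqF.
  by rewrite rt -!pD; congr (_ `^ _); ring.
have c2E : c2 = (rho / 2) ^+ tau * (x `^ b / (2 * x `^ nu)).
  rewrite /c2 xnE exprMn exprVn exprS; field.
  by rewrite !gt_eqF.
have c2c1 : c2 <= c1.
  rewrite c2E /c1 ler_wpM2l //.
    by rewrite exprn_ge0 // divr_ge0 // ltW //; case/andP: rho01.
  by rewrite ler_wpM2r // invr_ge0 mulr_ge0 // ltW.
have c20 : 0 < c2 by rewrite divr_gt0.
have h1 : 1 <= 2 ^+ tau :> R by rewrite exprn_ege1 // ler1n.
have th8 : 2 ^+ tau * 256 <= x `^ th.
  apply: le_trans xth; rewrite exprD; have -> : 2 ^+ 8 = 256 :> R by ring.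
  by [].
have mD : 4 * x `^ mu <= D.
  apply: le_trans Dlow; apply: le_trans (pm _ _ H1); rewrite pD.
  by rewrite mulrC ler_pM2l //; lra.
have omc : x `^ om < c2.
  rewrite /c2 ltr_pdivlMr //; apply: lt_le_trans (pm _ _ H2).
  rewrite pD ltr_pM2l // exprS; lra.
have := incidence_bound Ecut rho01 (ltW (px mu)) (ltW (px om)) (px nu) degn codegm mD
  (lt_le_trans omc c2c1).
apply/negP; rewrite -ltNge -/e -/D -/c1.
have up : x `^ mu + x `^ nu * x `^ om / c1 <= x `^ mu + x `^ nu * x `^ om / c2.
  rewrite lerD2l ler_wpM2l ?mulr_ge0 ?(ltW (px _)) // lef_pV2 ?posrE //.
  exact: lt_le_trans c2c1.
have D2 : x `^ (2 * (b - a)) <= D ^+ 2.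
  rewrite mulrC powRrM powR_mulrn ?(ltW (px _)) // lerXn2r ?nnegrE ?(ltW (px _)) //.
  by apply: le_trans Dlow; apply: ltW.
apply: lt_le_trans D2.
have r0 : 0 <= rho * #|TQ|%:R by rewrite mulr_ge0 //; case/andP: rho01 => /ltW.
apply: le_lt_trans (_ : 32 * x `^ (a - si) * (x `^ mu + x `^ nu * x `^ om / c2) < _).
  apply: le_trans (_ : 32 * rho * #|TQ|%:R * (x `^ mu + x `^ nu * x `^ om / c2) <= _).
    by rewrite ler_wpM2l // -mulrA mulr_ge0.
  rewrite ler_wpM2r ?addr_ge0 ?divr_ge0 ?mulr_ge0 ?(ltW (px _)) ?(ltW c20) //.
  rewrite -mulrA ler_wpM2l // addrC pD ler_wpM2l // ltW //; by case/andP: rho01.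
have -> : x `^ nu * x `^ om / c2 = 2 ^+ tau.+1 * x `^ (nu + om - (b - nu - si * tau%:R)).
  rewrite [X in _ = _ * X]powRB; last by rewrite (gt_eqF x0) implybT.
  rewrite /c2 [x `^ (nu + om)]pD; field; by rewrite !gt_eqF.
have -> : 32 * x `^ (a - si) * (x `^ mu + 2 ^+ tau.+1 * x `^ (nu + om - (b - nu - si * tau%:R)))
  = 32 * x `^ (a - si + mu) + 64 * 2 ^+ tau * x `^ (a - si + nu + om - (b - nu - si * tau%:R)).
  have -> : x `^ (a - si + mu) = x `^ (a - si) * x `^ mu by rewrite pD.
  have -> : x `^ (a - si + nu + om - (b - nu - si * tau%:R)) =
     x `^ (a - si) * x `^ (nu + om - (b - nu - si * tau%:R)).
    by rewrite -pD; congr (_ `^ _); ring.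
  rewrite exprS; ring.
set Y := x `^ (2 * (b - a)).
have Y1 : x `^ (a - si + mu) * (2 ^+ tau * 256) <= Y.
  by apply: le_trans (pm _ _ H3); rewrite [leRHS]pD ler_wpM2l // ltW.
have Y2 : x `^ (a - si + nu + om - (b - nu - si * tau%:R)) * (2 ^+ tau * 256) <= Y.
  by apply: le_trans (pm _ _ H4); rewrite [leRHS]pD ler_wpM2l // ltW.
have Y0 : 0 < Y by exact: px.
set y1 := x `^ (a - si + mu) in Y1 *; set y2 := x `^ _ in Y2 *.
have y10 : 0 < y1 by exact: px.
have : y1 * 256 <= y1 * (2 ^+ tau * 256) by rewrite ler_pM2l //; lra.
lra.
Qed.

End Cutting.

Local Open Scope classical_set_scope.
Local Open Scope ring_scope.

(** * Polynomial expressions, specializations and transcendence degree *)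

Section AlgebraicOverSubfield.
Variables (K : fieldType) (F : set K).
Hypothesis FP : is_subfield F.

Definition algebraic_over (z : K) :=
  exists p : {poly K}, [/\ p != 0, forall i, F p`_i & root p z].

(** Carrying the proof in the predicate lets a closure instance be attached to the set [F], and so a
    field type be built from it, to which the library theory of algebraic elements applies. *)
Definition subfield_pred (_ : is_subfield F) : {pred K} := mem F.

HB.instance Definition _ := GRing.isDivringClosed.Build K (subfield_pred FP) FP.

Definition subfield_type := sig (fun x : K => x \in subfield_pred FP).

HB.instance Definition _ := SubChoice.on subfield_type.
HB.instance Definition _ := [SubChoice_isSubIntegralDomain of subfield_type by <:].
HB.instance Definition _ := [SubIntegralDomain_isSubField of subfield_type by <:].

Lemma algebraic_overE z :
  algebraic_over z <-> algebraicOver (val : subfield_type -> K) z.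
Proof.
split=> [[p [p0 pF pz]]|[p p0 pz]].
  have pF' i : p`_i \in subfield_pred FP by exact/mem_set.
  pose q : {poly subfield_type} := \poly_(i < size p) Sub p`_i (pF' i).
  have qE : map_poly val q = p.
    apply/polyP => i; rewrite coef_map coef_poly; case: ltnP => [//|h].
    by rewrite [RHS]nth_default.
  exists q; last by rewrite qE.
  by apply: contraNneq p0 => q0; rewrite -qE q0 rmorph0.
exists (map_poly val p); split => //; first by rewrite map_poly_eq0.
by move=> i; rewrite coef_map; apply: set_mem; exact: valP.
Qed.

Lemma algebraic_over_id z : F z -> algebraic_over z.
Proof.
move=> Fz; apply/algebraic_overE.
have zF : z \in subfield_pred FP by exact: mem_set.
exact: (algebraic_id _ (Sub z zF : subfield_type)).
Qed.

Lemma algebraic_overD x y :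
  algebraic_over x -> algebraic_over y -> algebraic_over (x + y).
Proof. by move=> /algebraic_overE h /algebraic_overE h'; exact/algebraic_overE/algebraic_add. Qed.

Lemma algebraic_overM x y :
  algebraic_over x -> algebraic_over y -> algebraic_over (x * y).
Proof. by move=> /algebraic_overE h /algebraic_overE h'; exact/algebraic_overE/algebraic_mul. Qed.

Lemma algebraic_over_trans (p : {poly K}) z :
  p != 0 -> root p z -> (forall i, algebraic_over p`_i) -> algebraic_over z.
Proof.
move=> p0 pz pF; apply/algebraic_overE/integral_algebraic.
apply: (@integral_root _ _ _ p) => // x /(nthP 0)[i _ <-].
exact/integral_algebraic/algebraic_overE.
Qed.

End AlgebraicOverSubfield.

Section Pexp.
Variables (K : fieldType) (C0 : set K).
Hypothesis C0P : is_subfield C0.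

(** Polynomials over [C0] as syntax: no fixed number of variables, substitution by structural
    recursion, countably many when [C0] is countable, and a direct translation into terms of the
    language. *)
Inductive pexp :=
| PV of nat
| PC of C0
| PA of pexp & pexp
| PM of pexp & pexp.

Fixpoint pev (s : seq K) (p : pexp) : K :=
  match p with
  | PV k => s`_k
  | PC c => set_val c
  | PA p q => pev s p + pev s q
  | PM p q => pev s p * pev s q
  end.

Let C00 : C0 0.
Proof. by have [h1 h2 _] := C0P; rewrite -(subrr 1); apply/set_mem/h2. Qed.
Let C01 : C0 1.
Proof. by have [h1 _ _] := C0P; apply/set_mem. Qed.
Let C0N x : C0 x -> C0 (- x).
Proof. by have [_ h2 _] := C0P => Cx; rewrite -sub0r; apply/set_mem/h2; apply/mem_set. Qed.
Let C0D x y : C0 x -> C0 y -> C0 (x + y).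
Proof.
have [_ h2 _] := C0P => Cx Cy; rewrite -[y]opprK; apply/set_mem/h2; apply/mem_set => //.
exact: C0N.
Qed.
Let C0V x : C0 x -> C0 x^-1.
Proof. by have [_ _ h3] := C0P => Cx; rewrite -div1r; apply/set_mem/h3; apply/mem_set. Qed.
Let C0M x y : C0 x -> C0 y -> C0 (x * y).
Proof.
have [_ _ h3] := C0P => Cx Cy; rewrite -[y]invrK; apply/set_mem/h3; apply/mem_set => //.
exact: C0V.
Qed.

Lemma subfield0 : C0 0. Proof. exact: C00. Qed.
Lemma subfield1 : C0 1. Proof. exact: C01. Qed.
Lemma subfieldD x y : C0 x -> C0 y -> C0 (x + y). Proof. exact: C0D. Qed.
Lemma subfieldM x y : C0 x -> C0 y -> C0 (x * y). Proof. exact: C0M. Qed.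

Definition pcst c (Cc : C0 c) : pexp := PC (SigSub (mem_set Cc)).
Lemma pev_cst s c (Cc : C0 c) : pev s (pcst Cc) = c. Proof. by []. Qed.

Definition P0 := pcst C00.
Definition P1 := pcst C01.
Definition PN p := PM (pcst (C0N C01)) p.
Lemma pev0 s : pev s P0 = 0. Proof. by []. Qed.
Lemma pev1 s : pev s P1 = 1. Proof. by []. Qed.
Lemma pevN s p : pev s (PN p) = - pev s p. Proof. by rewrite /= mulN1r. Qed.

Definition psum (ps : seq pexp) := foldr PA P0 ps.
Lemma pev_sum s ps : pev s (psum ps) = \sum_(p <- ps) pev s p.
Proof. by elim: ps => [|p ps IH]; rewrite ?big_nil ?big_cons //= IH. Qed.

Definition pprod (ps : seq pexp) := foldr PM P1 ps.
Lemma pev_prod s ps : pev s (pprod ps) = \prod_(p <- ps) pev s p.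
Proof. by elim: ps => [|p ps IH]; rewrite ?big_nil ?big_cons //= IH. Qed.

Definition pexn p k := iter k (PM p) P1.
Lemma pev_exn s p k : pev s (pexn p k) = pev s p ^+ k.
Proof. by elim: k => [|k IH]; rewrite ?expr0 ?exprS //= -/(pexn p k) IH. Qed.

Fixpoint psub (f : nat -> pexp) (p : pexp) : pexp :=
  match p with
  | PV k => f k
  | PC c => PC c
  | PA p q => PA (psub f p) (psub f q)
  | PM p q => PM (psub f p) (psub f q)
  end.

Lemma pev_psub f s s' p : (forall k, pev s (f k) = s'`_k) -> pev s (psub f p) = pev s' p.
Proof. by move=> h; elim: p => //= p IHp q IHq; rewrite IHp IHq. Qed.

Definition pshift := psub (fun k => PV k.+1).
Lemma pev_shift z s p : pev (z :: s) (pshift p) = pev s p.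
Proof. exact: pev_psub. Qed.

(** Variable 0 becomes the indeterminate and the others take their values from [s], so that
    evaluation at [z] is evaluation in [z :: s]. *)
Fixpoint upoly (s : seq K) (p : pexp) : {poly K} :=
  match p with
  | PV 0 => 'X
  | PV k.+1 => (s`_k)%:P
  | PC c => (set_val c)%:P
  | PA p q => upoly s p + upoly s q
  | PM p q => upoly s p * upoly s q
  end.

Lemma horner_upoly s p z : (upoly s p).[z] = pev (z :: s) p.
Proof.
elim: p => [[|k]|c|p IHp q IHq|p IHp q IHq] /=; rewrite ?hornerX ?hornerC //.
  by rewrite hornerD IHp IHq.
by rewrite hornerM IHp IHq.
Qed.

(** The coefficients are themselves expressions, the same for all [s]; one that vanishes at [s] then
    vanishes at every specialization of [s]. *)
Fixpoint pcoef (p : pexp) (j : nat) : pexp :=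
  match p with
  | PV 0 => if j == 1%N then P1 else P0
  | PV k.+1 => if j == 0%N then PV k else P0
  | PC c => if j == 0%N then PC c else P0
  | PA p q => PA (pcoef p j) (pcoef q j)
  | PM p q => psum [seq PM (pcoef p i) (pcoef q (j - i)%N) | i <- iota 0 j.+1]
  end.

Lemma coef_upoly s p j : (upoly s p)`_j = pev s (pcoef p j).
Proof.
elim: p j => [[|k]|c|p IHp q IHq|p IHp q IHq] j.
- by rewrite coefX /=; case: eqP.
- by rewrite coefC /=; case: eqP.
- by rewrite coefC /=; case: eqP.
- by rewrite coefD /= IHp IHq.
- rewrite coefM -[pcoef _ _]/(psum _) pev_sum big_map -(big_mkord xpredT
    (fun i => (upoly s p)`_i * (upoly s q)`_(j - i))) /index_iota subn0.
  by apply: eq_bigr => i _; rewrite IHp IHq.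
Qed.

Fixpoint pofseq (cs : seq pexp) : pexp :=
  if cs is c :: cs' then PA (PM (pofseq cs') (PV 0)) (pshift c) else P0.

Lemma upoly_shift s p : upoly s (pshift p) = (pev s p)%:P.
Proof. by elim: p => //= p IHp q IHq; rewrite ?polyCD ?polyCM IHp IHq. Qed.

Lemma coef_pofseq s cs j : (upoly s (pofseq cs))`_j = pev s (nth P0 cs j).
Proof.
elim: cs j => [|c cs IH] j; first by rewrite /= coefC nth_nil /=; case: eqP.
by rewrite /= coefD coefMX upoly_shift coefC; case: j => [|j]; rewrite ?add0r ?addr0 //= IH.
Qed.

Lemma size_pofseq s cs : (size (upoly s (pofseq cs)) <= size cs)%N.
Proof. by apply/leq_sizeP => j h; rewrite coef_pofseq nth_default. Qed.

(* s' is a specialization of s over C0. *)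
Definition sp (s s' : seq K) :=
  size s = size s' /\ forall p, pev s p = 0 -> pev s' p = 0.

Lemma sp_refl s : sp s s. Proof. by []. Qed.
Lemma sp_trans s2 s1 s3 : sp s1 s2 -> sp s2 s3 -> sp s1 s3.
Proof. by move=> [h1 h2] [h3 h4]; split=> [|p /h2/h4//]; rewrite h1. Qed.

Lemma sp_eq s s' p q : sp s s' -> pev s p = pev s q -> pev s' p = pev s' q.
Proof.
move=> [_ h] e; apply/eqP; rewrite -subr_eq0 -pevN; apply/eqP.
by apply: (h (PA p (PN q))); rewrite /= mulN1r e subrr.
Qed.

(* [sprel s s'] is the graph of the ring morphism C0[s] -> C0[s'] when [sp s s'] holds. *)
Definition sprel (s s' : seq K) (x y : K) := exists p, x = pev s p /\ y = pev s' p.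

Lemma sp_rel s s' t t' : sp s s' -> size t = size t' ->
  (forall k, sprel s s' t`_k t'`_k) -> sp t t'.
Proof.
move=> [_ h] st /choice[f fP]; split=> // p pt.
have E1 : pev s (psub f p) = pev t p by apply: pev_psub => k; case: (fP k).
have E2 : pev s' (psub f p) = pev t' p by apply: pev_psub => k; case: (fP k).
by rewrite -E2; apply: h; rewrite E1.
Qed.

Lemma rel_nth s s' k : sprel s s' s`_k s'`_k.
Proof. by exists (PV k). Qed.

Lemma rel_cst s s' c : C0 c -> sprel s s' c c.
Proof. by move=> Cc; exists (pcst Cc). Qed.

Lemma sp_catl s t s' t' : sp (s ++ t) (s' ++ t') -> size s = size s' -> sp s s'.
Proof.
move=> h ss; apply: sp_rel (h) (ss) _ => k; case: (ltnP k (size s)) => ks; last first.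
  have ks' : (size s' <= k)%N by rewrite -ss.
  by rewrite !nth_default //; exact: (rel_cst _ _ C00).
by exists (PV k); rewrite /= !nth_cat -ss ks.
Qed.

Lemma sp_catr s t s' t' : sp (s ++ t) (s' ++ t') -> size s = size s' -> sp t t'.
Proof.
move=> h ss; apply: sp_rel (h) _ _.
  by case: h => + _; rewrite !size_cat ss => /addnI.
move=> k; exists (PV (size s + k)); rewrite /= !nth_cat -ss ltnNge leq_addr /=.
by rewrite addKn.
Qed.

Lemma sp_catC s t s' t' : sp (s ++ t) (s' ++ t') -> size s = size s' -> sp (t ++ s) (t' ++ s').
Proof.
move=> h ss; have tt : size t = size t'.
  by case: h => + _; rewrite !size_cat ss => /addnI.
apply: sp_rel (h) _ _; first by rewrite !size_cat ss tt.
move=> k; rewrite !nth_cat -tt; case: ltnP => kt.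
  by exists (PV (size s + k)); rewrite /= !nth_cat -ss ltnNge leq_addr /= addKn.
case: (ltnP (k - size t) (size s)) => ks; last first.
  have ks' : (size s' <= k - size t)%N by rewrite -ss.
  by rewrite !nth_default //; exact: (rel_cst _ _ C00).
by exists (PV (k - size t)%N); rewrite /= !nth_cat -ss ks.
Qed.

(* Algebraicity over the field generated by C0 and the sequence [t]. *)
Definition acl (t : seq K) : set K :=
  [set z | exists p, upoly t p != 0 /\ pev (z :: t) p = 0].

Definition ratfield (t : seq K) : set K :=
  [set z | exists p q, pev t q != 0 /\ z = pev t p / pev t q].

Lemma ratfield_ring t p : ratfield t (pev t p).
Proof. by exists p, P1; rewrite pev1 oner_neq0 divr1. Qed.

Lemma ratfield_subfield t : is_subfield (ratfield t).
Proof.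
split; first by apply: mem_set; rewrite -(pev1 t); exact: ratfield_ring.
- move=> x y /set_mem[p [q [q0 ->]]] /set_mem[p' [q' [q'0 ->]]]; apply: mem_set.
  exists (PA (PM p q') (PN (PM p' q))), (PM q q'); split; first by rewrite /= mulf_neq0.
  by rewrite /= mulN1r -mulNr addf_div // mulNr.
- move=> x y /set_mem[p [q [q0 ->]]] /set_mem[p' [q' [q'0 ->]]]; apply: mem_set.
  have [E|p'0] := eqVneq (pev t p') 0.
    by exists P0, P1; rewrite pev1 pev0 oner_neq0 E mul0r invr0 mulr0 mul0r.
  exists (PM p q'), (PM q p'); split; first by rewrite /= mulf_neq0.
  by rewrite /= invf_div mulf_div.
Qed.

Lemma aclE t z : acl t z <-> algebraic_over (ratfield t) z.
Proof.
split=> [[p [p0 pz]]|[p [p0 pF pz]]].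
  exists (upoly t p); split => //; first by move=> i; rewrite coef_upoly; exact: ratfield_ring.
  by rewrite rootE horner_upoly pz.
have /choice[cs csP] i : exists c : pexp * pexp, pev t c.2 != 0 /\ p`_i = pev t c.1 / pev t c.2.
  by have [a [b]] := pF i; exists (a, b).
pose den := \prod_(i <- iota 0 (size p)) pev t (cs i).2.
have den0 : den != 0 by rewrite prodf_seq_neq0; apply/allP => i _; case: (csP i).
have cden i : (i < size p)%N -> exists q, pev t q = den * p`_i.
  move=> ip; exists (PM (cs i).1 (pprod [seq (cs j).2 | j <- rem i (iota 0 (size p))])).
  rewrite /= pev_prod big_map /den [in RHS](big_rem i) ?mem_iota //=.
  by have [d0 ->] := csP i; field.
have /choice[ds dsP] i : exists d, (i < size p)%N -> pev t d = den * p`_i.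
  by case: (ltnP i (size p)) => [/cden[q]|]; [exists q | exists P0].
have E : upoly t (pofseq [seq ds i | i <- iota 0 (size p)]) = den *: p.
  apply/polyP => i; rewrite coef_pofseq coefZ; case: (ltnP i (size p)) => ip.
    by rewrite (nth_map 0%N) ?size_iota // nth_iota // dsP.
  by rewrite !nth_default ?size_map ?size_iota // mulr0.
exists (pofseq [seq ds i | i <- iota 0 (size p)]); split.
  by rewrite E scaler_eq0 negb_or den0.
by rewrite -horner_upoly E hornerZ (rootP pz) mulr0.
Qed.

Lemma acl_pev t p : acl t (pev t p).
Proof. by apply/aclE/algebraic_over_id; [exact: ratfield_subfield | exact: ratfield_ring]. Qed.

Lemma acl_ratfield t : ratfield t `<=` acl t.
Proof. by move=> z tz; apply/aclE/algebraic_over_id => //; exact: ratfield_subfield. Qed.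

Lemma acl_mem t z : z \in t -> acl t z.
Proof. by move=> /(nthP 0)[i _ <-]; exact: (acl_pev t (PV i)). Qed.

Lemma acl_cst t c : C0 c -> acl t c.
Proof. by move=> Cc; exact: (acl_pev t (pcst Cc)). Qed.

Lemma aclD t x y : acl t x -> acl t y -> acl t (x + y).
Proof. by move=> /aclE h /aclE h'; exact/aclE/(algebraic_overD (ratfield_subfield t)). Qed.

Lemma aclM t x y : acl t x -> acl t y -> acl t (x * y).
Proof. by move=> /aclE h /aclE h'; exact/aclE/(algebraic_overM (ratfield_subfield t)). Qed.

Lemma acl_trans s t z : (forall x, x \in s -> acl t x) -> acl s z -> acl t z.
Proof.
move=> st [p [p0 pz]]; apply/aclE.
apply: (@algebraic_over_trans _ _ (ratfield_subfield t) (upoly s p)) => //.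
  by rewrite rootE horner_upoly pz.
move=> i; apply/aclE; rewrite coef_upoly; elim: (pcoef p i) => /=.
- move=> k; case: (ltnP k (size s)) => ks; first by apply: st; exact: mem_nth.
  by rewrite nth_default //; apply: acl_cst; exact: C00.
- by move=> c; apply: acl_cst; apply: set_valP.
- by move=> a ha b hb; apply: aclD.
- by move=> a ha b hb; apply: aclM.
Qed.

Lemma acl_sub s t z : {subset s <= t} -> acl s z -> acl t z.
Proof. by move=> st; apply: acl_trans => x /st; exact: acl_mem. Qed.

Lemma acl_cons_trans x t z : acl t x -> acl (x :: t) z -> acl t z.
Proof. by move=> tx; apply: acl_trans => y /[!inE]/predU1P[->//|]; exact: acl_mem. Qed.

End Pexp.

Section Rank.
Variables (K : fieldType) (C0 : set K).
Hypothesis C0P : is_subfield C0.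
Hypothesis char0 : forall n, n.+1%:R != 0 :> K.
Local Notation pexp := (pexp C0).
Local Notation acl := (@acl K C0).
Local Notation sp := (@sp K C0).
Local Notation sprel := (@sprel K C0).

Lemma natr_inj (i j : nat) : i%:R = j%:R :> K -> i = j.
Proof.
wlog ij : i j / (i <= j)%N => [hw|].
  by case: (leqP i j) => [/hw//|/ltnW/hw h /esym/h].
move=> /eqP; rewrite eq_sym -subr_eq0 -natrB //; case E : (j - i)%N => [|d].
  by move=> _; apply/eqP; rewrite eqn_leq ij -subn_eq0 E.
by rewrite (negPf (char0 d)).
Qed.

Lemma poly_infinite_roots (p : {poly K}) : (forall n, root p n%:R) -> p = 0.
Proof.
move=> pr; apply/eqP; apply: contraT => p0.
have := max_poly_roots p0 (_ : all (root p) [seq i%:R | i <- iota 0 (size p)]) _.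
rewrite size_map size_iota ltnn => -> //.
  by apply/allP => _ /mapP[i _ ->].
by rewrite map_inj_uniq ?iota_uniq //; exact: natr_inj.
Qed.

Lemma upoly_eq0 (s s' : seq K) (p : pexp) : sp s s' -> upoly s p = 0 -> upoly s' p = 0.
Proof.
move=> [_ h] p0; apply/polyP => j; rewrite coef0 coef_upoly //; apply: h.
by rewrite -coef_upoly // p0 coef0.
Qed.

(** A relation on [z :: s] has all its coefficients zero at [s], as [z] is transcendental, hence
    also at [s']. *)
Lemma sp_cons_transc s s' z z' : sp s s' -> ~ acl s z -> sp (z :: s) (z' :: s').
Proof.
move=> ss zs; split=> [|p pz]; first by rewrite /= ss.1.
have /(upoly_eq0 ss) p0 : upoly s p = 0.
  by apply/eqP; apply: contra_notT zs => p0; exists p.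
by rewrite -horner_upoly p0 horner0.
Qed.

(** A minimal polynomial of [z], kept as an expression and truncated to its first [n.+1]
    coefficients, so that the bound on its degree survives in every environment. *)
Lemma acl_min s z : acl s z -> exists g n,
  [/\ forall t, (size (upoly t g) <= n.+1)%N, pev s (pcoef C0P g n) != 0,
      pev (z :: s) g = 0 &
      forall p : pexp, (size (upoly s p) <= n)%N -> pev (z :: s) p = 0 -> upoly s p = 0].
Proof.
move=> [p [p0 pz]].
pose Q n := `[< exists q : pexp, [/\ size (upoly s q) = n, upoly s q != 0 & pev (z :: s) q = 0] >].
have exQ : exists n, Q n by exists (size (upoly s p)); apply/asboolP; exists p.
case: (ex_minnP exQ) => n /asboolP[q [qn q0 qz]] nmin.
case: n qn nmin => [|n] qn nmin; first by move: q0; rewrite -size_poly_eq0 qn eqxx.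
pose g := pofseq C0P [seq pcoef C0P q i | i <- iota 0 n.+1].
have gE : upoly s g = upoly s q.
  apply/polyP => i; rewrite coef_pofseq; case: (ltnP i n.+1) => ip.
    by rewrite (nth_map 0%N) ?size_iota // nth_iota // -coef_upoly.
  by rewrite !nth_default ?size_map ?size_iota ?qn.
exists g, n; split.
- by move=> t; apply: leq_trans (size_pofseq _ _ _) _; rewrite size_map size_iota.
- by rewrite -coef_upoly gE -[n]/(n.+1.-1) -qn -lead_coefE lead_coef_eq0.
- by rewrite -horner_upoly gE horner_upoly.
- move=> r rn rz; apply/eqP; apply: contraT => r0.
  have /nmin : Q (size (upoly s r)) by apply/asboolP; exists r.
  by rewrite leqNgt ltnS rn.
Qed.

(** A minimal relation without constant term could be divided by the variable, since [w] is nonzero.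
    The constant term must vanish whenever [w] specializes to 0, so it converts a condition on [w]
    into one on [s]. *)
Lemma acl_const s w : acl s w -> w != 0 ->
  exists2 g : pexp, pev (w :: s) g = 0 & pev s (pcoef C0P g 0) != 0.
Proof.
move=> ws w0; have [g [n [gn l0 gw gmin]]] := acl_min ws; exists g => //.
apply: contraTneq l0 => c0; rewrite negbK.
pose g' := pofseq C0P [seq pcoef C0P g i.+1 | i <- iota 0 n].
have gE : upoly s g = upoly s g' * 'X.
  apply/polyP => -[|i]; rewrite coefMX /=; first by rewrite coef_upoly c0.
  rewrite coef_pofseq; case: (ltnP i n) => ip.
    by rewrite (nth_map 0%N) ?size_iota // nth_iota // coef_upoly.
  rewrite [in RHS]nth_default ?size_map ?size_iota // nth_default //.
  by apply: leq_trans (gn _) _; rewrite ltnS.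
have g'0 : upoly s g' = 0.
  apply: gmin; first by apply: leq_trans (size_pofseq _ _ _) _; rewrite size_map size_iota.
  move: gw; rewrite -horner_upoly gE hornerM hornerX => /eqP.
  by rewrite mulf_eq0 (negPf w0) orbF horner_upoly => /eqP.
by rewrite -coef_upoly gE g'0 mul0r coef0.
Qed.

(** Pseudo-division by [g]: multiplying by its leading coefficient, nonzero at both [s] and [s'],
    lowers the degree of a relation until minimality of [g] forces its coefficients to vanish. *)
Lemma sp_cons_alg s s' z z' (g : pexp) n : sp s s' ->
  (forall t, (size (upoly t g) <= n.+1)%N) ->
  pev s (pcoef C0P g n) != 0 -> pev s' (pcoef C0P g n) != 0 ->
  pev (z :: s) g = 0 -> pev (z' :: s') g = 0 ->
  (forall p : pexp, (size (upoly s p) <= n)%N -> pev (z :: s) p = 0 -> upoly s p = 0) ->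
  sp (z :: s) (z' :: s').
Proof.
move=> ss gn l0 l0' gz gz' gmin; split=> [|p]; first by rewrite /= ss.1.
suff H m : forall p : pexp, (size (upoly s p) <= m)%N -> (size (upoly s' p) <= m)%N ->
    pev (z :: s) p = 0 -> pev (z' :: s') p = 0.
  by apply: (H (maxn (size (upoly s p)) (size (upoly s' p)))); rewrite ?leq_maxl ?leq_maxr.
elim: m {p} => [|m IH] p pm pm' pz.
  by rewrite -horner_upoly; move: pm'; rewrite leqn0 size_poly_eq0 => /eqP ->; rewrite horner0.
case: (ltnP m n) => mn.
  have p0 : upoly s p = 0 by apply: gmin => //; exact: leq_trans pm mn.
  by rewrite -horner_upoly (upoly_eq0 ss p0) horner0.
pose q : pexp := PA (PM (pshift (pcoef C0P g n)) p)
  (PN C0P (PM (PM (pshift (pcoef C0P p m)) g) (pexn C0P (PV _ 0) (m - n)))).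
have qE t : upoly t q = (pev t (pcoef C0P g n)) *: upoly t p -
    (pev t (pcoef C0P p m)) *: (upoly t g * 'X^(m - n)).
  rewrite /q /= !upoly_shift rmorphN /= polyC1 mulN1r -!mul_polyC -!mulrA.
  congr (_ - _ * (_ * _)); elim: (m - n)%N => [|k IHk] //=.
  by rewrite exprS -IHk.
have qm t : (size (upoly t p) <= m.+1)%N -> (size (upoly t q) <= m)%N.
  move=> tm; apply/leq_sizeP => j; rewrite leq_eqVlt => /predU1P[<-|mj]; rewrite qE coefB !coefZ coefMXn.
    rewrite ltnNge leq_subr /= subKn // !coef_upoly.
    by rewrite mulrC subrr.
  rewrite (nth_default _ (leq_trans tm mj)) mulr0 ifF.
    rewrite [X in _ - _ * X]nth_default ?mulr0 ?subrr //.
    by apply: leq_trans (gn t) _; lia.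
  by apply/negbTE; rewrite -leqNgt; lia.
have qz : pev (z :: s) q = 0.
  rewrite -horner_upoly qE hornerD hornerN !hornerZ hornerM !horner_upoly pz gz.
  by rewrite mul0r !mulr0 subr0.
have := IH q (qm _ pm) (qm _ pm') qz.
rewrite -horner_upoly qE hornerD hornerN !hornerZ hornerM !horner_upoly gz' mul0r mulr0 subr0 => /eqP.
by rewrite mulf_eq0 (negPf l0') => /eqP.
Qed.

(** Were the relation, read as a polynomial in [y], identically zero over [z :: t], it would remain
    so with the transcendental [z] replaced by any integer; the polynomial in [z] over [y :: t]
    would then have infinitely many roots. *)
Lemma acl_exchange t y z : acl (y :: t) z -> ~ acl t z -> acl (z :: t) y.
Proof.
move=> [p [p0 pz]] tz.
pose sw k := PV C0 (if k == 0%N then 1%N else if k == 1%N then 0%N else k).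
have swE a b (q : pexp) : pev (a :: b :: t) (psub sw q) = pev (b :: a :: t) q.
  by apply: pev_psub => -[|[|k]].
exists (psub sw p); split; last by rewrite swE.
apply/eqP => q0; case/eqP: p0; apply: poly_infinite_roots => i.
rewrite rootE horner_upoly -swE -horner_upoly.
have st : sp (z :: t) (i%:R :: t) by apply: sp_cons_transc.
by rewrite (upoly_eq0 st q0) horner0.
Qed.

(* The transcendence degree of s over C0(t), computed greedily. *)
Fixpoint rk (t s : seq K) : nat :=
  if s is x :: s' then (~~ `[< acl t x >] + rk (x :: t) s')%N else 0%N.

Definition acl_incl (s t : seq K) := forall x, x \in s -> acl t x.

Lemma acl_incl_sub s t : {subset s <= t} -> acl_incl s t.
Proof. by move=> st x /st; exact: acl_mem. Qed.

Lemma acl_incl_trans s t u : acl_incl s t -> acl_incl t u -> acl_incl s u.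
Proof. by move=> st tu x /st; exact: acl_trans. Qed.

Lemma acl_incl_cons x s t : acl_incl s t -> acl_incl (x :: s) (x :: t).
Proof.
move=> st y /[!inE]/predU1P[->|/st]; first by apply: acl_mem; rewrite ?inE ?eqxx.
by apply: acl_sub => // z; rewrite inE orbC => ->.
Qed.

Lemma acl_incl_cat s t u : acl_incl s u -> acl_incl t u -> acl_incl (s ++ t) u.
Proof. by move=> su tu x /[!mem_cat]/orP[/su|/tu]. Qed.

Lemma rk_base t t' s : acl_incl t t' -> (rk t' s <= rk t s)%N.
Proof.
elim: s t t' => //= x s IH t t' tt; apply: leq_add; last first.
  by apply: IH; apply: acl_incl_cons.
case: asboolP => //= tx; case: asboolP => //= tx'; case: tx.
exact: acl_trans tt tx'.
Qed.

Lemma rk_eqv t t' s : acl_incl t t' -> acl_incl t' t -> rk t s = rk t' s.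
Proof. by move=> h h'; apply/eqP; rewrite eqn_leq !rk_base. Qed.

Lemma rk_eq_mem t t' s : t =i t' -> rk t s = rk t' s.
Proof. by move=> tt; apply: rk_eqv; apply: acl_incl_sub => x; rewrite tt. Qed.

Lemma rk_cat t a b : rk t (a ++ b) = (rk t a + rk (a ++ t) b)%N.
Proof.
elim: a t => [|x a IH] t //=; rewrite IH addnA; congr (_ + _)%N.
by apply: rk_eq_mem => y; rewrite !inE !mem_cat !inE orbCA.
Qed.

Lemma rk_swap t x y s : rk t [:: x, y & s] = rk t [:: y, x & s].
Proof.
rewrite /= !addnA; congr (_ + _)%N; last first.
  by apply: rk_eq_mem => z; rewrite !inE orbCA.
have w a b : acl t a -> acl (b :: t) a by apply: acl_sub => // z; rewrite inE orbC => ->.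
case: asboolP => tx; case: asboolP => txy; case: asboolP => ty; case: asboolP => tyx //=;
  try by [case: tyx; exact: w|case: txy; exact: w].
- by case: ty; exact: acl_cons_trans txy.
- by case: tx; exact: acl_cons_trans tyx.
- by case: tyx; apply: acl_exchange.
- by case: txy; apply: acl_exchange.
Qed.

Lemma rk_catC t a b : rk t (a ++ b) = rk t (b ++ a).
Proof.
elim: a t b => [|x a IH] t b; first by rewrite cats0.
have mv c u : rk u (x :: c) = rk u (c ++ [:: x]).
  by elim: c u => //= y c IHc u; rewrite -IHc -[RHS]/(rk u [:: y, x & c]) rk_swap.
rewrite cat_cons [LHS]/= IH -[LHS]/(rk t (x :: b ++ a)).
have -> : b ++ x :: a = (b ++ [:: x]) ++ a by rewrite -catA.
rewrite [RHS]rk_cat -mv -cat_cons [LHS]rk_cat; congr (_ + _)%N.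
by apply: rk_eq_mem => y; rewrite !(mem_cat, inE) orbC !orbA; do ?case: (y \in _); rewrite ?orbT.
Qed.

Lemma rk_sym t a b : (rk t a + rk (a ++ t) b = rk t b + rk (b ++ t) a)%N.
Proof. by rewrite -!rk_cat rk_catC. Qed.

Lemma rk_acl0 t s : acl_incl s t -> rk t s = 0%N.
Proof.
elim: s t => //= x s IH t st; rewrite IH; last first.
  move=> y ys; apply: (@acl_sub _ _ _ t); first by [].
    by move=> z; rewrite inE orbC => ->.
  by apply: st; rewrite inE ys orbT.
by case: asboolP => // -[]; apply: st; rewrite inE eqxx.
Qed.

Lemma rk0_acl t s : rk t s = 0%N -> acl_incl s t.
Proof.
elim: s t => //= x s IH t /eqP; rewrite addn_eq0 => /andP[].
case: asboolP => // tx _ /eqP /IH st y; rewrite inE => /predU1P[->//|/st].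
exact: acl_cons_trans.
Qed.

Lemma rk_cat_acl t a b : acl_incl b (a ++ t) -> rk t (a ++ b) = rk t a.
Proof. by move=> h; rewrite rk_cat (rk_acl0 h) addn0. Qed.

Lemma rk_le t a b : acl_incl b (a ++ t) -> (rk t b <= rk t a)%N.
Proof. by move=> /rk_cat_acl <-; rewrite rk_catC rk_cat leq_addr. Qed.

Lemma rk_eq t a b : acl_incl b (a ++ t) -> acl_incl a (b ++ t) -> rk t a = rk t b.
Proof. by move=> h h'; apply/eqP; rewrite eqn_leq !rk_le. Qed.

Lemma rk_size t a : (rk t a <= size a)%N.
Proof. by elim: a t => //= x a IH t; rewrite -add1n leq_add // leq_b1. Qed.

Definition relS (S S' u u' : seq K) := size u = size u' /\ forall k, sprel S S' u`_k u'`_k.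

Lemma relS_refl S S' : size S = size S' -> relS S S' S S'.
Proof. by move=> h; split => // k; exact: rel_nth. Qed.

Lemma sp_relS S S' u u' : sp S S' -> relS S S' u u' -> sp u u'.
Proof. by move=> h [h1 h2]; apply: sp_rel h h1 h2. Qed.

Lemma relS_nil S S' : relS S S' [::] [::].
Proof. by split=> // k; rewrite nth_nil; exact: (rel_cst _ _ (subfield0 C0P)). Qed.

Lemma relS_cons S S' x x' u u' : sprel S S' x x' -> relS S S' u u' -> relS S S' (x :: u) (x' :: u').
Proof. by move=> h [h1 h2]; split=> [|[|k]] //=; rewrite h1. Qed.

Lemma relS_behead S S' x x' u u' : relS S S' (x :: u) (x' :: u') -> sprel S S' x x' /\ relS S S' u u'.
Proof. by move=> [/=[h1] h2]; split; [exact: (h2 0%N) | split=> // k; exact: (h2 k.+1)]. Qed.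

Lemma relS_catE S S' u u' v v' : size u = size u' ->
  relS S S' (u ++ v) (u' ++ v') -> relS S S' u u' /\ relS S S' v v'.
Proof.
elim: u u' => [|x u IH] [|x' u'] //=; first by move=> _ h; split => //; exact: relS_nil.
by move=> [/IH{}IH] /relS_behead[h /IH[h1 h2]]; split => //; apply: relS_cons.
Qed.

Lemma relS_catrev S S' u u' v v' : relS S S' u u' -> relS S S' v v' -> relS S S' (catrev u v) (catrev u' v').
Proof.
elim: u u' v v' => [|x u IH] [|x' u'] v v' //; try by case.
by move=> /relS_behead[h h1] h2; exact: (IH _ _ _ h1 (relS_cons h h2)).
Qed.

Lemma relS_mask S S' m u u' : relS S S' u u' -> relS S S' (mask m u) (mask m u').
Proof.
elim: m u u' => [|b m IH] [|x u] [|x' u'] //; rewrite ?mask0; try by [case|move=> _; exact: relS_nil].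
by move=> /relS_behead[h h1] /=; case: b; [apply: relS_cons => // |]; exact: IH.
Qed.

Lemma sp_indep t t' a b : sp t t' -> rk t b = size b -> size a = size b ->
  sp (catrev b t) (catrev a t').
Proof.
elim: b a t t' => [|x b IH] [|y a] t t' //= tt.
case: asboolP => /= tx.
  by rewrite add0n => h; have := rk_size (x :: t) b; rewrite h ltnn.
by rewrite add1n => -[h] [h1]; apply: IH => //; exact: sp_cons_transc.
Qed.

Lemma sp_acl s s' x x' : sp (x :: s) (x' :: s') -> sp s' s -> acl s x -> acl s' x'.
Proof.
move=> h h' [p [p0 px]]; exists p; split; last by case: h => _; exact.
by apply: contra_neq p0; exact: upoly_eq0.
Qed.

Lemma sp_bi_rk t t' a a' : size a = size a' -> sp (catrev a t) (catrev a' t') ->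
  sp (catrev a' t') (catrev a t) -> rk t a = rk t' a'.
Proof.
elim: a a' t t' => [|x a IH] [|x' a'] t t' //= [sz] h h'.
have hx : sp (x :: t) (x' :: t').
  by move: h; rewrite !catrevE; move/sp_catr; apply => //; rewrite !size_rev.
have hx' : sp (x' :: t') (x :: t).
  by move: h'; rewrite !catrevE; move/sp_catr; apply => //; rewrite !size_rev.
have ht := @sp_catr _ _ [:: x] t [:: x'] t' hx erefl.
have ht' := @sp_catr _ _ [:: x'] t' [:: x] t hx' erefl.
rewrite (IH _ _ _ sz h h'); congr (~~ _ + _)%N.
by apply: asbool_equiv_eq; split; apply: sp_acl.
Qed.

Lemma rk_basis t s : exists2 m, size m = size s &
  rk t (mask m s) = size (mask m s) /\ rk t s = size (mask m s).
Proof.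
elim: s t => [|x s IH] t; first by exists [::].
have [tx|tx] := pselect (acl t x).
  have E u : rk (x :: t) u = rk t u.
    apply: rk_eqv; last by apply: acl_incl_sub => y; rewrite inE orbC => ->.
    by move=> y /[!inE]/predU1P[->//|]; exact: acl_mem.
  have [m sm [h1 h2]] := IH t; exists (false :: m); first by rewrite /= sm.
  by rewrite /= h1 E h2; case: asboolP.
have [m sm [h1 h2]] := IH (x :: t); exists (true :: m); first by rewrite /= sm.
by rewrite /= h1 h2; case: asboolP.
Qed.

Section Specialization.
Variables (t a x : seq K).
Hypothesis ax : sp (a ++ t) (x ++ t).
Hypothesis sax : size a = size x.

Let relA : relS (a ++ t) (x ++ t) a x /\ relS (a ++ t) (x ++ t) t t.
Proof. by apply: relS_catE => //; apply: relS_refl; rewrite !size_cat sax. Qed.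

(** A basis of [x] is independent, so on its positions the specialization can be reversed, and the
    entries of [a] there are independent too. *)
Lemma sp_basis : exists m, [/\ size m = size x,
  rk t x = size (mask m x), rk t (mask m a) = rk t x &
  sp (catrev (mask m x) t) (catrev (mask m a) t)].
Proof.
have [m sm [h1 h2]] := rk_basis t x; exists m.
have szm : size (mask m a) = size (mask m x) by rewrite !size_mask // sm.
have S1 : sp (catrev (mask m x) t) (catrev (mask m a) t).
  by apply: sp_indep => //; exact: sp_refl.
have S2 : sp (catrev (mask m a) t) (catrev (mask m x) t).
  apply: sp_relS ax _; case: relA => h h'.
  by apply: relS_catrev => //; exact: relS_mask.
by split => //; rewrite h2 -h1; apply: sp_bi_rk.
Qed.

Lemma sp_rk_le : (rk t x <= rk t a)%N.
Proof.
have [m [_ _ <- _]] := sp_basis; apply: rk_le => y ym.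
by apply: acl_mem => //; rewrite mem_cat (mem_mask ym).
Qed.

(** Positions of a basis of [x] are positions of a basis of [a]. If a relation of [x] took a value
    [w] other than 0 at [a], then [w] would satisfy a relation over that basis with nonzero constant
    term; as [w] goes to 0, the constant term vanishes at the basis of [x], hence at that of [a]. *)
Lemma sp_rk_eq : (rk t a <= rk t x)%N -> sp (x ++ t) (a ++ t).
Proof.
move=> le; have [m [sm E1 E2 S1]] := sp_basis.
split; first by rewrite !size_cat sax.
move=> f fx; apply/eqP; apply: contraT => w0; set w := pev _ _ in w0.
have E3 : rk t (mask m a) = rk t a by apply/eqP; rewrite E2 eqn_leq sp_rk_le.
have aB : acl_incl a (mask m a ++ t).
  apply: rk0_acl; apply/eqP; rewrite -(eqn_add2l (rk t (mask m a))) addn0 -rk_cat rk_catC.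
  rewrite rk_cat_acl ?E3 // => y ym.
  by apply: acl_mem => //; rewrite mem_cat (mem_mask ym).
have wB : acl (catrev (mask m a) t) w.
  apply: (@acl_trans _ _ C0P (a ++ t)); last exact: acl_pev.
  move=> y yat; apply: (@acl_sub _ _ C0P (mask m a ++ t)).
    by move=> z; rewrite catrevE !mem_cat mem_rev.
  move: yat; rewrite mem_cat => /orP[/aB//|yt].
  by apply: acl_mem => //; rewrite mem_cat yt orbT.
have [g gw c0] := acl_const wB w0.
set B := catrev (mask m a) t in wB gw c0 S1.
have S3 : sp (w :: B) (0 :: catrev (mask m x) t).
  apply: sp_relS ax _; case: relA => h h'; apply: relS_cons.
    by exists f; rewrite fx.
  by apply: relS_catrev => //; exact: relS_mask.
have : pev (catrev (mask m x) t) (pcoef C0P g 0) = 0.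
  by rewrite -coef_upoly -horner_coef0 horner_upoly; apply: S3.2.
by move/(S1.2 _)/eqP; rewrite (negPf c0).
Qed.

End Specialization.

(** A triangular system: the minimal polynomial of each entry that is algebraic over the ones after
    it, with the non-vanishing of all leading coefficients. Being a specialization of [s] is an
    infinite condition; this finite one implies it and can be put in a formula. *)
Lemma sp_generic_formula s : exists (gs : seq pexp) (h : pexp),
  [/\ forall g, g \in map (pev s) gs -> g = 0, pev s h != 0 &
   forall s', size s' = size s -> (forall g, g \in map (pev s') gs -> g = 0) ->
     pev s' h != 0 -> sp s s'].
Proof.
elim: s => [|z s [gs [h [gs0 h0 H]]]].
  exists [::], (P1 C0P); split => //; first by rewrite oner_neq0.
  by move=> s' /size0nil -> _ _; exact: sp_refl.
have shE y u : map (pev (y :: u)) (map (@pshift _ _) gs) = map (pev u) gs.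
  by rewrite -map_comp; apply: eq_map => p /=; rewrite pev_shift.
have [zs|zs] := pselect (acl s z).
  have [g [n [gn l0 gz gmin]]] := acl_min zs.
  exists (g :: map (@pshift _ _) gs), (PM (pshift h) (pshift (pcoef C0P g n))); split.
  - by move=> y; rewrite /= shE inE => /predU1P[->//|]; exact: gs0.
  - by rewrite /= !pev_shift mulf_neq0.
  - move=> [|z' s'] // [sz] /= gs0'; rewrite !pev_shift mulf_eq0 negb_or => /andP[h0' l0'].
    apply: (@sp_cons_alg s s' z z' g n) => //.
      apply: H => // y ys; apply: gs0'; rewrite shE inE ys orbT //.
    by apply: gs0'; rewrite inE eqxx.
exists (map (@pshift _ _) gs), (pshift h); split.
- by move=> y; rewrite shE; exact: gs0.
- by rewrite pev_shift.
- move=> [|z' s'] // [sz]; rewrite shE pev_shift => gs0' h0'.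
  by apply: sp_cons_transc => //; exact: H.
Qed.

Section Closed.
Hypothesis Kcl : forall p : {poly K}, (1 < size p)%N -> exists x, root p x.

(** The Nullstellensatz, entry by entry. The condition that [f] be nonzero is passed to the
    remaining entries through a nonzero coefficient: of [f] itself if [z] is transcendental, of the
    relation satisfied by the value [w] of [f] if [z] is algebraic. A transcendental entry becomes
    an integer, an algebraic one a root in the algebraically closed [K]. *)
Lemma sp_point_in_acl t s (f : pexp) : pev (s ++ t) f != 0 -> exists c : seq K,
  [/\ acl_incl c t, sp (s ++ t) (c ++ t), size c = size s & pev (c ++ t) f != 0].
Proof.
elim: s f => [|z s IH] f fs; first by exists [::]; split => //; exact: sp_refl.
have [zs|zs] := pselect (acl (s ++ t) z); last first.
  have f0 : upoly (s ++ t) f != 0.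
    by apply: contraNneq fs => f0; rewrite cat_cons -horner_upoly f0 horner0.
  have cf0 : pev (s ++ t) (pcoef C0P f (size (upoly (s ++ t) f)).-1) != 0.
    by rewrite -coef_upoly -lead_coefE lead_coef_eq0.
  have [c [ct sc szc cf]] := IH _ cf0.
  have f0' : upoly (c ++ t) f != 0.
    by apply: contraNneq cf => f0'; rewrite -coef_upoly f0' coef0.
  have [i fi] : exists i : nat, ~~ root (upoly (c ++ t) f) i%:R.
    apply: contrapT => h; case/eqP: f0'; apply: poly_infinite_roots => i.
    by apply: contrapT => /negP hi; apply: h; exists i.
  exists (i%:R :: c); split => //=; last 2 first.
  - by rewrite szc.
  - by rewrite -horner_upoly; apply: contraNN fi => /eqP; rewrite rootE => ->.
  - move=> y /[!inE]/predU1P[->|/ct//].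
    apply: acl_cst => //; elim: i {fi} => [|i]; first exact: subfield0.
    by rewrite -natr1; move/(subfieldD C0P); apply; exact: subfield1.
  - exact: sp_cons_transc.
have [g [n [gn l0 gz gmin]]] := acl_min zs.
set w := pev _ _ in fs.
have wa : acl (s ++ t) w by apply: acl_cons_trans zs _ => //; exact: acl_pev.
have [g1 gz1 c0] := acl_const wa fs.
have [c [ct sc szc]] := IH (PM (pcoef C0P g n) (pcoef C0P g1 0)) (mulf_neq0 l0 c0).
rewrite /= mulf_eq0 negb_or => /andP[l0' c0'].
have szg : (1 < size (upoly (c ++ t) g))%N.
  rewrite ltnNge; apply/negP => le.
  have n0 : (0 < n)%N.
    case: n gn l0 gz gmin l0' => [|//] gn l0 gz _ _.
    move: gz; rewrite -horner_upoly (size1_polyC (gn _)) hornerC coef_upoly => /eqP.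
    by rewrite (negPf l0).
  by move: l0'; rewrite -coef_upoly nth_default ?eqxx //; exact: leq_trans n0.
have [z' /rootP] := Kcl szg; rewrite horner_upoly => gz'.
have S : sp (z :: s ++ t) (z' :: c ++ t) by apply: (@sp_cons_alg _ _ _ _ g n).
exists (z' :: c); split => //=; last 2 first.
- by rewrite szc.
- have S2 : sp (w :: s ++ t) (pev (z' :: c ++ t) f :: c ++ t).
    apply: sp_relS S _; apply: relS_cons; first by exists f.
    have := @relS_refl (z :: s ++ t) (z' :: c ++ t).
    by case=> [|h1 h2]; [rewrite /= !size_cat szc | split=> [|k]; [case: h1 | exact: (h2 k.+1)]].
  apply: contraNneq c0' => f0; rewrite -coef_upoly -horner_coef0 horner_upoly.
  by apply/eqP; have := S2.2 _ gz1; rewrite -[pev _ f]/(pev ((z' :: c) ++ t) f) f0.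
- move=> y /[!inE]/predU1P[->|/ct//].
  apply: (@acl_trans _ _ C0P (c ++ t)); last first.
    by exists g; split => //; rewrite -size_poly_gt0 (leq_trans _ szg).
  by apply: acl_incl_cat => // x; exact: acl_mem.
Qed.

Hypothesis C0cl : alg_closed_in C0.

Lemma acl_nil z : acl [::] z -> C0 z.
Proof.
move=> [p [p0 pz]].
have pF i : C0 (upoly [::] p)`_i.
  rewrite coef_upoly; elim: (pcoef C0P p i) => /=.
  - by move=> k; rewrite nth_nil; exact: subfield0.
  - by move=> c; exact: set_valP.
  - by move=> a ha b hb; exact: subfieldD.
  - by move=> a ha b hb; exact: subfieldM.
have /(algebraic_overE C0P)[q q0 qz] : algebraic_over C0 z.
  by exists (upoly [::] p); split => //; rewrite rootE horner_upoly pz.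
have [m sm] := ubnP (size q); elim: m q sm q0 qz => // m IH q sm q0 qz.
have szq : (1 < size (map_poly (val : subfield_type C0P -> K) q))%N.
  by apply: (@root_size_gt1 _ z); rewrite ?map_poly_eq0.
have [c Cc qc] : exists2 x, C0 x & root (map_poly (val : subfield_type C0P -> K) q) x.
  apply: C0cl szq; apply/allP => y /(nthP 0)[i _ <-]; rewrite coef_map.
  exact: valP.
have c' : c \in subfield_pred C0P by exact: mem_set.
pose d : subfield_type C0P := Sub c c'.
have /factor_theorem[r qE] : root q d by rewrite -(fmorph_root (val : subfield_type C0P -> K)).
have qE' : map_poly (val : subfield_type C0P -> K) q =
    map_poly (val : subfield_type C0P -> K) r * ('X - c%:P).
  by rewrite qE rmorphM; congr (_ * _); apply: map_polyXsubC.
move: qz; rewrite qE' rootM root_XsubC => /orP[rz|/eqP ->] //.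
apply: (IH r) => //; last by apply: contraNneq q0 => r0; rewrite qE r0 mul0r.
have r0 : r != 0 by apply: contraNneq q0 => r0; rewrite qE r0 mul0r.
by move: sm; rewrite qE size_Mmonic ?monicXsubC // size_XsubC addn2.
Qed.

End Closed.
End Rank.

(** * Ultraproducts, saturation and coarse dimension *)

Section UltraBasics.
Variables (R : realType) (U : nonprincipal_ultrafilter).
Local Notation K := (ultrapower R U).
Local Notation C := (R[i]).

Lemma near_ge (N : nat) : \forall s \near ufilter U, (N <= s)%N.
Proof.
elim: N => [|N IH]; first exact: nearW.
have [/ufilter_nonprincipal//|] := in_ultra_setVsetC [set N] (ufilterP U).
move=> NN; near=> s.
have h : (N <= s)%N by near: s.
have /eqP h' : s != N by apply/eqP; near: s.
by rewrite ltn_neqAle h eq_sym; apply/andP; split => //; apply/eqP.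
Unshelve. all: by end_near. Qed.

Lemma near_not (P : nat -> Prop) : ~ (\forall s \near ufilter U, P s) ->
  \forall s \near ufilter U, ~ P s.
Proof. by move=> h; have [/h|] := in_ultra_setVsetC [set s | P s] (ufilterP U). Qed.

Lemma near_and (P Q : nat -> Prop) : (\forall s \near ufilter U, P s) ->
  (\forall s \near ufilter U, Q s) -> \forall s \near ufilter U, P s /\ Q s.
Proof. by move=> h h'; apply: filterS2 h h' => s. Qed.

Lemma near_notE (P : nat -> Prop) : (\forall s \near ufilter U, ~ P s) ->
  ~ (\forall s \near ufilter U, P s).
Proof. by move=> h h'; have /filter_ex[s []] := near_and h h'. Qed.

Lemma rep_ucl (f : nat -> C) : \forall s \near ufilter U, rep (ucl U f) s = f s.
Proof. by apply/ucl_eq; rewrite repK. Qed.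

Lemma rep0 : \forall s \near ufilter U, rep (0 : K) s = 0.
Proof. by apply/ucl_eq; rewrite repK ucl0. Qed.

Lemma rep_eq (x y : K) : x = y <-> \forall s \near ufilter U, rep x s = rep y s.
Proof. by rewrite -ucl_eq !repK. Qed.

Lemma repD (x y : K) : \forall s \near ufilter U, rep (x + y) s = rep x s + rep y s.
Proof. by apply/ucl_eq; rewrite uclD !repK. Qed.

Lemma repM (x y : K) : \forall s \near ufilter U, rep (x * y) s = rep x s * rep y s.
Proof. by apply/ucl_eq; rewrite uclM !repK. Qed.

Lemma ultrapower_char0 (n : nat) : n.+1%:R != 0 :> K.
Proof.
apply/eqP => /rep_eq E.
have H m : \forall s \near ufilter U, rep (m%:R : K) s = m%:R.
  elim: m => [|m IH]; first exact: rep0.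
  rewrite -natr1; have h1 : \forall s \near ufilter U, rep (1 : K) s = 1.
    by apply/ucl_eq; rewrite repK ucl1.
  near=> s; have -> : rep (m%:R + 1 : K) s = rep (m%:R : K) s + rep (1 : K) s.
    by near: s; exact: repD.
  have -> : rep (m%:R : K) s = m%:R by near: s.
  by have -> : rep (1 : K) s = 1; [near: s | rewrite natr1].
have /filter_ex[s [h1 [h2 h3]]] := near_and (H n.+1) (near_and E rep0).
by move: h1; rewrite h2 h3 => /eqP; rewrite eq_sym pnatr_eq0.
Unshelve. all: by end_near. Qed.

Lemma ultrapower_horner (p : {poly K}) (z : K) :
  \forall s \near ufilter U, rep p.[z] s =
    (\poly_(i < size p) rep p`_i s).[rep z s].
Proof.
have -> : p.[z] = \sum_(i < size p) p`_i * z ^+ i by rewrite horner_coef.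
have H (m : nat) : (m <= size p)%N -> \forall s \near ufilter U,
    rep (\sum_(i < m) p`_i * z ^+ i) s = \sum_(i < m) rep p`_i s * rep z s ^+ i.
  elim: m => [|m IH] mp.
    by rewrite big_ord0; apply: filterS rep0 => s ->; rewrite big_ord0.
  have HX k : \forall s \near ufilter U, rep (z ^+ k) s = rep z s ^+ k.
    elim: k => [|k IHk].
      by rewrite expr0; apply/ucl_eq; rewrite repK -ucl1; apply/ucl_eq; exact: nearW.
    by rewrite exprS; apply: filterS2 (repM z (z ^+ k)) IHk => s -> ->; rewrite exprS.
  rewrite big_ord_recr /=; near=> s; rewrite big_ord_recr /=.
  rewrite (_ : rep _ s = rep (\sum_(i < m) p`_i * z ^+ i) s + rep (p`_m * z ^+ m) s); last first.
    by near: s; exact: repD.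
  rewrite (_ : rep (p`_m * z ^+ m) s = rep p`_m s * rep (z ^+ m) s); last first.
    by near: s; exact: repM.
  congr (_ + _ * _); last by near: s; exact: HX.
  by near: s; apply: IH; exact: ltnW.
apply: filterS (H _ (leqnn _)) => s ->.
by rewrite horner_poly.
Unshelve. all: by end_near. Qed.

Lemma ultrapower_closed (p : {poly K}) : (1 < size p)%N -> exists x, root p x.
Proof.
move=> sp; pose q s : {poly C} := \poly_(i < size p) rep p`_i s.
have lq : \forall s \near ufilter U, size (q s) = size p.
  have : ~ (\forall s \near ufilter U, rep (lead_coef p) s = rep (0 : K) s).
    move/rep_eq/eqP; rewrite lead_coef_eq0 => /eqP p0.
    by rewrite p0 size_poly0 in sp.
  move=> /near_not h; apply: filterS2 h rep0 => s h0 h1; rewrite h1 in h0.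
  apply: size_poly_eq; apply/eqP; rewrite -lead_coefE; exact: h0.
pose x s := xget 0 [set x | root (q s) x].
exists (ucl U x); apply/rootP/rep_eq; near=> s.
have -> : rep p.[ucl U x] s = (q s).[rep (ucl U x) s] by near: s; exact: ultrapower_horner.
have -> : rep (ucl U x) s = x s by near: s; exact: rep_ucl.
have -> : rep (0 : K) s = 0 by near: s; exact: rep0.
have sq : size (q s) = size p by near: s.
apply/rootP; rewrite /x; case: xgetP => [y _ //|].
have /closed_rootP[y ry] : size (q s) != 1%N by rewrite sq; case: (size p) sp => // -[].
by move=> /(_ y).
Unshelve. all: by end_near. Qed.

Definition slq (s : nat) (S : seq K) : seq C := [seq rep z s | z <- S].

Lemma slq_cat s S T : slq s (S ++ T) = slq s S ++ slq s T.
Proof. exact: map_cat. Qed.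

Lemma nth_slq S : \forall s \near ufilter U, forall k, rep S`_k s = (slq s S)`_k.
Proof.
apply: filterS rep0 => s h k; case: (ltnP k (size S)) => kS.
  by rewrite /slq (nth_map 0).
by rewrite !nth_default ?size_map.
Qed.

Lemma tuple_lift n (y : nat -> n.-tuple C) :
  exists x : n.-tuple K, \forall s \near ufilter U, slice s x = y s.
Proof.
exists [tuple ucl U (fun s => tnth (y s) j) | j < n].
have : \forall s \near ufilter U, forall j,
    rep (tnth [tuple ucl U (fun s => tnth (y s) j) | j < n] j) s = tnth (y s) j.
  by apply: filter_forall => j; apply/ucl_eq; rewrite repK tnth_mktuple.
by apply: filterS => s xs; apply: eq_from_tnth => j; rewrite tnth_map xs.
Qed.

Lemma ultraprodI n (F G : nat -> set (n.-tuple C)) :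
  ultraprod F `&` ultraprod G = @ultraprod R U n (fun s => F s `&` G s).
Proof.
apply/seteqP; split => x; first by move=> [/= h h']; apply: filterS2 h h' => s.
by move=> h; split; apply: filterS h => s [].
Qed.

Lemma ultraprodC n (F : nat -> set (n.-tuple C)) (x : n.-tuple K) :
  ~ ultraprod F x <-> ultraprod (fun s => ~` F s) x.
Proof. by split=> [/near_not|/near_notE]. Qed.

(** Diagonal choice: in the factor [s] take a point of the first [l + 1] sets for the largest
    [l <= s] for which they meet. For given [j] this [l] is at least [j] for almost all [s], because
    the ultrafilter is non-principal. *)
Lemma saturation n (F : nat -> nat -> set (n.-tuple C)) :
  (forall l, exists x : n.-tuple K, forall j, (j <= l)%N -> ultraprod (F j) x) ->
  exists x : n.-tuple K, forall j, ultraprod (F j) x.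
Proof.
move=> fip; pose G l s := exists y, forall j, (j <= l)%N -> F j s y.
have GU l : \forall s \near ufilter U, G l s.
  have [x xF] := fip l.
  have : \forall s \near ufilter U, forall j : 'I_l.+1, F j s (slice s x).
    by apply: filter_forall => j; apply: xF; rewrite -ltnS.
  apply: filterS => s h; exists (slice s x) => j jl.
  exact: (h (Ordinal (jl : (j < l.+1)%N))).
pose y s : n.-tuple C := xget (nseq_tuple n 0)
  [set y | forall l, (l <= s)%N -> G l s -> forall j, (j <= l)%N -> F j s y].
have [x xy] := tuple_lift y; exists x => j; rewrite /ultraprod /=; near=> s.
have -> : slice s x = y s by near: s.
have js : (j <= s)%N by near: s; exact: near_ge.
have Gs : G j s by near: s.
rewrite /y; case: xgetP => [z _ /(_ j js Gs j (leqnn j))//|].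
have exl : exists l, (l <= s)%N && `[< G l s >] by exists j; rewrite js; apply/asboolP.
have lts l : (l <= s)%N && `[< G l s >] -> (l <= s)%N by case/andP.
case: (ex_maxnP exl lts) => l /andP[ls /asboolP[z zl]] lmax /(_ z) [] m ms Gm i im.
by apply: zl; apply: leq_trans im _; apply: lmax; rewrite ms; apply/asboolP.
Unshelve. all: by end_near. Qed.

End UltraBasics.

Section Small.
Variables (R : realType) (U : nonprincipal_ultrafilter) (xi : nat -> R).
Local Notation K := (ultrapower R U).
Local Notation C := (R[i]).
Hypothesis xi_inf : forall r : R, \forall s \near ufilter U, r < xi s.

Lemma near_powR (e M : R) : 0 < e -> \forall s \near ufilter U, M <= xi s `^ e.
Proof.
move=> e0; pose M' := Num.max M 1.
apply: filterS (xi_inf (M' `^ e^-1)) => s h.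
have M0 : 0 <= M' by rewrite le_max ler01 orbT.
apply: le_trans (_ : M' <= _); first by rewrite le_max lexx.
rewrite -[X in X <= _](@powRr1 _ M') // -(mulVf (lt0r_neq0 e0)) powRrM.
by rewrite ge0_ler_powR ?nnegrE ?powR_ge0 // ?ltW //; apply: le_lt_trans h; exact: powR_ge0.
Qed.

Lemma near_xi1 : \forall s \near ufilter U, 1 < xi s.
Proof. exact: xi_inf. Qed.

Definition fewer (T : choiceType) (A : set T) (x : R) :=
  finite_set A /\ #|` fset_set A|%:R <= x.

Lemma fewer_sub (T : choiceType) (A B : set T) x y :
  A `<=` B -> x <= y -> fewer B x -> fewer A y.
Proof.
move=> AB xy [Bf Bx]; have Af := sub_finite_set AB Bf; split=> //.
apply: le_trans (le_trans Bx xy); rewrite ler_nat.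
by apply: fsubset_leq_card; rewrite -fset_set_sub.
Qed.

Lemma fewerU (T : choiceType) (A B : set T) x y :
  fewer A x -> fewer B y -> fewer (A `|` B) (x + y).
Proof.
move=> [Af Ax] [Bf By]; split; first by rewrite finite_setU.
rewrite fset_setU //; apply: le_trans (lerD Ax By); rewrite -natrD ler_nat.
by rewrite -cardfsUI leq_addr.
Qed.

Definition smallF (b : R) n (F : nat -> set (n.-tuple C)) :=
  \forall s \near ufilter U, fewer (F s) (xi s `^ b).

(* delta(X) <= b, up to increasing b by an arbitrarily small amount. *)
Definition small (b : R) n (X : set (n.-tuple K)) :=
  exists2 F, X `<=` ultraprod F & smallF b F.

Lemma small_ultraprod b n (F : nat -> set (n.-tuple C)) :
  small b (@ultraprod R U n F) -> smallF b F.
Proof.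
by move=> [G /ultraprod_sub FG]; apply: filterS2 FG => s FG; exact: fewer_sub.
Qed.

Lemma small_sub b n (X Y : set (n.-tuple K)) : X `<=` Y -> small b Y -> small b X.
Proof. by move=> XY [F YF Fb]; exists F => //; exact: subset_trans XY YF. Qed.

Lemma small_le b c n (X : set (n.-tuple K)) : b <= c -> small b X -> small c X.
Proof.
move=> bc [F XF Fb]; exists F => //; apply: filterS2 Fb near_xi1 => s h x1.
by apply: fewer_sub h => //; apply: ler_powR => //; exact: ltW.
Qed.

Lemma smallU b c n (X Y : set (n.-tuple K)) : b < c ->
  small b X -> small b Y -> small c (X `|` Y).
Proof.
move=> bc [F XF Fb] [G YG Gb]; exists (fun s => F s `|` G s).
  by move=> x [/XF|/YG]; apply: filterS => s; [left|right].
have h2 := @near_powR (c - b) 2 _; near=> s.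
have x1 : 1 < xi s by near: s; exact: near_xi1.
apply: fewer_sub (fewerU (_ : fewer (F s) (xi s `^ b)) (_ : fewer (G s) (xi s `^ b))) => //;
  try by near: s.
have -> : xi s `^ c = xi s `^ (c - b) * xi s `^ b.
  by rewrite -powRD ?subrK // (gt_eqF (lt_trans ltr01 x1)) implybT.
by rewrite -mulr2n -mulr_natl ler_wpM2r ?powR_ge0 //; near: s; apply: h2; rewrite subr_gt0.
Unshelve. all: by end_near. Qed.

Lemma small_bigU b c n (Y : nat -> set (n.-tuple K)) l : b < c ->
  (forall j, small b (Y j)) -> small c [set x | exists2 j, (j <= l)%N & Y j x].
Proof.
elim: l c => [|l IH] c bc Yb.
  by apply: small_sub (small_le (ltW bc) (Yb 0%N)) => x [[]].
have bc' : b < (b + c) / 2 by lra.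
have bc'' : (b + c) / 2 < c by lra.
apply: small_sub (smallU bc'' (IH _ bc' Yb) (small_le (ltW bc') (Yb l.+1))).
move=> x [j]; rewrite leq_eqVlt ltnS => /predU1P[->|jl] Yj; [by right|left].
by exists j.
Qed.

Lemma log_card_lt (T : choiceType) (A : set T) (b x : R) : 1 < x ->
  (log_card R A * ((ln x)^-1)%:E < b%:E)%E -> fewer A (x `^ b).
Proof.
move=> x1; rewrite /log_card.
have lx : 0 < ln x by rewrite ln_gt0.
case: asboolP => Af; last by rewrite mulyr gtr0_sg ?invr_gt0 // mul1e ltNge leey.
rewrite -EFinM lte_fin ltr_pdivrMr // => h; split => //.
have x0 : 0 < x by apply: lt_trans x1.
case: (posnP #|` fset_set A|) => [->|A0]; first exact: powR_ge0.
rewrite -ler_ln ?posrE ?powR_gt0 ?ltr0n // ln_powR; exact: ltW.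
Qed.

Lemma log_card_le (T : choiceType) (A : set T) (b x : R) : 1 < x -> 0 <= b ->
  fewer A (x `^ b) -> (log_card R A * ((ln x)^-1)%:E <= b%:E)%E.
Proof.
move=> x1 b0 [Af Ab]; rewrite /log_card asboolT //.
have lx : 0 < ln x by rewrite ln_gt0.
have x0 : 0 < x by apply: lt_trans x1.
rewrite -EFinM lee_fin ler_pdivrMr //.
case: (posnP #|` fset_set A|) => [->|A0]; first by rewrite ln0 // mulr_ge0 // ltW.
by rewrite -ln_powR ler_ln ?posrE ?powR_gt0 ?ltr0n.
Qed.

Lemma delta_lt_small (b : R) n (X : set (n.-tuple K)) :
  (delta xi X < b%:E)%E -> small b X.
Proof.
move=> /ereal_inf_lt[_ [F /= XF <-] Fb]; exists F => //.
have := @ultralimit_cvg R U (fun s => (log_card R (F s) * ((ln (xi s))^-1)%:E)%E).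
move=> /(_ [set x | (x < b%:E)%E]) /= h.
have {}h : \forall s \near ufilter U, (log_card R (F s) * ((ln (xi s))^-1)%:E < b%:E)%E.
  by apply: h; exact: (open_ereal_lt' Fb).
by apply: filterS2 h near_xi1 => s h1 h2; exact: log_card_lt.
Qed.

(** The sign condition on [b] reflects the convention that the empty set has delta 0. *)
Lemma small_delta (b : R) n (X : set (n.-tuple K)) : 0 <= b ->
  small b X -> (delta xi X <= b%:E)%E.
Proof.
move=> b0 [F XF Fb]; apply: (@le_trans _ _ (delta_fam U xi F)).
  by apply: ereal_inf_lbound; exists F.
have <- : lim ((fun=> b%:E : \bar R) @ ufilter U) = b%:E.
  by apply: lim_cst; exact: ereal_hausdorff.
rewrite /delta_fam.
apply: lee_lim; [exact: ultralimit_cvg | exact: is_cvg_cst | ].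
by apply: filterS2 Fb near_xi1 => s h1 h2; exact: log_card_le.
Qed.

End Small.

Section Counting.
Variable R : realType.

Lemma fewer_image (T T' : choiceType) (f : T -> T') (A : set T) (x : R) :
  fewer A x -> fewer (f @` A) x.
Proof.
move=> [Af Ax]; split; first exact: finite_image.
rewrite fset_set_image //; apply: le_trans Ax; rewrite ler_nat.
exact: leq_imfset_card.
Qed.

Lemma fewer_fibration (T T' V : choiceType) (f : T -> T' -> V) (B : set T')
    (Fib : T' -> set T) (x y : R) : 0 <= x ->
  fewer B y -> (forall b, B b -> fewer (Fib b) x) ->
  fewer [set v | exists b a, [/\ B b, Fib b a & v = f a b]] (x * y).
Proof.
move=> x0 [Bf By] FibF.
apply: (@fewer_sub _ _ _ [set v | exists b a, [/\ b \in (fset_set B : seq T'), B b, Fib b a & v = f a b]]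
   (x * #|` fset_set B|%:R)).
- move=> _ [b [a [Bb Fa ->]]]; exists b, a; split => //.
  by rewrite (in_fset_set Bf); exact: mem_set.
- exact: ler_wpM2l.
elim: (fset_set B : seq T') => [|c s IH].
  rewrite mulr0; split; last by rewrite (_ : [set _ | _] = set0) ?fset_set0 // ; apply/seteqP; split => // v [b [a []]].
  by rewrite (_ : [set _ | _] = set0) //; apply/seteqP; split => // v [b [a []]].
have [Bc|nBc] := pselect (B c); last first.
  apply: fewer_sub IH; last by rewrite ler_wpM2l // ler_nat.
  move=> _ [b [a [+ Bb Fa ->]]]; rewrite inE => /predU1P[E|bs]; last by exists b, a.
  by case: nBc; rewrite -E.
apply: (fewer_sub _ _ (fewerU (fewer_image (f^~ c) (FibF c Bc)) IH)); last first.
  by rewrite /= -natr1 mulrDr mulr1 addrC.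
move=> _ [b [a [+ Bb Fa ->]]]; rewrite inE => /predU1P[E|bs]; first by left; exists a; rewrite -?E.
by right; exists b, a.
Qed.

Lemma sum_count_le (T T' : eqType) (pi : T -> T') (ys : seq T') (zs : seq T) :
  uniq ys -> (\sum_(c <- ys) count (fun z => pi z == c) zs <= size zs)%N.
Proof.
move=> uy; elim: zs => [|z zs IH] /=; first by rewrite big1.
rewrite big_split /= -add1n leq_add //.
have -> : (\sum_(c <- ys) (pi z == c) = count_mem (pi z) ys)%N.
  by elim: ys {uy IH} => [|c ys IH]; rewrite ?big_nil // big_cons IH /= eq_sym.
by rewrite count_uniq_mem // leq_b1.
Qed.

(** Double counting: the fibres over [W] embed disjointly in [Z] and have more than [x] elements
    each. *)
Lemma fewer_base (T T' V : choiceType) (f : T -> T' -> V) (pi : V -> T') (W : set T')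
    (Fib : T' -> set T) (Z : set V) (x y : R) :
  0 < x -> (forall a b, pi (f a b) = b) -> (forall b, injective (f^~ b)) ->
  fewer Z y -> (forall b a, W b -> Fib b a -> Z (f a b)) ->
  (forall b, W b -> ~ fewer (Fib b) x) -> fewer W (y / x).
Proof.
move=> x0 pif finj [Zf Zy] WZ WN.
have fib_fin b : W b -> finite_set (Fib b).
  move=> Wb; apply: sub_finite_set (_ : Fib b `<=` (f^~ b) @^-1` Z) _ => [a|].
    exact: WZ.
  by apply: finite_preimage => // a a' _ _; exact: finj.
have xF b : W b -> x < #|` fset_set (Fib b)|%:R.
  by move=> Wb; rewrite ltNge; apply/negP => h; apply: (WN b Wb); split=> //; exact: fib_fin.
have Wf : finite_set W.
  apply: sub_finite_set (_ : W `<=` pi @` Z) (finite_image _ Zf) => b Wb.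
  have : (0 < #|` fset_set (Fib b)|)%N by rewrite -(@ltr_nat R); apply: lt_trans x0 (xF b Wb).
  rewrite cardfs_gt0 => /fset0Pn[a]; rewrite (in_fset_set (fib_fin _ Wb)) => /set_mem Fa.
  by exists (f a b); [exact: WZ | exact: pif].
split => //; rewrite ler_pdivlMr // mulrC; apply: le_trans Zy.
apply: (@le_trans _ _ (\sum_(c <- fset_set W) count (fun z => pi z == c) (fset_set Z))%N%:R); last first.
  by rewrite ler_nat; apply: sum_count_le; exact: fset_uniq.
have <- : \sum_(c <- (fset_set W : seq T')) x = x * #|` fset_set W|%:R.
  by rewrite big_const_seq count_predT iter_addr_0 mulr_natr.
rewrite natr_sum big_seq [leRHS]big_seq; apply: ler_sum => c.
rewrite in_fset_set // => /set_mem Wc; apply: le_trans (ltW (xF c Wc)) _.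
rewrite ler_nat -size_filter -(size_map (f^~ c)); apply: uniq_leq_size.
  by rewrite map_inj_uniq ?fset_uniq //; exact: finj.
move=> _ /mapP[a + ->]; rewrite (in_fset_set (fib_fin _ Wc)) => /set_mem Fa.
by rewrite mem_filter pif eqxx /= in_fset_set //; apply: mem_set; exact: WZ.
Qed.

End Counting.

(** * First-order formulas: renaming, enumeration and transfer to the factors *)

Section Renaming.
Variables (L : language) (Cst : Type).
Local Notation term := (fo_term L Cst).
Local Notation formula := (fo_formula L Cst).

(* Renamings send a variable to a variable or to the constant 0. *)
Fixpoint ren_term (f : nat -> option nat) (t : term) : term :=
  match t with
  | TVar k => if f k is Some j then TVar _ _ j else TZero _ _
  | TZero => TZero _ _
  | TOne => TOne _ _
  | TAdd a b => TAdd (ren_term f a) (ren_term f b)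
  | TOpp a => TOpp (ren_term f a)
  | TMul a b => TMul (ren_term f a) (ren_term f b)
  | TCst c => TCst _ c
  | TFun g ts => TFun (fun i => ren_term f (ts i))
  end.

Definition ren_lift (f : nat -> option nat) (k : nat) : option nat :=
  if k is k'.+1 then omap S (f k') else Some 0%N.

Fixpoint ren_formula (f : nat -> option nat) (phi : formula) : formula :=
  match phi with
  | FEq a b => FEq (ren_term f a) (ren_term f b)
  | FRel r ts => FRel (fun i => ren_term f (ts i))
  | FNot p => FNot (ren_formula f p)
  | FAnd p q => FAnd (ren_formula f p) (ren_formula f q)
  | FEx p => FEx (ren_formula (ren_lift f) p)
  end.

Variables (M : pzRingType) (S : fo_structure L Cst M).

Definition ren_env (f : nat -> option nat) (e : nat -> M) (k : nat) : M :=
  if f k is Some j then e j else 0.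

Lemma ren_termP f e t : term_val S e (ren_term f t) = term_val S (ren_env f e) t.
Proof.
elim: t => //=; first by move=> k; rewrite /ren_env; case: (f k).
- by move=> a -> b ->.
- by move=> a ->.
- by move=> a -> b ->.
- move=> g ts IH; congr (Defs.sfun _ _); apply: eq_from_tnth => i.
  by rewrite !tnth_mktuple.
Qed.

Lemma ren_formulaP f e phi : holds S e (ren_formula f phi) <-> holds S (ren_env f e) phi.
Proof.
elim: phi f e => /=.
- by move=> a b f e; rewrite !ren_termP.
- move=> r ts f e; rewrite (_ : [tuple _ | i < _] =
    [tuple term_val S (ren_env f e) (ts i) | i < lrel_arity r]) //.
  by apply: eq_from_tnth => i; rewrite !tnth_mktuple ren_termP.
- by move=> p IH f e; rewrite IH.
- by move=> p IHp q IHq f e; rewrite IHp IHq.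
- move=> p IH f e; split=> -[x h]; exists x; move: h; rewrite IH;
  rewrite (_ : ren_env (ren_lift f) _ = (fun k => if k is k'.+1 then ren_env f e k' else x)) //;
  by apply/funext => -[|k] //=; rewrite /ren_env /=; case: (f k).
Qed.

End Renaming.

Section CountableFormulas.
Variables (L : language) (Cst : Type) (code : Cst -> nat).
Hypothesis code_inj : injective code.
Local Notation term := (fo_term L Cst).
Local Notation formula := (fo_formula L Cst).
Local Notation tree := (GenTree.tree nat).

Fixpoint code_term (t : term) : tree :=
  match t with
  | TVar k => GenTree.Node 0 [:: GenTree.Leaf k]
  | TZero => GenTree.Node 1 [::]
  | TOne => GenTree.Node 2 [::]
  | TAdd a b => GenTree.Node 3 [:: code_term a; code_term b]
  | TOpp a => GenTree.Node 4 [:: code_term a]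
  | TMul a b => GenTree.Node 5 [:: code_term a; code_term b]
  | TCst c => GenTree.Node 6 [:: GenTree.Leaf (code c)]
  | TFun g ts => GenTree.Node 7 (GenTree.Leaf (choice.pickle g) ::
      [seq code_term (ts i) | i <- enum 'I_(lfun_arity g)])
  end.

Fixpoint code_formula (phi : formula) : tree :=
  match phi with
  | FEq a b => GenTree.Node 0 [:: code_term a; code_term b]
  | FRel r ts => GenTree.Node 1 (GenTree.Leaf (choice.pickle r) ::
      [seq code_term (ts i) | i <- enum 'I_(lrel_arity r)])
  | FNot p => GenTree.Node 2 [:: code_formula p]
  | FAnd p q => GenTree.Node 3 [:: code_formula p; code_formula q]
  | FEx p => GenTree.Node 4 [:: code_formula p]
  end.

Lemma eq_map_enum n (T : Type) (f g : 'I_n -> T) :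
  [seq f i | i <- enum 'I_n] = [seq g i | i <- enum 'I_n] -> f = g.
Proof.
move=> h; apply/funext => i.
have ei : (index i (enum 'I_n) < size (enum 'I_n))%N by rewrite index_mem mem_enum.
have := congr1 (fun s => nth (f i) s (index i (enum 'I_n))) h.
by rewrite !(nth_map i _ _ ei) !nth_index ?mem_enum.
Qed.

Lemma code_term_inj : injective code_term.
Proof.
elim.
- by move=> k [] //= j [->].
- by case.
- by case.
- by move=> a IHa b IHb [] //= a' b' [/IHa -> /IHb ->].
- by move=> a IHa [] //= a' [/IHa ->].
- by move=> a IHa b IHb [] //= a' b' [/IHa -> /IHb ->].
- by move=> c [] //= c' [/code_inj ->].
- move=> g ts IH [] //= g' ts' [/(pcan_inj (@choice.pickleK _)) E].
  case: g' / E ts' => ts' h; congr TFun; apply/funext => i; apply: IH.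
  by have /(congr1 (fun f => f i)) := eq_map_enum h.
Qed.

Lemma code_formula_inj : injective code_formula.
Proof.
elim.
- by move=> a b [] //= a' b' [/code_term_inj -> /code_term_inj ->].
- move=> r ts [] //= r' ts' [/(pcan_inj (@choice.pickleK _)) E].
  case: r' / E ts' => ts' h; congr FRel; apply/funext => i; apply: code_term_inj.
  by have /(congr1 (fun f => f i)) := eq_map_enum h.
- by move=> p IHp [] //= p' [/IHp ->].
- by move=> p IHp q IHq [] //= p' q' [/IHp -> /IHq ->].
- by move=> p IHp [] //= p' [/IHp ->].
Qed.

(** Saturation handles countably many conditions, so points that avoid all small definable sets are
    built along an enumeration of the formulas. *)
Lemma formula_enum : exists en : nat -> formula, forall phi, exists n, en n = phi.
Proof.
pose phi0 : formula := FEq (TZero _ _) (TZero _ _).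
pose c phi := choice.pickle (code_formula phi).
have /choice[en enP] n : exists phi, forall psi, c psi = n -> c phi = n.
  have [[psi h]|h] := pselect (exists psi, c psi = n); first by exists psi.
  by exists phi0 => psi hp; case: h; exists psi.
exists en => phi; exists (c phi); apply: code_formula_inj.
by apply: (pcan_inj (@choice.pickleK _)); exact: (enP (c phi) phi).
Qed.

End CountableFormulas.

Section Los.
Variables (R : realType) (U : nonprincipal_ultrafilter) (L : language) (Cst : Type).
Variable Ks : nat -> fo_structure L Cst R[i].
Local Notation K := (ultrapower R U).
Local Notation C := (R[i]).
Local Notation S := (ultraproduct U Ks).

Definition renv (e : nat -> K) (s : nat) (k : nat) : C := rep (e k) s.

Lemma los_term e t : \forall s \near ufilter U,
  rep (term_val S e t) s = term_val (Ks s) (renv e s) t.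
Proof.
elim: t => /=.
- by move=> k; exact: nearW.
- exact: rep0.
- by apply/ucl_eq; rewrite repK ucl1.
- by move=> a IHa b IHb; apply: filterS3 (repD (term_val S e a) (term_val S e b)) IHa IHb => s -> -> ->.
- move=> a IHa; have := repD (term_val S e a) (- term_val S e a); rewrite subrr => h.
  have h' := rep0 R U; near=> s.
  have <- : rep (term_val S e a) s = term_val (Ks s) (renv e s) a by near: s.
  have h1 : rep (0 : K) s = rep (term_val S e a) s + rep (- term_val S e a) s by near: s.
  have h2 : rep (0 : K) s = 0 by near: s.
  by apply/eqP; rewrite -addr_eq0 addrC -h1 h2.
- by move=> a IHa b IHb; apply: filterS3 (repM (term_val S e a) (term_val S e b)) IHa IHb => s -> -> ->.
- by move=> c; exact: rep_ucl.
- move=> g ts IH.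
  have h : \forall s \near ufilter U, forall o, rep (term_val S e (ts o)) s =
      term_val (Ks s) (renv e s) (ts o) by exact: filter_forall.
  have h2 := rep_ucl U (fun s => @Defs.sfun _ _ _ (Ks s) g (slice s [tuple term_val S e (ts i) | i < lfun_arity g])).
  apply: filterS2 h2 h => s -> h'; congr (Defs.sfun _ _).
  by apply: eq_from_tnth => i; rewrite tnth_map !tnth_mktuple h'.
Unshelve. all: by end_near. Qed.

(** For a quantifier, witnesses are chosen factor by factor and glued into an element of the
    ultraproduct; for a negation, the ultrafilter decides. *)
Lemma los e phi : holds S e phi <-> \forall s \near ufilter U, holds (Ks s) (renv e s) phi.
Proof.
elim: phi e => /=.
- move=> a b e; rewrite rep_eq; have ha := los_term e a; have hb := los_term e b.
  split => h; near=> s.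
    have <- : rep (term_val S e a) s = term_val (Ks s) (renv e s) a by near: s.
    have <- : rep (term_val S e b) s = term_val (Ks s) (renv e s) b by near: s.
    by near: s.
  have -> : rep (term_val S e a) s = term_val (Ks s) (renv e s) a by near: s.
  have -> : rep (term_val S e b) s = term_val (Ks s) (renv e s) b by near: s.
  by near: s.
- move=> r ts e.
  have h : \forall s \near ufilter U, forall o, rep (term_val S e (ts o)) s =
      term_val (Ks s) (renv e s) (ts o) by apply: filter_forall => o; exact: los_term.
  have E : \forall s \near ufilter U,
      slice s [tuple term_val S e (ts i) | i < lrel_arity r] =
      [tuple term_val (Ks s) (renv e s) (ts i) | i < lrel_arity r].
    apply: filterS h => s h; apply: eq_from_tnth => i.
    by rewrite tnth_map !tnth_mktuple h.
  by split => h'; apply: filterS2 E h' => s ->.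
- by move=> p IH e; rewrite IH; split=> [/near_not|/near_notE].
- move=> p IHp q IHq e; rewrite IHp IHq; split=> [[h h']|h]; first exact: near_and.
  by split; apply: filterS h => s [].
- move=> p IH e.
  have E x s : renv (fun k => if k is k'.+1 then e k' else x) s =
      (fun k => if k is k'.+1 then renv e s k' else rep x s).
    by apply/funext => -[|k].
  split=> [[x /IH h]|h].
    by apply: filterS h => s h; exists (rep x s); rewrite -E.
  pose y s := xget 0 [set x | holds (Ks s) (fun k => if k is k'.+1 then renv e s k' else x) p].
  exists (ucl U y); apply/IH; apply: filterS2 h (rep_ucl U y) => s [x hx] ys.
  rewrite E ys; rewrite /y; case: xgetP => [z _ //|].
  by move=> /(_ x).
Unshelve. all: by end_near. Qed.

End Los.

Lemma tuple_split (T : Type) n m (z : (n + m).-tuple T) :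
  exists (x : n.-tuple T) (y : m.-tuple T), z = [tuple of x ++ y].
Proof.
have sx : size (take n z) == n by rewrite size_take size_tuple; case: ltnP => //; lia.
have sy : size (drop n z) == m by rewrite size_drop size_tuple addKn.
by exists (Tuple sx), (Tuple sy); apply: val_inj; rewrite /= cat_take_drop.
Qed.

(** * Definable sets and additivity of the coarse dimension *)

Section Definability.
Variables (R : realType) (U : nonprincipal_ultrafilter) (C0 : set (ultrapower R U)).
Variables (L : language) (Ks : nat -> fo_structure L C0 R[i]) (xi : nat -> R).
Local Notation K := (ultrapower R U).
Local Notation C := (R[i]).
Local Notation S := (ultraproduct U Ks).
Hypothesis S_cst : forall c : C0, scst S c = set_val c.
Hypothesis xi_inf : forall r : R, \forall s \near ufilter U, r < xi s.
Hypothesis delta_cont : delta_continuous S xi.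

(* Sequences serve as environments, with value 0 beyond their end. *)
Definition fdefs (P : seq K -> Prop) :=
  exists phi : fo_formula L C0, forall e, P e <-> holds S (nth 0 e) phi.

Lemma fdefs_and P Q : fdefs P -> fdefs Q -> fdefs (fun e => P e /\ Q e).
Proof. by move=> [p hp] [q hq]; exists (FAnd p q) => e /=; rewrite hp hq. Qed.

Lemma fdefs_not P : fdefs P -> fdefs (fun e => ~ P e).
Proof. by move=> [p hp]; exists (FNot p) => e /=; rewrite hp. Qed.

Lemma fdefs_ext P Q : fdefs P -> (forall e, P e <-> Q e) -> fdefs Q.
Proof. by move=> [p hp] PQ; exists p => e; rewrite -PQ hp. Qed.

Lemma fdefs_true : fdefs (fun=> True).
Proof. by exists (FEq (TZero _ _) (TZero _ _)). Qed.

Lemma fdefs_all (T : eqType) (s : seq T) (P : T -> seq K -> Prop) :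
  (forall i, i \in s -> fdefs (P i)) -> fdefs (fun e => forall i, i \in s -> P i e).
Proof.
elim: s => [|i s IH] Ps; first by apply: fdefs_ext fdefs_true _ => e.
apply: (fdefs_ext (fdefs_and (Ps i _) (IH _))); first by rewrite inE eqxx.
  by move=> j js; apply: Ps; rewrite inE js orbT.
move=> e; split=> [[h h'] j|h].
  by rewrite inE => /predU1P[->//|]; exact: h'.
by split=> [|j js]; apply: h; rewrite inE ?eqxx ?js ?orbT.
Qed.

Lemma fdefs_has (T : eqType) (s : seq T) (P : T -> seq K -> Prop) :
  (forall i, i \in s -> fdefs (P i)) -> fdefs (fun e => exists2 i, i \in s & P i e).
Proof.
move=> Ps; apply: (fdefs_ext (fdefs_not (fdefs_all (fun i si => fdefs_not (Ps i si))))) => e.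
split=> [h|[i si Pi] h]; last exact: h si Pi.
by apply: contrapT => h'; apply: h => i si Pi; apply: h'; exists i.
Qed.

Lemma fdefs_ex P : fdefs P -> fdefs (fun e => exists x, P (x :: e)).
Proof.
move=> [p hp]; exists (FEx p) => e /=.
have E x : (fun k => if k is k'.+1 then nth 0 e k' else x) = nth 0 (x :: e).
  by apply/funext => -[|k].
by split=> -[x h]; exists x; move: h; rewrite E ?hp // -hp.
Qed.

Lemma fdefs_exn m P : fdefs P -> fdefs (fun e => exists2 v, size v = m & P (v ++ e)).
Proof.
elim: m P => [|m IH] P Pd.
  apply: fdefs_ext Pd _ => e; split=> [h|[v /size0nil ->]//]; by exists [::].
apply: fdefs_ext (IH _ (fdefs_ex Pd)) _ => e; split.
  by move=> [v sv [x h]]; exists (x :: v); rewrite /= ?sv.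
by move=> [[|x v] // [sv] h]; exists v => //; exists x.
Qed.

Lemma fdefs_comp P (f : seq K -> seq K) (r : nat -> option nat) : fdefs P ->
  (forall e k, nth 0 (f e) k = if r k is Some j then nth 0 e j else 0) ->
  fdefs (fun e => P (f e)).
Proof.
move=> [p hp] fr; exists (ren_formula r p) => e; rewrite hp ren_formulaP.
by rewrite (_ : ren_env r (nth 0 e) = nth 0 (f e)) //; apply/funext => k; rewrite fr.
Qed.

Lemma fdefs_drop n P : fdefs P -> fdefs (fun e => P (drop n e)).
Proof. by move=> Pd; apply: (fdefs_comp (r := fun k => Some (n + k)%N)) Pd _ => e k; rewrite nth_drop. Qed.

Lemma fdefs_take n P : fdefs P -> fdefs (fun e => P (take n e)).
Proof.
move=> Pd; apply: (fdefs_comp (r := fun k => if (k < n)%N then Some k else None)) Pd _ => e k.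
by case: ltnP => kn; [rewrite nth_take | rewrite nth_default // size_take; case: ltnP; lia].
Qed.

Lemma fdefs_map (idx : seq nat) P : fdefs P -> fdefs (fun e => P [seq nth 0 e i | i <- idx]).
Proof.
move=> Pd; apply: (fdefs_comp (r := fun k => if (k < size idx)%N then Some (nth 0%N idx k) else None)) Pd _ => e k.
by case: ltnP => kn; [rewrite (nth_map 0%N) | rewrite nth_default ?size_map].
Qed.

Fixpoint pterm (p : pexp C0) : fo_term L C0 :=
  match p with
  | PV k => TVar _ _ k
  | PC c => TCst _ c
  | PA a b => TAdd (pterm a) (pterm b)
  | PM a b => TMul (pterm a) (pterm b)
  end.

Lemma ptermE e p : term_val S (nth 0 e) (pterm p) = pev e p.
Proof.
by elim: p => //= [a -> b ->|a -> b ->].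
Qed.

Lemma fdefs_pev (p : pexp C0) : fdefs (fun e => pev e p = 0).
Proof. by exists (FEq (pterm p) (TZero _ _)) => e /=; rewrite ptermE. Qed.

Lemma fdefs_intp P : fdefs P -> exists Ps : nat -> seq C -> Prop,
  forall e, P e <-> \forall s \near ufilter U, Ps s (slq s e).
Proof.
move=> [p hp]; exists (fun s y => holds (Ks s) (nth 0 y) p) => e.
rewrite hp los; have h := nth_slq e.
by split=> h'; apply: filterS2 h h' => s E; rewrite (_ : renv _ s = nth 0 (slq s e)) //;
  apply/funext => k; rewrite -E.
Qed.

Lemma intp_ultraprod (Ps : nat -> seq C -> Prop) (P : seq K -> Prop) :
  (forall e, P e <-> \forall s \near ufilter U, Ps s (slq s e)) -> forall n t,
  [set x : n.-tuple K | P (x ++ t)] =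
    ultraprod (fun s => [set y : n.-tuple C | Ps s (y ++ slq s t)]).
Proof.
move=> PPs n t; apply/seteqP; split=> x.
  by move=> /PPs; apply: filterS => s; rewrite slq_cat.
by move=> h; apply/PPs; apply: filterS h => s; rewrite slq_cat.
Qed.

Lemma definable0P n (Y : set (n.-tuple K)) :
  definable S set0 Y <-> exists2 P, fdefs P & forall x, Y x <-> P (tval x).
Proof.
split=> [[phi [b [b0 ->]]]|[P [phi hp] YP]].
  exists (fun e => holds S (nth 0 e) phi); first by exists phi.
  have -> : b = [::] by case: b b0 => // z b /(_ z) /(_ (mem_head _ _)).
  by move=> x /=; rewrite cats0.
exists phi, [::]; split; first by move=> z.
by apply/seteqP; split=> x /=; rewrite cats0 -hp YP.
Qed.

(* delta(a/t) <= b, up to increasing b by an arbitrarily small amount. *)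
Definition tpsmall (b : R) n (a : n.-tuple K) (t : seq K) :=
  exists P, [/\ fdefs P, P (a ++ t) & small xi b [set x : n.-tuple K | P (x ++ t)]].

(** Smallness of the fibre over one point says nothing about the fibres over the others. Continuity
    of delta gives a definable [W] that contains all points with large fibres but not the given one;
    outside [W] the fibres are uniformly small and the bounds for base and fibre multiply. *)
Lemma tpsmall_add n m (a : n.-tuple K) (b : m.-tuple K) t (al be e : R) :
  0 <= al -> 0 < e -> tpsmall al a (b ++ t) -> tpsmall be b t ->
  tpsmall (al + be + e) [tuple of a ++ b] t.
Proof.
move=> al0 e0 [P [Pd Pa Psm]] [Q [Qd Qb Qsm]].
pose l := size t; pose bt : (m + l).-tuple K := [tuple of b ++ in_tuple t].
pose Y : set ((n + (m + l)).-tuple K) := [set z | P (tval z)].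
have Yd : definable S set0 Y by apply/definable0P; exists P.
have e2 : 0 < e / 2 by lra.
have [W [/definable0P[PW Wd WP] W1 W2]] := delta_cont (al + e / 2) Yd e2.
have nWbt : ~ PW (b ++ t).
  move=> h; have /W2 /= : W bt by apply/WP.
  rewrite leNgt => /negP; apply; apply: le_lt_trans (_ : al%:E < _)%E; last by rewrite lte_fin; lra.
  by apply: small_delta.
pose H e := Q (drop n e) /\ (~ PW (drop n e) /\ P e).
exists H; split.
- apply: fdefs_and; first exact: fdefs_drop.
  by apply: fdefs_and => //; apply: fdefs_not; exact: fdefs_drop.
- by rewrite /H /= -catA drop_size_cat ?size_tuple.
have [Ps PPs] := fdefs_intp Pd.
have [Bs QB Bsm] := Qsm.
pose Fib s (y : m.-tuple C) := [set x : n.-tuple C | Ps s (x ++ y ++ slq s t)].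
pose Hs s := [set z : (n + m).-tuple C | exists (y : m.-tuple C) (x : n.-tuple C),
  [/\ Bs s y /\ fewer (Fib s y) (xi s `^ (al + e)), Fib s y x & z = [tuple of x ++ y]]].
exists Hs.
  move=> z; have [x [y ->]] := tuple_split z.
  rewrite /H /= -catA drop_size_cat ?size_tuple // => -[Qy [nWy Pxy]].
  have : small xi (al + e) [set x : n.-tuple K | P (x ++ (y ++ t))].
    apply: delta_lt_small => //; rewrite ltNge; apply/negP => h; apply: nWy.
    apply/(WP [tuple of y ++ in_tuple t]); apply: W1 => /=.
    by apply: le_trans h; rewrite lee_fin; lra.
  rewrite (intp_ultraprod PPs) => /small_ultraprod Fsm.
  have Bys := QB _ Qy; move/PPs: Pxy => Pxy.
  rewrite /ultraprod /=; near=> s; exists (slice s y), (slice s x); split.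
  - split; first by near: s.
    have : fewer [set y0 : n.-tuple C | Ps s (y0 ++ slq s (y ++ t))] (xi s `^ (al + e)).
      by near: s.
    by rewrite slq_cat.
  - have : Ps s (slq s (x ++ y ++ t)) by near: s.
    by rewrite !slq_cat.
  - by apply: val_inj; rewrite /= map_cat.
near=> s.
have x1 : 1 < xi s by near: s; exact: near_xi1.
have -> : al + be + e = (al + e) + be by ring.
rewrite powRD; last by rewrite (gt_eqF (lt_trans ltr01 x1)) implybT.
apply: fewer_fibration; first exact: powR_ge0.
  apply: (@fewer_sub _ _ _ (Bs s) _ _ _ (lexx _)); last by near: s.
  by move=> y [].
by move=> y [].
Unshelve. all: by end_near. Qed.

(** By continuity [b] lies in a definable set [W] over which all fibres are large. If the pair were
    in a small set, dividing its size by that of the fibres would make [W] small. *)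
Lemma tpsmall_addN n m (a : n.-tuple K) (b : m.-tuple K) (al be si : R) :
  0 < al -> si < al + be -> ~ tpsmall al a b -> ~ tpsmall be b [::] ->
  ~ tpsmall si [tuple of a ++ b] [::].
Proof.
move=> al0 siab na nb [P [Pd Pab Psm]].
(* The first bound keeps the fibre exponent [al - 2 * e] nonnegative, the second keeps
   [si - (al - 2 * e)] below [be]. *)
rewrite cats0 in Pab; pose e := Num.min (al / 2) ((al + be - si) / 4).
have e0 : 0 < e by rewrite lt_min; apply/andP; split; lra.
have [e1 e2] : e <= al / 2 /\ e <= (al + be - si) / 4.
  by rewrite !ge_min !lexx orbT.
pose Y : set ((n + m).-tuple K) := [set z | P (tval z)].
have Yd : definable S set0 Y by apply/definable0P; exists P.
have [W [/definable0P[PW Wd WP] W1 W2]] := delta_cont (al - e) Yd e0.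
have Wb : PW b.
  apply/WP/W1 => /=; rewrite subrK leNgt; apply/negP => h; apply: na.
  by exists P; split => //; exact: delta_lt_small h.
have [Ps PPs] := fdefs_intp Pd; have [Ws PWs] := fdefs_intp Wd.
pose Fib s (y : m.-tuple C) := [set x : n.-tuple C | Ps s (x ++ y)].
have big : \forall s \near ufilter U, forall y : m.-tuple C, Ws s y ->
    ~ fewer (Fib s y) (xi s `^ (al - 2 * e)).
  have := @ultraprod_sub R U m (fun s => [set y | Ws s y])
     (fun s => [set y : m.-tuple C | ~ fewer (Fib s y) (xi s `^ (al - 2 * e))]).
  apply => y yW; apply/ultraprodC => /= Fsm.
  have /WP/W2 /= : PW y by apply/PWs; exact: yW.
  rewrite leNgt => /negP; apply.
  apply: (@le_lt_trans _ _ (al - 2 * e)%:E); last by rewrite lte_fin; lra.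
  apply: small_delta => //; first by lra.
  rewrite (intp_ultraprod PPs); exists (fun s => [set x : n.-tuple C | Ps s (x ++ slq s y)]) => //.
apply: nb; exists PW; split => //; first by rewrite cats0.
rewrite (intp_ultraprod PWs); exists (fun s => [set y : m.-tuple C | Ws s (y ++ slq s ([::] : seq K))]) => //.
move: Psm; rewrite (intp_ultraprod PPs) => /small_ultraprod Zsm; rewrite /smallF; near=> s.
have x1 : 1 < xi s by near: s; exact: near_xi1.
have W0 : fewer [set y : m.-tuple C | Ws s y] (xi s `^ si / xi s `^ (al - 2 * e)).
  apply: (@fewer_base R _ _ _ (fun (x : n.-tuple C) (y : m.-tuple C) => [tuple of x ++ y])
    (fun z => insubd (nseq_tuple m 0) (drop n z)) _ (Fib s) [set z : (n + m).-tuple C | Ps s (z ++ slq s ([::] : seq K))]).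
  - by rewrite powR_gt0 // (lt_trans ltr01).
  - by move=> x y; rewrite /= drop_size_cat ?size_tuple // valKd.
  - move=> y x x' /(congr1 (take n \o val)) /=.
    by rewrite !take_size_cat ?size_tuple // => /val_inj.
  - by near: s.
  - by move=> y x _; rewrite /Fib /= cats0.
  - by near: s.
apply: fewer_sub W0; first by move=> y; rewrite /= cats0.
rewrite -powRB; last by rewrite (gt_eqF (lt_trans ltr01 x1)) implybT.
by apply: ler_powR; [exact: ltW | lra].
Unshelve. all: by end_near. Qed.

End Definability.

(** * Generic points *)

Section Generic.
Variables (R : realType) (U : nonprincipal_ultrafilter) (C0 : set (ultrapower R U)).
Local Notation K := (ultrapower R U).
Local Notation C := (R[i]).
Hypothesis C0P : is_subfield C0.
Hypothesis C0cl : alg_closed_in C0.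
Hypothesis C0count : countable C0.
Local Notation pexp := (pexp C0).
Local Notation acl := (@acl K C0).
Local Notation sp := (@sp K C0).
Local Notation rk := (@rk K C0).

Let char0 := @ultrapower_char0 R U.
Let Kcl := @ultrapower_closed R U.

Fixpoint pexp_code (code : C0 -> nat) (p : pexp) : GenTree.tree nat :=
  match p with
  | PV k => GenTree.Node 0 [:: GenTree.Leaf k]
  | PC c => GenTree.Node 1 [:: GenTree.Leaf (code c)]
  | PA a b => GenTree.Node 2 [:: pexp_code code a; pexp_code code b]
  | PM a b => GenTree.Node 3 [:: pexp_code code a; pexp_code code b]
  end.

Lemma C0_code : exists code : C0 -> nat, injective code.
Proof.
have /countable_injP[f fi] := C0count.
exists (fun c => f (set_val c)) => c d /fi h; apply: val_inj; apply: h;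
apply: mem_set; exact: set_valP.
Qed.

Lemma pexp_enum : exists en : nat -> pexp, forall p, exists n, en n = p.
Proof.
have [code codeI] := C0_code.
have cI : injective (pexp_code code).
  elim.
  - by move=> k [] //= j [->].
  - by move=> c [] //= d [/codeI ->].
  - by move=> a IHa b IHb [] //= a' b' [/IHa -> /IHb ->].
  - by move=> a IHa b IHb [] //= a' b' [/IHa -> /IHb ->].
pose c p := choice.pickle (pexp_code code p).
have /choice[en enP] n : exists p, forall q, c q = n -> c p = n.
  have [[q h]|h] := pselect (exists q, c q = n); first by exists q.
  by exists (P0 C0P) => q hq; case: h; exists q.
exists en => p; exists (c p); apply: cI.
by apply: (pcan_inj (@choice.pickleK _)); exact: (enP (c p) p).
Qed.

Fixpoint pevC (s : nat) (y : seq C) (p : pexp) : C :=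
  match p with
  | PV k => y`_k
  | PC c => rep (set_val c) s
  | PA a b => pevC s y a + pevC s y b
  | PM a b => pevC s y a * pevC s y b
  end.

Lemma pev_rep (e : seq K) (p : pexp) :
  \forall s \near ufilter U, rep (pev e p) s = pevC s (slq s e) p.
Proof.
elim: p => /=.
- by move=> k; apply: filterS (nth_slq e) => s.
- by move=> c; exact: nearW.
- by move=> a IHa b IHb; apply: filterS3 (repD (pev e a) (pev e b)) IHa IHb => s -> -> ->.
- by move=> a IHa b IHb; apply: filterS3 (repM (pev e a) (pev e b)) IHa IHb => s -> -> ->.
Qed.

Lemma pev_eq0_near (e : seq K) (p : pexp) :
  pev e p = 0 <-> \forall s \near ufilter U, pevC s (slq s e) p = 0.
Proof.
have h := pev_rep e p; have h0 := rep0 R U; rewrite rep_eq.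
by split=> h'; apply: filterS3 h h0 h' => s -> ->.
Qed.

Definition cst_or0 (c : K) : pexp :=
  if pselect (C0 c) is left h then pcst h else P0 C0P.

Lemma pev_cst_or0 e c : C0 c -> pev e (cst_or0 c) = c.
Proof. by rewrite /cst_or0; case: pselect. Qed.

(** Freezes the variables from [n] on at the entries of [c]; [pprep] freezes the initial ones. For
    entries in [C0] this turns a polynomial with parameters into one over [C0]. *)
Definition papp (n : nat) (c : seq K) (p : pexp) : pexp :=
  psub (fun k => if (k < n)%N then PV C0 k else cst_or0 c`_(k - n)) p.

Definition pprep (c : seq K) (p : pexp) : pexp :=
  psub (fun k => if (k < size c)%N then cst_or0 c`_k else PV C0 (k - size c)) p.

Definition inC0 (c : seq K) := forall x, x \in c -> C0 x.

Lemma inC0_nth c k : inC0 c -> C0 c`_k.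
Proof.
move=> h; case: (ltnP k (size c)) => kc; first by apply: h; exact: mem_nth.
by rewrite nth_default //; exact: subfield0.
Qed.

Lemma pev_papp n c p x : inC0 c -> size x = n -> pev x (papp n c p) = pev (x ++ c) p.
Proof.
move=> hc sx; apply: pev_psub => k; rewrite nth_cat sx; case: ifP => // _.
by rewrite pev_cst_or0 //; exact: inC0_nth.
Qed.

Lemma pev_pprep c p x : inC0 c -> pev x (pprep c p) = pev (c ++ x) p.
Proof.
move=> hc; apply: pev_psub => k; rewrite nth_cat; case: ifP => // _.
by rewrite pev_cst_or0 //; exact: inC0_nth.
Qed.

Lemma sp_point (s : seq K) (f : pexp) : pev s f != 0 -> exists c : seq K,
  [/\ inC0 c, sp s c, size c = size s & pev c f != 0].
Proof.
move=> fs; have [] := @sp_point_in_acl _ _ C0P char0 Kcl [::] s f; first by rewrite cats0.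
move=> c; rewrite !cats0 => -[h1 h2 h3 h4]; exists c; split => // x /h1.
exact: acl_nil.
Qed.

Lemma specialize_cst t t0 (c : seq K) (p : pexp) : inC0 c -> sp t t0 ->
  pev (c ++ t) p = 0 -> pev (c ++ t0) p = 0.
Proof. by move=> hc [_ h]; rewrite -!pev_pprep //; exact: h. Qed.

(** This is irreducibility of the locus of [a] over the larger field C0(t): two nonempty open
    subsets meet. All of [b], [b'] and [t] are moved to points of [C0] with both values still
    nonzero. With the parameters [t0] now in [C0], both conditions hold at the generic point [a],
    hence jointly at a point [x] over [C0]; non-vanishing with [t0] implies non-vanishing with
    [t]. *)
Lemma sp_mul (a t b b' : seq K) (p q : pexp) : sp a b -> sp a b' ->
  pev (b ++ t) p != 0 -> pev (b' ++ t) q != 0 ->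
  exists2 x, sp a x & pev (x ++ t) (PM p q) != 0.
Proof.
move=> ab ab' pb qb; set n := size a.
have sb : size b = n by rewrite -ab.1.
have sb' : size b' = n by rewrite -ab'.1.
pose p1 := psub (fun k => PV C0 (if (k < n)%N then k else (n + k)%N)) p.
pose q1 := psub (fun k => PV C0 (n + k)%N) q.
have p1E y y' z : size y = n -> size y' = n -> pev (y ++ y' ++ z) p1 = pev (y ++ z) p.
  move=> sy sy'; apply: pev_psub => k; rewrite [in RHS]nth_cat sy.
  case: ltnP => kn; rewrite /= nth_cat sy; first by rewrite kn.
  by rewrite ltnNge leq_addr /= addKn nth_cat sy' ltnNge kn.
have q1E y y' z : size y = n -> pev (y ++ y' ++ z) q1 = pev (y' ++ z) q.
  by move=> sy; apply: pev_psub => k /=; rewrite nth_cat sy ltnNge leq_addr /= addKn.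
have pq0 : pev (b ++ b' ++ t) (PM p1 q1) != 0 by rewrite /= p1E // q1E // mulf_neq0.
have [c0 [c0C spc sc0 c0N]] := sp_point pq0.
pose c := take n c0; pose c' := take n (drop n c0); pose t0 := drop n (drop n c0).
have c0E : c0 = c ++ c' ++ t0 by rewrite /c /c' /t0 !cat_take_drop.
have sc : size c = n by rewrite size_take sc0 size_cat sb; case: ltnP => //; lia.
have sc' : size c' = n.
  by rewrite size_take size_drop sc0 !size_cat sb sb'; case: ltnP => //; lia.
have cC : inC0 c by move=> x xc; apply: c0C; rewrite c0E mem_cat xc.
have c'C : inC0 c' by move=> x xc; apply: c0C; rewrite c0E !mem_cat xc orbT.
have t0C : inC0 t0 by move=> x xc; apply: c0C; rewrite c0E !mem_cat xc !orbT.
move: spc c0N; rewrite c0E /= p1E // q1E // mulf_eq0 negb_or => spc /andP[pc qc].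
have bc : sp b c by apply: (sp_catl C0P spc); rewrite sb sc.
have spc2 : sp (b' ++ t) (c' ++ t0) by apply: (sp_catr spc); rewrite sb sc.
have bc' : sp b' c' by apply: (sp_catl C0P spc2); rewrite sb' sc'.
have tt0 : sp t t0 by apply: (sp_catr spc2); rewrite sb' sc'.
have pa : pev a (papp n t0 p) != 0.
  apply: contraNneq pc => h; rewrite -(pev_papp _ t0C sc); apply/eqP.
  exact: (sp_trans ab bc).2.
have qa : pev a (papp n t0 q) != 0.
  apply: contraNneq qc => h; rewrite -(pev_papp _ t0C sc'); apply/eqP.
  exact: (sp_trans ab' bc').2.
have [x [xC ax sx]] := @sp_point a (PM (papp n t0 p) (papp n t0 q)) (mulf_neq0 pa qa).
rewrite /= mulf_eq0 negb_or !pev_papp // => /andP[px qx].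
exists x => //; rewrite /= mulf_neq0 //.
  by apply: contraNneq px => h; apply/eqP; apply: specialize_cst h.
by apply: contraNneq qx => h; apply/eqP; apply: specialize_cst h.
Qed.

(* Saturation provides a point of the locus of [a] that is generic over C0(t);
   finite satisfiability is irreducibility, which holds over any extension
   because C0 is algebraically closed. *)
Lemma generic_point (a t : seq K) :
  exists2 x, sp a x & forall b, sp a b -> sp (x ++ t) (b ++ t).
Proof.
have [en enP] := pexp_enum; pose n := size a.
pose Z j := `[< pev a (en j) = 0 >].
pose N j := `[< exists2 b, sp a b & pev (b ++ t) (en j) != 0 >].
pose F j s := [set y : n.-tuple C |
  (Z j -> pevC s y (en j) = 0) /\ (N j -> pevC s (y ++ slq s t) (en j) <> 0)].
have FE j (x : n.-tuple K) : ultraprod (F j) x <->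
    (Z j -> pev x (en j) = 0) /\ (N j -> pev (x ++ t) (en j) <> 0).
  split.
    move=> h; split=> [Zj|Nj]; first by apply/pev_eq0_near; apply: filterS h => s [/(_ Zj)].
    move/pev_eq0_near; apply: near_notE; apply: filterS h => s [_ /(_ Nj)].
    by rewrite slq_cat.
  move=> [h h']; rewrite /ultraprod /= /F /=; apply: near_and.
    have [Zj|nZ] := boolP (Z j); last by apply: nearW.
    by have /pev_eq0_near := h Zj; apply: filterS.
  have [Nj|nN] := boolP (N j); last by apply: nearW.
  have := h' Nj; move=> h2; have : ~ (\forall s \near ufilter U, pevC s (slq s (x ++ t)) (en j) = 0).
    by move/pev_eq0_near.
  by move/near_not; apply: filterS => s; rewrite slq_cat.
have [l|x xF] := @saturation R U n F.
  have [b ab bN] : exists2 b, sp a b & forall j, (j < l.+1)%N -> N j -> pev (b ++ t) (en j) != 0.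
    have [b ab bN] : exists2 b, sp a b & pev (b ++ t) (pprod C0P [seq en j | j <- iota 0 l.+1 & N j]) != 0.
      elim: (iota 0 l.+1) => [|j js [b ab bN]].
        by exists a; rewrite //= oner_neq0.
      rewrite /=; case: ifP => [/asboolP[b' ab' b'N]|_]; last by exists b.
      exact: sp_mul ab' ab b'N bN.
    exists b => // j jl Nj; move: bN; rewrite pev_prod big_map prodf_seq_neq0 => /allP.
    by move=> /(_ j); rewrite mem_filter Nj mem_iota; apply.
  have sb : size b == n by rewrite -ab.1.
  exists (Tuple sb) => j jl; apply/FE; split=> [/asboolP|Nj]; first exact: ab.2.
  by apply/eqP/bN.
exists x.
  split=> [|p pa]; first by rewrite size_tuple.
  have [j jp] := enP p; have [h _] := (FE j x).1 (xF j).
  by rewrite -jp; apply: h; apply/asboolP; rewrite jp.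
move=> b ab; split; first by rewrite !size_cat size_tuple -ab.1.
move=> p px; apply/eqP; apply: contraT => pb.
have [j jp] := enP p; have [_ h] := (FE j x).1 (xF j).
by case: h; [apply/asboolP; exists b => //; rewrite jp | rewrite jp].
Qed.

(** A relation over C0(t) on the generic point holds on its whole locus. Moving [t] to parameters
    [t0] in [C0] that keep one coefficient nonzero, the relation holds at all points of the locus
    with entries in [C0]; these are dense, so it holds at [a]. *)
Lemma generic_acl (a t x : seq K) (J : seq nat) (i : nat) :
  sp a x -> (forall b, sp a b -> sp (x ++ t) (b ++ t)) ->
  (forall j, j \in i :: J -> (j < size a)%N) ->
  acl ([seq x`_j | j <- J] ++ t) x`_i -> acl [seq a`_j | j <- J] a`_i.
Proof.
move=> ax gen iJ [g [g0 gx]]; set n := size a.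
have [j gj] : exists j, pev ([seq x`_j | j <- J] ++ t) (pcoef C0P g j) != 0.
  exists (size (upoly ([seq x`_j | j <- J] ++ t) g)).-1.
  by rewrite -coef_upoly -lead_coefE lead_coef_eq0.
pose ix k := PV C0 (if (k < size J)%N then nth 0%N J k else (n + (k - size J))%N).
pose ixi k := if k is k'.+1 then ix k' else PV C0 i.
have ixE y z k : size y = n -> pev (y ++ z) (ix k) = ([seq y`_j | j <- J] ++ z)`_k.
  move=> sy; rewrite /= nth_cat sy nth_cat size_map; case: (ltnP k (size J)) => kJ.
    by rewrite iJ ?(nth_map 0%N) // inE mem_nth ?orbT.
  by rewrite ltnNge leq_addr /= addKn.
have GE y z : size y = n -> pev (y ++ z) (psub ixi g) = pev (y`_i :: [seq y`_j | j <- J] ++ z) g.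
  move=> sy; apply: pev_psub => -[|k]; last exact: ixE.
  by rewrite /= nth_cat sy iJ ?inE ?eqxx.
have QE y z : size y = n -> pev (y ++ z) (psub ix (pcoef C0P g j)) =
    pev ([seq y`_j | j <- J] ++ z) (pcoef C0P g j).
  by move=> sy; apply: pev_psub => k; exact: ixE.
have sx : size x = n by rewrite -ax.1.
have [c0 [c0C spc sc0 c0N]] := @sp_point (x ++ t) (psub ix (pcoef C0P g j))
   (etrans (congr1 (fun u => u != 0) (QE x t sx)) gj).
pose c := take n c0; pose t0 := drop n c0.
have c0E : c0 = c ++ t0 by rewrite /c /t0 cat_take_drop.
have sc : size c = n by rewrite size_take sc0 size_cat sx; case: ltnP => //; lia.
have cC : inC0 c by move=> u uc; apply: c0C; rewrite c0E mem_cat uc.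
have t0C : inC0 t0 by move=> u uc; apply: c0C; rewrite c0E mem_cat uc orbT.
rewrite c0E in spc c0N.
have xc : sp x c by apply: (sp_catl C0P spc); rewrite sx sc.
have tt0 : sp t t0 by apply: (sp_catr spc); rewrite sx sc.
have Ga : pev a (papp n t0 (psub ixi g)) = 0.
  apply/eqP; apply: contraT => /sp_point[c' [c'C ac' sc']].
  rewrite pev_papp // (specialize_cst c'C tt0) ?eqxx //.
  by apply: (gen _ ac').2; rewrite GE.
have Qa : pev a (papp n t0 (psub ix (pcoef C0P g j))) != 0.
  apply: contraNneq c0N => h; rewrite -(pev_papp _ t0C sc); apply/eqP.
  exact: (sp_trans ax xc).2.
rewrite pev_papp // GE // in Ga; rewrite pev_papp // QE // in Qa.
have : acl ([seq a`_j | j <- J] ++ t0) a`_i.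
  exists g; split => //; apply: contraNneq Qa => g00.
  by rewrite -coef_upoly g00 coef0.
apply: acl_trans => // u; rewrite mem_cat => /orP[]; first exact: acl_mem.
by move/t0C; exact: acl_cst.
Qed.

Lemma generic_rk (a t x : seq K) : sp a x ->
  (forall b, sp a b -> sp (x ++ t) (b ++ t)) -> (rk [::] a <= rk t x)%N.
Proof.
move=> ax gen.
suff H (I J : seq nat) : (forall j, j \in I ++ J -> (j < size a)%N) ->
    (rk [seq nth 0%R a j | j <- J] [seq nth 0%R a j | j <- I] <=
     rk ([seq nth 0%R x j | j <- J] ++ t) [seq nth 0%R x j | j <- I])%N.
  have Ea : [seq nth 0 a j | j <- iota 0 (size a)] = a by rewrite map_nth_iota0 // take_size.
  have Ex : [seq nth 0 x j | j <- iota 0 (size a)] = x by rewrite ax.1 map_nth_iota0 // take_size.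
  have := H (iota 0 (size a)) [::]; rewrite Ea Ex; apply.
  by move=> j; rewrite cats0 mem_iota.
elim: I J => //= i I IH J IJ; apply: leq_add; last first.
  apply: (IH (i :: J)) => j jI; apply: IJ; move: jI; rewrite !(mem_cat, inE).
  by case: (j \in I); case: (j == i); case: (j \in J).
case: asboolP => //= h; case: asboolP => //= h'; case: h.
apply: generic_acl ax gen _ h' => j jJ; apply: IJ; move: jJ.
by rewrite !(mem_cat, inE); case: (j \in I); case: (j == i); case: (j \in J).
Qed.

(** A point of full rank over [t] and the point given by [generic_point] are specializations of each
    other, by [sp_rk_eq]. *)
Lemma sp_generic_over (a t x y : seq K) : sp a x -> (rk [::] a <= rk t x)%N ->
  sp a y -> sp (x ++ t) (y ++ t).
Proof.
move=> ax le ay; have [z az gen] := generic_point a t.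
have zx := gen _ ax.
have sz : size z = size x by rewrite -az.1 ax.1.
have le' : (rk t z <= rk t x)%N.
  apply: leq_trans le; apply: leq_trans (rk_base C0P z (t := [::]) _) _; first by [].
  by apply: sp_rk_le => //; rewrite ?cats0 // az.1.
exact: sp_trans (sp_rk_eq C0P char0 zx sz le') (gen _ ay).
Qed.

End Generic.

Lemma base_inj (m N : nat) (f g : nat -> nat) :
  (forall i, (i < m)%N -> (f i < N)%N) -> (forall i, (i < m)%N -> (g i < N)%N) ->
  (\sum_(i < m) f i * N ^ i = \sum_(i < m) g i * N ^ i)%N ->
  forall i, (i < m)%N -> f i = g i.
Proof.
elim: m f g => [|m IH] f g fN gN // E.
have N0 : (0 < N)%N by apply: leq_ltn_trans (fN 0%N _).
have sh (h : nat -> nat) : (\sum_(i < m.+1) h i * N ^ i = (\sum_(i < m) h i.+1 * N ^ i) * N + h 0)%N.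
  rewrite big_ord_recl expn0 muln1 addnC big_distrl /=; congr (_ + _)%N.
  by apply: eq_bigr => i _; rewrite /bump /= expnSr mulnA.
move: E; rewrite !sh => E.
have := congr1 (modn^~ N) E; rewrite !modnMDl !modn_small ?fN ?gN // => E0.
have := congr1 (divn^~ N) E; rewrite !divnMDl // !divn_small ?fN ?gN // !addn0 => E1.
move=> [|i] im //.
apply: (IH (fun i => f i.+1) (fun i => g i.+1)) => // j jm; [exact: fN | exact: gN].
Qed.

(** * Comparison with multivariate polynomials and with the transcendence degree of the statement *)

Section MpolyBridge.
Variables (K : fieldType) (C0 : set K).
Hypothesis C0P : is_subfield C0.
Hypothesis char0 : forall n, n.+1%:R != 0 :> K.
Local Notation pexp := (pexp C0).
Local Notation acl := (@acl K C0).
Local Notation sp := (@sp K C0).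
Local Notation rk := (@rk K C0).

(** Kronecker substitution: at the point with entries n^(N^i), where [N] exceeds all exponents,
    distinct monomials become distinct powers of [n], by uniqueness of digits in base [N]. *)
Lemma mpoly_fun_eq0 m (p : {mpoly K[m]}) : (forall x : m.-tuple K, p.@[tnth x] = 0) -> p = 0.
Proof.
move=> pv; pose N := msize p.
pose w (mm : 'X_{1..m}) := (\sum_(i < m) mm i * N ^ i)%N.
pose P : {poly K} := \sum_(mm <- msupp p) p@_mm *: 'X^(w mm).
have P0 : P = 0.
  apply: (poly_infinite_roots char0) => n; rewrite rootE horner_sum; apply/eqP.
  rewrite -[RHS](pv [tuple n%:R ^+ (N ^ i) | i < m]) mevalE; apply: eq_bigr => mm _.
  rewrite hornerZ hornerXn; congr (_ * _); rewrite /w -prodrXr.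
  by apply: eq_bigr => i _; rewrite tnth_mktuple -exprM mulnC.
apply/mpolyP => mm; rewrite mcoeff0; have [mmp|] := boolP (mm \in msupp p); last first.
  exact: memN_msupp_eq0.
have := congr1 (fun q : {poly K} => q`_(w mm)) P0; rewrite coef0 coef_sum.
rewrite (bigD1_seq mm) ?msupp_uniq //= coefZ coefXn eqxx mulr1 big_seq_cond big1 ?addr0 //.
move=> mm' /andP[mm'p mmN]; rewrite coefZ coefXn; case: eqP => [E|_]; last by rewrite mulr0.
case/eqP: mmN; apply/mnmP => i; apply/esym.
pose ext (u : 'X_{1..m}) (k : nat) := if insub k is Some i then u i else 0%N.
have extE (u : 'X_{1..m}) (j : 'I_m) : ext u j = u j by rewrite /ext valK.
rewrite -!extE; apply: (@base_inj m N) => //.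
- move=> j jm; rewrite -[j]/(val (Ordinal jm)) extE.
  by apply: leq_ltn_trans (msize_mdeg_lt mmp); rewrite mdegE (bigD1 (Ordinal jm)) //= leq_addr.
- move=> j jm; rewrite -[j]/(val (Ordinal jm)) extE.
  by apply: leq_ltn_trans (msize_mdeg_lt mm'p); rewrite mdegE (bigD1 (Ordinal jm)) //= leq_addr.
- by under eq_bigr do rewrite extE; under [RHS]eq_bigr do rewrite extE.
Qed.

Lemma mpoly_pexp m (p : {mpoly K[m]}) : mpoly_over C0 p ->
  exists q : pexp, forall x : m.-tuple K, p.@[tnth x] = pev x q.
Proof.
move=> pC; exists (psum C0P [seq PM (pcst (pC mm))
  (pprod C0P [seq pexn C0P (PV C0 (i : 'I_m)) (mm i) | i <- enum 'I_m]) | mm <- msupp p]) => x.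
rewrite mevalE pev_sum [RHS]big_map; apply: eq_bigr => mm _ /=; congr (_ * _).
rewrite pev_prod big_map -[LHS]big_enum /=; apply: eq_bigr => i _.
by rewrite pev_exn /= (tnth_nth 0).
Qed.

Lemma pexp_mpoly m (q : pexp) :
  exists2 p : {mpoly K[m]}, mpoly_over C0 p & forall x : m.-tuple K, p.@[tnth x] = pev x q.
Proof.
pose S : {pred K} := subfield_pred C0P.
have toC0 (p : {mpoly K[m]}) : p \is a mpolyOver m (subfield_pred C0P) -> mpoly_over C0 p.
  by move=> /mpolyOverP h mm; apply: set_mem; exact: h.
suff [p pS pE] : exists2 p : {mpoly K[m]}, p \is a mpolyOver m (subfield_pred C0P) &
    forall x : m.-tuple K, p.@[tnth x] = pev x q.
  by exists p => //; exact: toC0.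
elim: q => [k|c|a [p pS pE] b [p' pS' pE']|a [p pS pE] b [p' pS' pE']].
- case: (ltnP k m) => km; last first.
    exists 0; first exact: mpolyOver0.
    by move=> x; rewrite meval0 /= nth_default // size_tuple.
  exists 'X_(Ordinal km); first exact: mpolyOverX.
  by move=> x; rewrite mevalXU (tnth_nth 0).
- exists (set_val c)%:MP; last by move=> x; rewrite mevalC.
  by rewrite mpolyOverC; apply: mem_set; exact: set_valP.
- by exists (p + p'); [exact: rpredD | move=> x; rewrite mevalD pE pE'].
- by exists (p * p'); [exact: rpredM | move=> x; rewrite mevalM pE pE'].
Qed.

Lemma sp_indep_any (t y : seq K) : rk [::] t = size t -> size y = size t -> sp t y.
Proof.
move=> ht sy; have := sp_indep C0P (sp_refl C0 [::]) ht sy.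
rewrite !catrevE !cats0 => h; apply: (sp_relS h).
have := relS_catrev (relS_refl C0 h.1) (relS_nil C0P (rev t) (rev y)).
by rewrite !catrevE !revK !cats0.
Qed.

Lemma rk_lt_dep b (t : seq K) : (rk b t < size t)%N ->
  exists2 i, (i < size t)%N & acl (catrev (take i t) b) (nth 0%R t i).
Proof.
elim: t b => //= x t IH b; case: asboolP => /= bx.
  by move=> _; exists 0%N.
by rewrite add1n ltnS => /IH[i it h]; exists i.+1.
Qed.

(** If an entry is algebraic over the earlier ones, independence makes the relation the zero
    polynomial; varying that entry over the integers shows that the univariate relation is zero as
    well, a contradiction. Conversely a tuple of full rank specializes to every tuple. *)
Lemma alg_indep_rk m (t : m.-tuple K) : alg_indep C0 t <-> rk [::] t = m.
Proof.
split=> [ai|ht p pC pt].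
  apply/eqP; rewrite eqn_leq; have := rk_size C0 [::] t; rewrite size_tuple => -> /=.
  rewrite leqNgt; apply/negP => lt; have [|i] := @rk_lt_dep [::] t; first by rewrite size_tuple.
  rewrite size_tuple => im [g [g0 gt]].
  pose f k := if k is k'.+1 then (if (k' < i)%N then PV C0 (i - k'.+1) else P0 C0P) else PV C0 i.
  have fE (y : seq K) : size y = m -> pev y (psub f g) = pev (y`_i :: catrev (take i y) [::]) g.
    move=> sy; apply: pev_psub => -[|k] //=; rewrite catrevE cats0.
    have si : size (take i y) = i by rewrite size_take sy im.
    case: ltnP => ki; last by rewrite nth_default // size_rev si.
    by rewrite nth_rev ?si // nth_take //; lia.
  have [p pC pE] := pexp_mpoly m (psub f g).
  have p0 : p = 0 by apply: ai => //; rewrite pE fE ?size_tuple.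
  case/eqP: g0; apply: (poly_infinite_roots char0) => n; rewrite rootE horner_upoly.
  have sy : size (set_nth 0 t i n%:R) == m.
    by rewrite size_set_nth size_tuple; apply/eqP/maxn_idPr.
  have := pE (Tuple sy); rewrite p0 meval0 fE ?size_tuple //= nth_set_nth /= eqxx.
  rewrite (_ : take i (set_nth 0 t i n%:R) = take i t) => [<-//|].
  apply: (@eq_from_nth _ 0); rewrite !size_take size_set_nth size_tuple (maxn_idPr im) //.
  by move=> j; rewrite im => ji; rewrite !nth_take // nth_set_nth /= ltn_eqF.
apply: mpoly_fun_eq0 => y; have [q qE] := mpoly_pexp pC.
have ty : sp t y by apply: sp_indep_any; rewrite ?ht ?size_tuple.
by rewrite qE; apply: ty.2; rewrite -qE.
Qed.

Lemma gen_fieldE : gen_field C0 = C0.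
Proof.
apply/seteqP; split; last exact: sub_gen_smallest.
by apply: smallest_sub.
Qed.

Lemma gen_field_ratfield (a : seq K) : gen_field (C0 `|` [set` a]) `<=` ratfield C0 a.
Proof.
apply: smallest_sub; first exact: ratfield_subfield.
move=> x [Cx|xa]; first exact: (ratfield_ring C0P a (pcst Cx)).
have -> : x = pev a (PV C0 (index x a)) by rewrite /= nth_index.
exact: ratfield_ring.
Qed.

Lemma d0_rk (R : realType) (a : seq K) :
  trdeg R C0 (gen_field (C0 `|` [set` a])) = ((rk [::] a)%:R : R)%:E.
Proof.
apply/eqP; rewrite eq_le; apply/andP; split.
  apply: ge_ereal_sup => _ [m [t [ta /alg_indep_rk ht]] <-]; rewrite lee_fin ler_nat.
  rewrite -ht; apply: rk_le => // x xt; rewrite cats0; apply: acl_ratfield => //.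
  by apply: gen_field_ratfield; exact: ta.
have [m sm [h1 h2]] := rk_basis C0P [::] a.
apply: ereal_sup_ubound; exists (size (mask m a)); last by rewrite h2.
exists (in_tuple (mask m a)); split; last exact/alg_indep_rk.
by move=> x /mem_mask xa; apply: sub_gen_smallest; right.
Qed.

End MpolyBridge.

(** * Places and points of varieties *)

Section Places.
Variables (K : fieldType) (C0 : set K).
Hypothesis C0P : is_subfield C0.
Local Notation pexp := (pexp C0).
Local Notation sp := (@sp K C0).

(* The graph of a local morphism over C0 from a subring of [K] to [K];
   specializations of points are described by such graphs. *)
Record place (rho : K -> K -> Prop) : Prop := Place {
  place_cst : forall c, C0 c -> rho c c ;
  placeD : forall x y x' y', rho x y -> rho x' y' -> rho (x + x') (y + y') ;
  placeM : forall x y x' y', rho x y -> rho x' y' -> rho (x * x') (y * y') ;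
  place0 : forall y, rho 0 y -> y = 0 ;
  placeV : forall x y, rho x y -> y != 0 -> rho x^-1 y^-1 }.

Definition relR (rho : K -> K -> Prop) (s s' : seq K) :=
  size s = size s' /\ forall k, rho s`_k s'`_k.

Lemma relR_behead rho x x' u u' : relR rho (x :: u) (x' :: u') -> rho x x' /\ relR rho u u'.
Proof. by move=> [/=[h1] h2]; split; [exact: (h2 0%N) | split=> // k; exact: (h2 k.+1)]. Qed.

Lemma relR_cons (rho : K -> K -> Prop) x x' u u' : rho x x' -> relR rho u u' -> relR rho (x :: u) (x' :: u').
Proof. by move=> h [h1 h2]; split=> [|[|k]] //=; rewrite h1. Qed.

Lemma relR_tuple (rho : K -> K -> Prop) m (s s' : m.-tuple K) : rho 0 0 ->
  (forall k, rho (tnth s k) (tnth s' k)) -> relR rho s s'.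
Proof.
move=> r0 h; split=> [|k]; first by rewrite !size_tuple.
case: (ltnP k m) => km; last by rewrite !nth_default ?size_tuple.
by have := h (Ordinal km); rewrite !(tnth_nth 0).
Qed.

Lemma tuple_relR (rho : K -> K -> Prop) m (s s' : m.-tuple K) :
  relR rho s s' -> forall k, rho (tnth s k) (tnth s' k).
Proof. by move=> [_ h] k; rewrite !(tnth_nth 0). Qed.

Section Rho.
Variables (rho : K -> K -> Prop).
Hypothesis rhoP : place rho.

Lemma place00 : rho 0 0.
Proof. by apply: place_cst => //; exact: subfield0. Qed.

Lemma place_neq0 x y : rho x y -> y != 0 -> x != 0.
Proof. by move=> h; apply: contra_neq => E; move: h; rewrite E => /(place0 rhoP). Qed.

Lemma place_div x y x' y' : rho x y -> rho x' y' -> y' != 0 -> rho (x / x') (y / y').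
Proof. by move=> h h' y0; apply: placeM => //; exact: placeV. Qed.

Lemma relR_nil : relR rho [::] [::].
Proof. by split=> // k; rewrite nth_nil; exact: place00. Qed.

Lemma relR_cat u u' v v' : relR rho u u' -> relR rho v v' -> relR rho (u ++ v) (u' ++ v').
Proof.
elim: u u' => [|x u IH] [|x' u'] //; try by case.
by move=> /relR_behead[h /IH{}IH] /IH h2; apply: relR_cons.
Qed.

Lemma relR_catE u u' v v' : size u = size u' ->
  relR rho (u ++ v) (u' ++ v') -> relR rho u u' /\ relR rho v v'.
Proof.
elim: u u' => [|x u IH] [|x' u'] //=; first by move=> _ h; split => //; exact: relR_nil.
by move=> [/IH{}IH] /relR_behead[h /IH[h1 h2]]; split => //; apply: relR_cons.
Qed.

Lemma relR_flatten (I : Type) (s : seq I) (f g : I -> seq K) :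
  (forall i, relR rho (f i) (g i)) ->
  relR rho (flatten [seq f i | i <- s]) (flatten [seq g i | i <- s]).
Proof. by move=> h; elim: s => [|i s IH] /=; [exact: relR_nil | exact: relR_cat]. Qed.

Lemma relR_flattenE (I : eqType) (s : seq I) (f g : I -> seq K) :
  (forall i, size (f i) = size (g i)) ->
  relR rho (flatten [seq f i | i <- s]) (flatten [seq g i | i <- s]) ->
  forall i, i \in s -> relR rho (f i) (g i).
Proof.
move=> sfg; elim: s => [|j s IH] //= /relR_catE[|h1 h2] // i.
by rewrite inE => /predU1P[->//|]; exact: IH.
Qed.

Lemma place_pev s s' (p : pexp) : relR rho s s' -> rho (pev s p) (pev s' p).
Proof.
move=> [_ h]; elim: p => //= [c|a IHa b IHb|a IHa b IHb].
- by apply: place_cst => //; exact: set_valP.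
- exact: placeD.
- exact: placeM.
Qed.

Lemma place_sp s s' : relR rho s s' -> sp s s'.
Proof.
move=> h; split=> [|p ps]; first by case: h.
by apply: (place0 rhoP); rewrite -ps; exact: place_pev.
Qed.

Lemma place_meval m (p : {mpoly K[m]}) (x y : m.-tuple K) : mpoly_over C0 p ->
  (forall k, rho (tnth x k) (tnth y k)) -> rho p.@[tnth x] p.@[tnth y].
Proof.
move=> /(mpoly_pexp C0P)[q qE] h; rewrite !qE; apply: place_pev.
by apply: relR_tuple => //; exact: place00.
Qed.

End Rho.

(** The localization of C0[s] at the kernel of the map to C0[s']: fractions whose denominator does
    not vanish at [s']. *)
Lemma sp_place s s' : sp s s' -> exists2 rho, place rho & relR rho s s'.
Proof.
move=> h; have h0 (q : pexp) : pev s' q != 0 -> pev s q != 0.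
    by apply: contra_neq => qs; exact: (h.2 _ qs).
exists (fun x y => exists p q : pexp, [/\ pev s' q != 0, x = pev s p / pev s q & y = pev s' p / pev s' q]).
  split.
  - move=> c Cc; exists (pcst Cc), (P1 C0P).
    by rewrite !pev1 !pev_cst !divr1 oner_neq0.
  - move=> x y x' y' [p [q [q0 -> ->]]] [p' [q' [q'0 -> ->]]].
    exists (PA (PM p q') (PM p' q)), (PM q q'); split; rewrite /= ?mulf_neq0 //.
      by rewrite addf_div // h0.
    by rewrite addf_div.
  - move=> x y x' y' [p [q [q0 -> ->]]] [p' [q' [q'0 -> ->]]].
    by exists (PM p p'), (PM q q'); split; rewrite /= ?mulf_neq0 ?mulf_div.
  - move=> y [p [q [q0 /esym/eqP + ->]]]; rewrite mulf_eq0 invr_eq0 (negPf (h0 _ q0)) orbF.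
    by move=> /eqP ps; rewrite (h.2 _ ps) mul0r.
  - move=> x y [p [q [q0 -> ->]]]; rewrite mulf_eq0 invr_eq0 negb_or => /andP[p0 _].
    by exists q, p; rewrite !invf_div.
split; first by case: h.
by move=> k; exists (PV C0 k), (P1 C0P); rewrite !pev1 !divr1 oner_neq0.
Qed.

Lemma place_comp rho rho' : place rho -> place rho' ->
  place (fun x z => exists2 y, rho x y & rho' y z).
Proof.
move=> h h'; split.
- by move=> c Cc; exists c; exact: place_cst.
- by move=> x z x' z' [y a b] [y' a' b']; exists (y + y'); exact: placeD.
- by move=> x z x' z' [y a b] [y' a' b']; exists (y * y'); exact: placeM.
- by move=> z [y /(place0 h) -> /(place0 h')].
- move=> x z [y a b] z0; exists y^-1; last exact: placeV.
  by apply: placeV => //; exact: place_neq0 b z0.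
Qed.

Lemma relR_comp rho rho' s s' s'' : relR rho s s' -> relR rho' s' s'' ->
  relR (fun x z => exists2 y, rho x y & rho' y z) s s''.
Proof. by move=> [h1 h2] [h3 h4]; split=> [|k]; [rewrite h1 | exists s'`_k]. Qed.

Section Variety.
Variables (T : Type) (V : atlas K T).
Hypothesis VP : is_variety C0 V.

(** One chart around both points suffices: by [pspec_chart] every chart around [y] also contains
    [x], and the relation holds there. *)
Definition pspec (rho : K -> K -> Prop) (x y : T) :=
  exists i : chart V, [/\ dom i x, dom i y &
    forall k, rho (tnth (coords i x) k) (tnth (coords i y) k)].

(** The formula of [h] near [y] has a denominator nonzero at [y], hence at [x]; so it computes both
    images and is respected by [rho]. *)
Lemma pspec_morph rho (T' : Type) (W : atlas K T') (h : T -> T') x y (j : chart W) :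
  place rho -> is_morphism C0 V W h -> pspec rho x y -> dom j (h y) ->
  dom j (h x) /\ forall k, rho (tnth (coords j (h x)) k) (tnth (coords j (h y)) k).
Proof.
move=> rhoP [_ hm] [i [ix iy ixy]] jy.
have [q [P [qC PC q0 H]]] := hm i j y iy jy.
have qq : rho q.@[tnth (coords i x)] q.@[tnth (coords i y)] by exact: place_meval.
have qx := place_neq0 rhoP qq q0.
have [jx Ex] := H x ix qx; have [_ Ey] := H y iy q0.
split => // k; rewrite Ex Ey; apply: place_div => //.
by apply: place_meval.
Qed.

Lemma pspec_chart rho x y (j : chart V) : place rho -> pspec rho x y -> dom j y ->
  dom j x /\ forall k, rho (tnth (coords j x) k) (tnth (coords j y) k).
Proof. by move=> rhoP; apply: pspec_morph => //; case: VP. Qed.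

Lemma pspec_pts rho x y : pspec rho x y -> pts V x /\ pts V y.
Proof. by move=> [i [ix iy _]]; split; exists i. Qed.

Lemma pspec_comp rho rho' x y z : place rho -> place rho' -> pspec rho x y -> pspec rho' y z ->
  pspec (fun a c => exists2 b, rho a b & rho' b c) x z.
Proof.
move=> rhoP rhoP' h [i [iy iz iyz]]; have [ix ixy] := pspec_chart rhoP h iy.
by exists i; split => // k; exists (tnth (coords i y) k).
Qed.

Lemma flatE n m (t : n.-tuple (m.-tuple K)) : tval (flat t) = flatten (map val t).
Proof. by []. Qed.

Lemma flat_mktuple n m (f : 'I_n -> m.-tuple K) :
  tval (flat [tuple f j | j < n]) = flatten [seq tval (f j) | j <- enum 'I_n].
Proof. by rewrite flatE /= -map_comp. Qed.

Section Power.
Variable n : nat.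

Definition cs (i : chart (pow_atlas V n)) (x : n.-tuple T) : seq K :=
  flatten [seq tval (coords (tnth i j) (tnth x j)) | j <- enum 'I_n].

Lemma csE i x : tval (coords (a := pow_atlas V n) i x) = cs i x.
Proof. exact: flat_mktuple. Qed.

Lemma size_cs i x : size (cs i x) = (n * adim V)%N.
Proof. by rewrite -csE size_tuple. Qed.

(* y lies in the locus of x over C0(t). *)
Definition gsp (t : seq K) (x y : n.-tuple T) :=
  exists rho, [/\ place rho, relR rho t t & forall j, pspec rho (tnth x j) (tnth y j)].

Lemma relR_cs rho i x y : place rho ->
  (forall j k, rho (tnth (coords (tnth i j) (tnth x j)) k) (tnth (coords (tnth i j) (tnth y j)) k)) ->
  relR rho (cs i x) (cs i y).
Proof.
move=> rhoP h; apply: relR_flatten => // j.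
by apply: relR_tuple => //; exact: place00.
Qed.

Lemma gsp_chart t x y (i : chart (pow_atlas V n)) : gsp t x y -> dom i y ->
  dom i x /\ sp (cs i x ++ t) (cs i y ++ t).
Proof.
move=> [rho [rhoP tt xy]] iy.
have h j := pspec_chart rhoP (xy j) (iy j).
split=> [j|]; first by case: (h j).
apply: (place_sp rhoP); apply: relR_cat => //; apply: relR_cs => // j.
by case: (h j).
Qed.

Lemma sp_gsp t x y (i : chart (pow_atlas V n)) : dom i x -> dom i y ->
  sp (cs i x ++ t) (cs i y ++ t) -> gsp t x y.
Proof.
move=> ix iy /sp_place[rho rhoP rr]; exists rho; split => //.
  by case: (relR_catE rhoP _ rr) => //; rewrite !size_cs.
move=> j; exists (tnth i j); split; [exact: (ix j) | exact: (iy j) |].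
case: (relR_catE rhoP _ rr) => [|h _]; first by rewrite !size_cs.
have := relR_flattenE rhoP (f := fun j => tval (coords (tnth i j) (tnth x j)))
  (g := fun j => tval (coords (tnth i j) (tnth y j))) _ h.
move=> /(_ _ j) h'; apply: tuple_relR; apply: h'; last by rewrite mem_enum.
by move=> j'; rewrite !size_tuple.
Qed.

Lemma gsp_refl t x : (forall j, pts V (tnth x j)) -> gsp t x x.
Proof.
move=> xV; exists eq; split=> [|//|j].
  by split=> // [x' y x1 y1 -> ->|x' y x1 y1 -> ->|x' y ->].
by have [i _ ix] := xV j; exists i.
Qed.

Lemma gsp_trans t y x z : gsp t x y -> gsp t y z -> gsp t x z.
Proof.
move=> [rho [rhoP tt xy]] [rho' [rhoP' tt' yz]].
exists (fun a c => exists2 b, rho a b & rho' b c); split.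
- exact: place_comp.
- exact: relR_comp tt tt'.
- by move=> j; exact: pspec_comp (xy j) (yz j).
Qed.

Lemma pow_chart x : (forall j, pts V (tnth x j)) -> exists i : chart (pow_atlas V n), dom i x.
Proof.
move=> xV; have /choice[f fP] j : exists i : chart V, dom i (tnth x j).
  by have [i _ ix] := xV j; exists i.
by exists [tuple f j | j < n] => j; rewrite tnth_mktuple.
Qed.

Lemma gsp_closed x : (forall j, pts V (tnth x j)) ->
  closed_over C0 (pow_atlas V n) [set y | gsp [::] x y].
Proof.
move=> xV; split.
  move=> y [rho [rhoP _ xy]]; have [i iy] : exists i : chart (pow_atlas V n), dom i y.
    by apply: pow_chart => j; case: (pspec_pts (xy j)).
  by exists i.
move=> i; have [ix|nix] := pselect (dom i x).
  exists (zeros [set p | mpoly_over C0 p /\ p.@[tnth (coords (a := pow_atlas V n) i x)] = 0]).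
    by exists [set p | mpoly_over C0 p /\ p.@[tnth (coords (a := pow_atlas V n) i x)] = 0]; split => // p [].
  move=> y iy; split=> [xy p [pC p0]|h].
    have [_] := gsp_chart xy iy; rewrite !cats0 => h.
    have [q qE] := mpoly_pexp C0P pC.
    by rewrite qE csE; apply: h.2; rewrite -csE -qE.
  apply: sp_gsp ix iy _; rewrite !cats0; split; first by rewrite !size_cs.
  move=> q q0; have [p pC pE] := pexp_mpoly C0P (adim (pow_atlas V n)) q.
  by rewrite -csE -pE; apply: h; split => //; rewrite pE csE.
(* A chart around a specialization of [x] contains [x]; as this one does not, the locus is empty in
   it. *)
exists (zeros [set 1]).
  exists [set 1]; split => // p ->; move=> mm; rewrite mcoeff1.
  by case: (mm == 0%MM); [exact: subfield1 | exact: subfield0].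
move=> y iy; split; first by move=> xy; case: nix; case: (gsp_chart xy iy).
by move=> /(_ 1 erefl) /eqP; rewrite meval1 oner_eq0.
Qed.

Lemma locus_gsp x : (forall j, pts V (tnth x j)) ->
  locus C0 (pow_atlas V n) x = [set y | gsp [::] x y].
Proof.
move=> xV; apply/seteqP; split=> y.
  move=> h; apply: (h [set y | gsp [::] x y]); split; first exact: gsp_closed.
  exact: gsp_refl.
move=> xy Z [[ZV Zc] Zx].
have [i iy] : exists i : chart (pow_atlas V n), dom i y.
  by case: xy => rho [rhoP _ xy]; apply: pow_chart => j; case: (pspec_pts (xy j)).
have [ix] := gsp_chart xy iy; rewrite !cats0 => h.
have [A [S [SC ->]] ZA] := Zc i.
apply/(ZA y iy) => p Sp; have /(ZA x ix)/(_ p Sp) px := Zx.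
have [q qE] := mpoly_pexp C0P (SC _ Sp).
by rewrite qE csE; apply: h.2; rewrite -csE -qE.
Qed.

Lemma nth_flatten_const (d : nat) (ss : seq (seq K)) j : (j < size ss)%N ->
  (forall s, s \in ss -> size s = d) ->
  nth [::] ss j = take d (drop (j * d) (flatten ss)).
Proof.
elim: ss j => // s ss IH [|j] /= jss hs.
  by rewrite mul0n drop0 take_size_cat // hs // inE eqxx.
rewrite mulSn -{2}(hs s) ?inE ?eqxx // drop_cat ltnNge leq_addr /= addKn.
by apply: IH => // s' s's; apply: hs; rewrite inE s's orbT.
Qed.

(** Chart images are closed over [C0], so specialized coordinates are again the coordinates of a
    point. *)
Lemma realize x c (i : chart (pow_atlas V n)) : dom i x -> sp (cs i x) c ->
  exists2 y, dom i y & cs i y = c.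
Proof.
move=> ix h; pose d := adim V.
have szc : size c = (n * d)%N by rewrite -h.1 size_cs.
pose cc j := take d (drop (j * d) c).
have szcc (j : 'I_n) : size (cc j) == d.
  rewrite /cc size_take size_drop szc -mulnBl; case: ltnP => //; rewrite leq_eqVlt ltnNge.
  have jn : (0 < n - j)%N by rewrite subn_gt0.
  by rewrite leq_pmull //= orbF => /eqP ->.
have /choice[y yP] (j : 'I_n) : exists y, dom (tnth i j) y /\ tval (coords (tnth i j) y) = cc j.
  have [_ ca _ _] := VP; have [S [SC SE]] := ca (tnth i j).
  have : (coords (tnth i j) @` dom (tnth i j)) (Tuple (szcc j)).
    rewrite SE => p Sp; have [q qE] := mpoly_pexp C0P (SC _ Sp).
    rewrite qE /=.
    have : (coords (tnth i j) @` dom (tnth i j)) (coords (tnth i j) (tnth x j)).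
      by exists (tnth x j) => //; exact: ix.
    rewrite SE => /(_ p Sp); rewrite qE.
    have xE : tval (coords (tnth i j) (tnth x j)) = take d (drop (j * d) (cs i x)).
      have hs : (j < size (enum 'I_n))%N by rewrite size_enum_ord.
      rewrite -(@nth_flatten_const d); first by rewrite (nth_map j _ _ hs) nth_ord_enum.
        by rewrite size_map.
      by move=> s /mapP[j' _ ->]; rewrite size_tuple.
    have hj : sp (coords (tnth i j) (tnth x j)) (cc j).
      apply: (sp_relS h); rewrite xE /cc; split.
        by rewrite !size_take !size_drop h.1.
      move=> k; case: (ltnP k d) => kd; last first.
        have sz (u : seq K) : (size (take d u) <= k)%N.
          by rewrite size_take; case: ltnP => // /leq_trans; apply.
        by rewrite !nth_default //; exact: (rel_cst _ _ (subfield0 C0P)).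
      by rewrite !nth_take // !nth_drop; exact: rel_nth.
    exact: hj.2.
  by move=> [y iy E]; exists y; split => //; rewrite E.
exists [tuple y j | j < n].
  by move=> j; rewrite tnth_mktuple; case: (yP j).
apply: (@eq_from_nth _ 0); first by rewrite size_cs szc.
rewrite size_cs => k kn; have d0 : (0 < d)%N by rewrite lt0n; apply: contraTneq kn => d0; rewrite /d in d0; rewrite d0 muln0.
have kj : (k %/ d < n)%N by rewrite ltn_divLR.
have E : take d (drop (k %/ d * d) (cs i [tuple y j | j < n])) = cc (k %/ d)%N.
  have hs : (Ordinal kj < size (enum 'I_n))%N by rewrite size_enum_ord.
  rewrite -[(k %/ d)%N]/(val (Ordinal kj)) /cs -(@nth_flatten_const d).
  - rewrite (nth_map (Ordinal kj) _ _ hs) nth_ord_enum tnth_mktuple.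
    by case: (yP (Ordinal kj)).
  - by rewrite size_map.
  by move=> s /mapP[j' _ ->]; rewrite size_tuple.
have := congr1 (nth 0 ^~ (k %% d)%N) E; rewrite /cc !nth_take ?ltn_pmod // !nth_drop.
by rewrite -divn_eq.
Qed.

End Power.
End Variety.
End Places.

(** * Generic and rational points of the group *)

Section GroupPoints.
Variables (R : realType) (U : nonprincipal_ultrafilter) (C0 : set (ultrapower R U)).
Local Notation K := (ultrapower R U).
Hypothesis C0P : is_subfield C0.
Hypothesis C0cl : alg_closed_in C0.
Hypothesis C0count : countable C0.
Variables (N : nat) (G : group_data K (N.-tuple K)).
Hypothesis GP : is_comm_alg_group C0 G.
Hypothesis Gemb : constructibly_embedded C0 G.
Local Notation pexp := (pexp C0).
Local Notation acl_incl := (@acl_incl K C0).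
Local Notation sp := (@sp K C0).
Local Notation rk := (@rk K C0).
Local Notation T := (N.-tuple K).
Local Notation gsp := (@gsp K C0 T G _).
Local Notation place := (@place K C0).
Local Notation pspec := (@pspec K T G).

Let char0 := @ultrapower_char0 R U.
Let Kcl := @ultrapower_closed R U.
Let VP : is_variety C0 G. Proof. by case: GP. Qed.

(** The graph of the chart is constructible, and the chart is injective. By [sp_point_in_acl] the
    half of the pair to be shown algebraic can be replaced, within the graph, by one algebraic over
    the other half; by uniqueness it is unchanged. *)
Lemma acl_coords (i : chart G) x : dom i x ->
  acl_incl (coords i x) x /\ acl_incl x (coords i x).
Proof.
move=> ix; have [s [sC sE]] := Gemb i.
have : [set [tuple of x ++ coords i x] | x in dom i] [tuple of x ++ coords i x] by exists x.
rewrite sE => -[c [cs c1 c2]]; have [c1C c2C] := sC c cs.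
have /choice[q qP] (p : {mpoly K[N + adim G]}) : exists q : pexp, mpoly_over C0 p ->
    forall y : (N + adim G).-tuple K, p.@[tnth y] = pev y q.
  have [/mpoly_pexp[//|q qE]|nC] := pselect (mpoly_over C0 p); first by exists q.
  by exists (P0 C0P) => /nC.
have key (y z : seq K) : size y = N -> size z = adim G ->
    sp (x ++ coords i x) (y ++ z) -> pev (y ++ z) (q c.2) != 0 ->
    exists2 x', dom i x' & tval x' = y /\ tval (coords i x') = z.
  move=> sy sz spyz qyz.
  have syz : size (y ++ z) == (N + adim G)%N by rewrite size_cat sy sz.
  have : [set [tuple of x ++ coords i x] | x in dom i] (Tuple syz).
    rewrite sE; exists c; split => //.
      move=> p pc; rewrite (qP p (c1C _ pc)); apply: spyz.2.
      by rewrite -[_ ++ _]/(tval [tuple of x ++ coords i x]) -(qP p (c1C _ pc)) c1.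
    by rewrite (qP _ c2C).
  move=> [x' ix' /(congr1 val) /= E]; exists x' => //.
  have sx' : size (tval x') = size y by rewrite size_tuple.
  move/eqP: E; rewrite eqseq_cat //.
  by case/andP => /eqP -> /eqP ->.
have perm_nth (y z : seq K) : size y = N -> size z = adim G -> forall k,
    pev (z ++ y) (PV C0 (if (k < N)%N then (adim G + k)%N
                      else if (k < N + adim G)%N then (k - N)%N else k)) = (y ++ z)`_k.
  move=> sy sz k /=; case: ltnP => kN; first by rewrite !nth_cat sy sz kN ltnNge leq_addr /= addKn.
  case: ltnP => h; first by rewrite !nth_cat sy sz [(k < N)%N]ltnNge kN /= ltn_subLR // h.
  by rewrite !nth_default ?size_cat ?sy ?sz // addnC.
split.
  have q2 : pev (coords i x ++ x) (psub (fun k => PV C0 (if (k < N)%N then (adim G + k)%N else if (k < N + adim G)%N then (k - N)%N else k)) (q c.2)) != 0.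
    rewrite (@pev_psub _ _ _ _ (x ++ coords i x)).
      by rewrite -[x ++ _]/(tval [tuple of x ++ coords i x]) -qP.
    by move=> k; apply: perm_nth; rewrite size_tuple.
  have [d [da spd sd dq]] := sp_point_in_acl C0P char0 Kcl q2.
  have sxd : sp (x ++ coords i x) (x ++ d) by apply: sp_catC => //; rewrite sd.
  have [] := key x d _ _ sxd; rewrite ?sd ?size_tuple //.
    rewrite (@pev_psub _ _ _ _ (x ++ d)) in dq => [//|].
    by move=> k; apply: perm_nth; rewrite ?sd size_tuple.
  by move=> x' ix' [/val_inj -> ->].
have q2 : pev (x ++ coords i x) (q c.2) != 0.
  by rewrite -[x ++ _]/(tval [tuple of x ++ coords i x]) -qP.
have [d [da spd sd dq]] := sp_point_in_acl C0P char0 Kcl q2.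
have sdN : size d = N by rewrite sd size_tuple.
have [x1 ix1 [dE /val_inj E]] := key d (coords i x) sdN (size_tuple _) spd dq.
have [ci _ _ _] := VP; have xx : x1 = x by apply: (ci i); rewrite ?inE.
by rewrite -xx dE E.
Qed.

Definition pt n (x : n.-tuple T) : seq K := flatten [seq tval (tnth x j) | j <- enum 'I_n].

Lemma acl_cs n (i : chart (pow_atlas G n)) (x : n.-tuple T) : dom i x ->
  acl_incl (cs i x) (pt x) /\ acl_incl (pt x) (cs i x).
Proof.
move=> ix; split => z /flattenP[_ /mapP[j _ ->] zj].
  have [h _] := acl_coords (ix j); have := h z zj; apply: acl_sub => // y yj.
  by apply/flattenP; exists (tval (tnth x j)) => //; apply/mapP; exists j; rewrite ?mem_enum.
have [_ h] := acl_coords (ix j); have := h z zj; apply: acl_sub => // y yj.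
apply/flattenP; exists (tval (coords (tnth i j) (tnth x j))) => //.
by apply/mapP; exists j; rewrite ?mem_enum.
Qed.

Lemma rk_cs n (i : chart (pow_atlas G n)) (x : n.-tuple T) t : dom i x ->
  rk t (cs i x) = rk t (pt x).
Proof.
move=> /acl_cs[h1 h2]; apply: rk_eq => // z; [move/h2|move/h1]; apply: acl_sub => // y yj;
by rewrite mem_cat yj.
Qed.

Lemma rk_base_cs n (i : chart (pow_atlas G n)) (x : n.-tuple T) t s : dom i x ->
  rk (cs i x ++ t) s = rk (pt x ++ t) s.
Proof.
move=> /acl_cs[h1 h2]; apply: rk_eqv => //; apply: acl_incl_cat.
- by move=> z /h1; apply: acl_sub => // y yj; rewrite mem_cat yj.
- by move=> z zt; apply: acl_mem => //; rewrite mem_cat zt orbT.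
- by move=> z /h2; apply: acl_sub => // y yj; rewrite mem_cat yj.
- by move=> z zt; apply: acl_mem => //; rewrite mem_cat zt orbT.
Qed.

Definition ptsn n (x : n.-tuple T) := forall j, pts G (tnth x j).

Lemma gsp_ptsn n t (x y : n.-tuple T) : gsp t x y -> ptsn x /\ ptsn y.
Proof. by move=> [rho [_ _ h]]; split=> j; case: (pspec_pts (h j)). Qed.

Lemma gsp_rk_le n t (a x : n.-tuple T) : gsp t a x -> (rk t (pt x) <= rk t (pt a))%N.
Proof.
move=> ax; have [_ xG] := gsp_ptsn ax; have [i ix] := pow_chart xG.
have [ia h] := gsp_chart C0P VP ax ix; rewrite -(rk_cs t ix) -(rk_cs t ia).
by apply: sp_rk_le => //; rewrite !size_cs.
Qed.

Lemma gsp_rk_eq n t (a x : n.-tuple T) : gsp t a x -> (rk t (pt a) <= rk t (pt x))%N ->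
  gsp t x a.
Proof.
move=> ax le; have [_ xG] := gsp_ptsn ax; have [i ix] := pow_chart xG.
have [ia h] := gsp_chart C0P VP ax ix; apply: (sp_gsp C0P ix ia).
by apply: sp_rk_eq => //; rewrite ?size_cs // (rk_cs t ix) (rk_cs t ia).
Qed.

Lemma gsp_generic_over n t (a x b : n.-tuple T) : gsp [::] a x ->
  (rk [::] (pt a) <= rk t (pt x))%N -> gsp [::] a b -> gsp t x b.
Proof.
move=> ax le ab; have [_ bG] := gsp_ptsn ab; have [i ib] := pow_chart bG.
have [ia hb] := gsp_chart C0P VP ab ib; rewrite !cats0 in hb.
have xa : gsp [::] x a.
  by apply: gsp_rk_eq => //; apply: leq_trans le _; exact: rk_base.
have [ix _] := gsp_chart C0P VP xa ia.
have [_ hx] := gsp_chart C0P VP ax ix; rewrite !cats0 in hx.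
apply: (sp_gsp C0P ix ib); apply: (sp_generic_over C0P C0cl C0count hx) => //.
by rewrite (rk_cs _ ia) (rk_cs _ ix).
Qed.

Lemma generic_pt n t (a : n.-tuple T) : ptsn a ->
  exists2 x, gsp [::] a x & (rk [::] (pt a) <= rk t (pt x))%N.
Proof.
move=> aG; have [i ia] := pow_chart aG.
have [c ac gen] := generic_point C0P C0cl C0count (cs i a) t.
have [x ix xc] := realize C0P VP ia ac.
exists x; first by apply: (sp_gsp C0P ia ix); rewrite !cats0 xc.
by rewrite -(rk_cs _ ia) -(rk_cs _ ix) xc; exact: generic_rk gen.
Qed.

Definition ratpoint n (x : n.-tuple T) :=
  exists2 i : chart (pow_atlas G n), dom i x & inC0 C0 (cs i x).

Lemma rational_pt n (a : n.-tuple T) : ptsn a -> exists2 x, gsp [::] a x & ratpoint x.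
Proof.
move=> aG; have [i ia] := pow_chart aG.
have [|c [cC ac sc _]] := @sp_point R U C0 C0P C0cl (cs i a) (P1 C0P).
  by rewrite pev1 oner_neq0.
have [x ix xc] := realize C0P VP ia ac.
exists x; first by apply: (sp_gsp C0P ia ix); rewrite !cats0 xc.
by exists i; rewrite ?xc.
Qed.

Lemma relR_refl_pspec n rho (i : chart (pow_atlas G n)) x : dom i x ->
  place rho -> relR rho (cs i x) (cs i x) -> forall j, pspec rho (tnth x j) (tnth x j).
Proof.
move=> ix rhoP h j; exists (tnth i j); split; [exact: (ix j)|exact: (ix j)|].
have h' := relR_flattenE C0P rhoP (f := fun j => tval (coords (tnth i j) (tnth x j)))
  (g := fun j => tval (coords (tnth i j) (tnth x j))) (fun=> erefl) h (mem_enum 'I_n j).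
exact: tuple_relR h'.
Qed.

Lemma rational_pspec n rho (x : n.-tuple T) : ratpoint x -> place rho ->
  forall j, pspec rho (tnth x j) (tnth x j).
Proof.
move=> [i ix iC] rhoP; apply: (relR_refl_pspec ix) => //; split => // k.
by apply: (place_cst rhoP); exact: inC0_nth.
Qed.

(* Two independent generic points of the locus of [a] specialize to any two of
   its points. *)
Lemma gsp_pair n t (a v w v' w' : n.-tuple T) :
  gsp [::] a v -> gsp [::] a w -> gsp [::] a v' -> gsp [::] a w' ->
  (rk [::] (pt a) <= rk t (pt v))%N ->
  (rk [::] (pt a) <= rk (pt v ++ t) (pt w))%N ->
  exists rho, [/\ place rho, relR rho t t,
    forall j, pspec rho (tnth v j) (tnth v' j) & forall j, pspec rho (tnth w j) (tnth w' j)].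
Proof.
move=> av aw av' aw' rv rw; set r := rk [::] (pt a) in rv rw.
have [aG vG] := gsp_ptsn av; have [_ v'G] := gsp_ptsn av'.
have [i iv] := pow_chart vG; have [i' iv'] := pow_chart v'G.
(* An auxiliary point [x], generic over [v], [v'] and [t], allows one move at a time: [w] to [x]
   fixing [v], then [v] to [v'] fixing [x], then [x] to [w'] fixing [v']. *)
have [x ax rx] := generic_pt (cs i v ++ cs i' v' ++ t) aG.
have [_ xG] := gsp_ptsn ax; have [l lx] := pow_chart xG.
have [rho1 [P1 t1 h1]] : gsp (cs i v ++ t) w x.
  by apply: gsp_generic_over aw _ ax; rewrite (rk_base_cs _ _ iv).
have rxt : (rk t (pt x) <= r)%N.
  by apply: leq_trans (gsp_rk_le ax); exact: rk_base.
have rxv : (r <= rk (pt v ++ t) (pt x))%N.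
  apply: leq_trans rx _; rewrite -(rk_base_cs _ _ iv); apply: rk_base => //.
  apply: acl_incl_sub => // y; rewrite !mem_cat => /orP[->//|->].
  by rewrite !orbT.
have rvx : (r <= rk (cs l x ++ t) (pt v))%N.
  rewrite (rk_base_cs _ _ lx); have := rk_sym C0P char0 t (pt v) (pt x).
  by move: (rk _ _) (rk _ _) (rk _ _) (rk _ _) rv rxv rxt => *; lia.
have [rho2 [P2 t2 h2]] : gsp (cs l x ++ t) v v' by exact: gsp_generic_over av rvx av'.
have [rho3 [P3 t3 h3]] : gsp (cs i' v' ++ t) x w'.
  apply: gsp_generic_over ax _ aw'; apply: leq_trans rx _; apply: rk_base => //.
  by apply: acl_incl_sub => // y; rewrite !mem_cat => /orP[->|->]; rewrite ?orbT.
have [vv1 tt1] := relR_catE C0P P1 erefl t1.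
have [xx2 tt2] := relR_catE C0P P2 erefl t2.
have [vv3 tt3] := relR_catE C0P P3 erefl t3.
exists (fun a c => exists2 b, (exists2 b', rho1 a b' & rho2 b' b) & rho3 b c); split.
- by apply: place_comp => //; exact: place_comp.
- by apply: relR_comp tt3; exact: relR_comp tt1 tt2.
- move=> j; apply: (pspec_comp C0P VP _ P3 _ (relR_refl_pspec iv' P3 vv3 j)); first exact: place_comp.
  exact: (pspec_comp C0P VP P1 P2 (relR_refl_pspec iv P1 vv1 j) (h2 j)).
- move=> j; apply: (pspec_comp C0P VP _ P3 _ (h3 j)); first exact: place_comp.
  exact: (pspec_comp C0P VP P1 P2 (h1 j) (relR_refl_pspec lx P2 xx2 j)).
Qed.

Lemma pts_gmul x y : pts G x -> pts G y -> pts G (gmul G x y).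
Proof.
move=> xG yG; have [h _] := gmul_morphism GP.
have := h [tuple x; y]; rewrite /= !(tnth_nth x) /=; apply.
have [i iy] : exists i : chart (pow_atlas G 2), dom i [tuple x; y].
  by apply: pow_chart => -[[|[|j]] hj] //; rewrite (tnth_nth x).
by exists i.
Qed.

Lemma pts_ginv x : pts G x -> pts G (ginv G x).
Proof. by have [h _] := ginv_morphism GP; exact: h. Qed.

Lemma pts_gone : pts G (gone G).
Proof. by have [i h _] := gone_rational GP; exists i. Qed.

Lemma gmul_assoc x y z : pts G x -> pts G y -> pts G z ->
  gmul G x (gmul G y z) = gmul G (gmul G x y) z.
Proof. by move=> /mem_set hx /mem_set hy /mem_set hz; exact: (gmulA GP). Qed.

Lemma gmul_comm x y : pts G x -> pts G y -> gmul G x y = gmul G y x.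
Proof. by move=> /mem_set hx /mem_set hy; exact: (gmulC GP). Qed.

Lemma gmul_1g x : pts G x -> gmul G (gone G) x = x.
Proof. by move=> /mem_set hx; exact: (gmul1 GP). Qed.

Lemma gmul_Vg x : pts G x -> gmul G (ginv G x) x = gone G.
Proof. by move=> /mem_set hx; exact: (gmulV GP). Qed.

Lemma gmul_VKg x y : pts G x -> pts G y -> gmul G x (gmul G (ginv G x) y) = y.
Proof.
move=> hx hy; rewrite gmul_assoc ?(gmul_comm hx) ?gmul_Vg ?gmul_1g //; exact: pts_ginv.
Qed.

Lemma gmul_KVg x y : pts G x -> pts G y -> gmul G (ginv G x) (gmul G x y) = y.
Proof. by move=> hx hy; rewrite gmul_assoc ?gmul_Vg ?gmul_1g //; exact: pts_ginv. Qed.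

End GroupPoints.

Section GroupTuples.
Variables (R : realType) (U : nonprincipal_ultrafilter) (C0 : set (ultrapower R U)).
Local Notation K := (ultrapower R U).
Hypothesis C0P : is_subfield C0.
Hypothesis C0cl : alg_closed_in C0.
Hypothesis C0count : countable C0.
Variables (N : nat) (G : group_data K (N.-tuple K)).
Hypothesis GP : is_comm_alg_group C0 G.
Hypothesis Gemb : constructibly_embedded C0 G.
Local Notation acl_incl := (@acl_incl K C0).
Local Notation rk := (@rk K C0).
Local Notation T := (N.-tuple K).
Local Notation gsp := (@gsp K C0 T G _).
Local Notation place := (@place K C0).
Local Notation tuple_pspec := (@pspec K _ (pow_atlas G _)).
Local Notation pspec := (@pspec K T G).
Local Notation gm := (gmul (pow_group G _)).
Local Notation gi := (ginv (pow_group G _)).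
Local Notation ptsn := (ptsn G).

Let char0 := @ultrapower_char0 R U.
Let VP : is_variety C0 G. Proof. by case: GP. Qed.

Lemma pspec_pow n rho (x y : n.-tuple T) : place rho ->
  (forall j, pspec rho (tnth x j) (tnth y j)) -> tuple_pspec rho x y.
Proof.
move=> rhoP h; have [i iy] : exists i : chart (pow_atlas G n), dom i y.
  by apply: pow_chart => j; case: (pspec_pts (h j)).
have hj j := pspec_chart C0P VP rhoP (h j) (iy j).
exists i; split=> // [j|]; first by case: (hj j).
by apply: tuple_relR; rewrite !csE; apply: (relR_cs C0P rhoP) => j; case: (hj j).
Qed.

Lemma pspec_gmul rho x y x' y' : place rho -> pspec rho x y -> pspec rho x' y' ->
  pspec rho (gmul G x x') (gmul G y y').
Proof.
move=> rhoP h h'; have [_ yG] := pspec_pts h; have [_ y'G] := pspec_pts h'.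
have [j _ jy] := pts_gmul GP yG y'G.
have h2 : tuple_pspec rho [tuple x; x'] [tuple y; y'].
  by apply: pspec_pow => // -[[|[|k]] hk] //; rewrite !(tnth_nth x).
by have [] := pspec_morph C0P (j := j) rhoP (gmul_morphism GP) h2 jy; exists j.
Qed.

Lemma pspec_ginv rho x y : place rho -> pspec rho x y -> pspec rho (ginv G x) (ginv G y).
Proof.
move=> rhoP h; have [_ yG] := pspec_pts h; have [j _ jy] := pts_ginv GP yG.
by have [] := pspec_morph C0P (j := j) rhoP (ginv_morphism GP) h jy; exists j.
Qed.

Lemma acl_morphism (T' : Type) (V : atlas K T') (h : T' -> T) (i : chart V) x :
  is_morphism C0 V G h -> dom i x -> acl_incl (h x) (coords i x).
Proof.
move=> [hp hm] ix; have [|j _ jh] := hp x; first by exists i.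
have [_ hx] := acl_coords C0P GP Gemb jh; apply: acl_incl_trans (hx) _ => //.
have [q [P [qC PC q0 H]]] := hm i j x ix jh; have [_ E] := H x ix q0.
have [q' q'E] := mpoly_pexp C0P qC.
move=> z /(nthP 0)[k]; rewrite size_tuple => km <-.
have -> : (coords j (h x))`_k = tnth (coords j (h x)) (Ordinal km) by rewrite (tnth_nth 0).
have [P' P'E] := mpoly_pexp C0P (PC (Ordinal km)).
rewrite E q'E P'E; apply: acl_ratfield => //; exists P', q'; split => //.
by rewrite -q'E.
Qed.

Lemma acl_gmul x y : pts G x -> pts G y -> acl_incl (gmul G x y) (x ++ y).
Proof.
move=> xG yG; have [i ixy] : exists i : chart (pow_atlas G 2), dom i [tuple x; y].
  by apply: pow_chart => -[[|[|k]] hk] //; rewrite !(tnth_nth x).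
have := acl_morphism (gmul_morphism GP) ixy; rewrite csE => h.
have [h2 _] := acl_cs C0P GP Gemb ixy.
have h3 := acl_incl_trans C0P h h2; rewrite !(tnth_nth x) /= in h3.
apply: (acl_incl_trans C0P h3); apply: acl_incl_sub => // z.
move=> /flattenP[_ /mapP[[[|[|k]] hk] _ ->] //]; rewrite !(tnth_nth x) mem_cat => -> //.
by rewrite orbT.
Qed.

Lemma acl_ginv x : pts G x -> acl_incl (ginv G x) x.
Proof.
move=> [i _ ix]; have [h _] := acl_coords C0P GP Gemb ix.
exact: (acl_incl_trans C0P (acl_morphism (ginv_morphism GP) ix) h).
Qed.

Lemma pt_sub n (x : n.-tuple T) j : {subset tval (tnth x j) <= pt x}.
Proof. by move=> z zx; apply/flattenP; exists (tval (tnth x j)) => //; apply/mapP; exists j; rewrite ?mem_enum. Qed.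

Lemma acl_gm n (x y : n.-tuple T) : ptsn x -> ptsn y -> acl_incl (pt (gm x y)) (pt x ++ pt y).
Proof.
move=> xG yG z /flattenP[_ /mapP[j _ ->]]; rewrite tnth_mktuple.
move=> /(acl_gmul (xG j) (yG j)); apply: acl_sub => // u; rewrite !mem_cat.
by move=> /orP[] /pt_sub -> //; rewrite orbT.
Qed.

Lemma acl_gi n (x : n.-tuple T) : ptsn x -> acl_incl (pt (gi x)) (pt x).
Proof.
move=> xG z /flattenP[_ /mapP[j _ ->]]; rewrite tnth_mktuple.
by move=> /(acl_ginv (xG j)); apply: acl_sub => // u; exact: pt_sub.
Qed.

Lemma ptsn_gm n (x y : n.-tuple T) : ptsn x -> ptsn y -> ptsn (gm x y).
Proof. by move=> hx hy j; rewrite tnth_mktuple; apply: (pts_gmul GP); [exact: hx|exact: hy]. Qed.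

Lemma ptsn_gi n (x : n.-tuple T) : ptsn x -> ptsn (gi x).
Proof. by move=> hx j; rewrite tnth_mktuple; apply: (pts_ginv GP); exact: hx. Qed.

Lemma gmA n (x y z : n.-tuple T) : ptsn x -> ptsn y -> ptsn z -> gm x (gm y z) = gm (gm x y) z.
Proof.
by move=> hx hy hz; apply: eq_from_tnth => j; rewrite !tnth_mktuple; apply: (gmul_assoc GP).
Qed.

Lemma gmC n (x y : n.-tuple T) : ptsn x -> ptsn y -> gm x y = gm y x.
Proof.
by move=> hx hy; apply: eq_from_tnth => j; rewrite !tnth_mktuple; apply: (gmul_comm GP).
Qed.

Lemma gmVK n (x y : n.-tuple T) : ptsn x -> ptsn y -> gm x (gm (gi x) y) = y.
Proof.
by move=> hx hy; apply: eq_from_tnth => j; rewrite !tnth_mktuple; apply: (gmul_VKg GP).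
Qed.

Lemma gmKV n (x y : n.-tuple T) : ptsn x -> ptsn y -> gm (gi x) (gm x y) = y.
Proof.
by move=> hx hy; apply: eq_from_tnth => j; rewrite !tnth_mktuple; apply: (gmul_KVg GP).
Qed.

Lemma gmI n (x y z : n.-tuple T) : ptsn x -> ptsn y -> ptsn z -> gm x y = gm x z -> y = z.
Proof. by move=> hx hy hz E; rewrite -(gmKV hx hy) E gmKV. Qed.

Definition psn n rho (x y : n.-tuple T) := forall j, pspec rho (tnth x j) (tnth y j).

Lemma psn_gm n rho (x y x' y' : n.-tuple T) : place rho -> psn rho x y -> psn rho x' y' ->
  psn rho (gm x x') (gm y y').
Proof. by move=> rhoP h h' j; rewrite !tnth_mktuple; exact: pspec_gmul. Qed.

Lemma psn_gi n rho (x y : n.-tuple T) : place rho -> psn rho x y -> psn rho (gi x) (gi y).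
Proof. by move=> rhoP h j; rewrite !tnth_mktuple; exact: pspec_ginv. Qed.

Lemma psn_gsp n rho (x y : n.-tuple T) : place rho -> psn rho x y -> gsp [::] x y.
Proof. by move=> rhoP h; exists rho; split => //; exact: (relR_nil C0P rhoP). Qed.

Lemma rk_gm n t (x u : n.-tuple T) : ptsn x -> ptsn u -> acl_incl (pt u) t ->
  rk t (pt (gm u x)) = rk t (pt x).
Proof.
move=> hx hu ut; apply: rk_eq => //.
  rewrite -{1}(gmKV hu hx); apply: acl_incl_trans (acl_gm _ _) _ => //; [exact: ptsn_gi|exact: ptsn_gm|].
  apply: acl_incl_cat.
    apply: acl_incl_trans (acl_gi hu) _ => //; apply: acl_incl_trans ut _ => //.
    by apply: acl_incl_sub => // z; rewrite mem_cat orbC => ->.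
  by apply: acl_incl_sub => // z; rewrite mem_cat => ->.
apply: acl_incl_trans (acl_gm hu hx) _ => //; apply: acl_incl_cat.
  apply: acl_incl_trans ut _ => //.
  by apply: acl_incl_sub => // z; rewrite mem_cat orbC => ->.
by apply: acl_incl_sub => // z; rewrite mem_cat => ->.
Qed.

(* x y^-1 z; a closed set stable under it is a coset. *)
Definition tern n (x y z : n.-tuple T) := gm x (gm (gi y) z).

Lemma psn_tern n rho (x y z x' y' z' : n.-tuple T) : place rho -> psn rho x x' ->
  psn rho y y' -> psn rho z z' -> psn rho (tern x y z) (tern x' y' z').
Proof. by move=> rhoP hx hy hz; apply: psn_gm => //; apply: psn_gm => //; exact: psn_gi. Qed.

Lemma tern_rectangle n (p q v v' : n.-tuple T) : ptsn p -> ptsn q -> ptsn v -> ptsn v' ->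
  tern (gm q v) (gm p v) (gm p v') = gm q v'.
Proof.
move=> hp hq hv hv'; have hpv := ptsn_gm hp hv; have hpv' := ptsn_gm hp hv'.
rewrite /tern; set x := gm (gi _) _.
have hx : ptsn x by apply: ptsn_gm => //; exact: ptsn_gi.
have vx : gm v x = v'.
  apply: (gmI hp) => //; first exact: ptsn_gm.
  by rewrite gmA // gmVK.
by rewrite -gmA // vx.
Qed.

Definition ternary n (a : n.-tuple T) := forall x y z, gsp [::] a x -> gsp [::] a y ->
  gsp [::] a z -> gsp [::] a (tern x y z).

(** Because x y^-1 z is x u^-1 (u y^-1 z). *)
Lemma ternary_through n (a u : n.-tuple T) : gsp [::] a u ->
  (forall x y, gsp [::] a x -> gsp [::] a y -> gsp [::] a (tern x u y)) ->
  (forall x y, gsp [::] a x -> gsp [::] a y -> gsp [::] a (tern u x y)) -> ternary a.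
Proof.
move=> au h1 h2 x y z ax ay az; have := h1 _ _ ax (h2 _ _ ay az).
have [_ hu] := gsp_ptsn au; have [_ hy] := gsp_ptsn ay; have [_ hz] := gsp_ptsn az.
by rewrite /tern gmKV //; apply: ptsn_gm => //; exact: ptsn_gi.
Qed.

(* A rectangle of generic points: the translation by z - u maps the generic
   point y of the locus back into the locus, hence the whole locus, and so does
   its inverse. *)
Lemma ternary_rectangle n (a u z y y' : n.-tuple T) :
  gsp [::] a u -> gsp [::] a z -> gsp [::] a y -> gsp [::] a y' -> y' = tern z u y -> y = tern u z y' ->
  (rk [::] (pt a) <= rk (pt u) (pt z))%N -> (rk [::] (pt a) <= rk (pt z ++ pt u) (pt y))%N ->
  (rk [::] (pt a) <= rk (pt z ++ pt u) (pt y'))%N -> ternary a.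
Proof.
move=> au az ay ay' E E' rz ry ry'; have [_ uG] := gsp_ptsn au; have [i iu] := pow_chart uG.
have rz' : (rk [::] (pt a) <= rk (cs i u) (pt z))%N.
  by have := rk_base_cs C0P GP Gemb [::] (pt z) iu; rewrite !cats0 => ->.
have rb w : rk (pt z ++ cs i u) w = rk (pt z ++ pt u) w.
  rewrite (@rk_eq_mem K C0 C0P _ (cs i u ++ pt z)); last by move=> b; rewrite !mem_cat orbC.
  by rewrite (rk_base_cs C0P GP Gemb _ _ iu); apply: rk_eq_mem => // b; rewrite !mem_cat orbC.
apply: (ternary_through au) => b c ab ac.
  rewrite -rb in ry.
  have [rho [rhoP tt zb yc]] := gsp_pair C0P C0cl C0count GP Gemb az ay ab ac rz' ry.
  apply: (gsp_trans C0P VP ay'); rewrite E; apply: (psn_gsp rhoP).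
  by apply: psn_tern => //; exact: (relR_refl_pspec C0P iu rhoP tt).
rewrite -rb in ry'.
have [rho [rhoP tt zb yc]] := gsp_pair C0P C0cl C0count GP Gemb az ay' ab ac rz' ry'.
apply: (gsp_trans C0P VP ay); rewrite E'; apply: (psn_gsp rhoP).
by apply: psn_tern => //; exact: (relR_refl_pspec C0P iu rhoP tt).
Qed.

(** The locus is translated by one of its points. The point [p] has chart coordinates in [C0], so
    places fix it; the translate is then the locus of p^-1 a, and closed over [C0]. *)
Lemma ternary_coset n (a p : n.-tuple T) : gsp [::] a p -> ratpoint C0 G p -> ternary a ->
  is_coset_of_alg_subgroup C0 (pow_group G n) [set y | gsp [::] a y].
Proof.
move=> ap pQ tern_a; have [aG pG] := gsp_ptsn ap.
have pp rho : place rho -> psn rho p p by exact: (rational_pspec C0P pQ).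
have piG := ptsn_gi pG; have paG := ptsn_gm piG aG.
have HE h : gsp [::] (gm (gi p) a) h <-> ptsn h /\ gsp [::] a (gm p h).
  split=> [ah|[hG [rho [rhoP tt h']]]].
    have [_ hG] := gsp_ptsn ah; split => //; case: ah => rho [rhoP tt h'].
    by rewrite -{1}(gmVK pG aG); apply: (psn_gsp rhoP); apply: psn_gm => //; exact: pp.
  rewrite -(gmKV pG hG); apply: (psn_gsp rhoP).
  by apply: psn_gm => //; apply: psn_gi => //; exact: pp.
have pts1 : ptsn [tuple gone G | i < n] by move=> j; rewrite tnth_mktuple; exact: (pts_gone GP).
have g1 (x : n.-tuple T) : ptsn x -> gm x [tuple gone G | i < n] = x.
  move=> xG; rewrite gmC //; apply: eq_from_tnth => j.
  by rewrite !tnth_mktuple (gmul_1g GP).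
exists [set h | gsp [::] (gm (gi p) a) h], p; split.
- split; first exact: (gsp_closed C0P VP).
  split.
  + by move=> h /gsp_ptsn[_ /pow_chart[i ih]]; exists i.
  + by apply/HE; split => //; rewrite g1.
  + move=> x y /HE[xG ax] /HE[yG ay]; apply/HE; split; first exact: ptsn_gm.
    have := tern_a _ _ _ ax ap ay; rewrite /tern gmKV // -gmA //.
  + move=> x /HE[xG ax]; apply/HE; split; first exact: ptsn_gi.
    have := tern_a _ _ _ ap ax ap; rewrite /tern; set w := gm (gi _) p.
    have pxG := ptsn_gm pG xG.
    have wG : ptsn w by apply: ptsn_gm => //; exact: ptsn_gi.
    suff -> : w = gi x by [].
    have xwG := ptsn_gm xG wG; have xiG := ptsn_gi xG.
    have xw : gm x w = [tuple gone G | i < n].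
      by apply: (gmI pG) => //; rewrite gmA // gmVK // g1.
    by rewrite -(gmKV xG wG) xw g1.
- by have [i ip] := pow_chart pG; exists i.
apply/seteqP; split=> [y ay|_ [h /HE[_ h'] <-]] //.
have [_ yG] := gsp_ptsn ay.
exists (gm (gi p) y); last exact: gmVK.
by apply/HE; split; [exact: ptsn_gm | rewrite gmVK].
Qed.

End GroupTuples.

(** * Gluing the loci of coordinate projections *)

Section Glue.
Variables (R : realType) (U : nonprincipal_ultrafilter) (C0 : set (ultrapower R U)).
Local Notation K := (ultrapower R U).
Hypothesis C0P : is_subfield C0.
Hypothesis C0cl : alg_closed_in C0.
Hypothesis C0count : countable C0.
Variables (N : nat) (G : group_data K (N.-tuple K)).
Hypothesis GP : is_comm_alg_group C0 G.
Hypothesis Gemb : constructibly_embedded C0 G.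
Local Notation acl_incl := (@acl_incl K C0).
Local Notation rk := (@rk K C0).
Local Notation T := (N.-tuple K).
Local Notation gsp := (@gsp K C0 T G _).
Local Notation place := (@place K C0).
Local Notation ptsn := (ptsn G).

Let char0 := @ultrapower_char0 R U.
Let VP : is_variety C0 G. Proof. by case: GP. Qed.

Definition sub n m (f : 'I_m -> 'I_n) (x : n.-tuple T) : m.-tuple T := [tuple tnth x (f l) | l < m].

Lemma psn_sub n m (f : 'I_m -> 'I_n) rho (x y : n.-tuple T) : psn G rho x y -> psn G rho (sub f x) (sub f y).
Proof. by move=> h j; rewrite !tnth_mktuple; exact: h. Qed.

Lemma gsp_sub n m (f : 'I_m -> 'I_n) t (x y : n.-tuple T) : gsp t x y -> gsp t (sub f x) (sub f y).
Proof. by move=> [rho [rhoP tt h]]; exists rho; split => //; exact: psn_sub. Qed.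

Lemma tern_sub n m (f : 'I_m -> 'I_n) (x y z : n.-tuple T) :
  sub f (tern G x y z) = tern G (sub f x) (sub f y) (sub f z).
Proof. by apply: eq_from_tnth => j; rewrite !tnth_mktuple. Qed.

Lemma pt_subP n m (f : 'I_m -> 'I_n) (x : n.-tuple T) : {subset pt (sub f x) <= pt x}.
Proof. by move=> z /flattenP[_ /mapP[j _ ->]]; rewrite tnth_mktuple; exact: pt_sub. Qed.

(** The points whose projections lie in the loci of the projections of [a] may form a set with other
    components. A point [y] of this set that specializes to [a] lies on the right one: it is
    algebraic over its projection along [g], so its rank is at most that of [a] and the
    specialization is reversible. The points tested are built from [a], a rational [p] and a [w]
    generic over [a]; moving [w] to [p] brings them back to [a], since a p^-1 p = a. *)
Lemma ternary_glue n k m (g : 'I_k -> 'I_n) (f : 'I_n -> 'I_m -> 'I_n) (a : n.-tuple T) :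
  ptsn a -> (forall j, ternary C0 G (sub (f j) a)) ->
  (forall j l, exists l', f j l' = g l) -> (forall j, exists l, f j l = j) ->
  rk [::] (pt (sub g a)) = rk [::] (pt a) -> ternary C0 G a.
Proof.
move=> aG tern_f fg fj rg; set r := rk [::] (pt a) in rg.
have [p ap pQ] := rational_pt C0P C0cl GP aG; have [_ pG] := gsp_ptsn ap.
have pp rho : place rho -> psn G rho p p by exact: (rational_pspec C0P pQ).
have aa : gsp [::] a a by exact: gsp_refl.
have in_locus y : gsp [::] y a -> (forall j, gsp [::] (sub (f j) a) (sub (f j) y)) -> gsp [::] a y.
  move=> ya yf; apply: (gsp_rk_eq C0P GP Gemb ya).
  have rgy : (r <= rk [::] (pt (sub g y)))%N.
    by rewrite -rg; apply: (gsp_rk_le C0P GP Gemb); exact: gsp_sub.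
  have sub_fg j : {subset pt (sub g y) <= pt (sub (f j) y)}.
    move=> z /flattenP[_ /mapP[l _ ->]]; rewrite tnth_mktuple.
    have [l' <-] := fg j l; rewrite (_ : tnth y (f j l') = tnth (sub (f j) y) l'); first exact: pt_sub.
    by rewrite tnth_mktuple.
  have rf j : (rk [::] (pt (sub (f j) y)) <= r)%N.
    apply: leq_trans (gsp_rk_le C0P GP Gemb (yf j)) _; rewrite /r; apply: (rk_le C0P char0).
    by apply: (acl_incl_sub C0P) => z /pt_subP; rewrite mem_cat => ->.
  have ya_j : acl_incl (pt y) (pt (sub g y)).
    move=> z /flattenP[_ /mapP[j _ ->] zj]; have [l E] := fj j.
    suff : rk (pt (sub g y)) (pt (sub (f j) y)) = 0%N.
      move/(rk0_acl C0P); apply; apply: (@pt_sub R U N m _ l).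
      by rewrite tnth_mktuple E.
    have := rk_cat C0P [::] (pt (sub g y)) (pt (sub (f j) y)); rewrite cats0.
    have : (rk [::] (pt (sub g y) ++ pt (sub (f j) y)) <= rk [::] (pt (sub (f j) y)))%N.
      apply: (rk_le C0P char0); apply: (acl_incl_sub C0P) => u.
      by rewrite cats0 mem_cat => /orP[/sub_fg|].
    by have := rf j; move: rgy; move: (rk _ _) (rk _ _) (rk _ _) (rk _ _) => *; lia.
  apply: leq_trans (rk_le C0P char0 (a := pt (sub g y)) _) _.
    by move=> z /ya_j; rewrite cats0.
  case E: (pt (sub g y)) => [|z s] //; rewrite -E.
  have /flattenP[_ /mapP[l _ _] _] : z \in pt (sub g y) by rewrite E mem_head.
  apply: leq_trans (rf (g l)); apply: (rk_le C0P char0); apply: (acl_incl_sub C0P) => u.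
  by rewrite mem_cat => /sub_fg ->.
have [i ia] := pow_chart aG.
have [w aw rw] := generic_pt C0P C0cl C0count GP Gemb (pt a) aG; have [_ wG] := gsp_ptsn aw.
have rw' : (r <= rk (cs i a) (pt w))%N.
  by have := rk_base_cs C0P GP Gemb [::] (pt w) ia; rewrite !cats0 => ->.
have [rho [rhoP tt wp]] := gsp_generic_over C0P C0cl C0count GP Gemb aw rw' ap.
have ra := relR_refl_pspec C0P ia rhoP tt.
have ternr : tern G a p p = a.
  rewrite /tern (gmC GP) //; last by apply: (ptsn_gm GP) => //; exact: (ptsn_gi GP).
  by rewrite -(gmA GP) // ?(gmKV GP) //; exact: (ptsn_gi GP).
have ternl : tern G p p a = a by rewrite /tern (gmVK GP).
have tern1 : gsp [::] a (tern G a p w).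
  apply: in_locus => [|j]; last by rewrite tern_sub; apply: tern_f; exact: gsp_sub.
  by rewrite -{2}ternr; apply: (psn_gsp C0P rhoP); apply: (psn_tern C0P GP) => //; exact: pp.
have tern2 : gsp [::] a (tern G p w a).
  apply: in_locus => [|j]; last by rewrite tern_sub; apply: tern_f; exact: gsp_sub.
  by rewrite -{2}ternl; apply: (psn_gsp C0P rhoP); apply: (psn_tern C0P GP) => //; exact: pp.
have pair b c : gsp [::] a b -> gsp [::] a c -> exists rho, [/\ place rho, psn G rho a b & psn G rho w c].
  move=> ab ac; have [||rho' [h1 _ h2 h3]] := gsp_pair (t := [::]) C0P C0cl C0count GP Gemb aa aw ab ac.
  - by [].
  - by rewrite cats0.
  - by exists rho'.
apply: (ternary_through GP ap) => b c ab ac.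
  have [rho' [h1 h2 h3]] := pair b c ab ac; apply: (gsp_trans C0P VP tern1).
  by apply: (psn_gsp C0P h1); apply: (psn_tern C0P GP) => //; exact: pp.
have [rho' [h1 h2 h3]] := pair c b ac ab; apply: (gsp_trans C0P VP tern2).
by apply: (psn_gsp C0P h1); apply: (psn_tern C0P GP) => //; exact: pp.
Qed.

End Glue.

(** * Coarse dimension of types *)

Section TypeSize.
Variables (R : realType) (U : nonprincipal_ultrafilter) (C0 : set (ultrapower R U)).
Variables (L : language) (Ks : nat -> fo_structure L C0 R[i]) (xi : nat -> R).
Local Notation K := (ultrapower R U).
Local Notation C := (R[i]).
Local Notation S := (ultraproduct U Ks).
Hypothesis C0P : is_subfield C0.
Hypothesis C0count : countable C0.
Hypothesis S_cst : forall c : C0, scst S c = set_val c.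
Hypothesis xi_inf : forall r : R, \forall s \near ufilter U, r < xi s.
Hypothesis delta_cont : delta_continuous S xi.
Local Notation tpsmall := (tpsmall Ks xi).
Local Notation fdefs := (fdefs Ks).
Local Notation small := (small xi).
Local Notation acl := (@acl K C0).
Local Notation acl_incl := (@acl_incl K C0).

Definition tps (b : R) (a t : seq K) := tpsmall b (in_tuple a) t.

Lemma tpsE b n (a : n.-tuple K) t : tpsmall b a t <-> tps b a t.
Proof.
case: a => s sn; rewrite /tps /=; move: (sn); rewrite -(eqP sn) => sn'.
by rewrite (_ : Tuple sn' = in_tuple s) //; exact: val_inj.
Qed.

Lemma tps_add a b t (al be e : R) : 0 <= al -> 0 < e ->
  tps al a (b ++ t) -> tps be b t -> tps (al + be + e) (a ++ b) t.
Proof.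
by move=> al0 e0 h h'; have /tpsE := tpsmall_add (a := in_tuple a) (b := in_tuple b) xi_inf delta_cont al0 e0 h h'.
Qed.

Lemma tps_addN a b (al be si : R) : 0 < al -> si < al + be -> ~ tps al a b -> ~ tps be b [::] ->
  ~ tps si (a ++ b) [::].
Proof.
by move=> al0 e0 h h' h2; have := tpsmall_addN (a := in_tuple a) (b := in_tuple b) xi_inf delta_cont al0 e0 h h'; rewrite tpsE.
Qed.

Lemma fdefs_eq_nth i j : fdefs (fun e => e`_i = e`_j).
Proof. by exists (FEq (TVar _ _ i) (TVar _ _ j)). Qed.

Lemma tps_base b a t t' : {subset t <= t'} -> tps b a t -> tps b a t'.
Proof.
move=> tt [P [Pd Pa Psm]]; set n := size a.
pose idx := [seq index z t' | z <- t].
have tE : t = [seq t'`_i | i <- idx].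
  rewrite -map_comp -[LHS]map_id; apply/eq_in_map => z /tt zt.
  by rewrite /= nth_index.
pose f e := [seq nth 0 e i | i <- iota 0 n ++ [seq (n + i)%N | i <- idx]] : seq K.
have fE (x : n.-tuple K) : f (x ++ t') = x ++ t.
  rewrite /f map_cat -[X in X ++ _](_ : tval x = _) ?[in RHS]tE; last first.
    rewrite -[LHS]take_size size_tuple -(map_nth_iota0 0) ?size_tuple //.
    by apply/eq_in_map => i; rewrite mem_iota add0n /= nth_cat size_tuple => ->.
  by rewrite -map_comp; congr (_ ++ _); apply: eq_map => i; rewrite /= nth_cat size_tuple ltnNge leq_addr /= addKn.
exists (fun e => P (f e)); split.
- exact: fdefs_map.
- by rewrite (fE (in_tuple a)).
- by rewrite (_ : [set x : n.-tuple K | P (f (x ++ t'))] = [set x : n.-tuple K | P (x ++ t)]) //;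
    apply/seteqP; split => x /=; rewrite fE.
Qed.

Lemma fdefs_cut n m P : fdefs P -> fdefs (fun e => P (take n e ++ drop (n + m) e)).
Proof.
move=> Pd; clear -Pd.
apply: (fdefs_comp (r := fun k => if (k < n)%N then Some k else Some (m + k)%N)) => // e k; rewrite nth_cat size_take; case: (ltnP n (size e)) => ne.
  case: (ltnP k n) => kn; first by rewrite nth_take.
  by rewrite nth_drop; congr (nth _ _ _); lia.
case: (ltnP k (size e)) => ke; first by rewrite nth_take ?(leq_trans ke) // (leq_trans ke).
rewrite nth_default; last by rewrite size_drop (_ : _ - _ = 0)%N //; apply/eqP; rewrite subn_eq0 (leq_trans ne) ?leq_addr.
by case: ifP => _; rewrite nth_default // (leq_trans ke) ?leq_addl.
Qed.

Lemma tps_map b a t (idx : seq nat) : {in idx, forall i, (i < size a)%N} ->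
  tps b a t -> tps b [seq a`_i | i <- idx] t.
Proof.
move=> idx_lt [P [Pd Pa [F PF Fb]]]; set n := size a; pose m := size idx.
pose Q e := P (take n e ++ drop (n + m) e) /\
  forall k, k \in iota 0 m -> e`_(nth 0%N idx k) = e`_(n + k)%N :> K.
have QE (x y : seq K) : size x = n -> size y = m ->
    Q (x ++ y ++ t) <-> P (x ++ t) /\ y = [seq x`_i | i <- idx].
  move=> sx sy; rewrite /Q take_size_cat // catA drop_size_cat ?size_cat ?sx ?sy // -catA.
  have yE k : (k < m)%N -> (x ++ y ++ t)`_(n + k)%N = y`_k.
    by move=> km; rewrite nth_cat sx ltnNge leq_addr /= addKn nth_cat sy km.
  have xE k : (k < m)%N -> (x ++ y ++ t)`_(nth 0%N idx k) = [seq x`_i | i <- idx]`_k.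
    by move=> km; rewrite nth_cat sx (nth_map 0%N) // idx_lt ?mem_nth.
  split=> -[h h']; split=> //.
    apply: (@eq_from_nth _ 0); first by rewrite size_map sy.
    by rewrite sy => k km; rewrite -yE // -xE // h' // mem_iota.
  by move=> k; rewrite mem_iota add0n => /= km; rewrite xE // yE // h'.
pose a' := [seq a`_i | i <- idx]; have sa' : size a' = m by rewrite size_map.
pose g (y : n.-tuple C) : (size a').-tuple C := [tuple nth 0 y (nth 0%N idx k) | k < size a'].
exists (fun e => exists2 x, size x = n & Q (x ++ e)); split.
- apply: fdefs_exn; apply: fdefs_and.
    exact: fdefs_cut.
  by apply: fdefs_all => k _; exact: fdefs_eq_nth.
- by exists a => //; apply/QE => //; split => //; move: Pa.
exists (fun s => g @` F s).
  move=> y /= [x sx]; rewrite QE ?size_tuple // => -[Px yE].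
  have sxn : size x == n by rewrite sx.
  have := PF (Tuple sxn) Px; rewrite /ultraprod /=; move=> h.
  have h2 : \forall s \near ufilter U, forall k : 'I_(size a'), rep (tnth y k) s = nth 0 (slq s x) (nth 0%N idx k).
    apply: filter_forall => k; have := nth_slq x; apply: filterS => s hs.
    rewrite -hs; congr (rep _ s); rewrite (tnth_nth 0) yE (nth_map 0%N) //.
    by apply: leq_trans (ltn_ord k) _; rewrite sa'.
  apply: filterS2 h h2 => s Fs ys; exists (slice s (Tuple sxn)) => //.
  by apply: eq_from_tnth => k; rewrite tnth_mktuple tnth_map ys.
by apply: filterS Fb => s; exact: fewer_image.
Qed.

Lemma tps_catl b a a' t : tps b (a ++ a') t -> tps b a t.
Proof.
move=> h; have := @tps_map b (a ++ a') t (iota 0 (size a)) _ h.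
rewrite map_nth_iota0 ?size_cat ?leq_addr // take_size_cat //; apply => i.
by rewrite mem_iota add0n /= => ia; rewrite ?size_cat ltn_addr.
Qed.

Lemma finite_roots (q : {poly K}) : q != 0 -> exists rs : seq K, forall z, root q z -> z \in rs.
Proof.
move: {2}(size q) (leqnn (size q)) => k; elim: k q => [|k IH] q sq q0.
  by move: q0; rewrite -size_poly_eq0; case: (size q) sq.
have [[z rz]|no] := pselect (exists z, root q z); last first.
  by exists [::] => z rz; case: no; exists z.
have /factor_theorem[q' E] := rz.
have q'0 : q' != 0 by apply: contraNneq q0 => q'0; rewrite E q'0 mul0r.
have [|rs rsP] := IH q' _ q'0.
  by move: sq; rewrite E size_Mmonic ?monicXsubC // size_XsubC addn2.
exists (z :: rs) => w; rewrite E rootM root_XsubC inE => /orP[/rsP ->|->] //.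
by rewrite orbT.
Qed.

Lemma fewer_list (T : choiceType) (s : seq T) : fewer [set` s] ((size s)%:R : R).
Proof.
elim: s => [|x s IH].
  by rewrite set_nil; split => //; rewrite fset_set0 cardfs0.
have h1 : fewer [set x] (1 : R) by split; rewrite ?fset_set1 ?cardfs1.
apply: (fewer_sub _ _ (fewerU h1 IH)); last by rewrite /= -natr1 addrC.
by move=> y; rewrite /= inE => /predU1P[->|ys]; [left|right].
Qed.

(** The roots of the relation form a finite definable set, whose fixed size is below every positive
    power of [xi] in almost all factors. *)
Lemma tps_alg1 e z t : 0 < e -> acl t z -> tps e [:: z] t.
Proof.
move=> e0 [p [p0 pz]]; have [rs rsP] := finite_roots p0; apply/(tpsE e [tuple z]).
exists (fun e => pev e p = 0); split; [exact: fdefs_pev | exact: pz |].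
exists (fun s => (fun w => [tuple rep w s]) @` [set` rs]).
  move=> x /= px; apply: nearW => s; exists (tnth x ord0).
    apply: rsP; apply/rootP; rewrite horner_upoly -[RHS]px; congr (pev _ p).
    by case: x {px} => -[|w [|? ?]] // i; rewrite (tnth_nth 0).
  by apply: val_inj; case: x {px} => -[|w [|? ?]] // i; rewrite (tnth_nth 0).
have := near_powR xi_inf (size rs)%:R e0; apply: filterS => s h.
by apply: fewer_image; have [h1 h2] := fewer_list rs; split => //; exact: le_trans h2 h.
Qed.

Lemma tps_nil e t : 0 < e -> tps e [::] t.
Proof.
by move=> e0; have := tps_alg1 e0 (acl_cst C0P t (subfield0 C0P)); exact: (@tps_map e [:: 0] t [::]).
Qed.

Lemma tps_alg e a t : 0 < e -> acl_incl a t -> tps e a t.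
Proof.
elim: a e => [|z a IH] e e0 at_; first exact: tps_nil.
have e3 : 0 < e / 3 by lra.
rewrite (_ : e = e / 3 + e / 3 + e / 3); last by field.
apply: (@tps_add [:: z] a) => //; first exact: ltW.
  apply: tps_alg1 => //; have := at_ z (mem_head _ _); apply: acl_sub => // w wt.
  by rewrite mem_cat wt orbT.
by apply: IH => // w wa; apply: at_; rewrite inE wa orbT.
Qed.

Lemma tps_acl b e x y t : 0 < e -> tps b x t -> acl_incl y (x ++ t) -> tps (b + e) y t.
Proof.
move=> e0 xb yx; apply: (@tps_catl _ _ x).
rewrite (_ : b + e = e / 2 + b + e / 2); last by field.
by apply: tps_add => //; [lra | lra | apply: tps_alg => //; lra].
Qed.

(* Every formula is met infinitely often, with bounds tending to [B]. *)
Lemma big_point_dec B n (F : nat -> nat -> set (n.-tuple C)) t :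
  (forall j x, ultraprod (F j.+1) x -> @ultraprod R U n (F j) x) ->
  (forall j b, b < B -> ~ small b (@ultraprod R U n (F j))) ->
  exists x : n.-tuple K, (forall j, ultraprod (F j) x) /\ forall c, c < B -> ~ tps c x t.
Proof.
move=> Fdec FN; have [code codeI] := C0_code C0count.
have [en enP] := @formula_enum L C0 code codeI.
pose c (j : nat) : R := B - j.+1%:R^-1.
have cle i j : (i <= j)%N -> c i <= c j.
  by move=> ij; rewrite lerD2l lerN2 lef_pV2 ?posrE ?ltr0n // ler_nat.
have cB j : c j < B by rewrite ltrBlDr ltrDl invr_gt0 ltr0n.
(* The 2-adic valuation takes each value infinitely often, so each formula is also treated at
   indices where [c j] is close to [B]. *)
pose Z j := [set y : n.-tuple K | holds S (nth 0 (y ++ t)) (en (logn 2 j))].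
have /choice[A AP] j : exists A, smallF U xi (c j) A /\ (small (c j) (Z j) -> Z j `<=` @ultraprod R U n A).
  have [[A ZA As]|h] := pselect (small (c j) (Z j)); first by exists A.
  exists (fun=> set0); split => //.
  by apply: nearW => s; split => //; rewrite fset_set0 cardfs0 powR_ge0.
have [l|x xP] := @saturation R U n (fun j s => F j s `&` ~` A j s).
  have /existsNP[x /not_implyP[Fx nA]] : ~ (ultraprod (F l) `<=`
      [set x : n.-tuple K | exists2 j, (j <= l)%N & ultraprod (A (minn j l)) x]).
    move=> h; apply: (FN l (c l.+1) (cB _)); apply: small_sub h _.
    apply: (@small_bigU _ _ _ xi_inf (c l)) => [|j].
      by rewrite ltrD2l ltrN2 ltf_pV2 ?posrE ?ltr0n // ltr_nat.
    exists (A (minn j l)) => //; have [h _] := AP (minn j l).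
    apply: filterS2 h (near_xi1 xi_inf) => s h1 h2; apply: fewer_sub h1 => //.
    by apply: ler_powR; [exact: ltW | apply: cle; exact: geq_minr].
  exists x => j jl; rewrite -ultraprodI; split; last first.
    by apply/ultraprodC => Ax; apply: nA; exists j; rewrite ?(minn_idPl jl).
  have : ultraprod (F (l - (l - j))%N) x.
    elim: (l - j)%N => [|i IH]; first by rewrite subn0.
    case: (ltnP i l) => il; last by rewrite (_ : _ - i.+1 = l - i)%N //; lia.
    by apply: Fdec; rewrite subnSK.
  by rewrite subKn.
exists x; split=> [j|b bB /(tpsE b x t)[P [[phi hp] Px Psm]]].
  by have := xP j; rewrite -ultraprodI => -[].
have [j jE] := enP phi.
have [l [lj bl]] : exists l, logn 2 l = j /\ b <= c l.
  have [m mb] : exists m : nat, (B - b)^-1 < m%:R.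
    by exists (Num.truncn (B - b)^-1).+1; exact: truncnS_gt.
  exists (2 ^ j * m.*2.+1)%N; split.
    by rewrite mulnC logn_Gauss ?pfactorK // coprime2n /= odd_double.
  have Bb : 0 < B - b by rewrite subr_gt0.
  have m0 : 0 < m%:R :> R by apply: lt_trans mb; rewrite invr_gt0.
  rewrite lerBrDr addrC -lerBrDr; apply: le_trans (_ : m%:R^-1 <= _).
    rewrite lef_pV2 ?posrE // ler_nat; apply: leqW.
    apply: (@leq_trans m.*2.+1); first by apply: leqW; rewrite -addnn leq_addr.
    by rewrite leq_pmull // expn_gt0.
  by rewrite -[leRHS]invrK lef_pV2 ?posrE ?invr_gt0 //; exact: ltW.
have ZE : Z l = [set y : n.-tuple K | P (y ++ t)].
  by rewrite /Z lj jE; apply/seteqP; split => y /=; rewrite hp.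
have := xP l; rewrite -ultraprodI => -[_ /ultraprodC]; apply.
have [_ h] := AP l; apply: h; rewrite ZE //.
exact: small_le bl Psm.
Qed.

Lemma big_point b c n (F : nat -> set (n.-tuple C)) t : c < b ->
  ~ small b (@ultraprod R U n F) ->
  exists2 x : n.-tuple K, ultraprod F x & ~ tps c x t.
Proof.
move=> cb FN; have [||x [Fx xt]] := @big_point_dec b n (fun=> F) t => //.
  by move=> _ b' b'b h; apply: FN; exact: small_le (ltW b'b) h.
by exists x; [exact: (Fx 0%N) | exact: xt].
Qed.

End TypeSize.

(** * Dimension and transcendence degree *)

Section PolynomialExpressions.
Variables (K : fieldType) (C0 : set K).
Hypothesis C0P : is_subfield C0.
Local Notation pexp := (pexp C0).

Lemma size_upoly (p : pexp) : exists n, forall s, (size (upoly s p) <= n)%N.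
Proof.
elim: p => [[|k]|c|p [n hp] q [m hq]|p [n hp] q [m hq]].
- by exists 2%N => s; rewrite /= size_polyX.
- by exists 1%N => s; exact: size_polyC_leq1.
- by exists 1%N => s; exact: size_polyC_leq1.
- exists (maxn n m) => s; apply: leq_trans (size_polyD _ _) _.
  by rewrite geq_max !leq_max hp hq orbT.
- exists (n + m)%N => s; apply: leq_trans (size_polyMleq _ _) _.
  by apply: leq_trans (leq_pred _) _; exact: leq_add.
Qed.

Lemma homogenize (f q : pexp) (P : nat -> pexp) : exists D (H : pexp), forall e u : seq K, pev e q != 0 ->
  (forall k, u`_k = pev e (P k) / pev e q) -> pev e H = pev e q ^+ D * pev u f.
Proof.
elim: f => [k|c|f [D [H h]] g [D' [H' h']]|f [D [H h]] g [D' [H' h']]].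
- by exists 1%N, (P k) => e u q0 uE; rewrite /= uE expr1 mulrC divfK.
- by exists 0%N, (PC c) => e u q0 _; rewrite expr0 mul1r.
- exists (D + D')%N, (PA (PM H (pexn C0P q D')) (PM H' (pexn C0P q D))) => e u q0 uE.
  by rewrite /= !pev_exn (h e u) // (h' e u) // exprD; ring.
- exists (D + D')%N, (PM H H') => e u q0 uE.
  by rewrite /= (h e u) // (h' e u) // exprD; ring.
Qed.

End PolynomialExpressions.

Section AbsoluteClosed.
Variables (K : fieldType) (C0 : set K).
Hypothesis C0P : is_subfield C0.
Variables (T : Type) (V : atlas K T).
Hypothesis VP : is_variety C0 V.

Lemma subfieldT : is_subfield (@setT K).
Proof. by split=> // *; exact: mem_set. Qed.

Lemma mpoly_overT m (p : {mpoly K[m]}) : mpoly_over setT p.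
Proof. by []. Qed.

Local Notation pexpT := (pexp (@setT K)).

Lemma closed_outside (i : chart V) : closed_over setT V (pts V `\` dom i).
Proof.
split=> [x []//|j].
pose S : set {mpoly K[adim V]} := [set q | forall y, dom j y -> q.@[tnth (coords j y)] != 0 -> dom i y].
exists (zeros S); first by exists S; split => // p _ ; exact: mpoly_overT.
move=> x jx; split=> [[_ nix] q Sq|xS].
  by apply/eqP; apply: contraT => q0; case: nix; exact: Sq jx q0.
split; first by exists j.
move=> ix; have [_ _ [_ tr] _] := VP; have [q [P [_ _ q0 H]]] := tr j i x jx ix.
by move: q0; rewrite xS ?eqxx // => y jy qy; case: (H y jy qy).
Qed.

(** In another chart [j] the set is cut out by all polynomials that vanish on it. That these suffice
    is seen from [f] rewritten in the coordinates of [j], cleared of denominators and multiplied by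
    one more [q], which makes it vanish also where the transition formula is undefined. *)
Lemma closed_zero (i : chart V) (f : pexpT) :
  closed_over setT V [set x | pts V x /\ (dom i x -> pev (coords i x) f = 0)].
Proof.
split=> [x []//|j].
pose Z x := dom i x -> pev (coords i x) f = 0.
pose S : set {mpoly K[adim V]} := [set F | forall y, dom j y -> Z y -> F.@[tnth (coords j y)] = 0].
exists (zeros S); first by exists S; split => // p _ ; exact: mpoly_overT.
move=> x jx; split=> [[_ zx] F SF|xS]; first exact: SF.
split=> [|ix]; first by exists j.
have [_ _ [_ tr] _] := VP; have [q [P [_ _ q0 H]]] := tr j i x jx ix.
have [q' q'E] := mpoly_pexp subfieldT (mpoly_overT q).
have /choice[P' P'E] (k : 'I_(adim V)) := mpoly_pexp subfieldT (mpoly_overT (tnth P k)).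
pose Pn k := if insub k is Some k' then P' k' else P0 subfieldT.
have [D [h hE]] := homogenize subfieldT f q' Pn.
have uE y : dom j y -> q.@[tnth (coords j y)] != 0 -> forall k,
    (coords i y)`_k = pev (coords j y) (Pn k) / pev (coords j y) q'.
  move=> jy qy k; rewrite /Pn; case: insubP => [k' _ <-|]; last first.
    by rewrite -leqNgt => km; rewrite nth_default ?size_tuple // pev0 mul0r.
  by rewrite -q'E -P'E; have [_ /(_ k')] := H y jy qy; rewrite (tnth_nth 0).
have [F _ FE] := pexp_mpoly subfieldT (adim V) (PM q' h).
have : S F.
  move=> y jy Zy; rewrite FE /=; have [->|qy] := eqVneq (pev (coords j y) q') 0; first by rewrite mul0r.
  have qy' : q.@[tnth (coords j y)] != 0 by rewrite q'E.
  by rewrite (hE _ (coords i y)) // ?Zy ?mulr0 //; [case: (H y jy qy') | exact: uE].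
move=> /xS; rewrite FE /= => /eqP; rewrite mulf_eq0 -q'E (negPf q0) /=.
rewrite (hE _ (coords i x)); [|by rewrite -q'E|exact: uE].
by rewrite mulf_eq0 expf_eq0 -q'E (negPf q0) andbF /= => /eqP.
Qed.

End AbsoluteClosed.

Section Chain.
Variables (R : realType) (U : nonprincipal_ultrafilter) (C0 : set (ultrapower R U)).
Local Notation K := (ultrapower R U).
Local Notation C := (R[i]).
Hypothesis C0P : is_subfield C0.
Hypothesis C0count : countable C0.
Variables (T : Type) (V : atlas K T).
Hypothesis VP : is_variety C0 V.
Local Notation pexpT := (pexp (@setT K)).
Local Notation acl := (@acl K C0).
Local Notation acl_incl := (@acl_incl K C0).
Local Notation rk := (@rk K C0).

Let KP := subfieldT K.
Let char0 := @ultrapower_char0 R U.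

Fixpoint consts (p : pexpT) : seq K :=
  match p with
  | PV _ => [::]
  | PC c => [:: set_val c]
  | PA a b => consts a ++ consts b
  | PM a b => consts a ++ consts b
  end.

Lemma acl_consts (p : pexpT) c t : {subset consts p <= t} -> acl (c ++ t) (pev c p).
Proof.
elim: p => /= [k|a|a IHa b IHb|a IHa b IHb] h.
- case: (ltnP k (size c)) => kc; first by apply: acl_mem => //; rewrite mem_cat mem_nth.
  by rewrite nth_default //; apply: acl_cst => //; exact: subfield0.
- by apply: acl_mem => //; rewrite mem_cat h ?orbT // mem_head.
- by apply: aclD => //; [apply: IHa|apply: IHb] => z zz; apply: h; rewrite mem_cat zz ?orbT.
- by apply: aclM => //; [apply: IHa|apply: IHb] => z zz; apply: h; rewrite mem_cat zz ?orbT.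
Qed.

(** Reads the variables from [n] on as the constants [tau], passing from expressions over [C0] with
    parameters to expressions over [K], where the members of the chain are irreducible. *)
Definition absolute (n : nat) (tau : seq K) : pexp C0 -> pexpT :=
  fix ab p := match p with
  | PV k => if (k < n)%N then PV _ k else pcst (I : setT (tau`_(k - n) : K))
  | PC c => pcst (I : setT (set_val c : K))
  | PA a b => PA (ab a) (ab b)
  | PM a b => PM (ab a) (ab b)
  end.

Lemma pev_absolute n tau p y : size y = n -> pev y (absolute n tau p) = pev (y ++ tau) p.
Proof.
move=> sy; elim: p => //= [k|a -> b -> //|a -> b -> //].
by rewrite nth_cat sy; case: ltnP.
Qed.

Variables (i : chart V) (e : nat) (Z : nat -> set T) (g : nat -> pexpT).
Hypothesis Zirr : forall k, (k <= e)%N -> irreducible V (Z k).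
Hypothesis ZV : forall k, (k <= e)%N -> Z k `<=` pts V.
Hypothesis Zsub : forall k, (k < e)%N -> Z k `<=` Z k.+1.
Hypothesis Z0 : exists2 x, Z 0%N x & dom i x.
Hypothesis g0 : forall k x, (k < e)%N -> Z k x -> dom i x -> pev (coords i x) (g k) = 0.
Hypothesis gN : forall k, (k < e)%N -> exists x, [/\ Z k.+1 x, dom i x & pev (coords i x) (g k) != 0].

Fixpoint gvals j (c : seq K) : seq K :=
  if j is j'.+1 then pev c (g j') :: gvals j' c else [::].

Fixpoint gexps j : seq pexpT := if j is j'.+1 then g j' :: gexps j' else [::].

Lemma size_gvals j c : size (gvals j c) = j. Proof. by elim: j => //= j ->. Qed.

Lemma pev_gvals j c p : pev c (psub (nth (P0 KP) (gexps j)) p) = pev (gvals j c) p.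
Proof. by apply: pev_psub => k; elim: j k => [|j IH] [|k] //=; rewrite ?nth_nil. Qed.

Lemma irreducible_mul k (a b : pexpT) : (k <= e)%N ->
  (forall x, Z k x -> dom i x -> pev (coords i x) (PM a b) = 0) ->
  (forall x, Z k x -> dom i x -> pev (coords i x) a = 0) \/
  (forall x, Z k x -> dom i x -> pev (coords i x) b = 0).
Proof.
move=> ke ab; have [_ irr] := Zirr ke.
have [x zx|h|h] := irr _ _ (closed_zero VP i a) (closed_zero VP i b).
- have [ix|nix] := pselect (dom i x); last by left; split=> [|/nix//]; exact: ZV zx.
  have /eqP := ab x zx ix; rewrite /= mulf_eq0 => /orP[]/eqP h; [left|right]; split => //; exact: ZV zx.
- by left => x zx; case: (h x zx) => _; exact.
- by right => x zx; case: (h x zx) => _; exact.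
Qed.

(* Restricting to the smaller member of the chain kills the last g, hence the
   lowest coefficient of a relation is itself a relation. *)
Lemma gvals_independent j (Q : pexpT) : (j <= e)%N ->
  (forall x, Z j x -> dom i x -> pev (gvals j (coords i x)) Q = 0) ->
  forall y, size y = j -> pev y Q = 0.
Proof.
elim: j Q => [|j IH] Q je QZ y sy.
  by have [x zx ix] := Z0; rewrite (size0nil sy); exact: (QZ x zx ix).
apply/eqP; apply: contraT => Qy.
pose N l := `[< exists2 y', size y' = j & pev y' (pcoef KP Q l) != 0 >].
have exN : exists l, N l.
  case: y sy Qy => [//|z y' [sy'] Qy]; exists (size (upoly y' Q)).-1; apply/asboolP.
  exists y' => //; rewrite -coef_upoly -lead_coefE lead_coef_eq0.
  by apply: contraNneq Qy => E; rewrite -horner_upoly E horner0.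
case: (ex_minnP exN) => m /asboolP[y' sy' my'] mmin.
have [n nP] := size_upoly Q.
pose F := pofseq KP [seq pcoef KP Q (m + l)%N | l <- iota 0 n].
have coefF u l : size u = j -> (upoly u F)`_l = (upoly u Q)`_(m + l).
  move=> su; rewrite coef_pofseq; case: (ltnP l n) => ln.
    by rewrite (nth_map 0%N) ?size_iota // nth_iota // add0n -coef_upoly.
  rewrite !nth_default ?size_map ?size_iota ?pev0 //.
  by apply: leq_trans (nP u) _; apply: leq_trans ln _; exact: leq_addl.
have QF u : size u = j -> upoly u Q = 'X^m * upoly u F.
  move=> su; apply/polyP => l; rewrite coefXnM; case: ltnP => lm; last by rewrite coefF // subnKC.
  rewrite coef_upoly; apply/eqP; apply: contraT => h.
  by have := mmin l; rewrite leqNgt lm; apply; apply/asboolP; exists u.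
have := @irreducible_mul j.+1 (pexn KP (g j) m) (psub (nth (P0 KP) (gexps j.+1)) F) je.
case.
- move=> x zx ix; have := QZ x zx ix; rewrite -horner_upoly QF ?size_gvals //.
  by rewrite hornerM hornerXn horner_upoly -(pev_gvals j.+1) /= pev_exn.
- have [x [zx ix gx]] := gN je; move/(_ x zx ix); rewrite pev_exn => /eqP.
  by rewrite expf_eq0 (negPf gx) andbF.
move=> F0; have [] := negP my'; apply/eqP.
apply: (IH (pcoef KP Q m) (ltnW je)) => // x zx ix.
have := F0 x (Zsub je zx) ix; rewrite pev_gvals /= (g0 je) // -horner_upoly.
by rewrite horner_coef0 coefF ?size_gvals // addn0 coef_upoly.
Qed.

(** The values of the [e] functions [g k] satisfy no relation on the largest member of the chain,
    even with coefficients in [K]. Saturation gives a point of the chart where they satisfy none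
    over C0(tau), with [tau] the constants occurring in the [g k]. They are algebraic over the
    coordinates and [tau], so the coordinates have rank at least [e] over [tau], hence over [C0]. *)
Lemma chain_point : exists2 x, dom i x & (e <= rk [::] (coords i x))%N.
Proof.
pose tau := flatten [seq consts (g k) | k <- iota 0 e].
have [en enP] := @pexp_enum R U C0 C0P C0count; pose n := adim V.
pose val (p : pexp C0) := psub (nth (P0 KP) (gexps e)) (absolute e tau p).
have valE c p : pev c (val p) = pev (gvals e c ++ tau) p.
  by rewrite pev_gvals pev_absolute // size_gvals.
pose ZZ j := `[< forall x, dom i x -> pev (coords i x) (en j) = 0 >].
pose NN j := `[< exists x, [/\ Z e x, dom i x & pev (coords i x) (val (en j)) != 0] >].
pose F j s := [set y : n.-tuple C |
  (ZZ j -> pevC s y (en j) = 0) /\ (NN j -> pevC s y (val (en j)) <> 0)].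
have FE j (x : n.-tuple K) : ultraprod (F j) x <->
    (ZZ j -> pev x (en j) = 0) /\ (NN j -> pev x (val (en j)) <> 0).
  split.
    move=> h; split=> [Zj|Nj]; first by apply/pev_eq0_near; apply: filterS h => s [/(_ Zj)].
    by move/pev_eq0_near; apply: near_notE; apply: filterS h => s [_ /(_ Nj)].
  move=> [h h']; rewrite /ultraprod /= /F /=; apply: near_and.
    have [Zj|nZ] := boolP (ZZ j); last by apply: nearW.
    by have /pev_eq0_near := h Zj; apply: filterS.
  have [Nj|nN] := boolP (NN j); last by apply: nearW.
  have h2 : ~ (\forall s \near ufilter U, pevC s (slq s x) (val (en j)) = 0).
    by move/pev_eq0_near; exact: h' Nj.
  by move: h2 => /near_not; apply: filterS => s.
have [l|c cF] := @saturation R U n F.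
  have [x zx [ix xN]] : exists2 x, Z e x & dom i x /\ pev (coords i x) (pprod KP [seq val (en j) | j <- iota 0 l.+1 & NN j]) != 0.
    elim: (iota 0 l.+1) => [|j js [x zx [ix xN]]].
      have [x zx ix] := Z0; exists x; last by rewrite /= oner_neq0.
      have : (e <= e)%N by []; elim: {-2}e => // k IH ke; apply: (Zsub ke); exact: IH (ltnW ke).
    rewrite /=; case: ifP => [/asboolP[x' [zx' ix' x'N]]|_]; last by exists x.
    apply: contrapT => h; have [] := @irreducible_mul e (val (en j)) (pprod KP [seq val (en j) | j <- js & NN j]) (leqnn e).
    - move=> y zy iy; apply/eqP; apply: contraT => yN; case: h; exists y => //.
    - by move/(_ x' zx' ix')/eqP; rewrite (negPf x'N).
    - by move/(_ x zx ix)/eqP; rewrite (negPf xN).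
  exists (coords i x) => j jl; apply/FE; split=> [/asboolP|Nj]; first exact.
  move: xN; rewrite pev_prod big_map prodf_seq_neq0 => /allP /(_ j).
  by rewrite mem_filter Nj mem_iota => /(_ jl)/eqP.
have [x ix xc] : (coords i @` dom i) c.
  have [_ ca _ _] := VP; have [S [SC SE]] := ca i.
  rewrite SE => p Sp; have [q qE] := mpoly_pexp C0P (SC _ Sp).
  have [j jq] := enP q; have [h _] := (FE j c).1 (cF j).
  rewrite qE -jq; apply: h; apply/asboolP => x ix; rewrite jq -qE.
  by have : (coords i @` dom i) (coords i x) by [exists x]; rewrite SE => /(_ p Sp).
have cN (p : pexp C0) : (exists2 y, size y = e & pev (y ++ tau) p != 0) -> pev (gvals e c ++ tau) p != 0.
  move=> [y sy yp]; have [j jp] := enP p; have [_ h] := (FE j c).1 (cF j).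
  rewrite -valE -jp; apply/eqP/h; apply/asboolP; rewrite jp.
  apply: contrapT => hN; move: yp; rewrite -(@pev_absolute e) // => /negP; apply; apply/eqP.
  apply: (gvals_independent (leqnn e)) sy => w zw iw; rewrite -pev_gvals -/(val p).
  by apply/eqP; apply: contraT => wN; case: hN; exists w.
exists x => //; rewrite xc.
apply: (@leq_trans (rk tau (gvals e c))); last first.
  apply: leq_trans (rk_base C0P _ (_ : acl_incl [::] tau)); last by [].
  apply: (rk_le C0P char0) => z.
  have sub k : (k <= e)%N -> {subset gvals k c <= acl (c ++ tau)}.
    elim: k => // k IH ke w; rewrite inE => /predU1P[->|/(IH (ltnW ke))//].
    apply: mem_set; apply: acl_consts => u uc; apply/flattenP; exists (consts (g k)) => //.
    by apply: map_f; rewrite mem_iota.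
  by move/(sub e (leqnn e))/set_mem.
rewrite leqNgt; apply/negP => lt; have := @rk_lt_dep K C0 tau (gvals e c).
rewrite size_gvals => /(_ lt)[k ke [p [p0 pz]]].
pose y := gvals e c; rewrite -/y in p0 pz; have sy : size y = e by exact: size_gvals.
pose ix' k' := if k' is k1.+1 then (if (k1 < k)%N then (k - k1.+1)%N else (e + (k1 - k))%N) else k.
pose p' := psub (fun k => PV C0 (ix' k)) p.
have p'E (w : seq K) : size w = e -> pev (w ++ tau) p' = pev (w`_k :: catrev (take k w) tau) p.
  move=> sw; apply: pev_psub => -[|k1] /=; first by rewrite nth_cat sw ke.
  rewrite catrevE [in RHS]nth_cat size_rev size_take sw ke.
  case: ltnP => k1k; last by rewrite nth_cat sw ltnNge leq_addr /= addKn.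
  rewrite nth_rev size_take sw ke //.
  have h : (k - k1.+1 < k)%N by rewrite ltn_subrL (leq_ltn_trans _ k1k).
  by rewrite nth_cat sw (ltn_trans h ke) nth_take.
have /negP[] : pev (y ++ tau) p' != 0; last by rewrite p'E // pz.
apply: cN; have [z zN] : exists z, (upoly (catrev (take k y) tau) p).[z] != 0.
  apply: contrapT => h; have /negP := p0; apply; apply/eqP; apply: (poly_infinite_roots char0) => m.
  by apply/rootP/eqP; apply: contraT => hm; case: h; exists m%:R.
exists (set_nth 0 y k z); first by rewrite size_set_nth sy; apply/maxn_idPr.
rewrite p'E; last by rewrite size_set_nth sy; apply/maxn_idPr.
rewrite nth_set_nth /= eqxx -horner_upoly (_ : take k (set_nth 0 y k z) = take k y) //.
apply: (@eq_from_nth _ 0).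
  by rewrite !size_take size_set_nth sy (maxn_idPr ke).
move=> l; rewrite size_take size_set_nth sy (maxn_idPr ke) ke => lk.
by rewrite !nth_take // nth_set_nth /= (ltn_eqF lk).
Qed.

End Chain.

Section Dimension.
Variables (R : realType) (U : nonprincipal_ultrafilter) (C0 : set (ultrapower R U)).
Local Notation K := (ultrapower R U).
Hypothesis C0P : is_subfield C0.
Hypothesis C0count : countable C0.
Variables (T : Type) (V : atlas K T).
Hypothesis VP : is_variety C0 V.

(** Links Krull dimension, defined by closed sets over [K], to rank over [C0]: in one chart around a
    point of the smallest member of a chain, each strict inclusion yields a function vanishing on
    the smaller set and not on the larger one. *)
Lemma variety_dim_le d : (forall (i : chart V) x, dom i x -> (rk C0 [::] (coords i x) <= d)%N) ->
  (variety_dim R V <= (d%:R)%:E)%E.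
Proof.
move=> rd; apply: ge_ereal_sup => _ [e [Z [Zci Zlt]] <-]; rewrite lee_fin ler_nat.
have Zirr k : (k <= e)%N -> irreducible V (Z k) by move=> ke; case: (Zci k ke).
have ZV k : (k <= e)%N -> Z k `<=` pts V by move=> ke; case: (Zci k ke) => -[].
have Zsub k : (k < e)%N -> Z k `<=` Z k.+1 by move=> ke; case: (Zlt k ke).
have [[x0 z0] _] := Zirr 0%N (leq0n e); have [i _ ix0] := ZV 0%N (leq0n e) x0 z0.
have Z0 k : (k <= e)%N -> Z k x0 by elim: k => // k IH ke; apply: (Zsub k ke); exact: IH (ltnW ke).
have /choice[g gP] k : exists g : pexp (@setT K), (k < e)%N ->
    (forall x, Z k x -> dom i x -> pev (coords i x) g = 0) /\
    exists x, [/\ Z k.+1 x, dom i x & pev (coords i x) g != 0].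
  have [ke|ke] := ltnP k e; last by exists (P0 (subfieldT K)).
  have [zc _] := Zci k (ltnW ke); have [_ irr] := Zirr _ ke.
  (* Otherwise [Z k.+1] would be covered by [Z k] and the closed complement of the chart, against
     irreducibility: it is not inside [Z k], and it meets the chart at [x0]. *)
  have [x [zx nzx ix]] : exists x, [/\ Z k.+1 x, ~ Z k x & dom i x].
    apply: contrapT => h; have [|h'|h'] := irr _ _ zc (closed_outside VP i).
    - move=> x zx; have [?|nz] := pselect (Z k x); [by left | right; split; first exact: ZV zx].
      by move=> ix; apply: h; exists x.
    - by case: (Zlt k ke) => _; apply.
    - by case: (h' x0 (Z0 _ ke)).
  have [_ /(_ i)[A [S [_ ->]] SE]] := zc.
  have [p [Sp px]] : exists p, S p /\ p.@[tnth (coords i x)] != 0.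
    apply: contrapT => h; apply: nzx; apply/(SE x ix) => p Sp.
    by apply/eqP; apply: contraT => px; case: h; exists p.
  have [q qE] := mpoly_pexp (subfieldT K) (mpoly_overT p).
  exists q => _; split=> [y zy iy|]; last by exists x; rewrite -qE.
  by rewrite -qE; have /(SE y iy) := zy; exact.
have [||x ix] := @chain_point R U C0 C0P C0count T V VP i e Z g Zirr ZV Zsub (ex_intro2 _ _ x0 z0 ix0).
- by move=> k x ke; case: (gP k ke) => + _; exact.
- by move=> k ke; case: (gP k ke).
by move/leq_trans; apply; exact: rd.
Qed.

End Dimension.

(** * Types in Gamma and X *)

Section Steps.
Variables (R : realType) (U : nonprincipal_ultrafilter) (C0 : set (ultrapower R U)).
Variables (L : language) (Ks : nat -> fo_structure L C0 R[i]) (xi : nat -> R).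
Local Notation K := (ultrapower R U).
Local Notation C := (R[i]).
Local Notation S := (ultraproduct U Ks).
Hypothesis C0P : is_subfield C0.
Hypothesis C0cl : alg_closed_in C0.
Hypothesis C0count : countable C0.
Hypothesis S_cst : forall c : C0, scst S c = set_val c.
Hypothesis xi_inf : forall r : R, \forall s \near ufilter U, r < xi s.
Hypothesis delta_cont : delta_continuous S xi.
Variables (N : nat) (G : group_data K (N.-tuple K)).
Hypothesis GP : is_comm_alg_group C0 G.
Hypothesis Gemb : constructibly_embedded C0 G.
Local Notation T := (N.-tuple K).
Local Notation tps := (tps Ks xi).
Local Notation fdefs := (fdefs Ks).
Local Notation small := (small xi).
Local Notation rk := (@rk K C0).
Local Notation gsp := (@gsp K C0 T G _).

Let char0 := @ultrapower_char0 R U.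
Let VP : is_variety C0 G. Proof. by case: GP. Qed.
Let KP := subfieldT K.

Lemma chart_def (i : chart G) : exists2 P, fdefs P & forall (y : T) (c : (adim G).-tuple K) r,
  P (y ++ c ++ r) <-> dom i y /\ coords i y = c.
Proof.
have [s [sC sE]] := Gemb i.
have /choice[q qP] (p : {mpoly K[N + adim G]}) : exists q : pexp C0, mpoly_over C0 p ->
    forall y : (N + adim G).-tuple K, p.@[tnth y] = pev y q.
  have [/mpoly_pexp[//|q qE]|nC] := pselect (mpoly_over C0 p); first by exists q.
  by exists (P0 C0P) => /nC.
exists (fun e => exists2 c, c \in s & (forall p, p \in c.1 -> pev (take (N + adim G) e) (q p) = 0) /\
    ~ pev (take (N + adim G) e) (q c.2) = 0).
  apply: fdefs_has => c _; apply: fdefs_and.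
    by apply: fdefs_all => p _; exact: (fdefs_take _ (fdefs_pev S_cst (q p))).
  by apply: fdefs_not; exact: (fdefs_take _ (fdefs_pev S_cst (q c.2))).
move=> y c r; pose z := [tuple of y ++ c].
have -> : take (N + adim G) (y ++ c ++ r) = tval z by rewrite catA take_size_cat // size_tuple.
have [ci _ _ _] := VP.
split=> [[c' cs [h1 h2]]|[iy yc]].
  have : [set z | exists c, [/\ c \in s, {in c.1, forall p, p.@[tnth z] = 0} & c.2.@[tnth z] != 0]] z.
    exists c'; have [C1 C2] := sC c' cs; split => //.
      by move=> p pc; rewrite (qP p (C1 p pc)) h1.
    by rewrite (qP _ C2); apply/eqP.
  rewrite -sE => -[x ix /(congr1 val) /= /eqP]; rewrite eqseq_cat ?size_tuple //.
  by move=> /andP[/eqP/val_inj <- /eqP/val_inj <-].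
have : [set [tuple of x ++ coords i x] | x in dom i] z.
  by exists y => //; apply: val_inj; rewrite /= yc.
rewrite sE => -[c' [cs h1 h2]]; have [C1 C2] := sC c' cs; exists c' => //; split.
  by move=> p pc; rewrite -(qP p (C1 p pc)) h1.
by rewrite -(qP _ C2); apply/eqP.
Qed.

Lemma cs1 (i : chart G) (x : T) : cs (n := 1) [tuple i] [tuple x] = tval (coords i x).
Proof.
rewrite /cs (_ : enum 'I_1 = [:: ord0]); last by rewrite enum_ordSl (_ : enum 'I_0 = [::]) //; apply: size0nil; rewrite size_enum_ord.
by rewrite /= cats0 !(tnth_nth x) /= !(tnth_nth i).
Qed.

(** As cgp concerns subvarieties over [K], the parameters [t] are absorbed into the coefficients
    here. *)
Lemma gsp1_closed t (x : T) : closed_over setT G [set y | gsp t [tuple x] [tuple y]].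
Proof.
split.
  by move=> y /gsp_ptsn[_ /(_ ord0)]; rewrite (tnth_nth y).
move=> j; have dom1 (y : T) : dom j y -> dom (a := pow_atlas G 1) [tuple j] [tuple y].
  by move=> jy l; rewrite !(tnth_nth y) (tnth_nth j) ord1.
pose A : set {mpoly K[adim G]} := [set p | dom j x -> exists q : pexp C0,
  pev (coords j x ++ t) q = 0 /\ forall y : (adim G).-tuple K, p.@[tnth y] = pev (y ++ t) q].
exists (zeros A); first by exists A; split => // p _; exact: mpoly_overT.
move=> y jy; split=> [xy p Ap|yA].
  have [jx h] := gsp_chart C0P VP xy (dom1 y jy).
  have jx' : dom j x by have := jx ord0; rewrite !(tnth_nth x) (tnth_nth j).
  have [q [q0 ->]] := Ap jx'; rewrite !cs1 in h; exact: h.2.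
have jx : dom j x.
  apply: contrapT => njx; have : A 1 by move=> jx; case: njx.
  by move/yA => /eqP; rewrite meval1 oner_eq0.
apply: (sp_gsp C0P (dom1 x jx) (dom1 y jy)); rewrite !cs1; split.
  by rewrite !size_cat !size_tuple.
move=> q q0; have [p _ pE] := pexp_mpoly KP (adim G) (absolute (adim G) t q).
rewrite -(@pev_absolute _ _ _ (adim G)) ?size_tuple // -pE; apply: yA => _; exists q; split => // z.
by rewrite pE pev_absolute ?size_tuple.
Qed.

Variables (X : set T) (d : nat).
Hypothesis d0 : (0 < d)%N.
Hypothesis Xdef : definable S set0 X.
Hypothesis Xcgp : cgp_in xi G X.
Hypothesis Gfull : forall t, exists2 x, pts G x & (d <= rk t x)%N.

Lemma pt1 (x : T) : pt [tuple x] = tval x.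
Proof.
rewrite /pt (_ : enum 'I_1 = [:: ord0]); last by rewrite enum_ordSl (_ : enum 'I_0 = [::]) //; apply: size0nil; rewrite size_enum_ord.
by rewrite /= cats0 !(tnth_nth x).
Qed.

(** The locus of [x] over C0(t) is a proper closed subset, so it meets [X] in delta 0 by cgp. To
    pass to the type of [x], the formula of [sp_generic_formula], with the chart coordinates
    quantified away, defines over [t] a set that contains [x] and is inside this intersection. *)
Lemma proper_tps (x : T) t e : X x -> (exists2 y, pts G y & ~ gsp t [tuple x] [tuple y]) ->
  0 < e -> tps e x t.
Proof.
move=> Xx [y0 y0G y0N] e0; have [_ XG _ _ Xproper] := Xcgp.
have [i _ ix] := XG _ Xx.
have XW : small e (X `&` [set y | gsp t [tuple x] [tuple y]]).
  apply: delta_lt_small => //; rewrite Xproper ?lte_fin //; first exact: gsp1_closed.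
  by split; [case: (gsp1_closed t x) | move=> h; exact: y0N (h y0 y0G)].
have [gs [h [gs0 hx gsh]]] := sp_generic_formula C0P (coords i x ++ t).
have /definable0P[PX PXd XE] := Xdef.
have [Pi Pid PiE] := chart_def i.
pose m := adim G; pose idx := iota m N ++ iota 0 m.
pose Q0 (e' : seq K) := Pi [seq e'`_l | l <- idx] /\ ((forall l, l \in iota 0 (size gs) -> pev (take m e' ++ drop (m + N) e') (nth h gs l) = 0) /\
  ~ pev (take m e' ++ drop (m + N) e') h = 0).
pose Q (e : seq K) := PX (take N e) /\ exists2 c, size c = m & Q0 (c ++ e).
have QE (y : T) : Q (y ++ t) <-> X y /\ exists2 c : m.-tuple K, (dom i y /\ coords i y = c) &
    (forall l, l \in iota 0 (size gs) -> pev (c ++ t) (nth h gs l) = 0) /\ pev (c ++ t) h <> 0.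
  rewrite /Q /Q0 take_size_cat ?size_tuple // -XE.
  have E (c : m.-tuple K) : [seq (c ++ y ++ t)`_l | l <- idx] = y ++ c ++ [::] /\
      take m (c ++ y ++ t) ++ drop (m + N) (c ++ y ++ t) = c ++ t.
    split; last by rewrite take_size_cat ?size_tuple // catA drop_size_cat // size_cat !size_tuple.
    rewrite cats0 map_cat; congr (_ ++ _).
      rewrite -[RHS]take_size size_tuple -(map_nth_iota0 0) ?size_tuple // (_ : iota m N = [seq (m + l)%N | l <- iota 0 N]) -?map_comp; last by rewrite -iotaDl addn0.
      apply/eq_in_map => l; rewrite mem_iota add0n /= => lN.
      by rewrite nth_cat size_tuple ltnNge leq_addr /= addKn nth_cat size_tuple lN.
    by rewrite map_nth_iota0 ?size_cat ?size_tuple ?leq_addr // take_size_cat // size_tuple.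
  split=> -[Xy [c]].
    move=> /eqP sc; have := E (Tuple sc) => -[E1 E2] /= [+ [h1 h2]].
    by rewrite [map _ _]E1 PiE [_ ++ drop _ _]E2 in h1 h2 * => iy; split => //; exists (Tuple sc).
  move=> iyc [h1 h2]; split => //; exists c; first by rewrite size_tuple.
  by have [E1 E2] := E c; rewrite E1 E2 PiE.
apply/(tpsE Ks xi e x t); exists Q; split.
- apply: fdefs_and; first exact: fdefs_take.
  apply: (fdefs_exn m); apply: fdefs_and; first exact: fdefs_map.
  apply: fdefs_and; last by apply: fdefs_not; exact: (fdefs_cut m N (fdefs_pev S_cst h)).
  by apply: fdefs_all => l _; exact: (fdefs_cut m N (fdefs_pev S_cst (nth h gs l))).
- apply/QE; split => //; exists (coords i x) => //; split; last by apply/eqP.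
  by move=> l; rewrite mem_iota => lg; rewrite -(nth_map h 0) //; apply: gs0; rewrite mem_nth ?size_map.
apply: small_sub XW => y /QE[Xy [c [iy yc] [h1 h2]]]; split => //.
have dom1 (z : T) : dom i z -> dom (a := pow_atlas G 1) [tuple i] [tuple z].
  by move=> jy l; rewrite !(tnth_nth z) (tnth_nth i) ord1.
apply: (sp_gsp C0P (dom1 x ix) (dom1 y iy)); rewrite !cs1; apply: gsh.
- by rewrite !size_cat !size_tuple.
- move=> g0 /(nthP 0)[l]; rewrite size_map => lg <-.
  by rewrite (nth_map h) // yc h1 // mem_iota.
- by rewrite yc; apply/eqP.
Qed.

Lemma nongeneric_tps (x : T) t e : X x -> (rk t x < d)%N -> 0 < e -> tps e x t.
Proof.
move=> Xx rx; apply: proper_tps => //; have [y yG ry] := Gfull t; exists y => // h.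
by have := gsp_rk_le C0P GP Gemb h; rewrite !pt1 leqNgt (leq_trans rx ry).
Qed.

Variable Gamma : set T.
Hypothesis Gamma_def : bigwedge_definable S set0 Gamma.
Hypothesis Gamma_sub : Gamma `<=` X.

Lemma Gamma_enum : exists F : nat -> nat -> set (N.-tuple C),
  [/\ forall j (x : T), Gamma x -> ultraprod (F j) x, forall x : T, (forall j, ultraprod (F j) x) -> Gamma x,
    forall j (x : T), ultraprod (F j.+1) x -> ultraprod (F j) x &
    forall j, exists2 P, fdefs P & forall x : T, ultraprod (F j) x <-> X x /\ P x].
Proof.
have [D [Dd GE]] := Gamma_def; have /definable0P[PX PXd XE] := Xdef.
have /choice[Q QP] j : exists Q, fdefs Q /\ forall x, D j x <-> Q (tval x).
  by have /definable0P[Q] := Dd j; exists Q.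
pose H j e := PX e /\ forall l, l \in iota 0 j.+1 -> Q l e.
have Hd j : fdefs (H j).
  by apply: fdefs_and => //; apply: fdefs_all => l _; case: (QP l).
have /choice[Ps PsE] j := fdefs_intp (Hd j).
have FE j : [set x : T | H j (x ++ [::])] = ultraprod (fun s => [set y : N.-tuple C | Ps j s (y ++ slq s ([::] : seq K))]).
  by rewrite (intp_ultraprod (PsE j)).
exists (fun j s => [set y : N.-tuple C | Ps j s (y ++ slq s ([::] : seq K))]); split.
- move=> j x Gx; rewrite -FE /H /= cats0; split; first by apply/XE; exact: Gamma_sub.
  by move=> l _; have [_ <-] := QP l; move: Gx; rewrite GE => /(_ l); apply.
- move=> x h; rewrite GE => j _; have := h j; rewrite -FE /H /= cats0 => -[_ h'].
  have jj : j \in iota 0 j.+1 by rewrite mem_iota ltnS /=.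
  by have [_ ->] := QP j; exact: (h' j jj).
- move=> j x; rewrite -!FE /H /= !cats0 => -[h h']; split => // l lj.
  have lj' : l \in iota 0 j.+2 by move: lj; rewrite (mem_iota 0 j.+1 l) (mem_iota 0 j.+2 l) !add0n => h2; apply: leq_trans h2 _.
  exact: (h' l lj').
- move=> j; exists (fun e => forall l, l \in iota 0 j.+1 -> Q l e).
    by apply: fdefs_all => l _; case: (QP l).
  by move=> x; rewrite -FE /H /= cats0 -XE.
Qed.

(** Gamma has an internal superset [A] of exponent [d + e]. If none of the decreasing definable
    approximations of Gamma were inside [A], saturation would produce a point of Gamma outside
    [A]. *)
Lemma Gamma_cover e : 0 < e -> (delta xi Gamma <= (d%:R)%:E)%E -> exists Xm : set T,
  [/\ definable S set0 Xm, Gamma `<=` Xm, Xm `<=` X & small (d%:R + e) Xm].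
Proof.
move=> e0 Gd; have [F [F1 F2 F3 F4]] := Gamma_enum.
have [A GA Asm] : small (d%:R + e) Gamma.
  by apply: delta_lt_small => //; apply: le_lt_trans Gd _; rewrite lte_fin ltrDl.
have [l lA] : exists l, @ultraprod R U N (F l) `<=` ultraprod A.
  apply: contrapT => h.
  have [l|x xP] := @saturation R U N (fun j s => F j s `&` ~` A s).
    have /existsNP[x /not_implyP[Fx nA]] : ~ (@ultraprod R U N (F l) `<=` ultraprod A).
      by move=> h'; apply: h; exists l.
    exists x => j jl; rewrite -ultraprodI; split; last exact/ultraprodC.
    have : ultraprod (F (l - (l - j))%N) x.
      elim: (l - j)%N => [|i IH]; first by rewrite subn0.
      case: (ltnP i l) => il; last by rewrite (_ : _ - i.+1 = l - i)%N //; lia.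
      by apply: F3; rewrite subnSK.
    by rewrite subKn.
  have xA : ~ ultraprod A x.
    by have := xP 0%N; rewrite -ultraprodI => -[_ /ultraprodC].
  apply: xA; apply: GA; apply: F2 => j.
  by have := xP j; rewrite -ultraprodI => -[].
have [P Pd PE] := F4 l; have /definable0P[PX PXd XE] := Xdef.
exists (ultraprod (F l)); split.
- apply/definable0P; exists (fun e => PX e /\ P e); first exact: fdefs_and.
  by move=> x; rewrite PE XE.
- by move=> x; exact: F1.
- by move=> x /PE[].
- by exists A.
Qed.

(** As [g] lies in every approximation of Gamma, none of them is small, and their intersection has a
    point that avoids the small sets over [t]. *)
Lemma Gamma_generic (g : T) t : Gamma g -> (forall c : R, c < d%:R -> ~ tps c g [::]) ->
  exists2 v : T, Gamma v & forall c : R, c < d%:R -> ~ tps c v t.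
Proof.
move=> Gg gN; have [F [F1 F2 F3 F4]] := Gamma_enum.
have [|x [xF xN]] := @big_point_dec R U C0 L Ks xi C0count xi_inf d%:R N F t F3.
  move=> j b bd h; apply: (gN b bd).
  have [P Pd PE] := F4 j; have /definable0P[PX PXd XE] := Xdef.
  apply/(tpsE Ks xi b g [::]); exists (fun e => PX e /\ P e); split.
  - exact: fdefs_and.
  - by rewrite cats0; have /PE[] := F1 j _ Gg; rewrite -XE.
  - by apply: small_sub h => y; rewrite /= cats0 => -[h1 h2]; apply/PE; rewrite XE.
by exists x; [exact: F2 | exact: xN].
Qed.

Variables (Xm : set T) (e : R).
Hypothesis Xm_def : definable S set0 Xm.
Hypothesis Xm_sub : Xm `<=` X.
Hypothesis e0 : 0 < e.
Hypothesis Xm_small : small (d%:R + e) Xm.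

Lemma Xm_tps (x : T) t : Xm x -> tps (d%:R + e) x t.
Proof.
move=> Xx; apply: (@tps_base _ _ _ _ _ _ _ _ [::]) => //.
have /definable0P[P Pd PE] := Xm_def.
apply/(tpsE Ks xi _ x [::]); exists P; split; rewrite ?cats0 //; first exact/PE.
by apply: small_sub Xm_small => y; rewrite /= cats0 -PE.
Qed.

Lemma steps (ps : seq T) t : (forall p, p \in ps -> Xm p) -> exists2 f : nat,
  (f * d <= rk t (flatten [seq tval p | p <- ps]))%N &
  forall eta, 0 < eta -> tps (f%:R * (d%:R + e) + eta) (flatten [seq tval p | p <- ps]) t.
Proof.
elim: ps => [|p ps IH] Xps.
  by exists 0%N => // eta eta0; rewrite mul0r add0r; exact: tps_nil.
have [|f fr fs] := IH; first by move=> q qps; apply: Xps; rewrite inE qps orbT.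
set b := flatten _ in fr fs; rewrite /= -/b.
have rE : rk t (p ++ b) = (rk t b + rk (b ++ t) p)%N by rewrite rk_catC // rk_cat.
have Xp : Xm p by apply: Xps; rewrite mem_head.
have [lt|ge] := ltnP (rk (b ++ t) p) d.
  exists f; first by rewrite rE (leq_trans fr) // leq_addr.
  move=> eta eta0; rewrite (_ : _ + eta = eta / 3 + (f%:R * (d%:R + e) + eta / 3) + eta / 3); last by field.
  apply: tps_add => //; [lra | lra | | by apply: fs; lra].
  by apply: nongeneric_tps => //; [exact: Xm_sub | lra].
exists f.+1; first by rewrite rE mulSn addnC leq_add.
move=> eta eta0; rewrite (_ : _ + eta = (d%:R + e) + (f%:R * (d%:R + e) + eta / 2) + eta / 2); last by rewrite -natr1; field.
apply: tps_add => //; [|lra|exact: Xm_tps|by apply: fs; lra].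
by rewrite addr_ge0 // ltW.
Qed.

(** The gap that makes the argument discrete: a size exceeding [j] steps requires one step more,
    hence [d] more in rank. *)
Lemma rk_of_not_tps (ps : seq T) t (j : nat) (b : R) : (forall p, p \in ps -> Xm p) ->
  j%:R * (d%:R + e) < b -> ~ tps b (flatten [seq tval p | p <- ps]) t ->
  (j.+1 * d <= rk t (flatten [seq tval p | p <- ps]))%N.
Proof.
move=> Xps jb bN; have [f fr fs] := steps t Xps.
apply: leq_trans fr; apply: leq_mul => //; rewrite ltnNge.
apply/negP => fj; apply: bN.
have h : f%:R * (d%:R + e) < b.
  by apply: le_lt_trans jb; apply: ler_wpM2r; [rewrite addr_ge0 // ltW | rewrite ler_nat].
have h2 : 0 < b - f%:R * (d%:R + e) by rewrite subr_gt0.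
by have := fs _ h2; rewrite [_ + (b - _)]addrC subrK.
Qed.

End Steps.

(** * The incidence bound in the ultraproduct *)

Section Separated.
Variables (R : realType) (U : nonprincipal_ultrafilter) (C0 : set (ultrapower R U)).
Local Notation C := (R[i]).
Local Notation pexp := (pexp C0).
Variable M : nat.

(* Sums of products of a function of the first M coordinates and a function of
   the others, with a number of terms independent of s. *)
Definition separated (f : nat -> seq C -> seq C -> R) :=
  exists (n : nat) (l : nat -> seq ((seq C -> R) * (seq C -> R))), (forall s, size (l s) = n) /\
    forall s y z, size y = M -> f s y z = \sum_(ab <- l s) ab.1 y * ab.2 z.

Lemma separated_l (a : nat -> seq C -> R) : separated (fun s y z => a s y).
Proof.
by exists 1%N, (fun s => [:: (a s, fun=> 1)]); split => // s y z _; rewrite big_seq1 mulr1.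
Qed.

Lemma separated_r (a : nat -> seq C -> R) : separated (fun s y z => a s z).
Proof.
by exists 1%N, (fun s => [:: (fun=> 1, a s)]); split => // s y z _; rewrite big_seq1 mul1r.
Qed.

Lemma separated_ext f g : (forall s y z, size y = M -> g s y z = f s y z) -> separated f -> separated g.
Proof. by move=> gf [n [l [ln fl]]]; exists n, l; split => // s y z sy; rewrite gf // fl. Qed.

Lemma separatedD f g : separated f -> separated g -> separated (fun s y z => f s y z + g s y z).
Proof.
move=> [n [l [ln fl]]] [m [k [km gk]]]; exists (n + m)%N, (fun s => l s ++ k s).
by split=> [s|s y z sy]; [rewrite size_cat ln km | rewrite big_cat fl // gk].
Qed.

Lemma separatedM f g : separated f -> separated g -> separated (fun s y z => f s y z * g s y z).
Proof.
move=> [n [l [ln fl]]] [m [k [km gk]]].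
exists (n * m)%N, (fun s => [seq ((fun y => a.1 y * b.1 y), (fun z => a.2 z * b.2 z)) | a <- l s, b <- k s]).
split=> [s|s y z sy]; first by rewrite size_allpairs ln km.
rewrite fl // gk // big_allpairs_dep big_distrl; apply: eq_bigr => a _.
by rewrite big_distrr; apply: eq_bigr => b _ /=; ring.
Qed.

Lemma separatedN f : separated f -> separated (fun s y z => - f s y z).
Proof.
move=> fS; apply: separated_ext (separatedM (separated_l (fun _ _ => -1)) fS) => s y z _.
by rewrite mulN1r.
Qed.

Lemma separated_pevC (p : pexp) :
  separated (fun s y z => complex.Re (pevC s (y ++ z) p)) /\
  separated (fun s y z => complex.Im (pevC s (y ++ z) p)).
Proof.
elim: p => [k|c|a [ar ai] b [br bi]|a [ar ai] b [br bi]].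
- have [kM|kM] := ltnP k M.
    split; [apply: (separated_ext _ (separated_l (fun s y => complex.Re y`_k)))|
            apply: (separated_ext _ (separated_l (fun s y => complex.Im y`_k)))];
    by move=> s y z sy; rewrite /= nth_cat sy kM.
  split; [apply: (separated_ext _ (separated_r (fun s z => complex.Re z`_(k - M))))|
          apply: (separated_ext _ (separated_r (fun s z => complex.Im z`_(k - M))))];
  by move=> s y z sy; rewrite /= nth_cat sy ltnNge kM.
- by split; [exact: (separated_l (fun s _ => complex.Re (rep (set_val c) s)))|
             exact: (separated_l (fun s _ => complex.Im (rep (set_val c) s)))].
- split; [apply: (separated_ext _ (separatedD ar br))|apply: (separated_ext _ (separatedD ai bi))];
  by move=> s y z _ /=; case: (pevC s _ a) => ? ?; case: (pevC s _ b).
- split; [apply: (separated_ext _ (separatedD (separatedM ar br) (separatedN (separatedM ai bi))))|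
          apply: (separated_ext _ (separatedD (separatedM ar bi) (separatedM ai br)))];
  by move=> s y z _ /=; case: (pevC s _ a) => ? ?; case: (pevC s _ b).
Qed.

(** Summed over a list of expressions, it turns the simultaneous vanishing of complex values into
    the vanishing of one real function; the cutting lemma works with real signs. *)
Definition normsq (u : C) : R := complex.Re u ^+ 2 + complex.Im u ^+ 2.

Lemma normsq_eq0 u : (normsq u == 0) = (u == 0).
Proof.
case: u => a b; rewrite /normsq /= paddr_eq0 ?sqr_ge0 // !sqrf_eq0.
by rewrite eq_complex.
Qed.

Lemma separated_normsq (ps : seq pexp) :
  separated (fun s y z => \sum_(p <- ps) normsq (pevC s (y ++ z) p)).
Proof.
elim: ps => [|p ps IH].
  by apply: (separated_ext _ (separated_l (fun _ _ => 0))) => s y z _; rewrite big_nil.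
have [pr pi] := separated_pevC p.
apply: (separated_ext _ (separatedD (separatedD (separatedM pr pr) (separatedM pi pi)) IH)) => s y z _.
by rewrite big_cons /normsq !expr2.
Qed.

Lemma separated_bilin f : separated f -> exists n, forall D, (n <= D)%N ->
  forall s, exists (phi psi : seq C -> nat -> R), forall y z, size y = M ->
  f s y z = bilin D phi psi y z.
Proof.
move=> [n [l [ln fl]]]; exists n => D nD s.
pose z0 : (seq C -> R) * (seq C -> R) := (fun=> 0, fun=> 0).
exists (fun y i => (nth z0 (l s) i).1 y), (fun z i => (nth z0 (l s) i).2 z) => y z sy.
rewrite fl // /bilin (big_nth z0) big_mkord ln (big_ord_widen _ (fun i => (nth z0 (l s) i).1 y * (nth z0 (l s) i).2 z) nD) big_mkcond.
apply: eq_bigr => i _; case: ltnP => // ni.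
by rewrite nth_default ?ln //= mul0r.
Qed.

Definition erel (Hs : seq pexp) (h : pexp) (s : nat) (y z : seq C) : bool :=
  all (fun p => pevC s (y ++ z) p == 0) Hs && (pevC s (y ++ z) h != 0).

(** [tau] depends only on the number of terms of the bilinear forms, which is read off the
    expressions and is the same in all factors [s]. *)
Lemma erel_cut (Hs : seq pexp) (h : pexp) : exists tau, forall s (TP TQ : finType)
  (f : TP -> seq C) (g : TQ -> seq C), (forall p, size (f p) = M) ->
  cut_rel R tau (fun p q => erel Hs h s (f p) (g q)).
Proof.
have [n1 H1] := separated_bilin (separated_normsq Hs).
have [n2 H2] := separated_bilin (separated_normsq [:: h]).
have [tau Htau] := bilin_cut_rel R (maxn n1 n2); exists tau => s TP TQ f g sf.
have [phi [psi E1]] := H1 _ (leq_maxl n1 n2) s.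
have [phi' [psi' E2]] := H2 _ (leq_maxr n1 n2) s.
apply: (Htau TP TQ (phi \o f) (phi' \o f) (psi \o g) (psi' \o g)) => p q.
rewrite -[bilin _ (phi \o f) _ _ _]/(bilin _ phi psi (f p) (g q)).
rewrite -[bilin _ (phi' \o f) _ _ _]/(bilin _ phi' psi' (f p) (g q)).
rewrite -E1 // -E2 // big_seq1 normsq_eq0; congr (_ && _).
elim: (Hs) => [|a l IH]; first by rewrite big_nil eqxx.
rewrite big_cons paddr_eq0 ?normsq_eq0 /= ?IH //; last by apply: sumr_ge0 => b _; rewrite /normsq addr_ge0 ?sqr_ge0.
by rewrite /normsq addr_ge0 ?sqr_ge0.
Qed.

End Separated.

Lemma card_fewer (R : realType) (TT : finType) (T' : choiceType) (f : TT -> T') (P : pred TT) (S : set T') (x : R) :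
  injective f -> (forall t, P t -> S (f t)) -> fewer S x -> #|P|%:R <= x.
Proof.
move=> fi PS [Sf Sx]; apply: le_trans Sx; rewrite ler_nat cardE -(size_map f).
apply: uniq_leq_size; first by rewrite map_inj_uniq ?enum_uniq.
move=> _ /mapP[t + ->]; rewrite mem_enum in_fset_set // => tP; apply: mem_set; exact: PS.
Qed.

Section Internal.
Variables (R : realType) (U : nonprincipal_ultrafilter) (C0 : set (ultrapower R U)).
Variables (L : language) (Ks : nat -> fo_structure L C0 R[i]) (xi : nat -> R).
Local Notation K := (ultrapower R U).
Local Notation C := (R[i]).
Hypothesis C0P : is_subfield C0.
Hypothesis C0count : countable C0.
Hypothesis xi_inf : forall r : R, \forall s \near ufilter U, r < xi s.
Local Notation tps := (tps Ks xi).
Local Notation small := (small xi).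
Local Notation pexp := (pexp C0).
Variables (M : nat) (Hs : seq pexp) (h : pexp).

Definition krel (y z : seq K) : bool :=
  all (fun p => pev (y ++ z) p == 0) Hs && (pev (y ++ z) h != 0).

Lemma krel_near (y z : seq K) : krel y z <-> \forall s \near ufilter U, erel Hs h s (slq s y) (slq s z).
Proof.
have key p : pev (y ++ z) p == 0 <-> \forall s \near ufilter U, pevC s (slq s y ++ slq s z) p == 0.
  split=> [/eqP/pev_eq0_near|hp].
    by apply: filterS => s; rewrite slq_cat => ->; rewrite eqxx.
  by apply/eqP/pev_eq0_near; apply: filterS hp => s /eqP; rewrite slq_cat.
rewrite /krel /erel; split.
  move=> /andP[hHs /eqP hh]; have {}hh : \forall s \near ufilter U, pevC s (slq s y ++ slq s z) h != 0.
    have : ~ (\forall s \near ufilter U, pevC s (slq s y ++ slq s z) h == 0) by move/key/eqP.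
    by move/near_not; apply: filterS => s /negP.
  have {}hHs : \forall s \near ufilter U, all (fun p => pevC s (slq s y ++ slq s z) p == 0) Hs.
    elim: (Hs) hHs => [|p l IH] /=; first by move=> _; exact: nearW.
    by move=> /andP[/key h1 /IH h2]; apply: filterS2 h1 h2 => s -> ->.
  by apply: filterS2 hHs hh => s -> ->.
move=> hE; apply/andP; split.
  have : \forall s \near ufilter U, all (fun p => pevC s (slq s y ++ slq s z) p == 0) Hs.
    by apply: filterS hE => s /andP[].
  elim: (Hs) => //= p l IH hl; apply/andP; split; last by apply: IH; apply: filterS hl => s /andP[].
  by apply/key; apply: filterS hl => s /andP[].
apply/negP => /key hh; have := near_and hE hh => /filter_ex[s [/andP[_ /negP]]]; exact.
Qed.

(** The incidence bound is applied in almost all factors, with [x = xi s], and the incidences found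
    there are glued into [p] and [z]. The set of partners [q], and then the set of common neighbours
    of [p] and [q], are internal and not small, so [q] and [z'] can be chosen in them outside the
    small sets over the earlier points. *)
Lemma internal_incidence : exists tau : nat, forall (A B : nat -> set (M.-tuple C)) (a b mu nu om si th c1 c2 : R),
  0 < th -> 0 <= si -> smallF U xi a A -> smallF U xi a B ->
  (forall p : M.-tuple K, ultraprod A p -> small nu [set z : M.-tuple K | ultraprod B z /\ krel p z]) ->
  ~ small b [set w : (M + M).-tuple K | exists (p z : M.-tuple K), [/\ ultraprod A p, ultraprod B z, krel p z & w = [tuple of p ++ z]]] ->
  mu + th <= b - a -> om + th <= b - nu - si * tau%:R ->
  a - si + mu + th <= 2 * (b - a) ->
  a - si + nu + om - (b - nu - si * tau%:R) + th <= 2 * (b - a) ->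
  c1 < om -> c2 < mu ->
  exists p z q z' : M.-tuple K, [/\ ultraprod A p /\ ultraprod B z, ultraprod A q /\ ultraprod B z',
    [/\ krel p z, krel q z, krel p z' & krel q z'], ~ tps c1 q (p ++ z) & ~ tps c2 z' (q ++ p ++ z)].
Proof.
have [tau cut] := erel_cut M Hs h; exists tau => A B a b mu nu om si th c1 c2 th0 si0 As Bs degn Ebig H1 H2 H3 H4 c1om c2mu.
pose W s (y z : M.-tuple C) := erel Hs h s y z.
pose codegs s (y q : M.-tuple C) := [set z' | B s z' /\ W s y z' /\ W s q z'].
pose rich s (y z : M.-tuple C) := [set q | A s q /\ W s q z /\ ~ fewer (codegs s y q) (xi s `^ mu)].
have deg : \forall s \near ufilter U, A s `<=` [set y | fewer [set z | B s z /\ W s y z] (xi s `^ nu)].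
  apply: (ultraprod_sub (U := U)) => p /[dup] pA /degn; rewrite (_ : [set _ | _] = ultraprod (fun s => [set z | B s z /\ W s (slice s p) z])).
    by move/small_ultraprod.
  apply/seteqP; split=> z /=; first by move=> [h1 /krel_near h2]; apply: filterS2 h1 h2 => s.
  by move=> hz; split; [apply: filterS hz => s [] | apply/krel_near; apply: filterS hz => s []].
pose pairs s := [set w : (M + M).-tuple C | exists (y z : M.-tuple C), [/\ A s y, B s z, W s y z & w = [tuple of y ++ z]]].
have big : \forall s \near ufilter U, ~ fewer (pairs s) (xi s `^ b).
  apply: near_not => hs; apply: Ebig; exists pairs => // w [p [z [pA zB /krel_near pz ->]]].
  apply: filterS3 pA zB pz => s pA zB pz; exists (slice s p), (slice s z); split => //.
  by apply: val_inj; rewrite /= map_cat.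
have main : \forall s \near ufilter U, exists yz : M.-tuple C * M.-tuple C,
    [/\ A s yz.1, B s yz.2, W s yz.1 yz.2 & ~ fewer (rich s yz.1 yz.2) (xi s `^ om)].
  have x2 := near_powR xi_inf (2 ^+ (tau + 8)) th0.
  have x1 := near_xi1 xi_inf.
  near=> s.
  have xs1 : 1 < xi s by near: s.
  have [Af Aa] : fewer (A s) (xi s `^ a) by near: s.
  have [Bf Ba] : fewer (B s) (xi s `^ a) by near: s.
  have degs : A s `<=` [set y | fewer [set z | B s z /\ W s y z] (xi s `^ nu)] by near: s.
  pose FA := fset_set (A s); pose FB := fset_set (B s).
  have inA (p : FA) : A s (val p) by have := valP p; rewrite in_fset_set // => /set_mem.
  have inB (p : FB) : B s (val p) by have := valP p; rewrite in_fset_set // => /set_mem.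
  have ofA y : A s y -> exists p : FA, val p = y.
    by move=> Ay; have yA : y \in FA by [rewrite in_fset_set //; exact: mem_set]; exists [` yA]%fset.
  have ofB y : B s y -> exists p : FB, val p = y.
    by move=> Ay; have yA : y \in FB by [rewrite in_fset_set //; exact: mem_set]; exists [` yA]%fset.
  pose E (p : FA) (u : FB) := W s (val p) (val u).
  have [||||||p [u [pu]]] := @incidence_pow R FA FB E tau (xi s) a b mu nu om si th
     (cut s FA FB (fun p => tval (val p)) (fun u => tval (val u)) _) (ltW xs1) _ si0 _ _ _ _ H1 H2 H3 H4.
  - by move=> p; rewrite size_tuple.
  - by near: s.
  - by rewrite -cardfE.
  - by rewrite -cardfE.
  - rewrite leNgt; apply/negP => lt.
    have nf : ~ fewer (pairs s) (xi s `^ b) by near: s.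
    apply: nf; pose l := enum [pred pu : FA * FB | E pu.1 pu.2].
    have := fewer_image (fun pu : FA * FB => [tuple of val pu.1 ++ val pu.2]) (fewer_list R l).
    apply: fewer_sub; last first.
      apply: le_trans (ltW lt); rewrite ler_nat -cardE -sum1_card big_mkcond pair_big /=.
      by apply: leq_sum => pu _; rewrite inE; case: (E _ _).
    move=> w [y [z [/ofA[p <-] /ofB[u <-] pu ->]]]; exists (p, u) => //=.
    by rewrite mem_enum inE.
  - by move=> p; rewrite cardsE; apply: (card_fewer val_inj _ (degs _ (inA p))) => t pt; split => //; exact: inB.
  rewrite ltNge cardsE => /negP hr; exists (val p, val u); split; [exact: inA|exact: inB|exact: pu|].
  move=> hf; apply: hr; apply: (card_fewer val_inj _ hf) => q /andP[qu hq]; split; first exact: inA.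
  split => // hc; move: hq; rewrite ltNge => /negP; apply; rewrite /codeg cardsE.
  by apply: (card_fewer val_inj _ hc) => t /andP[h1 h2]; split; [exact: inB | split].
have /choice[yz yzP] s : exists yz : M.-tuple C * M.-tuple C,
   (exists yz, [/\ A s yz.1, B s yz.2, W s yz.1 yz.2 & ~ fewer (rich s yz.1 yz.2) (xi s `^ om)]) ->
    [/\ A s yz.1, B s yz.2, W s yz.1 yz.2 & ~ fewer (rich s yz.1 yz.2) (xi s `^ om)].
  have [[yz ?]|hn] := pselect (exists yz, [/\ A s yz.1, B s yz.2, W s yz.1 yz.2 & ~ fewer (rich s yz.1 yz.2) (xi s `^ om)]); first by exists yz.
  by exists (nseq_tuple M 0, nseq_tuple M 0).
have [p py] := tuple_lift U (fun s => (yz s).1); have [z zy] := tuple_lift U (fun s => (yz s).2).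
have mainK : \forall s \near ufilter U,
    [/\ A s (slice s p), B s (slice s z), W s (slice s p) (slice s z) & ~ fewer (rich s (slice s p) (slice s z)) (xi s `^ om)].
  near=> s; have -> : slice s p = (yz s).1 by near: s.
  have -> : slice s z = (yz s).2 by near: s.
  by apply: yzP; near: s.
have pA : ultraprod A p by apply: filterS mainK => s [].
have zB : ultraprod B z by apply: filterS mainK => s [].
have pz : krel p z by apply/krel_near; apply: filterS mainK => s [].
have nI : ~ small om (ultraprod (fun s => rich s (slice s p) (slice s z)) : set (M.-tuple K)).
  move/small_ultraprod; apply: near_notE; by apply: filterS mainK => s [].
have [q qI qt] := big_point Ks C0count xi_inf (p ++ z) c1om nI.
have qA : ultraprod A q by apply: filterS qI => s [].
have qz : krel q z by apply/krel_near; apply: filterS qI => s [_ []].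
have nJ : ~ small mu (ultraprod (fun s => codegs s (slice s p) (slice s q)) : set (M.-tuple K)).
  move/small_ultraprod; apply: near_notE; by apply: filterS qI => s [_ []].
have [z' zJ zt] := big_point Ks C0count xi_inf (q ++ p ++ z) c2mu nJ.
exists p, z, q, z'; split => //.
- by split => //; apply: filterS zJ => s [].
- split => //; apply/krel_near; apply: filterS zJ => s [_ []] //.
Unshelve. all: by end_near. Qed.

Hypothesis S_cst : forall c : C0, scst (ultraproduct U Ks) c = set_val c.

Lemma fdefs_krel : fdefs Ks (fun e => krel (take M e) (drop M e)).
Proof.
pose Q e := (forall l, l \in iota 0 (size Hs) -> pev e (nth h Hs l) = 0) /\ ~ pev e h = 0.
have Qd : fdefs Ks Q.
  apply: fdefs_and; last by apply: fdefs_not; exact: fdefs_pev.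
  by apply: fdefs_all => l _; exact: fdefs_pev.
apply: fdefs_ext Qd _ => e; rewrite /krel cat_take_drop; split.
  move=> [h1 /eqP h2]; rewrite h2 andbT; apply/(all_nthP h) => l lH.
  by apply/eqP/h1; rewrite mem_iota.
by move=> /andP[/(all_nthP h) h1 /eqP h2]; split => // l; rewrite mem_iota => /h1/eqP.
Qed.

(** Sizes of internal sets are replaced by sizes of types: an internal set that is not small
    contains a point of large type over any given parameters, so a bound on all its points bounds
    the set. The constants [c1] to [c4] leave room for this passage. *)
Lemma definable_incidence : exists tau : nat, forall (PA PB : seq K -> Prop) (a b mu nu om si th c1 c2 c3 c4 : R),
  0 < th -> 0 <= si -> c1 < om -> c2 < mu -> c3 < nu -> c4 < a -> fdefs Ks PA -> fdefs Ks PB ->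
  (forall p : M.-tuple K, PA p -> tps c4 p [::]) -> (forall z : M.-tuple K, PB z -> tps c4 z [::]) ->
  (forall p z : M.-tuple K, PA p -> PB z -> krel p z -> tps c3 z p) ->
  (exists p z : M.-tuple K, [/\ PA p, PB z, krel p z & ~ tps b (p ++ z) [::]]) ->
  mu + th <= b - a -> om + th <= b - nu - si * tau%:R ->
  a - si + mu + th <= 2 * (b - a) ->
  a - si + nu + om - (b - nu - si * tau%:R) + th <= 2 * (b - a) ->
  exists p z q z' : M.-tuple K, [/\ PA p /\ PB z, PA q /\ PB z',
    [/\ krel p z, krel q z, krel p z' & krel q z'], ~ tps c1 q (p ++ z) & ~ tps c2 z' (q ++ p ++ z)].
Proof.
have [tau inc] := internal_incidence; exists tau => PA PB a b mu nu om si th c1 c2 c3 c4.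
move=> th0 si0 c1om c2mu c3nu c4a PAd PBd PAs PBs PABs [p0 [z0 [Ap0 Bz0 pz0 nb]]] H1 H2 H3 H4.
have [Ps PsE] := fdefs_intp PAd; have [Qs QsE] := fdefs_intp PBd.
pose A s := [set y : M.-tuple C | Ps s (y ++ slq s ([::] : seq K))].
pose B s := [set y : M.-tuple C | Qs s (y ++ slq s ([::] : seq K))].
have AE (x : M.-tuple K) : ultraprod A x <-> PA x by rewrite -(intp_ultraprod PsE) /= cats0.
have BE (x : M.-tuple K) : ultraprod B x <-> PB x by rewrite -(intp_ultraprod QsE) /= cats0.
have small_of (F : nat -> set (M.-tuple C)) t c c' : c < c' ->
    (forall x : M.-tuple K, ultraprod F x -> tps c x t) -> small c' (ultraprod F : set (M.-tuple K)).
  move=> cc' Ft; apply: contrapT => nF.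
  by have [x Fx] := big_point Ks C0count xi_inf t cc' nF; apply; exact: Ft.
have [||||p [z [q [z' [[pA zB] [qA z'B] h1 h2 h3]]]]] := inc A B a b mu nu om si th c1 c2 th0 si0 _ _ _ _ H1 H2 H3 H4 c1om c2mu.
- by apply: small_ultraprod; apply: (small_of A [::] _ _ c4a) => x /AE; exact: PAs.
- by apply: small_ultraprod; apply: (small_of B [::] _ _ c4a) => x /BE; exact: PBs.
- move=> p /AE pA.
  rewrite (_ : [set _ | _] = ultraprod (fun s => [set z | B s z /\ erel Hs h s (slice s p) z])).
    apply: (small_of _ p _ _ c3nu) => z hz; apply: PABs => //; first by apply/BE; apply: filterS hz => s [].
    by apply/krel_near; apply: filterS hz => s [].
  apply/seteqP; split=> z /=; first by move=> [h1 /krel_near h2]; apply: filterS2 h1 h2 => s.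
  by move=> hz; split; [apply: filterS hz => s [] | apply/krel_near; apply: filterS hz => s []].
- move=> sW; apply: nb; apply/(tpsE Ks xi b [tuple of p0 ++ z0] [::]).
  exists (fun e => PA (take M e) /\ (PB (drop M e) /\ krel (take M e) (drop M e))); split.
  + by apply: fdefs_and; [exact: fdefs_take | apply: fdefs_and; [exact: fdefs_drop | exact: fdefs_krel]].
  + by rewrite cats0 /= take_size_cat ?size_tuple // drop_size_cat ?size_tuple.
  apply: small_sub sW => w; have [x [y ->]] := tuple_split w.
  rewrite /= cats0 take_size_cat ?size_tuple // drop_size_cat ?size_tuple // => -[/AE xA [/BE yB xy]].
  by exists x, y.
by exists p, z, q, z'; split => //; split; (apply/AE || apply/BE).
Qed.

End Internal.

(** * Rectangles of generic points *)

Lemma nth_flatten_tuple (K : fieldType) m n (f : 'I_m -> n.-tuple K) (l : 'I_m) j : (j < n)%N ->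
  (flatten [seq tval (f l) | l <- enum 'I_m])`_(l * n + j) = (f l)`_j.
Proof.
move=> jn; have hs : (l < size (enum 'I_m))%N by rewrite size_enum_ord.
have E := @nth_flatten_const K n [seq tval (f l) | l <- enum 'I_m] l.
rewrite size_map in E; have := congr1 (fun u => u`_j) (E hs _).
rewrite nth_take // nth_drop (nth_map l) // nth_ord_enum => -> // s /mapP[l' _ ->].
by rewrite size_tuple.
Qed.

Lemma size_flatten_tuple (K : fieldType) m n (f : 'I_m -> n.-tuple K) :
  size (flatten [seq tval (f l) | l <- enum 'I_m]) = (m * n)%N.
Proof.
rewrite size_flatten /shape -map_comp (@eq_map _ _ _ (fun=> n)); last by move=> l; rewrite /= size_tuple.
rewrite sumnE big_map -[in RHS](size_enum_ord m) mulnC.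
by elim: (enum 'I_m) => [|l s IH]; rewrite ?big_nil ?muln0 // big_cons IH mulnS.
Qed.

Lemma flatten_tupleE (K : fieldType) m n (f : 'I_m -> n.-tuple K) (c : seq K) : size c = (m * n)%N ->
  (forall (l : 'I_m) j, (j < n)%N -> (f l)`_j = c`_(l * n + j)) ->
  flatten [seq tval (f l) | l <- enum 'I_m] = c.
Proof.
move=> sc fc; apply: (@eq_from_nth _ 0); first by rewrite size_flatten_tuple sc.
rewrite size_flatten_tuple => k km; have n0 : (0 < n)%N by case: n km {f fc sc} => //; rewrite muln0.
have kl : (k %/ n < m)%N by rewrite ltn_divLR.
rewrite (divn_eq k n) -[(k %/ n)%N]/(val (Ordinal kl)) nth_flatten_tuple ?ltn_pmod //.
by rewrite fc // ltn_pmod.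
Qed.

Section Charts.
Variables (R : realType) (U : nonprincipal_ultrafilter) (C0 : set (ultrapower R U)).
Local Notation K := (ultrapower R U).
Hypothesis C0P : is_subfield C0.
Variables (N : nat) (G : group_data K (N.-tuple K)).
Hypothesis GP : is_comm_alg_group C0 G.
Local Notation T := (N.-tuple K).
Local Notation gm := (gmul (pow_group G _)).
Local Notation pexp := (pexp C0).

Lemma cs2 (i j : chart G) (x y : T) : cs (n := 2) [tuple i; j] [tuple x; y] = coords i x ++ coords j y.
Proof.
rewrite /cs (_ : enum 'I_2 = [:: ord0; ord_max]); last by apply: (inj_map val_inj); rewrite val_enum_ord.
by rewrite /= cats0 !(tnth_nth x) /= !(tnth_nth i).
Qed.

Lemma mul_coords1 (i j l : chart G) (x y : T) : dom i x -> dom j y -> dom l (gmul G x y) ->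
  exists (q : pexp) (P : nat -> pexp), pev (coords i x ++ coords j y) q != 0 /\
    forall x' y', dom i x' -> dom j y' -> pev (coords i x' ++ coords j y') q != 0 ->
    dom l (gmul G x' y') /\ forall k, (coords l (gmul G x' y'))`_k =
      pev (coords i x' ++ coords j y') (P k) / pev (coords i x' ++ coords j y') q.
Proof.
move=> ix jy lxy; have [_ hm] := gmul_morphism GP.
have dom2 (x' y' : T) : dom i x' -> dom j y' -> dom (a := pow_atlas G 2) [tuple i; j] [tuple x'; y'].
  by move=> hx hy -[[|[|k]] hk] //; rewrite !(tnth_nth x) (tnth_nth i).
have [q [P [qC PC q0 H]]] := hm [tuple i; j] l [tuple x; y] (dom2 x y ix jy) lxy.
have [q' q'E] := mpoly_pexp C0P qC.
have /choice[P' P'E] (k : 'I_(adim G)) := mpoly_pexp C0P (PC k).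
exists q', (fun k => if insub k is Some k' then P' k' else P0 C0P).
have E x' y' : tval (coords (a := pow_atlas G 2) [tuple i; j] [tuple x'; y']) = coords i x' ++ coords j y'.
  by rewrite csE cs2.
split; first by rewrite -E -q'E.
move=> x' y' ix' jy' qx'; rewrite -E -q'E in qx'.
have [h1 h2] := H [tuple x'; y'] (dom2 x' y' ix' jy') qx'; split; first exact: h1.
move=> k; case: insubP => [k' _ <-|]; last first.
  by rewrite -leqNgt => km; rewrite nth_default ?size_tuple // pev0 mul0r.
have := h2 k'; rewrite (tnth_nth 0) P'E q'E !E => <-.
by [].
Qed.

Lemma mul_coords m (i j l : chart (pow_atlas G m)) (x y : m.-tuple T) :
  dom i x -> dom j y -> dom l (gm x y) ->
  exists (q : pexp) (P : nat -> pexp), pev (cs i x ++ cs j y) q != 0 /\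
    forall x' y', dom i x' -> dom j y' -> pev (cs i x' ++ cs j y') q != 0 ->
    dom l (gm x' y') /\ forall k, (cs l (gm x' y'))`_k =
      pev (cs i x' ++ cs j y') (P k) / pev (cs i x' ++ cs j y') q.
Proof.
move=> ix jy lxy; pose n := adim G; pose M := (m * n)%N.
pose ix2 (s : 'I_m) k := if (k < n)%N then PV C0 (s * n + k)
  else if (k < n + n)%N then PV C0 (M + (s * n + (k - n))) else P0 C0P.
have ixE s x' y' p : pev (cs i x' ++ cs j y') (psub (ix2 s) p) =
    pev (coords (tnth i s) (tnth x' s) ++ coords (tnth j s) (tnth y' s)) p.
  apply: pev_psub => k; rewrite /ix2; case: ltnP => kn.
    rewrite /= !nth_cat size_cs size_tuple kn (_ : (s * n + k < m * n)%N).
      exact: (nth_flatten_tuple (fun s => coords (tnth i s) (tnth x' s)) s kn).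
    by have := ltn_ord s; nia.
  case: ltnP => kn2; last by rewrite pev0 nth_default // size_cat !size_tuple.
  have kn3 : (k - n < n)%N by rewrite ltn_subLR.
  rewrite /= !nth_cat size_cs size_tuple ltnNge leq_addr /= addKn [(k < _)%N]ltnNge kn /=.
  exact: (nth_flatten_tuple (fun s => coords (tnth j s) (tnth y' s)) s kn3).
have hs s : exists (qP : pexp * (nat -> pexp)), pev (cs i x ++ cs j y) (psub (ix2 s) qP.1) != 0 /\
    forall x' y', dom i x' -> dom j y' -> pev (cs i x' ++ cs j y') (psub (ix2 s) qP.1) != 0 ->
    dom (tnth l s) (tnth (gm x' y') s) /\ forall k, (coords (tnth l s) (tnth (gm x' y') s))`_k =
      pev (cs i x' ++ cs j y') (psub (ix2 s) (qP.2 k)) / pev (cs i x' ++ cs j y') (psub (ix2 s) qP.1).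
  have := lxy s; rewrite tnth_mktuple => ls.
  have [q [P [q0 H]]] := mul_coords1 (ix s) (jy s) ls; exists (q, P); rewrite ixE; split => //.
  move=> x' y' ix' jy'; rewrite ixE tnth_mktuple => qx'.
  have [h1 h2] := H _ _ (ix' s) (jy' s) qx'; split => // k; rewrite h2 ixE //.
have /choice[qP qPE] := hs.
pose Q s := psub (ix2 s) (qP s).1.
pose q := pprod C0P [seq Q s | s <- enum 'I_m].
(* The common denominator is the product of the [m] separate ones; each numerator takes up the other
   factors. *)
pose Pk k := if insub (k %/ n)%N is Some s then
    PM (psub (ix2 s) ((qP s).2 (k %% n)%N)) (pprod C0P [seq Q s' | s' <- enum 'I_m & s' != s])
  else P0 C0P.
have q0E e : (pev e q != 0) = [forall s, pev e (Q s) != 0].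
  rewrite pev_prod big_map prodf_seq_neq0; apply/allP/forallP => [h s|h s _]; last exact: h.
  by have := h s; rewrite mem_enum; apply.
exists q, Pk; split; first by rewrite q0E; apply/forallP => s; case: (qPE s).
move=> x' y' ix' jy'; rewrite q0E => /forallP qs.
have H s := (qPE s).2 x' y' ix' jy' (qs s).
split=> [s|k]; first by case: (H s).
have [km|km] := ltnP k (m * n)%N; last first.
  rewrite nth_default ?size_cs // /Pk; case: insubP => [s sl _|]; last by rewrite pev0 mul0r.
  have [n0|n0] := posnP n; last by move: sl; rewrite ltn_divLR // ltnNge km.
  have [_ /(_ (k %% n)%N)] := H s; rewrite nth_default ?size_tuple ?[adim G]n0 // => E.
  have /eqP := esym E; rewrite mulf_eq0 invr_eq0 (negPf (qs s)) orbF => /eqP E2.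
  by rewrite /= E2 !mul0r.
have n0 : (0 < n)%N by move: km; case: (posnP n) => // E; rewrite E muln0.
have kl : (k %/ n < m)%N by rewrite ltn_divLR.
have kn : (k %% n < n)%N by rewrite ltn_pmod.
rewrite /Pk insubT /=; set s := Sub _ _ : 'I_m.
rewrite {1}(divn_eq k n) (nth_flatten_tuple (fun s => coords (tnth l s) (tnth (gm x' y') s)) s kn).
rewrite (H s).2 [in RHS]pev_prod /= !pev_prod big_map big_filter big_map.
rewrite big_map big_enum /= [X in _ = _ / X](bigD1 s) //= invfM mulrACA divff ?mulr1 //.
by apply/prodf_neq0 => s' _; exact: qs.
Qed.

End Charts.

Section Rectangle.
Variables (R : realType) (U : nonprincipal_ultrafilter) (C0 : set (ultrapower R U)).
Variables (L : language) (Ks : nat -> fo_structure L C0 R[i]) (xi : nat -> R).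
Local Notation K := (ultrapower R U).
Local Notation S := (ultraproduct U Ks).
Hypothesis C0P : is_subfield C0.
Hypothesis C0cl : alg_closed_in C0.
Hypothesis C0count : countable C0.
Hypothesis S_cst : forall c : C0, scst S c = set_val c.
Hypothesis xi_inf : forall r : R, \forall s \near ufilter U, r < xi s.
Hypothesis delta_cont : delta_continuous S xi.
Variables (N : nat) (G : group_data K (N.-tuple K)).
Hypothesis GP : is_comm_alg_group C0 G.
Hypothesis Gemb : constructibly_embedded C0 G.
Local Notation T := (N.-tuple K).
Local Notation fdefs := (fdefs Ks).
Local Notation gsp := (@gsp K C0 T G _).
Local Notation gm := (gmul (pow_group G _)).
Local Notation ptsn := (ptsn G).

Let char0 := @ultrapower_char0 R U.
Let VP : is_variety C0 G. Proof. by case: GP. Qed.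

Lemma mktupleE n (f : nat -> K) : tval [tuple f j | j < n] = [seq f j | j <- iota 0 n].
Proof. by rewrite /= -val_enum_ord -map_comp. Qed.

Lemma chart_image_def m (i : chart (pow_atlas G m)) (Xm : set T) : definable S set0 Xm ->
  exists2 P, fdefs P & forall c : (m * adim G).-tuple K, P c <->
    exists p : m.-tuple T, [/\ dom i p, forall l, Xm (tnth p l) & cs i p = c].
Proof.
move=> /definable0P[PX PXd XE]; pose n := adim G.
have /choice[Pi PiP] (l : 'I_m) : exists P, fdefs P /\ forall (y : T) (c : n.-tuple K) r,
    P (y ++ c ++ r) <-> dom (tnth i l) y /\ coords (tnth i l) y = c.
  by have [P Pd PE] := chart_def C0P S_cst GP Gemb (tnth i l); exists P.
pose idp (l : 'I_m) := [seq (l * N + j)%N | j <- iota 0 N].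
pose idc (l : 'I_m) := [seq (m * N + (l * n + j))%N | j <- iota 0 n].
pose Q (e : seq K) := forall l, l \in enum 'I_m ->
  Pi l [seq e`_j | j <- idp l ++ idc l] /\ PX [seq e`_j | j <- idp l].
pose xl (x : seq K) (l : 'I_m) : T := [tuple x`_(l * N + j) | j < N].
pose cl (c : seq K) (l : 'I_m) : n.-tuple K := [tuple c`_(l * n + j) | j < n].
have QE x c : size x = (m * N)%N -> size c = (m * n)%N -> Q (x ++ c) <->
    forall l, [/\ dom (tnth i l) (xl x l), coords (tnth i l) (xl x l) = cl c l & Xm (xl x l)].
  move=> sx sc; have Ep l : [seq (x ++ c)`_j | j <- idp l] = xl x l.
    rewrite (mktupleE N (fun j => _`_(l * N + j))) -map_comp; apply/eq_in_map => j; rewrite mem_iota add0n /= => jN.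
    by rewrite nth_cat sx; case: ltnP => //; have := ltn_ord l; nia.
  have Ec l : [seq (x ++ c)`_j | j <- idc l] = cl c l ++ [::].
    rewrite cats0 (mktupleE n (fun j => _`_(l * n + j))) -map_comp; apply/eq_in_map => j; rewrite mem_iota add0n /= => jN.
    by rewrite nth_cat sx ltnNge leq_addr /= addKn.
  split=> h l.
    have [] := h l (mem_enum 'I_m l); rewrite map_cat Ep Ec.
    by move=> /((PiP l).2 _ _ _)[h1 h2] /XE h3.
  move=> _; have [h1 h2 h3] := h l; rewrite map_cat Ep Ec.
  by split; [apply/((PiP l).2 _ _ _) | apply/XE].
exists (fun e => exists2 x, size x = (m * N)%N & Q (x ++ e)).
  apply: (fdefs_exn (m * N)); apply: fdefs_all => l _.
  by apply: fdefs_and; apply: fdefs_map => //; case: (PiP l).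
move=> c; split=> [[x sx /(QE _ _ sx (size_tuple c)) h]|[p [ip Xp pc]]].
  exists [tuple xl x l | l < m]; split.
  - by move=> l; rewrite tnth_mktuple; case: (h l).
  - by move=> l; rewrite tnth_mktuple; case: (h l).
  apply: flatten_tupleE; first by rewrite size_tuple.
  move=> l j jn; rewrite tnth_mktuple; have [_ -> _] := h l.
  by rewrite (mktupleE n (fun j => _`_(l * n + j))) (nth_map 0%N) ?size_iota // nth_iota.
have sx : size (pt p) = (m * N)%N by exact: size_flatten_tuple.
exists (pt p) => //; apply/QE; rewrite ?size_tuple // => l.
have -> : xl (pt p) l = tnth p l.
  apply: eq_from_tnth => j; rewrite tnth_mktuple (tnth_nth 0).
  exact: (nth_flatten_tuple (fun l => tnth p l) l (ltn_ord j)).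
split; [exact: ip | | exact: Xp].
apply: eq_from_tnth => j; rewrite tnth_mktuple (tnth_nth 0) -pc.
by rewrite (nth_flatten_tuple (fun l => coords (tnth i l) (tnth p l)) l (ltn_ord j)).
Qed.

(** The finite formula isolating a generic part of the locus of [a] is composed with multiplication
    in charts and cleared of denominators. It becomes a list of equations and one inequation,
    polynomial in the coordinates of the two factors, the shape to which the cutting lemma
    applies. *)
Lemma locus_rel m (a p v : m.-tuple T) (i j : chart (pow_atlas G m)) : ptsn a -> gm p v = a ->
  dom i p -> dom j v -> exists (Hs : seq (pexp C0)) (h : pexp C0),
  krel Hs h (cs i p) (cs j v) /\ forall p' v', dom i p' -> dom j v' ->
    krel Hs h (cs i p') (cs j v') -> gsp [::] a (gm p' v').
Proof.
move=> aG pv ip jv; have [l la] := pow_chart aG.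
have [q [P [q0 H]]] := mul_coords C0P GP ip jv (eq_ind_r (fun x => dom l x) la pv).
have [gs [h [gs0 h0 gsh]]] := sp_generic_formula C0P (cs l a).
have /choice[Dh DhP] (g : pexp C0) := homogenize C0P g q P.
have /choice[hm hmP] : forall g, exists H : pexp C0, forall e u : seq K, pev e q != 0 ->
   (forall k, u`_k = pev e (P k) / pev e q) -> pev e H = pev e q ^+ Dh g * pev u g.
  by move=> g; have [H' H'E] := DhP g; exists H'.
have hmE g p' v' : dom i p' -> dom j v' -> pev (cs i p' ++ cs j v') q != 0 ->
    (pev (cs i p' ++ cs j v') (hm g) == 0) = (pev (cs l (gm p' v')) g == 0).
  move=> ip' jv' qe; have [_ h2] := H p' v' ip' jv' qe.
  by rewrite (hmP g _ (cs l (gm p' v'))) // mulf_eq0 expf_eq0 (negPf qe) andbF.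
exists (map hm gs), (PM q (hm h)).
have krelE p' v' : dom i p' -> dom j v' -> krel (map hm gs) (PM q (hm h)) (cs i p') (cs j v') =
    (pev (cs i p' ++ cs j v') q != 0) && (all (fun g => pev (cs l (gm p' v')) g == 0) gs &&
      (pev (cs l (gm p' v')) h != 0)).
  move=> ip' jv'; rewrite /krel /= mulf_eq0 negb_or andbCA.
  case qe: (pev (cs i p' ++ cs j v') q == 0) => //=.
  rewrite all_map hmE ?qe //; congr (_ && _); apply: eq_all => g /=.
  by rewrite hmE ?qe.
split.
  rewrite krelE // q0 pv h0 andbT /=; apply/(all_nthP h) => k kg; apply/eqP/gs0.
  by rewrite -(nth_map h 0) // mem_nth ?size_map.
move=> p' v' ip' jv'; rewrite krelE // => /and3P[qe /(all_nthP h) gs1 h1].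
have [lpv _] := H p' v' ip' jv' qe.
apply: (sp_gsp C0P la lpv); rewrite !cats0; apply: gsh => //; first by rewrite !size_cs.
move=> g0 /(nthP 0)[k]; rewrite size_map => kg <-.
by rewrite (nth_map h) //; apply/eqP/gs1.
Qed.

End Rectangle.

(** [t] is the exponent of the cutting lemma. For [e = 0] the inequality between [a - si + mu + e]
    and [2 * (b - a)] is an equality, both sides being 2 (k+1) D; the gain [si] is chosen to
    outweigh all the multiples of [e] in it. The inequalities with [om] have a slack of at least
    1/2, and the choice of [e] keeps the cost [si * t] below that, at most 1/4. *)
Lemma incidence_exponents (R : realFieldType) (D k t e : R) : 1 <= D -> 0 <= k -> 0 <= t -> 0 < e ->
  40%:R * ((k + 2) * e) + 40%:R * ((k + 2) * t * e) = 1 ->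
  let a := (k + 2) * (D + e) + 2 * e in let b := (k + 2 + (k + 1)) * D - e in
  let mu := k * (D + e) + 2 * e in let nu := (k + 1) * (D + e) + 2 * e in
  let om := (k + 1) * D - 2^-1 in let si := (4 * (k + 2) + 12) * e in
  [/\ 0 <= si, k * (D + e) + e < om, mu + e <= b - a, om + e <= b - nu - si * t &
    a - si + mu + e <= 2 * (b - a) /\
    a - si + nu + om - (b - nu - si * t) + e <= 2 * (b - a)].
Proof.
move=> D1 k0 t0 e0; rewrite !(mulrDl, mulrDr) => E a b mu nu om si.
have ke : 0 <= k * e by rewrite mulr_ge0 // ltW.
have te : 0 <= t * e by rewrite mulr_ge0 // ltW.
have kte : 0 <= k * t * e by rewrite !mulr_ge0 // ltW.
by rewrite /a /b /mu /nu /om /si; split; [lra|lra|lra|lra|split; lra].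
Qed.

(** * Incidences between approximations of powers of Gamma *)

Section StepB.
Variables (R : realType) (U : nonprincipal_ultrafilter) (C0 : set (ultrapower R U)).
Variables (L : language) (Ks : nat -> fo_structure L C0 R[i]) (xi : nat -> R).
Local Notation K := (ultrapower R U).
Local Notation S := (ultraproduct U Ks).
Hypothesis C0P : is_subfield C0.
Hypothesis C0cl : alg_closed_in C0.
Hypothesis C0count : countable C0.
Hypothesis S_cst : forall c : C0, scst S c = set_val c.
Hypothesis xi_inf : forall r : R, \forall s \near ufilter U, r < xi s.
Hypothesis delta_cont : delta_continuous S xi.
Variables (N : nat) (G : group_data K (N.-tuple K)).
Hypothesis GP : is_comm_alg_group C0 G.
Hypothesis Gemb : constructibly_embedded C0 G.
Local Notation T := (N.-tuple K).
Local Notation tps := (tps Ks xi).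
Local Notation acl_incl := (@acl_incl K C0).
Local Notation rk := (@rk K C0).
Local Notation gsp := (@gsp K C0 T G _).
Local Notation gm := (gmul (pow_group G _)).
Local Notation gi := (ginv (pow_group G _)).
Local Notation ptsn := (ptsn G).
Variables (X Gamma : set T) (d : nat).
Hypothesis d0 : (0 < d)%N.
Hypothesis Xdef : definable S set0 X.
Hypothesis Xcgp : cgp_in xi G X.
Hypothesis Gfull : forall t, exists2 x, pts G x & (d <= rk t x)%N.
Hypothesis Gle : forall (x : T) t, pts G x -> (rk t x <= d)%N.
Hypothesis Gamma_def : bigwedge_definable S set0 Gamma.
Hypothesis Gamma_sub : Gamma `<=` X.
Hypothesis Gamma_grp : is_subgroup G Gamma.
Hypothesis Gamma_delta : (delta xi Gamma <= (d%:R)%:E)%E.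
Variable g : T.
Hypothesis Gg : Gamma g.
Hypothesis gN : forall c : R, c < d%:R -> ~ tps c g [::].

Let char0 := @ultrapower_char0 R U.

Lemma ptE m (p : m.-tuple T) : pt p = flatten [seq tval q | q <- tval p].
Proof. by rewrite /pt -[in RHS](map_tnth_enum p) -map_comp. Qed.

(** Entries are added one at a time, each chosen in Gamma generic over the previous ones and [w];
    sizes add by [tps_addN]. *)
Lemma Gamma_tuple m (w : seq K) (b : R) : (forall c, c < b -> ~ tps c w [::]) ->
  exists v : m.-tuple T, (forall l, Gamma (tnth v l)) /\
    forall c, c < m%:R * d%:R + b -> ~ tps c (pt v ++ w) [::].
Proof.
have dR : 0 < d%:R :> R by rewrite ltr0n.
move=> wN; elim: m => [|m [v [vG vN]]].
  exists [tuple]; split=> [[]//|c]; rewrite mul0r add0r ptE /=; exact: wN.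
have [x Gx xN] := Gamma_generic C0count xi_inf Xdef Gamma_def Gamma_sub (pt v ++ w) Gg gN.
exists [tuple of x :: v]; split=> [l|c cb].
  by have := mem_tnth l [tuple of x :: v]; rewrite inE => /predU1P[->//|/tnthP[l' ->]].
rewrite ptE /= -ptE -catA; pose eta := Num.min (d%:R / 2) ((m.+1%:R * d%:R + b - c) / 3).
have gap : 0 < m.+1%:R * d%:R + b - c by rewrite subr_gt0.
have eta0 : 0 < eta by rewrite lt_min; apply/andP; split; lra.
have [h1 h2] : eta <= d%:R / 2 /\ eta <= (m.+1%:R * d%:R + b - c) / 3 by rewrite !ge_min !lexx orbT.
move: gap h2; rewrite -natr1 mulrDl mul1r => gap h2.
apply: (@tps_addN R U C0 L Ks xi xi_inf delta_cont x (pt v ++ w) (d%:R - eta) (m%:R * d%:R + b - eta)).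
- by lra.
- by lra.
- by apply: xN; lra.
- by apply: vN; lra.
Qed.

Lemma rk_ptsn m (p : m.-tuple T) t : ptsn p -> (rk t (pt p) <= m * d)%N.
Proof.
move=> pG; have H (ps : seq T) t' : (forall q, q \in ps -> pts G q) ->
    (rk t' (flatten [seq tval q | q <- ps]) <= size ps * d)%N.
  elim: ps t' => //= q ps IH t' h; rewrite (rk_cat C0P) mulSn; apply: leq_add; first by apply: Gle; apply: h; exact: mem_head.
  by apply: IH => q' qps; apply: h; rewrite inE qps orbT.
by have := H p t; rewrite ptE size_tuple; apply => q /tnthP[l ->].
Qed.

Lemma ternary_incidence k0 (a : k0.+2.-tuple T) :
  (forall l, Gamma (tnth a l)) -> rk [::] (pt a) = (k0.+1 * d)%N ->
  (forall c : R, c < k0.+1%:R * d%:R -> ~ tps c (pt a) [::]) -> ternary C0 G a.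
Proof.
move=> aGam ra aN; pose m := k0.+2; have [GamG _ GamM GamV] := Gamma_grp.
have dR : 1 <= d%:R :> R by rewrite ler1n.
have [v [vGam vN]] := Gamma_tuple m aN.
have aG : ptsn a by move=> l; exact: GamG.
have vG : ptsn v by move=> l; exact: GamG.
have viG := ptsn_gi GP vG.
pose p := gm (gi v) a; have pG : ptsn p by exact: (ptsn_gm GP viG aG).
have pGam l : Gamma (tnth p l) by rewrite tnth_mktuple; apply: GamM => //; rewrite tnth_mktuple; exact: GamV.
have pv : gm p v = a by rewrite (gmC GP) // (gmVK GP).
have [i ip] := pow_chart pG; have [j jv] := pow_chart vG.
have [Hs [h [hpv hrel]]] := locus_rel C0P GP aG pv ip jv.
have [tau inc] := definable_incidence C0count xi_inf (m * adim G) Hs h S_cst.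
(* [tau] is known before [e] is fixed, so the approximation of Gamma can be taken fine enough to pay
   for the cut. *)
have [e e0 eE] : exists2 e : R, 0 < e & 40%:R * (m%:R * e) + 40%:R * (m%:R * tau%:R * e) = 1.
  exists (40%:R * m%:R * tau.+1%:R)^-1; first by rewrite invr_gt0 !mulr_gt0 ?ltr0n.
  have hE : 40%:R * m%:R * tau.+1%:R = 40%:R * m%:R + 40%:R * (m%:R * tau%:R) :> R.
    by rewrite -[tau.+1%:R]natr1 mulrDr mulr1 addrC mulrA.
  have nz : 40%:R * m%:R * tau.+1%:R != 0 :> R by rewrite !mulf_neq0 ?pnatr_eq0.
  by rewrite !mulrA -[40%:R * m%:R * tau%:R]mulrA -mulrDl -hE mulfV.
have [Xm [Xmd XmG XmX Xms]] := Gamma_cover C0count xi_inf d0 Xdef Gamma_def Gamma_sub e0 Gamma_delta.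
have XmP x : Xm x -> pts G x by move=> /XmX Xx; case: Xcgp => _ + _ _ _; exact.
have [PA PAd PAE] := chart_image_def C0P C0count S_cst GP Gemb i Xmd.
have [PB PBd PBE] := chart_image_def C0P C0count S_cst GP Gemb j Xmd.
(* The gap of [rk_of_not_tps], read on chart coordinates. *)
have LP (l : chart (pow_atlas G m)) (x : m.-tuple T) t (f : nat) (b : R) : dom l x -> (forall i, Xm (tnth x i)) ->
    f%:R * (d%:R + e) < b -> ~ tps b (cs l x) t -> (f.+1 * d <= rk t (pt x))%N.
  move=> lx Xx fb bN; rewrite ptE; pose b' := (f%:R * (d%:R + e) + b) / 2.
  apply: (rk_of_not_tps C0P S_cst xi_inf delta_cont GP Gemb Xdef Xcgp Gfull Xmd XmX e0 Xms (b := b')).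
  - by move=> q /tnthP[l' ->].
  - by rewrite /b'; lra.
  rewrite -ptE => hs; apply: bN; rewrite (_ : b = b' + (b - b')); last by ring.
  apply: (tps_acl C0P S_cst xi_inf delta_cont _ hs); first by rewrite /b'; lra.
  have [hc _] := acl_cs C0P GP Gemb lx; apply: (acl_incl_trans C0P hc).
  by apply: acl_incl_sub => // z zx; rewrite mem_cat zx.
have csT (l : chart (pow_atlas G m)) x : exists c : (m * adim G).-tuple K, tval c = cs l x.
  by exists (coords (a := pow_atlas G m) l x); rewrite csE.
have ptsX (x : m.-tuple T) : (forall i, Xm (tnth x i)) -> ptsn x by move=> Xx l; exact: XmP.
have full_bound (l : chart (pow_atlas G m)) (x : m.-tuple T) : dom l x -> (forall i, Xm (tnth x i)) ->
    tps (m%:R * (d%:R + e) + e) (cs l x) [::].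
  move=> lx Xx; apply: contrapT => hN.
  have := LP l x [::] m _ lx Xx _ hN; rewrite ltrDl e0 => /(_ isT).
  by rewrite leqNgt => /negP; apply; rewrite (leq_ltn_trans (rk_ptsn _ (ptsX x Xx))) // ltn_mul2r d0 ltnSn.
have rkV (x y : m.-tuple T) t : ptsn x -> ptsn y -> acl_incl (pt x) t -> rk t (pt (gm x y)) = rk t (pt y).
  by move=> xG yG xt; rewrite (rk_gm C0P GP Gemb).
pose k : R := k0%:R; pose D : R := d%:R.
have mE : m%:R = k + 2 :> R by rewrite /m /k -addn2 natrD.
have kE : k0.+1%:R = k + 1 :> R by rewrite /k natr1.
have kd0 : 0 <= k by rewrite ler0n.
rewrite mE in eE full_bound; have t0 : (0 : R) <= tau%:R by rewrite ler0n.
have [si0 H0 H1 H2 [H3 H4]] := incidence_exponents dR kd0 t0 e0 eE.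
have rk_le_a t (x : m.-tuple T) : gsp [::] a x -> (rk t (pt x) <= k0.+1 * d)%N.
  move=> ax; rewrite -ra; apply: leq_trans (gsp_rk_le C0P GP Gemb ax).
  exact: rk_base.
have pt_cs (l : chart (pow_atlas G m)) (x : m.-tuple T) t : dom l x -> {subset cs l x <= t} -> acl_incl (pt x) t.
  move=> lx xt; have [_ h2] := acl_cs C0P GP Gemb lx.
  by apply: (acl_incl_trans C0P h2); exact: acl_incl_sub.
(* With [k] one less than the number of independent entries, the exponents are about (k+2) D for the
   two sides, (2k+3) D for the incidences and (k+1) D for the degrees. The tuples [q] and [z'] are
   only asked to exceed k D; by [LP] they then have rank at least (k+1) D. *)
have [|||||||x [z [q [z' [[Ax Bz] [Aq Bz'] [xz qz xz' qz'] qN zN]]]]] := inc PA PB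
  ((k + 2) * (D + e) + 2 * e) ((k + 2 + (k + 1)) * D - e) (k * (D + e) + 2 * e) ((k + 1) * (D + e) + 2 * e)
  ((k + 1) * D - 2^-1) ((4 * (k + 2) + 12) * e) e (k * (D + e) + e) (k * (D + e) + e) ((k + 1) * (D + e) + e)
  ((k + 2) * (D + e) + e) e0 si0 H0 _ _ _ PAd PBd _ _ _ _ H1 H2 H3 H4.
- by lra.
- by lra.
- by lra.
- by move=> c /PAE[y [iy Xy <-]]; exact: full_bound.
- by move=> c /PBE[y [iy Xy <-]]; exact: full_bound.
(* Degrees: translation by [y] preserves rank over [y], and [gm y y'] lies in the locus of [a],
   whose points have rank at most (k+1) D. *)
- move=> c c' /PAE[y [iy Xy <-]] /PBE[y' [jy' Xy' <-]] yy'; apply: contrapT => hN.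
  have := LP j y' (cs i y) k0.+1 _ jy' Xy' _ hN; rewrite kE -/D ltrDl e0 => /(_ isT).
  rewrite -(rkV y y') //; [|exact: ptsX|exact: ptsX|exact: pt_cs iy _].
  rewrite leqNgt => /negP; apply; apply: leq_ltn_trans (rk_le_a _ _ (hrel y y' iy jy' yy')) _.
  by rewrite ltn_mul2r d0 ltnSn.
(* Number of incidences: [a] and [v] are algebraic over [p] and [v], and [v] was chosen generic over
   [a]. *)
- have [c cE] := csT i p; have [c' c'E] := csT j v; exists c, c'; split; rewrite ?cE ?c'E //.
  + by rewrite -cE; apply/PAE; exists p; split => // l; exact: XmG.
  + by rewrite -c'E; apply/PBE; exists v; split => // l; exact: XmG.
  move=> hs; apply: (vN ((k + 2 + (k + 1)) * D - e + e / 2)); first by rewrite -/m mE kE -/D mulrDl; lra.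
  apply: (tps_acl C0P S_cst xi_inf delta_cont _ hs); first by lra.
  have hv : acl_incl (pt v) ((cs i p ++ cs j v) ++ [::]).
    by apply: (pt_cs j) => // y yv; rewrite cats0 mem_cat yv orbT.
  have hp : acl_incl (pt p) ((cs i p ++ cs j v) ++ [::]).
    by apply: (pt_cs i) => // y yv; rewrite cats0 mem_cat yv.
  apply: acl_incl_cat => //; rewrite -pv; apply: (acl_incl_trans C0P (acl_gm C0P GP Gemb pG vG)).
  exact: acl_incl_cat.
have /PAE[p1 [ip1 Xp1 p1E]] := Ax; have /PBE[v1 [jv1 Xv1 v1E]] := Bz.
have /PAE[q1 [iq1 Xq1 q1E]] := Aq; have /PBE[w1 [jw1 Xw1 w1E]] := Bz'.
rewrite -p1E -v1E -q1E -w1E in xz qz xz' qz' qN zN.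
have q1r := LP i q1 (cs i p1 ++ cs j v1) k0 _ iq1 Xq1 _ qN.
have w1r := LP j w1 (cs i q1 ++ cs i p1 ++ cs j v1) k0 _ jw1 Xw1 _ zN.
have kDe : k0%:R * (d%:R + e) < k * (D + e) + e by rewrite ltrDl.
move: (q1r kDe) (w1r kDe) => {}q1r {}w1r; rewrite -ra in q1r w1r.
have p1G := ptsX _ Xp1; have q1G := ptsX _ Xq1; have v1G := ptsX _ Xv1; have w1G := ptsX _ Xw1.
have base (x1 : m.-tuple T) t t' : acl_incl t' t -> (rk [::] (pt a) <= rk t (pt x1))%N -> (rk [::] (pt a) <= rk t' (pt x1))%N.
  by move=> tt' h1; apply: leq_trans h1 _; exact: rk_base.
pose t2 := cs i p1 ++ cs j v1; pose t3 := cs i q1 ++ t2.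
have p1t : acl_incl (pt p1) t2 by apply: (pt_cs i) => // y yv; rewrite mem_cat yv.
have v1t : acl_incl (pt v1) t2 by apply: (pt_cs j) => // y yv; rewrite mem_cat yv orbT.
have t23 : acl_incl t2 t3 by apply: acl_incl_sub => // y yv; rewrite mem_cat yv orbT.
have q1t : acl_incl (pt q1) t3 by apply: (pt_cs i) => // y yv; rewrite mem_cat yv.
have p1t3 := acl_incl_trans C0P p1t t23; have v1t3 := acl_incl_trans C0P v1t t23.
have gmt (y1 y2 : m.-tuple T) t : ptsn y1 -> ptsn y2 -> acl_incl (pt y1) t -> acl_incl (pt y2) t -> acl_incl (pt (gm y1 y2)) t.
  by move=> g1 g2 h1 h2; apply: (acl_incl_trans C0P (acl_gm C0P GP Gemb g1 g2)); exact: acl_incl_cat.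
(* The ranks of the products reduce to those of [q1] and [w1] over the earlier points, since
   translation by a point algebraic over the base preserves rank. *)
apply: (ternary_rectangle C0P C0cl C0count GP Gemb (u := gm p1 v1) (z := gm q1 v1) (y := gm p1 w1) (y' := gm q1 w1)).
- exact: hrel.
- exact: hrel.
- exact: hrel.
- exact: hrel.
- by rewrite (tern_rectangle GP).
- by rewrite (tern_rectangle GP).
- apply: (base _ t2); first exact: gmt.
  by rewrite (gmC GP q1G v1G) rkV.
- apply: (base _ t3); first by apply: acl_incl_cat; exact: gmt.
  by rewrite rkV.
- apply: (base _ t3); first by apply: acl_incl_cat; exact: gmt.
  by rewrite rkV.
Qed.

End StepB.

(** * Coherent tuples and the reduction to one additional coordinate *)

Section Final.
Variables (R : realType) (U : nonprincipal_ultrafilter) (C0 : set (ultrapower R U)).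
Variables (L : language) (Ks : nat -> fo_structure L C0 R[i]) (xi : nat -> R).
Local Notation K := (ultrapower R U).
Local Notation S := (ultraproduct U Ks).
Hypothesis C0P : is_subfield C0.
Hypothesis C0cl : alg_closed_in C0.
Hypothesis C0count : countable C0.
Hypothesis S_cst : forall c : C0, scst S c = set_val c.
Hypothesis xi_inf : forall r : R, \forall s \near ufilter U, r < xi s.
Hypothesis delta_cont : delta_continuous S xi.
Variables (N : nat) (G : group_data K (N.-tuple K)).
Hypothesis GP : is_comm_alg_group C0 G.
Hypothesis Gemb : constructibly_embedded C0 G.
Local Notation T := (N.-tuple K).
Local Notation tps := (tps Ks xi).
Local Notation rk := (@rk K C0).
Local Notation gsp := (@gsp K C0 T G _).
Local Notation ptsn := (ptsn G).

Let char0 := @ultrapower_char0 R U.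
Let VP : is_variety C0 G. Proof. by case: GP. Qed.

Lemma d0_set0 (a : seq K) : d0 C0 a set0 = ((rk [::] a)%:R : R)%:E.
Proof.
rewrite /d0 (_ : coordinates_of set0 = set0); last by apply/seteqP; split=> // x [].
by rewrite !setU0 gen_fieldE // d0_rk.
Qed.

(** A bound below 0 says nothing about delta, hence the passage through the maximum of [c] and 0,
    which is still below the positive rank. *)
Lemma coherent_lower (a : seq K) (c : R) : delta_tp S xi a set0 = d0 C0 a set0 ->
  (0 < rk [::] a)%N -> c < (rk [::] a)%:R -> ~ tps c a [::].
Proof.
rewrite d0_set0 => E r0 cr [P [Pd Pa Psm]].
suff : (delta_tp S xi a set0 < ((rk [::] a)%:R)%:E)%E by rewrite E ltxx.
apply: (@le_lt_trans _ _ (Num.max c 0)%:E); last by rewrite lte_fin gt_max cr ltr0n.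
apply: (@le_trans _ _ (delta xi [set x : (size a).-tuple K | P (x ++ [::])])).
  apply: ereal_inf_lbound; exists [set x : (size a).-tuple K | P (x ++ [::])] => //; split => //.
  rewrite (_ : coordinates_of set0 = set0); last by apply/seteqP; split=> // x [].
  by apply/definable0P; exists P => // x; rewrite /= cats0.
apply: small_delta => //; first by rewrite le_max lexx orbT.
by apply: small_le Psm => //; rewrite le_max lexx.
Qed.

Lemma coherent_upper (a : seq K) (c : R) : delta_tp S xi a set0 = d0 C0 a set0 ->
  (rk [::] a)%:R < c -> tps c a [::].
Proof.
rewrite d0_set0 => E rc; have : (delta_tp S xi a set0 < c%:E)%E by rewrite E lte_fin.
move=> /ereal_inf_lt[_ [Y [Ya Yd] <-] Yc].
rewrite (_ : coordinates_of set0 = set0) in Yd; last by apply/seteqP; split=> // x [].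
have /definable0P[P Pd PE] := Yd; exists P; split; rewrite ?cats0 //; first by have /PE := Ya.
apply: (small_sub _ (delta_lt_small xi_inf Yc)) => x /=; rewrite cats0.
by move/PE.
Qed.

Lemma locus_rk0 n (a x : n.-tuple T) : ptsn a -> rk [::] (pt a) = 0%N -> gsp [::] a x -> x = a.
Proof.
move=> aG r0 ax; have [_ xG] := gsp_ptsn ax; have [i ix] := pow_chart xG.
have [ia h] := gsp_chart C0P VP ax ix; rewrite !cats0 in h.
have aC k : C0 (cs i a)`_k.
  have [ks|ks] := ltnP k (size (cs i a)); last by rewrite nth_default //; exact: subfield0.
  have [h1 _] := acl_cs C0P GP Gemb ia; apply: (acl_nil C0P C0cl).
  by apply: (acl_trans C0P (rk0_acl C0P r0)); apply: h1; exact: mem_nth.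
have [ci _ _ _] := VP.
apply: eq_from_tnth => l; apply: (ci (tnth i l)); rewrite ?inE; [exact: ix|exact: ia|].
apply: eq_from_tnth => k; rewrite !(tnth_nth 0).
have E (y : n.-tuple T) := nth_flatten_tuple (fun l => coords (tnth i l) (tnth y l)) l (ltn_ord k).
rewrite -!E; apply: (sp_eq C0P (q := pcst (aC (l * adim G + k)%N)) (p := PV C0 (l * adim G + k)) h).
by [].
Qed.

Lemma rk0_coset n (a : n.-tuple T) : ptsn a -> rk [::] (pt a) = 0%N ->
  is_coset_of_alg_subgroup C0 (pow_group G n) [set y | gsp [::] a y].
Proof.
move=> aG r0; have aa : gsp [::] a a by exact: gsp_refl.
apply: (ternary_coset C0P GP aa).
  have [i ia] := pow_chart aG; exists i => // x xa.
  have [h1 _] := acl_cs C0P GP Gemb ia; apply: (acl_nil C0P C0cl).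
  by apply: (acl_trans C0P (rk0_acl C0P r0)); exact: h1.
move=> x y z /(locus_rk0 aG r0)-> /(locus_rk0 aG r0)-> /(locus_rk0 aG r0)->.
by rewrite /tern (gmVK GP).
Qed.

Lemma pt_subE n m (f : 'I_m -> 'I_n) (a : n.-tuple T) :
  pt (sub f a) = flatten [seq tval (tnth a j) | j <- [seq f l | l <- enum 'I_m]].
Proof.
by rewrite /pt -map_comp; congr flatten; apply: eq_map => l; rewrite /= tnth_mktuple.
Qed.

End Final.

Theorem theorem8p1 (R : realType) (U : nonprincipal_ultrafilter)
    (C0 : set (ultrapower R U)) (L : language)
    (Ks : nat -> fo_structure L C0 R[i]) (xi : nat -> R)
    (N : nat) (G : group_data (ultrapower R U) (N.-tuple (ultrapower R U)))
    (Gamma X : set (N.-tuple (ultrapower R U)))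
    (n : nat) (gamma : n.-tuple (N.-tuple (ultrapower R U))) :
  countable C0 -> is_subfield C0 -> alg_closed_in C0 ->
  (forall c : C0, scst (ultraproduct U Ks) c = set_val c) ->
  (forall r : R, \forall s \near ufilter U, r < xi s) ->
  delta_continuous (ultraproduct U Ks) xi ->
  is_comm_alg_group C0 G -> constructibly_embedded C0 G ->
  is_subgroup G Gamma ->
  bigwedge_definable (ultraproduct U Ks) set0 Gamma ->
  definable (ultraproduct U Ks) set0 X -> Gamma `<=` X -> cgp_in xi G X ->
  delta xi Gamma = variety_dim R G ->
  (forall i, Gamma (tnth gamma i)) ->
  coherent (ultraproduct U Ks) xi gamma ->
  is_coset_of_alg_subgroup C0 (pow_group G n) (locus C0 (pow_group G n) gamma).
Proof.
move=> C0count C0P C0cl S_cst xi_inf delta_cont GP Gemb Gam_grp Gam_def Xdef Gam_sub Xcgp Gam_delta aGam [_ coh].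
have [GamG _ _ _] := Gam_grp; have VP : is_variety C0 G by case: GP.
have char0 := @ultrapower_char0 R U.
have aG : ptsn G gamma by move=> j; exact: GamG.
rewrite (locus_gsp C0P VP aG).
(* A tuple of constants: its locus is a point, and no entry is available as a generic point of G. *)
have [r0|rpos] := posnP (rk C0 [::] (pt gamma)); first exact: rk0_coset.
have [i0 ri0] : exists i0, (0 < rk C0 [::] (tnth gamma i0))%N.
  apply: contrapT => h; move: rpos; rewrite lt0n => /eqP; apply; apply: (rk_acl0 C0P).
  move=> z /flattenP[_ /mapP[j _ ->]]; apply: (rk0_acl C0P).
  by apply/eqP; rewrite -leqn0 leqNgt; apply/negP => hj; apply: h; exists j.
set g0 := tnth gamma i0 in ri0; set d := rk C0 [::] g0 in ri0.
have coh1 j : delta_tp (ultraproduct U Ks) xi (tval (tnth gamma j)) set0 = d0 C0 (tval (tnth gamma j)) set0.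
  by have := coh [:: j]; rewrite /= cats0.
have g0N (c : R) : c < d%:R -> ~ tps Ks xi c g0 [::].
  by move=> cd; exact: (coherent_lower C0P xi_inf (coh1 i0) ri0 cd).
(* Every point of G is a specialization of [g0]: otherwise [X] meets the proper locus of [g0] in
   delta 0, while coherence gives [g0] the positive delta [d]. So [d] bounds the rank of every point
   of G. *)
have g0gsp y : pts G y -> gsp C0 G [::] [tuple g0] [tuple y].
  move=> yG; apply: contrapT => h.
  have d0R : (0 : R) < d%:R by rewrite ltr0n.
  have hd : d%:R / 2 < d%:R :> R by lra.
  apply: (g0N _ hd); apply: (proper_tps C0P S_cst xi_inf GP Gemb Xdef Xcgp).
  - exact: (Gam_sub _ (aGam i0)).
  - by exists y.
  - by rewrite divr_gt0 ?ltr0n.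
have Gle (x : N.-tuple (ultrapower R U)) t : pts G x -> (rk C0 t x <= d)%N.
  move=> xG; apply: (@leq_trans (rk C0 [::] x)); first by apply: (rk_base C0P).
  by have := gsp_rk_le C0P GP Gemb (g0gsp x xG); rewrite !pt1.
have g0G : ptsn G [tuple g0] by move=> j; rewrite (tnth_nth g0) ord1; exact: (GamG _ (aGam i0)).
have Gfull t : exists2 x, pts G x & (d <= rk C0 t x)%N.
  have [x gx rx] := generic_pt C0P C0cl C0count GP Gemb t g0G.
  have [_ xG] := gsp_ptsn gx; exists (tnth x ord0); first exact: xG.
  have xE : x = [tuple tnth x ord0] by apply: eq_from_tnth => j; rewrite ord1.
  by move: rx; rewrite pt1 xE pt1 -xE.
have Gdelta : (delta xi Gamma <= (d%:R)%:E)%E.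
  rewrite Gam_delta; apply: (variety_dim_le C0P C0count VP) => i x ix.
  have [h1 _] := acl_coords C0P GP Gemb ix; apply: leq_trans (Gle x [::] _); last by exists i.
  by apply: (rk_le C0P char0) => z /h1; rewrite cats0.
(* A maximal family of independent generic entries is wanted; rank equal to [k * d] expresses both
   independence and genericity, as no point has rank above [d]. *)
pose P k := `[< exists f : 'I_k -> 'I_n, rk C0 [::] (pt (sub f gamma)) = (k * d)%N >].
have P1 : P 1%N.
  apply/asboolP; exists (fun=> i0); rewrite mul1n /d -(pt1 g0); congr (rk _ _ (pt _)).
  by apply: eq_from_tnth => j; rewrite ord1 tnth_mktuple.
have Pmax k : P k -> (k <= rk C0 [::] (pt gamma))%N.
  move=> /asboolP[f fk]; apply: (@leq_trans (k * d)%N); first by rewrite leq_pmulr.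
  by rewrite -fk; apply: (rk_le C0P char0); apply: acl_incl_sub => // z /pt_subP; rewrite cats0.
have exP : exists k, P k by exists 1%N.
case: (ex_maxnP exP Pmax) => k /asboolP[f fk] kmax.
have k0 : (0 < k)%N by exact: kmax.
(* The family [f] with the index [j] added in the last place. *)
pose ff j (l : 'I_k.+1) := if insub (val l) is Some l' then f (l' : 'I_k) else j.
have fff j l : exists l', ff j l' = f l.
  by exists (widen_ord (leqnSn k) l); rewrite /ff /= insubT //= => h; congr f; exact: val_inj.
have ffj j : exists l, ff j l = j by exists ord_max; rewrite /ff insubF //= ltnn.
have cohs m (h : 'I_m -> 'I_n) : delta_tp (ultraproduct U Ks) xi (pt (sub h gamma)) set0 =
    d0 C0 (pt (sub h gamma)) set0 by rewrite pt_subE; exact: coh.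
have sub_in m (h : 'I_m -> 'I_n) l : {subset tval (tnth gamma (h l)) <= pt (sub h gamma)}.
  have E : tnth (sub h gamma) l = tnth gamma (h l) by rewrite tnth_mktuple.
  by rewrite -E; exact: pt_sub.
have subff j : {subset pt (sub f gamma) <= pt (sub (ff j) gamma)}.
  move=> z /flattenP[_ /mapP[l _ ->]]; rewrite tnth_mktuple; have [l' <-] := fff j l.
  exact: sub_in.
have subj j : {subset tval (tnth gamma j) <= pt (sub (ff j) gamma)}.
  by move=> z zj; have [l E] := ffj j; apply: (sub_in _ (ff j) l); rewrite E.
have ffsub j : {subset pt (sub (ff j) gamma) <= pt (sub f gamma) ++ tnth gamma j}.
  move=> z /flattenP[_ /mapP[l _ ->]]; rewrite tnth_mktuple /ff mem_cat.
  case: insubP => [l' _ _|_] zl; last by rewrite zl orbT.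
  by rewrite (sub_in _ f l' z zl).
have rkcat j : rk C0 [::] (pt (sub (ff j) gamma)) = (k * d + rk C0 (pt (sub f gamma)) (tnth gamma j))%N.
  have := rk_cat C0P [::] (pt (sub f gamma)) (tnth gamma j); rewrite cats0 fk => <-.
  apply: (rk_eq C0P char0); apply: (acl_incl_sub C0P) => z; rewrite cats0; last exact: ffsub.
  by rewrite mem_cat => /orP[/subff|/subj].
(* By maximality the entry [j] has rank less than [d] over the family, so by cgp of [X] it adds
   nothing to delta; coherence equates delta and rank, so it adds nothing to the rank either. The
   four errors of 1/6 sum to less than 1. *)
have rk0 j : rk C0 (pt (sub f gamma)) (tnth gamma j) = 0%N.
  have lt : (rk C0 (pt (sub f gamma)) (tnth gamma j) < d)%N.
    rewrite ltn_neqAle Gle ?andbT; last exact: GamG.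
    apply/eqP => E; have : P k.+1 by apply/asboolP; exists (ff j); rewrite rkcat E mulSn addnC.
    by move/kmax; rewrite ltnn.
  apply/eqP; rewrite -leqn0 leqNgt; apply/negP => pos.
  have rpos' : (0 < rk C0 [::] (pt (sub (ff j) gamma)))%N by rewrite rkcat addn_gt0 pos orbT.
  have e6 : (0 : R) < 6^-1 by rewrite invr_gt0.
  apply: (coherent_lower C0P xi_inf (cohs _ (ff j)) rpos' (c := 6^-1 + ((k * d)%:R + 6^-1) + 6^-1 + 6^-1)).
    have h1 : (k * d).+1%:R <= (rk C0 [::] (pt (sub (ff j) gamma)))%:R :> R by rewrite ler_nat rkcat -addn1 leq_add2l.
    by apply: lt_le_trans h1; rewrite -[(k * d).+1%:R]natr1; lra.
  have h2 : tps Ks xi (6^-1) (tnth gamma j) (pt (sub f gamma)).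
    exact: (nongeneric_tps C0P S_cst xi_inf GP Gemb Xdef Xcgp Gfull (Gam_sub _ (aGam j)) lt e6).
  have h3 : tps Ks xi ((k * d)%:R + 6^-1) (pt (sub f gamma)) [::].
    by apply: (coherent_upper C0P xi_inf (cohs _ f)); rewrite fk ltrDl.
  rewrite -[X in tps _ _ _ _ X]cats0 in h2 *.
  have h4 := tps_add xi_inf delta_cont (ltW e6) e6 h2 h3.
  apply: (tps_acl C0P S_cst xi_inf delta_cont e6 h4); apply: (acl_incl_sub C0P) => z /ffsub.
  by rewrite cats0 !mem_cat orbC.
have rkff j : rk C0 [::] (pt (sub (ff j) gamma)) = (k * d)%N by rewrite rkcat rk0 addn0.
have rka : rk C0 [::] (pt (sub f gamma)) = rk C0 [::] (pt gamma).
  apply: (rk_eq C0P char0) => z; rewrite cats0.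
    by move=> /flattenP[_ /mapP[j _ ->]]; exact: (rk0_acl C0P (rk0 j)).
  by move=> /pt_subP zg; exact: acl_mem.
have [p ap pQ] := rational_pt C0P C0cl GP aG.
apply: (ternary_coset C0P GP ap pQ).
apply: (ternary_glue C0P C0cl C0count GP Gemb aG _ fff ffj rka) => j.
case: k f k0 {fk kmax} @ff {fff ffj subff subj ffsub rkcat rk0} rkff {rka} => // k f _ ff rkff.
apply: (ternary_incidence C0P C0cl C0count S_cst xi_inf delta_cont GP Gemb ri0 Xdef Xcgp Gfull Gle Gam_def Gam_sub Gam_grp Gdelta (aGam i0) g0N).
- by move=> l; rewrite tnth_mktuple.
- exact: rkff.
- move=> c cd; apply: (coherent_lower C0P xi_inf); rewrite ?rkff ?muln_gt0 ?natrM //.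
Qed.
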